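(* Consider high-dimensional ridge regression (loss $\ell(r)=r^2$, fixed $\tau>0$) in the setting described in the context, and assume that $\epsilon_i$ and $\sqrt{d}\beta^*_i$ have $8$ bounded moments. Then the full conformal prediction set $$\hat{C}_{\mathrm{full}} := \Big\{y : |y - X_{n+1}^\top\hat{\beta}^y| \leq \mathrm{Quantile}\Big(1-\alpha, \frac{1}{n+1} \sum_{i=1}^n \delta_{|Y_i - X_i^\top \hat{\beta}^y|} + \frac{1}{n+1}\delta_{|y - X_{n+1}^\top\hat{\beta}^y|}\Big)\Big\}$$ satisfies, as $n\to\infty$, $$\mathbb{P}\big(Y_{n+1} \in \hat{C}_{\mathrm{full}} \mid \{(X_i,Y_i)\}_{i=1}^n\big) \stackrel{\mathbb{P}}{\to} 1-\alpha.$$ Moreover, the uncorrected prediction set $$\hat{C}_{\mathrm{uncorr.}} := \Big\{y : |y - X_{n+1}^\top\hat{\beta}_{(n+1)}| \leq \mathrm{Quantile}\Big(1-\alpha, \frac{1}{n} \sum_{i=1}^{n} \delta_{|Y_i - X_{i}^\top\hat{\beta}_{(n+1)}|}\Big)\Big\}$$ has asymptotic undercoverage, $$\mathbb{P}\big(Y_{n+1} \in \hat{C}_{\mathrm{uncorr.}} \mid \{(X_i,Y_i)\}_{i=1}^n\big) \stackrel{\mathbb{P}}{\to} \mathbb{P}\Big( |\epsilon + \lambda N_{\infty}Z| \leq \mathrm{Quantile}\Big(1-\alpha, \Big|\frac{\epsilon + \lambda N_{\infty}Z}{1+2\lambda^2c_{\infty}}\Big|\Big)\Big) < 1-\alpha,$$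 where $(\lambda,\epsilon)$ denotes a copy of $(\lambda_i,\epsilon_i)$ independent of $Z\sim N(0,1)$.
   Context: Setting. All quantities are indexed by $n\to\infty$, with dimension $d=d_n$ satisfying $d/n\to\gamma\in(0,\infty)$; $\alpha\in(0,1)$ and $\tau>0$ are fixed. The covariates are $X_i=\lambda_iW_i\in\mathbb{R}^d$, $1\le i\le n+1$, where $(\lambda_i)$ are bounded, positive, i.i.d. random variables independent of $(W_{ij})_{i\in[n+1],j\in[d]}$, which are i.i.d., mean zero, unit variance and sub-Gaussian. The responses are $Y_i=X_i^\top\beta^*+\epsilon_i$, where $(\epsilon_i)$ are i.i.d. continuous random variables independent of $(\lambda_i,W_i)_{i}$, with a bounded density and a unique $1-\alpha$ quantile, and $\beta^*\in\mathbb{R}^d$ is random, independent of $(\lambda_i,W_i,\epsilon_i)_i$, with $\{\sqrt{d}\beta^*_j\}_{j=1}^d$ i.i.d. The laws of $\lambda_i$, $W_{ij}$, $\epsilon_i$, $\sqrt d\beta^*_j$ do not depend on $n,d$. Estimators (with $\ell(r)=r^2$). For $y\in\mathbb{R}$, $$\hat\beta^y:=\operatorname{argmin}_{\beta\in\mathbb{R}^d}\frac1{n+1}\sum_{i=1}^n\ell(Y_i-X_i^\top\beta)+\frac1{n+1}\ell(y-X_{n+1}^\top\beta)+\tau\|\beta\|_2^2,$$ $\hat\beta:=\hat\beta^{Y_{n+1}}$, and $\hat\beta_{(n+1)}:=\operatorname{argmin}_{\beta\in\mathbb{R}^d}\frac1n\sum_{i=1}^n\ell(Y_i-X_i^\top\beta)+\tau\|\beta\|_2^2$.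 Constants. $N_\infty>0$ denotes the constant such that $\|\beta^*-\hat\beta_{(n+1)}\|_2\stackrel{\mathbb{P}}{\to}N_\infty$, and $c_\infty>0$ denotes the constant such that $(Y_{n+1}-X_{n+1}^\top\hat\beta)-\frac{1}{1+2\lambda_{n+1}^2c_\infty}(Y_{n+1}-X_{n+1}^\top\hat\beta_{(n+1)})\stackrel{\mathbb{P}}{\to}0$; such constants exist under the assumptions of the claim. Notation. $\delta_x$ is the point mass at $x$; $\mathrm{Quantile}(1-\alpha,P)$ and $\mathrm{Quantile}(1-\alpha,U)$ denote the $1-\alpha$ quantile of a distribution $P$ or a random variable $U$ (smallest $t$ at which the CDF is at least $1-\alpha$); $\stackrel{\mathbb{P}}{\to}$ is convergence in probability. *)

(* Defs.v *)
From HB Require Import structures.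
From mathcomp Require Import all_boot all_order all_algebra.
From mathcomp Require Import all_classical all_reals all_analysis.

Set Implicit Arguments.
Unset Strict Implicit.
Unset Printing Implicit Defensive.

Import Order.TTheory GRing.Theory Num.Theory.
Import numFieldNormedType.Exports.

Local Open Scope classical_set_scope.
Local Open Scope ring_scope.

Section Laws.
Context {R : realType}.
Implicit Type mu : probability R R.

Definition bounded_positive mu : Prop :=
  exists B : R, mu [set x | 0 < x <= B] = 1%E.

Definition mean_zero mu : Prop := (\int[mu]_x x%:E = 0)%E.

(* Unit variance, for a law of mean zero. *)
Definition unit_second_moment mu : Prop := (\int[mu]_x (x ^+ 2)%:E = 1)%E.

Definition sub_gaussian mu : Prop :=
  exists2 K : R, 0 < K & forall t : R, 0 <= t ->
    (mu [set x | (t <= `|x|)%R] <= (2 * expR (- (t ^+ 2 / K ^+ 2)))%:E)%E.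

Definition bounded_density mu : Prop :=
  exists (f : R -> R) (M : R),
    [/\ measurable_fun [set: R] f,
        forall x, 0 <= f x <= M &
        forall A : set R, measurable A ->
          mu A = (\int[lebesgue_measure]_(x in A) (f x)%:E)%E].

(* [t] is a p-quantile when mu(]-oo, t]) >= p and mu([t, +oo[) >= 1 - p. *)
Definition has_unique_quantile (p : R) mu : Prop :=
  exists! t : R, (p%:E <= mu [set x | (x <= t)%R])%E /\
                 ((1 - p)%:E <= mu [set x | (t <= x)%R])%E.

Definition finite_abs_moment (k : nat) mu : Prop :=
  (\int[mu]_x (`|x| ^+ k)%:E < +oo)%E.

(* Smallest t with P(]-oo, t]) >= p; the infimum is attained when P is a
   probability and 0 < p < 1, by right-continuity of the CDF. *)
Definition quantile (p : R) (P : set R -> \bar R) : R :=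
  inf [set t : R | (p%:E <= P [set x | (x <= t)%R])%E].

End Laws.

Section Independence.
Context {d : measure_display} {T : measurableType d} {R : realType}.
Variable P : probability T R.

(* The sigma-algebra generated by a family of real random variables. *)
Definition sigma_family (I : Type) (X : I -> T -> R) : set (set T) :=
  <<s [set A | exists i (B : set R), measurable B /\ A = X i @^-1` B] >>.

Definition indep_families (I J : Type) (X : I -> T -> R) (Y : J -> T -> R) :=
  forall A B, sigma_family X A -> sigma_family Y B ->
    P (A `&` B) = (P A * P B)%E.

Definition join_families (I J : Type) (X : I -> T -> R) (Y : J -> T -> R)
    (k : I + J) : T -> R :=
  match k with inl i => X i | inr j => Y j end.

(* The product rule over proper subfamilies is the case where some of the
   sets [A i] are the whole line. *)
Definition iid_family (I : finType) (mu : probability R R) (X : I -> T -> R) :=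
  [/\ forall i, measurable_fun [set: T] (X i),
      forall i (A : set R), measurable A -> P (X i @^-1` A) = mu A &
      forall A : I -> set R, (forall i, measurable (A i)) ->
        P (\bigcap_(i in [set: I]) X i @^-1` A i)
        = (\prod_(i : I) P (X i @^-1` A i))%E].

End Independence.

Section Conditional.
Context {d : measure_display} {T : measurableType d} {R : realType}.
Variable P : probability T R.

Definition is_cond_prob (G : set (set T)) (E : set T) (h : T -> R) : Prop :=
  [/\ forall B : set R, measurable B -> G (h @^-1` B),
      P.-integrable [set: T] (EFin \o h) &
      forall A, G A -> (\int[P]_(x in A) (h x)%:E)%E = P (A `&` E)].

(* A version of P(E | G); it is unique up to P-almost sure equality, and
   exists by Radon-Nikodym as soon as G is a sub-sigma-algebra and E is
   measurable, so the default value is never used. *)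
Definition cond_prob (G : set (set T)) (E : set T) : T -> R :=
  xget (fun=> 0) [set h | is_cond_prob G E h].

End Conditional.

(* Convergence in probability to a constant; the n-th variable lives on its
   own probability space. *)
Definition cvg_in_probability {R : realType} (disp : nat -> measure_display)
    (T : forall n, measurableType (disp n)) (P : forall n, probability (T n) R)
    (X : forall n, T n -> R) (c : R) : Prop :=
  forall e : R, 0 < e ->
    (fun n => P n [set w | e < `|X n w - c|]) @ \oo --> (0 : \bar R).

Section Ridge.
Context {R : realType}.

Definition dotp (k : nat) (u v : 'cV[R]_k) : R := \sum_(j < k) u j 0 * v j 0.

(* Not [`|v|], which is the sup norm on matrices. *)
Definition l2norm (k : nat) (v : 'cV[R]_k) : R :=
  Num.sqrt (\sum_(j < k) v j 0 ^+ 2).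

Definition loss (r : R) : R := r ^+ 2.

(* For the ridge objectives below (tau > 0) the minimizer exists and is
   unique. *)
Definition argmin (k : nat) (f : 'cV[R]_k -> R) : 'cV[R]_k :=
  xget 0 [set b | forall b', f b <= f b'].

Variables (tau : R) (n k : nat) (X : 'I_n -> 'cV[R]_k) (Y : 'I_n -> R).

(* hat beta^y: the fit on the n training points and the test point (x, y). *)
Definition beta_full (x : 'cV[R]_k) (y : R) : 'cV[R]_k :=
  argmin (fun b =>
    n.+1%:R^-1 * (\sum_(i < n) loss (Y i - dotp (X i) b))
    + n.+1%:R^-1 * loss (y - dotp x b) + tau * l2norm b ^+ 2).

(* hat beta_(n+1): the fit on the n training points only. *)
Definition beta_loo : 'cV[R]_k :=
  argmin (fun b =>
    n%:R^-1 * (\sum_(i < n) loss (Y i - dotp (X i) b))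
    + tau * l2norm b ^+ 2).

Variable alpha : R.

Definition C_full (x : 'cV[R]_k) : set R :=
  [set y | let b := beta_full x y in
    `|y - dotp x b| <= quantile (1 - alpha) (fun A =>
      (n.+1%:R^-1)%:E * (\sum_(i < n) \d_(`|Y i - dotp (X i) b|%R) A)
      + (n.+1%:R^-1)%:E * \d_(`|y - dotp x b|%R) A)%E].

Definition C_uncorr (x : 'cV[R]_k) : set R :=
  [set y |
    `|y - dotp x beta_loo| <= quantile (1 - alpha) (fun A =>
      (n%:R^-1)%:E * (\sum_(i < n) \d_(`|Y i - dotp (X i) beta_loo|%R) A))%E].

End Ridge.

Section Model.
Context {R : realType} {T : Type} {n k : nat}.
Variables (lam : 'I_n.+1 -> T -> R) (W : 'I_n.+1 -> 'I_k -> T -> R)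
          (eps : 'I_n.+1 -> T -> R) (bstar : 'I_k -> T -> R).

Definition covariate (i : 'I_n.+1) (w : T) : 'cV[R]_k :=
  \col_j (lam i w * W i j w).

Definition bstar_vec (w : T) : 'cV[R]_k := \col_j bstar j w.

Definition response (i : 'I_n.+1) (w : T) : R :=
  dotp (covariate i w) (bstar_vec w) + eps i w.

(* The n + 1 points are indexed by 'I_n.+1: the last index is the test point,
   the others are the training sample. *)
Definition train_ord (i : 'I_n) : 'I_n.+1 := widen_ord (leqnSn n) i.

Definition trainX (w : T) (i : 'I_n) : 'cV[R]_k := covariate (train_ord i) w.
Definition trainY (w : T) (i : 'I_n) : R := response (train_ord i) w.
Definition testX (w : T) : 'cV[R]_k := covariate ord_max w.
Definition testY (w : T) : R := response ord_max w.

Definition train_family (s : 'I_n * 'I_k + 'I_n) (w : T) : R :=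
  match s with inl ij => trainX w ij.1 ij.2 0 | inr i => trainY w i end.

Definition hat_beta (tau : R) (w : T) : 'cV[R]_k :=
  beta_full tau (trainX w) (trainY w) (testX w) (testY w).

Definition hat_beta_loo (tau : R) (w : T) : 'cV[R]_k :=
  beta_loo tau (trainX w) (trainY w).

Definition covered_full (tau alpha : R) : set T :=
  [set w | C_full tau (trainX w) (trainY w) alpha (testX w) (testY w)].

Definition covered_uncorr (tau alpha : R) : set T :=
  [set w | C_uncorr tau (trainX w) (trainY w) alpha (testX w) (testY w)].

Definition estimation_error (tau : R) (w : T) : R :=
  l2norm (bstar_vec w - hat_beta_loo tau w).

Definition loo_residual_gap (tau c : R) (w : T) : R :=
  (testY w - dotp (testX w) (hat_beta tau w))
  - (1 + 2 * lam ord_max w ^+ 2 * c)^-1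
    * (testY w - dotp (testX w) (hat_beta_loo tau w)).

End Model.

Section Coverage.
Context {d : measure_display} {T : measurableType d} {R : realType}.
Variables (P : probability T R) (n k : nat).
Variables (lam : 'I_n.+1 -> T -> R) (W : 'I_n.+1 -> 'I_k -> T -> R)
          (eps : 'I_n.+1 -> T -> R) (bstar : 'I_k -> T -> R).
Variables (tau alpha : R).

Definition cond_coverage_full : T -> R :=
  cond_prob P (sigma_family (train_family lam W eps bstar))
    (covered_full lam W eps bstar tau alpha).

Definition cond_coverage_uncorr : T -> R :=
  cond_prob P (sigma_family (train_family lam W eps bstar))
    (covered_uncorr lam W eps bstar tau alpha).

End Coverage.

Section Limit.
Context {R : realType}.
Variables (muL muE : probability R R) (alpha N c : R).

(* The law of (lambda, epsilon, Z): three independent variables. *)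
Definition limit_law : set (R * R * R) -> \bar R :=
  ((muL \x muE) \x normal_prob (0 : R) 1)%E.

Definition limit_error (u : R * R * R) : R := u.1.2 + u.1.1 * N * u.2.

Definition limit_residual (u : R * R * R) : R :=
  limit_error u / (1 + 2 * u.1.1 ^+ 2 * c).

Definition limit_coverage_uncorr : \bar R :=
  limit_law [set u | `|limit_error u| <=
    quantile (1 - alpha)
      (pushforward limit_law (fun u => `|limit_residual u|))].

End Limit.

(* Main.v *)
Require Import Defs.
From HB Require Import structures.
From mathcomp Require Import all_boot all_order all_algebra.
From mathcomp Require Import all_classical all_reals all_analysis.
From mathcomp Require Import measurable_realfun.
From mathcomp Require Import ring lra.
From mathcomp Require perm.

Set Implicit Arguments.
Unset Strict Implicit.
Unset Printing Implicit Defensive.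

Import Order.TTheory GRing.Theory Num.Theory.
Import numFieldNormedType.Exports.

Local Open Scope classical_set_scope.
Local Open Scope ring_scope.


(** Why the theorem is true.

    Full conformal prediction.  Let [r i] be the residuals of the ridge fit on
    all [n.+1] points.  The test point is covered exactly when fewer than
    [(1 - alpha) * n.+1] of the [`|r i|] lie below its own ([le_quantile]).  The
    points are exchangeable, so this has probability [1 - alpha] up to ties; the
    claim is that it is asymptotically independent of the training data.  Take
    two points [a] and [b], and decide whether [a] is covered after deleting [b]
    from the fit and from the ranking, and conversely.  Given all other points,
    the two decisions are independent and have the same conditional probability
    [g].  The second moment of [g] is therefore a probability of joint coverage,
    which exchangeability evaluates to nearly [(1 - alpha) ^+ 2], so that [g] is
    nearly constant, and coverage of [a] is nearly independent of any event
    determined by the other points ([coverage_decorrelates]).  Testing the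
    conditional probability against such events gives the convergence
    ([cond_prob_deviation]).  The deletion is harmless for two reasons.  By strong
    convexity the total squared displacement of the residuals is bounded
    ([ridge_drop_stable]), so each single one moves by a vanishing amount
    ([pr_stability]); and each residual has a bounded density given the noise of
    the other points ([anti_concentration]), so that few comparisons between
    residuals are affected.

    The uncorrected set.  Given the training data, the error at the test point is
    [epsilon + lambda * (W . u)], where [u] is the estimation error.  Deleting one
    column of the design at a time shows that the coordinates of [u] have fourth
    moments of order [n ^- 2] ([mean_err_fourth]).  Replacing the entries of [W]
    one at a time by normal variables then gives the limit
    [epsilon + lambda * N * Z] ([interval_clt], [new_residual_decorrelates]), since
    the norm of [u] tends to [N].  A training residual differs little from the
    residual of this point in the fit on all points, hence by exchangeability and
    by the definition of [c] it behaves like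
    [(epsilon + lambda * N * Z) / (1 + 2 * lambda ^+ 2 * c)], and two training
    residuals are nearly independent ([pr_joint_below]).  So the empirical
    distribution of the training residuals converges ([pr_training_count]), its
    quantile converges to that of the shrunk variable, and the coverage
    converges to the probability that the unshrunk variable is below it
    ([uncorrected_coverage]).  This is less than [1 - alpha] because the shrinking
    is strict and a normal variable charges every interval
    ([limit_coverage_lt]).

    Each probability space is transported to the product space of the primitive
    variables ([primitive_law_product]).  There independence is the freedom to
    redraw a set of coordinates without changing the law ([resample_int]). *)

(** * Probabilities and bounded expectations as real numbers *)

Section Prob.
Context {d : measure_display} {T : measurableType d} {R : realType}.
Variable P : probability T R.
Implicit Types (A B C : set T) (f g : T -> R).

Definition pr A : R := fine (P A).

Definition Ex f : R := fine (\int[P]_x (f x)%:E)%E.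

Definition bdd_meas f := measurable_fun setT f /\ exists C : R, forall x, `|f x| <= C.

Lemma prE A : measurable A -> P A = (pr A)%:E.
Proof. by move=> mA; rewrite fineK// fin_num_measure. Qed.

Lemma pr_ge0 A : 0 <= pr A.
Proof. exact: fine_ge0. Qed.

Lemma pr_le1 A : measurable A -> pr A <= 1.
Proof. by move=> mA; rewrite -lee_fin -prE// probability_le1. Qed.

Lemma pr_le A B : measurable A -> measurable B -> A `<=` B -> pr A <= pr B.
Proof. by move=> mA mB AB; rewrite -lee_fin -!prE// le_measure// inE. Qed.

Lemma prT : pr setT = 1.
Proof. by rewrite /pr probability_setT. Qed.

Lemma prU_le A B : measurable A -> measurable B -> pr (A `|` B) <= pr A + pr B.
Proof.
move=> mA mB; have mU : measurable (A `|` B) by exact: measurableU.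
rewrite -lee_fin EFinD -!prE//; exact: measureU2.
Qed.

Lemma pr_sub2 A B C : measurable A -> measurable B -> measurable C ->
  A `<=` B `|` C -> pr A <= pr B + pr C.
Proof.
move=> mA mB mC ABC; apply: le_trans (prU_le mB mC).
by apply: pr_le => //; exact: measurableU.
Qed.

Lemma pr_close A B C : measurable A -> measurable B -> measurable C ->
  A `<=` B `|` C -> B `<=` A `|` C -> `|pr A - pr B| <= pr C.
Proof.
move=> mA mB mC h1 h2; have := pr_sub2 mA mB mC h1; have := pr_sub2 mB mA mC h2.
by rewrite ler_norml => ? ?; apply/andP; split; lra.
Qed.

Lemma bdd_int f : bdd_meas f -> P.-integrable setT (EFin \o f).
Proof.
move=> [mf [C fC]]; apply: measurable_bounded_integrable => //.
  by apply: (le_lt_trans (probability_le1 P measurableT)); rewrite ltry.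
exists C; split; first exact: num_real.
by move=> M CM x _ /=; apply: le_trans (fC x) (ltW CM).
Qed.

Lemma bdd_cst c : bdd_meas (fun=> c).
Proof. by split; [exact: measurable_cst|exists `|c|]. Qed.

Lemma bddD f g : bdd_meas f -> bdd_meas g -> bdd_meas (fun x => f x + g x).
Proof.
move=> [mf [C fC]] [mg [D gD]]; split; first exact: measurable_funD.
by exists (C + D) => x; apply: le_trans (ler_normD _ _) (lerD _ _).
Qed.

Lemma bddM f g : bdd_meas f -> bdd_meas g -> bdd_meas (fun x => f x * g x).
Proof.
move=> [mf [C fC]] [mg [D gD]]; split; first exact: measurable_funM.
by exists (C * D) => x; rewrite normrM ler_pM.
Qed.

Lemma bddN f : bdd_meas f -> bdd_meas (fun x => - f x).
Proof.
move=> [mf [C fC]]; split; first exact: measurable_funN.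
by exists C => x; rewrite normrN.
Qed.

Lemma bddB f g : bdd_meas f -> bdd_meas g -> bdd_meas (fun x => f x - g x).
Proof. by move=> bf bg; apply: bddD => //; exact: bddN. Qed.

Lemma bdd_norm f : bdd_meas f -> bdd_meas (fun x => `|f x|).
Proof.
move=> [mf [C fC]]; split; first exact: measurableT_comp.
by exists C => x; rewrite normr_id.
Qed.

Lemma bdd_indic A : measurable A -> bdd_meas (\1_A : T -> R).
Proof.
move=> mA; split; first exact: measurable_indic.
by exists 1 => x; rewrite indicE; case: (x \in A); rewrite ?normr1 ?normr0.
Qed.

Lemma bdd_sum (I : Type) (r : seq I) (f : I -> T -> R) :
  (forall i, bdd_meas (f i)) -> bdd_meas (fun x => \sum_(i <- r) f i x).
Proof.
move=> bf; elim: r => [|i r IH].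
  by under eq_fun do rewrite big_nil; exact: bdd_cst.
by under eq_fun do rewrite big_cons; exact: bddD.
Qed.

Lemma ExE f : bdd_meas f -> (\int[P]_x (f x)%:E)%E = (Ex f)%:E.
Proof. by move=> bf; rewrite /Ex fineK//; apply: integrable_fin_num => //; exact: bdd_int. Qed.

Lemma eq_Ex f g : f =1 g -> Ex f = Ex g.
Proof. by move=> fg; congr fine; apply: eq_integral => x _; rewrite fg. Qed.

Lemma Ex_cst c : Ex (fun=> c) = c.
Proof.
rewrite /Ex integral_cst//= -[X in (_ * X)%E]/(P setT) probability_setT.
by rewrite mule1.
Qed.

Lemma ExD f g : bdd_meas f -> bdd_meas g -> Ex (fun x => f x + g x) = Ex f + Ex g.
Proof. by move=> bf bg; rewrite /Ex -[LHS]/(Rintegral P setT _) RintegralD//; exact: bdd_int. Qed.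

Lemma ExZ c f : bdd_meas f -> Ex (fun x => c * f x) = c * Ex f.
Proof. by move=> bf; rewrite /Ex -[LHS]/(Rintegral P setT _) RintegralZl//; exact: bdd_int. Qed.

Lemma ExN f : bdd_meas f -> Ex (fun x => - f x) = - Ex f.
Proof.
move=> bf; rewrite -mulN1r -ExZ//; apply: eq_Ex => x; by rewrite mulN1r.
Qed.

Lemma ExB f g : bdd_meas f -> bdd_meas g -> Ex (fun x => f x - g x) = Ex f - Ex g.
Proof. by move=> bf bg; rewrite ExD ?ExN//; exact: bddN. Qed.

Lemma Ex_sum (I : Type) (r : seq I) (f : I -> T -> R) :
  (forall i, bdd_meas (f i)) ->
  Ex (fun x => \sum_(i <- r) f i x) = \sum_(i <- r) Ex (f i).
Proof.
move=> bf; elim: r => [|i r IH].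
  by rewrite big_nil (@eq_Ex _ (fun=> 0)) ?Ex_cst// => x; rewrite big_nil.
rewrite big_cons -IH -ExD//; last exact: bdd_sum.
by apply: eq_Ex => x; rewrite big_cons.
Qed.

Lemma le_Ex f g : bdd_meas f -> bdd_meas g -> (forall x, f x <= g x) -> Ex f <= Ex g.
Proof. by move=> bf bg fg; apply: le_Rintegral => //; exact: bdd_int. Qed.

Lemma Ex_ge0 f : (forall x, 0 <= f x) -> 0 <= Ex f.
Proof. by move=> f0; apply: Rintegral_ge0. Qed.

Lemma Ex_norm f : bdd_meas f -> `|Ex f| <= Ex (fun x => `|f x|).
Proof. by move=> bf; apply: le_normr_Rintegral => //; exact: bdd_int. Qed.

Lemma Ex_indic A : measurable A -> Ex (\1_A) = pr A.
Proof. by move=> mA; rewrite /Ex integral_indic// setIT. Qed.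

Lemma ExM_indic A B : measurable A -> measurable B ->
  Ex (fun x => \1_A x * \1_B x) = pr (A `&` B).
Proof.
move=> mA mB; rewrite -Ex_indic; last exact: measurableI.
by apply: eq_Ex => x; rewrite indicI.
Qed.

Lemma Ex_le_pr f A (c : R) : bdd_meas f -> measurable A -> (forall x, f x <= 1) ->
  0 <= c -> (forall x, ~ A x -> f x <= c) -> Ex f <= c + pr A.
Proof.
move=> bf mA f1 c0 fc.
rewrite -(Ex_cst c) -Ex_indic// -ExD; [|exact: bdd_cst|exact: bdd_indic].
apply: le_Ex => //; first by apply: bddD; [exact: bdd_cst|exact: bdd_indic].
move=> x; rewrite indicE; have [/[!inE] xA|/negP xA] := boolP (x \in A).
  by rewrite (le_trans (f1 x))// lerDr.
by rewrite addr0; apply: fc => ?; apply: xA; rewrite inE.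
Qed.

Lemma pr_markov f (c : R) : bdd_meas f -> (forall x, 0 <= f x) -> 0 < c ->
  measurable [set x | c <= f x] -> pr [set x | c <= f x] <= Ex f / c.
Proof.
move=> bf f0 c0 mA; rewrite ler_pdivlMr// mulrC -Ex_indic// -ExZ; last exact: bdd_indic.
apply: le_Ex => //; first by apply: bddM; [exact: bdd_cst|exact: bdd_indic].
move=> x; rewrite indicE; have [/[!inE]/= xA|_] := boolP (x \in _).
  by rewrite mulr1.
by rewrite mulr0.
Qed.

Lemma pr_markov_int f (c C : R) : measurable_fun setT f -> (forall x, 0 <= f x) -> 0 < c ->
  (\int[P]_x (f x)%:E <= C%:E)%E -> pr [set x | c <= f x] <= C / c.
Proof.
move=> mf f0 c0 fC.
have mA : measurable [set x | c <= f x].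
  rewrite -[X in measurable X]setTI.
  exact: (measurable_fun_ler (measurable_cst c) mf measurableT (Y := [set true])).
rewrite ler_pdivlMr// mulrC -lee_fin EFinM -prE//.
apply: le_trans fC; rewrite -(setIT [set x | c <= f x]) -integral_indic//.
rewrite -ge0_integralZl//; last 2 first.
- by apply/measurable_EFinP; exact: measurable_indic.
- by rewrite lee_fin ltW.
apply: ge0_le_integral => //.
- by move=> x _; rewrite mule_ge0// lee_fin// ltW.
- by apply/measurable_EFinP/measurable_funM => //; exact: measurable_indic.
- exact/measurable_EFinP.
- move=> x _; rewrite indicE; have [/[!inE]/= xA|_] := boolP (x \in _).
    by rewrite -EFinM lee_fin mulr1.
  by rewrite mule0 lee_fin.
Qed.

End Prob.

Lemma measurable_ler d (T : measurableType d) (R : realType) (f g : T -> R) :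
  measurable_fun setT f -> measurable_fun setT g -> measurable [set x | f x <= g x].
Proof.
move=> mf mg; rewrite -[X in measurable X]setTI.
exact: (measurable_fun_ler mf mg measurableT (Y := [set true])).
Qed.

Lemma measurable_ltr d (T : measurableType d) (R : realType) (f g : T -> R) :
  measurable_fun setT f -> measurable_fun setT g -> measurable [set x | f x < g x].
Proof.
move=> mf mg; rewrite -[X in measurable X]setTI.
exact: (measurable_fun_ltr mf mg measurableT (Y := [set true])).
Qed.

Lemma measurable_normr d (T : measurableType d) (R : realType) (f : T -> R) :
  measurable_fun setT f -> measurable_fun setT (fun x => `|f x|).
Proof. by move=> mf; exact: measurableT_comp. Qed.

Lemma measurable_affine (R : realType) (y a : R) :
  measurable_fun [set: R] (fun w : R => y + a * w).
Proof. by apply: measurable_funD => //; exact: mulrl_measurable. Qed.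


Section MeanLe.
Context {d : measure_display} {T : measurableType d} {R : realType}.
Variable P : probability T R.
Implicit Types (f g : T -> R) (a b c : R).

Definition nneg_meas f := measurable_fun setT f /\ forall x, 0 <= f x.

(** With the extended integral, an upper bound on the mean of a nonnegative
    function carries no integrability side condition. *)
Definition mean_le f a := (\int[P]_x (f x)%:E <= a%:E)%E.

Lemma mean_le_mono f g a : nneg_meas f -> nneg_meas g -> (forall x, f x <= g x) ->
  mean_le g a -> mean_le f a.
Proof.
move=> [mf f0] [mg g0] fg; apply: le_trans; apply: ge0_le_integral => //.
- by move=> x _; rewrite lee_fin.
- exact/measurable_EFinP.
- exact/measurable_EFinP.
- by move=> x _; rewrite lee_fin.
Qed.

Lemma mean_le_ae f g a : nneg_meas f -> nneg_meas g -> {ae P, forall x, f x <= g x} ->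
  mean_le g a -> mean_le f a.
Proof.
move=> [mf f0] [mg g0] fg; apply: le_trans; apply: ae_ge0_le_integral => //.
- by move=> x _; rewrite lee_fin.
- exact/measurable_EFinP.
- by move=> x _; rewrite lee_fin.
- exact/measurable_EFinP.
- by apply: filterS fg => x fgx _; rewrite lee_fin.
Qed.

Lemma mean_leD f g a b : nneg_meas f -> nneg_meas g -> mean_le f a -> mean_le g b ->
  mean_le (fun x => f x + g x) (a + b).
Proof.
move=> [mf f0] [mg g0] fa gb; rewrite /mean_le.
under eq_integral do rewrite EFinD.
have e0 x : [set: T] x -> (0 <= (f x)%:E)%E by rewrite lee_fin.
have e1 x : [set: T] x -> (0 <= (g x)%:E)%E by rewrite lee_fin.
rewrite (ge0_integralD P measurableT e0 _ e1); try exact/measurable_EFinP.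
by rewrite EFinD leeD.
Qed.

Lemma mean_leZ f a c : nneg_meas f -> 0 <= c -> mean_le f a -> mean_le (fun x => c * f x) (c * a).
Proof.
move=> [mf f0] c0 fa; rewrite /mean_le.
under eq_integral do rewrite EFinM.
have e0 x : [set: T] x -> (0 <= (f x)%:E)%E by rewrite lee_fin.
rewrite ge0_integralZl ?lee_fin//; last exact/measurable_EFinP.
by rewrite EFinM lee_wpmul2l// lee_fin.
Qed.

Lemma mean_le_cst a : mean_le (fun=> a) a.
Proof. by rewrite /mean_le integral_cst// [X in (_ * X)%E](@probability_setT _ _ _ P) mule1. Qed.

Lemma nnD f g : nneg_meas f -> nneg_meas g -> nneg_meas (fun x => f x + g x).
Proof.
move=> [mf f0] [mg g0]; split; first exact: measurable_funD.
by move=> x; rewrite addr_ge0.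
Qed.

Lemma nnZ f c : nneg_meas f -> 0 <= c -> nneg_meas (fun x => c * f x).
Proof.
move=> [mf f0] c0; split; first exact: measurable_funM.
by move=> x; rewrite mulr_ge0.
Qed.

Lemma nn_even f (m : nat) : measurable_fun setT f -> nneg_meas (fun x => f x ^+ (m.*2)).
Proof.
move=> mf; split; first exact: measurable_funX.
by move=> x; rewrite exprn_even_ge0// odd_double.
Qed.

Lemma nn_sqr f : measurable_fun setT f -> nneg_meas (fun x => f x ^+ 2).
Proof. exact: (@nn_even f 1). Qed.

Lemma nn_fourth f : measurable_fun setT f -> nneg_meas (fun x => f x ^+ 4).
Proof. exact: (@nn_even f 2). Qed.

Lemma nn_sum (I : Type) (r : seq I) (p : pred I) (f : I -> T -> R) :
  (forall i, nneg_meas (f i)) -> nneg_meas (fun x => \sum_(i <- r | p i) f i x).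
Proof.
move=> nf; split; last by move=> x; apply: sumr_ge0 => i _; have [] := nf i.
rewrite [X in measurable_fun _ X](_ : _ = (fun x => \sum_(i <- r) (if p i then f i x else 0))).
  by apply: measurable_sum => i; case: (p i) => //; have [] := nf i.
by apply/funext => x; rewrite big_mkcond.
Qed.

Lemma mean_le_sum (I : Type) (r : seq I) (f : I -> T -> R) (a : I -> R) :
  (forall i, nneg_meas (f i)) -> (forall i, mean_le (f i) (a i)) ->
  mean_le (fun x => \sum_(i <- r) f i x) (\sum_(i <- r) a i).
Proof.
move=> nf fa; elim: r => [|i r IH].
  rewrite big_nil /mean_le; under eq_integral do rewrite big_nil.
  exact: mean_le_cst.
rewrite big_cons /mean_le; under eq_integral do rewrite big_cons.
by apply: mean_leD => //; exact: nn_sum.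
Qed.

Lemma pr_mean_le f a c : nneg_meas f -> 0 < c -> mean_le f a -> pr P [set x | c <= f x] <= a / c.
Proof. by move=> [mf f0] c0 fa; exact: pr_markov_int. Qed.

Lemma mean_le_ge0 f a : nneg_meas f -> mean_le f a -> 0 <= a.
Proof.
move=> [_ f0] fa; rewrite -lee_fin; apply: le_trans fa.
by apply: integral_ge0 => x _; rewrite lee_fin.
Qed.

Lemma mean_le_sqr f a : measurable_fun setT f -> mean_le (fun x => f x ^+ 4) a ->
  mean_le (fun x => f x ^+ 2) (1 + a).
Proof.
move=> mf fa; apply: (@mean_le_mono _ (fun x => 1 + f x ^+ 4)).
- exact: nn_sqr.
- by apply: nnD; [split|exact: nn_fourth].
- move=> x; have := sqr_ge0 (f x ^+ 2 - 1); rewrite sqrrB -exprM.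
  by have := sqr_ge0 (f x); lra.
- by apply: mean_leD => //; [exact: nn_fourth|exact: mean_le_cst].
Qed.
End MeanLe.

(** * Conditional probabilities *)

Section CondProb.
Context {d : measure_display} {T : measurableType d} {R : realType}.
Variables (P : probability T R) (G0 : set (set T)) (E : set T).
Hypotheses (G0m : G0 `<=` measurable) (mE : measurable E).

Let G : set (set T) := <<s G0 >>.
Let T' := g_sigma_algebraType G0.

Lemma g_sigma_sub_measurable A : <<s G0 >> A -> measurable A.
Proof.
by move=> GA; apply: (smallest_sub (@sigma_algebra_measurable _ T) G0m); exact: GA.
Qed.

Let coarsen : T -> T' := fun x => x.

Let measurable_coarsen : measurable_fun setT coarsen.
Proof. by move=> _ A mA; rewrite setTI; exact: g_sigma_sub_measurable. Qed.

HB.instance Definition _ := isMeasurableFun.Build _ _ _ _ coarsen measurable_coarsen.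

Let P' : probability T' R := distribution P coarsen.

Let nu (A : set T') : \bar R := mrestr P mE (coarsen @^-1` A).

Let nu0 : nu set0 = 0%E. Proof. by rewrite /nu preimage_set0 measure0. Qed.

Let nu_ge0 A : (0 <= nu A)%E. Proof. exact: measure_ge0. Qed.

Let nu_sigma_additive : semi_sigma_additive nu.
Proof.
move=> F mF tF mUF.
have mF' i : d.-measurable (F i : set T) by apply: g_sigma_sub_measurable; first [exact: mF|exact: mUF].
have mUF' : d.-measurable (\bigcup_i F i : set T) by apply: g_sigma_sub_measurable; first [exact: mF|exact: mUF].
exact: (@measure_semi_sigma_additive _ _ _ (mrestr P mE : {measure set T -> \bar R})
  F mF' tF mUF').
Qed.

HB.instance Definition _ := isMeasure.Build _ _ _ nu nu0 nu_ge0 nu_sigma_additive.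

Let nu_fin : fin_num_fun nu.
Proof.
move=> A mA; rewrite /nu /mrestr/= fin_num_measure//.
by apply: measurableI => //; exact: g_sigma_sub_measurable.
Qed.

HB.instance Definition _ := @Measure_isFinite.Build _ _ _ nu nu_fin.

Let nu_dom : nu `<< P'.
Proof.
apply/null_content_dominatesP => A mA PA0.
apply/eqP; rewrite eq_le nu_ge0 andbT -PA0 /nu /mrestr /=.
rewrite le_measure// ?inE//; last exact: g_sigma_sub_measurable.
by apply: measurableI => //; exact: g_sigma_sub_measurable.
Qed.

(** Radon-Nikodym derivative of the trace of [E] with respect to the restriction
    of [P] to the smaller sigma-algebra. *)
Lemma cond_prob_exists : exists h : T -> R, is_cond_prob P G E h.
Proof.
pose f := Radon_Nikodym (charge_of_finite_measure nu) P'.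
have fin x : f x \is a fin_num by apply: Radon_Nikodym_fin_num.
have intf : P'.-integrable setT f by apply: Radon_Nikodym_integrable.
have mf : measurable_fun [set: T'] (fine \o f).
  by apply: measurableT_comp => //; exact: measurable_int intf.
have fE : (EFin \o (fine \o f)) = f by apply/funext => x /=; rewrite fineK.
have mfT : measurable_fun [set: T] (f : T -> \bar R).
  have mf' := measurable_int _ intf.
  by move=> _ B mB; rewrite setTI; apply: g_sigma_sub_measurable;
    have := mf' measurableT B mB; rewrite setTI.
exists (fine \o f : T -> R); split.
- by move=> B mB; have := mf measurableT B mB; rewrite setTI.
- rewrite fE; apply/integrableP; split => //.
  move/integrableP : intf => [mf' +].
  rewrite ge0_integral_pushforward//; last exact: measurableT_comp.
- move=> A GA.
  transitivity (\int[P]_(x in coarsen @^-1` A) ((f \o coarsen) x))%E.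
    by apply: eq_integral => x _ /=; rewrite fineK.
  rewrite -(@integral_pushforward _ _ _ _ _ coarsen measurable_coarsen P A f)//.
  + rewrite -[LHS]/(\int[P']_(y in A) f y)%E.
    by rewrite -(@Radon_Nikodym_integral _ _ _ (charge_of_finite_measure nu) P' A).
  + exact: measurable_int intf.
  + apply: (integrableS measurableT) => //; first exact: g_sigma_sub_measurable.
    apply/integrableP; split => //.
    move/integrableP : intf => [mf' +].
    by rewrite ge0_integral_pushforward//; exact: measurableT_comp.
Qed.

Lemma cond_probP : is_cond_prob P G E (cond_prob P G E).
Proof. by rewrite /cond_prob; have [h hh] := cond_prob_exists; exact: (xgetI _ hh). Qed.

(** It suffices to test the event against the conditioning sets: the sets
    where the conditional probability exceeds [c + e], or is below [c - e],
    are themselves among them, and on each of them the probability of [E]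
    is off by at least [e] times the probability of the set. *)
Lemma cond_prob_deviation (c e rho : R) : 0 < e ->
    (forall S, G S -> `|pr P (S `&` E) - c * pr P S| <= rho) ->
  pr P [set w | e < `|cond_prob P G E w - c|] <= 2 * rho / e.
Proof.
move=> e0 rhoP; have [Gh ih hE] := cond_probP; set h := cond_prob P G E in Gh ih hE *.
have Gitv (I : interval R) : G [set w | h w \in I].
  by rewrite -[X in G X]/(h @^-1` [set` I]); apply: Gh.
have mG A : G A -> measurable A by apply: g_sigma_sub_measurable; first [exact: mF|exact: mUF].
have key S : G S -> (\int[P]_(x in S) (h x)%:E)%E = (pr P (S `&` E))%:E.
  by move=> GS; rewrite hE// -prE//; apply: measurableI => //; exact: mG.
have cstS (S : set T) k : G S -> (\int[P]_(x in S) (k%:E))%E = (k * pr P S)%:E.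
  by move=> /mG mS; rewrite integral_cst//= prE.
have intS S : G S -> P.-integrable S (EFin \o h).
  by move=> GS; apply: (integrableS measurableT) => //; exact: mG.
have icst S k : G S -> P.-integrable S (EFin \o cst k).
  by move=> GS; apply: finite_measure_integrable_cst => //; exact: mG.
have up : pr P [set w | h w \in `]c + e, +oo[] <= rho / e.
  set S := [set w | _]; have GS : G S by exact: Gitv.
  rewrite ler_pdivlMr// mulrC.
  have : (((c + e) * pr P S)%:E <= (pr P (S `&` E))%:E)%E.
    rewrite -key// -cstS//; apply: le_integral; [exact: mG|exact: icst|exact: intS|].
    by move=> x /set_mem; rewrite /S/= in_itv/= andbT => /ltW; rewrite lee_fin.
  have := rhoP _ GS; rewrite lee_fin ler_norml => /andP[? ?]; lra.
have dn : pr P [set w | h w \in `]-oo, c - e[] <= rho / e.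
  set S := [set w | _]; have GS : G S by exact: Gitv.
  rewrite ler_pdivlMr// mulrC.
  have : ((pr P (S `&` E))%:E <= ((c - e) * pr P S)%:E)%E.
    rewrite -key// -cstS//; apply: le_integral; [exact: mG|exact: intS|exact: icst|].
    by move=> x /set_mem; rewrite /S/= in_itv/= => /ltW; rewrite lee_fin.
  have := rhoP _ GS; rewrite lee_fin ler_norml => /andP[? ?]; lra.
rewrite (_ : 2 * rho / e = rho / e + rho / e); last by field; rewrite gt_eqF.
apply: le_trans (lerD up dn); apply: pr_sub2.
- apply: measurable_ltr => //; apply: measurable_normr.
  by apply: measurable_funB => //; apply/measurable_EFinP; exact: measurable_int ih.
- by apply: mG; exact: Gitv.
- by apply: mG; exact: Gitv.
- move=> w /=; rewrite !in_itv/= andbT.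
  rewrite ltNge ler_norml negb_and -!ltNge => /orP[H|H]; [right|left]; lra.
Qed.

End CondProb.

(** * Product laws on finite families of reals *)

Definition cylinders (K : Type) (R : realType) : set (set (K -> R)) :=
  [set A | exists k (B : set R), measurable B /\ A = (fun z => z k) @^-1` B].

Arguments cylinders : clear implicits.

(** A generated sigma-algebra, so that measurability of a map into it is
    checked coordinate by coordinate. *)
Definition sample (K : Type) (R : realType) := g_sigma_algebraType (cylinders K R).

HB.instance Definition _ (K : Type) (R : realType) := Measurable.on (sample K R).

Definition sample_of (K : Type) (R : realType) (z : K -> R) : sample K R := z.
Definition coord (K : Type) (R : realType) (k : K) (z : sample K R) : R := (z : K -> R) k.

Lemma measurable_coord (K : Type) (R : realType) (k : K) :
  measurable_fun setT (@coord K R k).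
Proof.
by move=> _ B mB; rewrite setTI; apply: sub_sigma_algebra; exists k, B.
Qed.

Lemma measurable_to_sample d (T : measurableType d) (K : Type) (R : realType)
    (f : T -> sample K R) :
  (forall k, measurable_fun setT (fun x => coord k (f x))) -> measurable_fun setT f.
Proof.
move=> mf; apply: (@measurability _ _ _ (sample K R) _ _ (cylinders K R)) => //.
move=> _ [_ [k [B [mB ->]]] <-].
by have := mf k measurableT B mB.
Qed.

Definition prod_prob d1 d2 (T1 : measurableType d1) (T2 : measurableType d2) (R : realType)
    (P1 : probability T1 R) (P2 : probability T2 R) : set (T1 * T2) -> \bar R :=
  (P1 \x P2)%E.

Section ProdProb.
Context d1 d2 (T1 : measurableType d1) (T2 : measurableType d2) (R : realType).
Variables (P1 : probability T1 R) (P2 : probability T2 R).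
HB.instance Definition _ := Measure.on (prod_prob P1 P2).

Lemma prod_probT : prod_prob P1 P2 setT = 1%E.
Proof.
rewrite -setXTT; transitivity (P1 setT * P2 setT)%E; first exact: product_measure1E.
by rewrite !probability_setT mule1.
Qed.

HB.instance Definition _ := Measure_isProbability.Build _ _ _ (prod_prob P1 P2) prod_probT.
End ProdProb.

Section Boxes.
Context {K : finType} {R : realType}.
Notation S := (sample K R).

Definition box (B : K -> set R) : set S := [set z | forall k, B k (coord k z)].

Lemma measurable_box B : (forall k, measurable (B k)) -> measurable (box B).
Proof.
move=> mB; rewrite (_ : box B = \bigcap_(k in [set: K]) (coord k @^-1` B k)); last first.
  by apply/seteqP; split => [z zB k _|z zB k]; [exact: zB|exact: zB].
apply: fin_bigcap_measurable => // k _.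
by have := @measurable_coord K R k measurableT _ (mB k); rewrite setTI.
Qed.

Definition product_law (mu : K -> probability R R) (L : {measure set S -> \bar R}) :=
  forall B, (forall k, measurable (B k)) ->
    L (box B) = (\prod_k pr (mu k) (B k))%:E.

(** Boxes form a pi-system that generates the sigma-algebra. *)
Lemma product_law_unique mu (L1 L2 : {measure set S -> \bar R}) :
  product_law mu L1 -> product_law mu L2 ->
  forall A, measurable A -> L1 A = L2 A.
Proof.
move=> h1 h2 A mA.
pose G : set (set S) := [set C | exists B, (forall k, measurable (B k)) /\ C = box B].
have boxT : box (fun=> setT) = setT by apply/seteqP; split.
apply: (@measure_unique _ R S G (fun=> setT)) => //.
- rewrite -[LHS]/(<<s cylinders K R >>); apply/seteqP; split.
    apply: sub_sigma_algebra2 => _ [k [B [mB ->]]].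
    exists (fun j => if j == k then B else setT); split.
      by move=> j; case: ifP.
    apply/seteqP; split => [z /= Bz j|z /(_ k)]; last by rewrite eqxx.
    by case: eqP => // ->.
  apply: smallest_sub; first exact: sigma_algebra_measurable.
  by move=> _ [B [mB ->]]; exact: measurable_box.
- move=> _ _ [B1 [mB1 ->]] [B2 [mB2 ->]]; exists (fun k => B1 k `&` B2 k); split.
    by move=> k; exact: measurableI.
  by apply/seteqP; split => [z [z1 z2] k|z z12]; [split|split => k; have [] := z12 k].
- by move=> _; exists (fun=> setT); rewrite boxT.
- by rewrite bigcup_const//; exists 0%N.
- by move=> _ [B [mB ->]]; rewrite h1// h2.
- by move=> _; rewrite -boxT h1// ltry.
Qed.

End Boxes.

Section ProductLaw.
Context {K : finType} {R : realType}.
Notation S := (sample K R).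
Variables (mu : K -> probability R R) (L : probability S R).
Hypothesis Lmu : product_law mu L.

Section Image.
Context d (T : measurableType d) (Q : probability T R) (h : T -> S).
Hypotheses (mh : measurable_fun setT h)
  (hQ : forall B, (forall k, measurable (B k)) ->
     Q (h @^-1` box B) = (\prod_k pr (mu k) (B k))%:E).

Let hm : {mfun T >-> S} := HB.pack h (isMeasurableFun.Build _ _ _ _ h mh).

Lemma product_law_image A : measurable A -> L A = Q (h @^-1` A).
Proof.
move=> mA; rewrite -[RHS]/(distribution Q hm A).
by apply: (@product_law_unique _ _ mu) => // B mB; exact: hQ.
Qed.

Lemma product_law_image_int (F : S -> \bar R) : measurable_fun setT F ->
  (forall z, 0 <= F z)%E -> (\int[L]_z F z = \int[Q]_x F (h x))%E.
Proof.
move=> mF F0; transitivity (\int[distribution Q hm]_z F z)%E.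
  by apply: eq_measure_integral => A mA _; exact: product_law_image.
by rewrite ge0_integral_distribution.
Qed.
End Image.

Definition mix (J : pred K) (z1 z2 : S) : S :=
  sample_of (fun k => if J k then coord k z1 else coord k z2).

Lemma coord_mix J k z1 z2 : coord k (mix J z1 z2) = if J k then coord k z1 else coord k z2.
Proof. by []. Qed.

Lemma measurable_mix J : measurable_fun setT (fun z : S * S => mix J z.1 z.2).
Proof.
apply: measurable_to_sample => k; rewrite /coord /mix /sample_of; case: (J k).
- exact: (measurableT_comp (@measurable_coord K R k) measurable_fst).
- exact: (measurableT_comp (@measurable_coord K R k) measurable_snd).
Qed.

Let mix_law J B : (forall k, measurable (B k)) ->
  prod_prob L L ((fun z : S * S => mix J z.1 z.2) @^-1` box B)
  = (\prod_k pr (mu k) (B k))%:E.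
Proof.
move=> mB.
pose B1 k := if J k then B k else setT; pose B2 k := if J k then setT else B k.
have mB1 k : measurable (B1 k) by rewrite /B1; case: ifP.
have mB2 k : measurable (B2 k) by rewrite /B2; case: ifP.
rewrite (_ : _ @^-1` _ = box B1 `*` box B2); last first.
  apply/seteqP; split => [[z1 z2] /= zB|[z1 z2] /= [zB1 zB2] k]; last first.
    by rewrite coord_mix; have := zB1 k; have := zB2 k; rewrite /B1 /B2; case: (J k).
  by split => k; have := zB k; rewrite coord_mix /B1 /B2; case: (J k).
rewrite /prod_prob product_measure1E ?Lmu//; try exact: measurable_box.
rewrite -EFinM -big_split/=; congr _%:E; apply: eq_bigr => k _.
by rewrite /B1 /B2; case: (J k); rewrite prT ?mulr1 ?mul1r.
Qed.

(** Coordinates outside [J] can be redrawn independently without changing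
    the law: this is the form in which independence is used throughout. *)
Lemma resample_int J (F : S -> \bar R) : measurable_fun setT F ->
  (forall z, 0 <= F z)%E -> (\int[L]_z F z = \int[L]_z1 \int[L]_z2 F (mix J z1 z2))%E.
Proof.
move=> mF F0.
rewrite (product_law_image_int (@measurable_mix J) (@mix_law J) mF F0).
rewrite -[LHS]/(\int[(L \x L)%E]_x F (mix J x.1 x.2))%E.
rewrite (fubini_tonelli1 (fun x : S * S => F (mix J x.1 x.2)))//.
by apply: measurableT_comp => //; exact: measurable_mix.
Qed.

Lemma measurable_mix2 J z1 : measurable_fun setT (mix J z1).
Proof.
apply: measurable_to_sample => k; rewrite /coord /mix /sample_of.
by case: (J k); [exact: measurable_cst|exact: measurable_coord].
Qed.

Lemma measurable_preimage_mix J A z1 : measurable A -> measurable (mix J z1 @^-1` A).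
Proof. by move=> mA; rewrite -[X in measurable X]setTI; exact: measurable_mix2. Qed.

Lemma measurable_pr_mix J A : measurable A ->
  measurable_fun setT (fun z1 => pr L (mix J z1 @^-1` A)).
Proof.
move=> mA; apply: measurableT_comp => //.
have mA' : measurable ((fun z : S * S => mix J z.1 z.2) @^-1` A).
  by rewrite -[X in measurable X]setTI; exact: measurable_mix.
rewrite (_ : (fun z1 => _) = L \o xsection ((fun z : S * S => mix J z.1 z.2) @^-1` A)).
  exact: measurable_fun_xsection.
by apply/funext => z1 /=; congr (L _); apply/seteqP; split => z2; rewrite /xsection/= ?inE.
Qed.

Lemma bdd_pr_mix J A : measurable A -> bdd_meas (fun z1 => pr L (mix J z1 @^-1` A)).
Proof.
move=> mA; split; first exact: measurable_pr_mix.
exists 1 => z1; rewrite ger0_norm ?pr_ge0//; apply: pr_le1.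
exact: measurable_preimage_mix.
Qed.

(** Conditioning on the coordinates in [J]: a factor that depends only on them
    can be kept, and the event is replaced by its conditional probability. *)
Lemma Ex_resample J A g : measurable A -> bdd_meas g -> (forall z, 0 <= g z) ->
  (forall z1 z2, g (mix J z1 z2) = g z1) ->
  Ex L (fun z => g z * \1_A z) = Ex L (fun z => g z * pr L (mix J z @^-1` A)).
Proof.
move=> mA bg g0 gJ; congr fine; have [mg _] := bg.
rewrite (resample_int J); last 2 first.
- by apply/measurable_EFinP; apply: measurable_funM => //; exact: measurable_indic.
- by move=> z; rewrite lee_fin mulr_ge0// indicE ler0n.
apply: eq_integral => z1 _.
have mAz : measurable (mix J z1 @^-1` A) by exact: measurable_preimage_mix.
have -> : (fun z2 : S => (g (mix J z1 z2) * \1_A (mix J z1 z2))%:E) =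
    (fun z2 => ((g z1)%:E * (\1_(mix J z1 @^-1` A) z2)%:E)%E) :> (S -> \bar R).
  by apply/funext => z2; rewrite gJ EFinM.
rewrite ge0_integralZl ?lee_fin//; last by apply/measurable_EFinP; apply: measurable_indic.
by rewrite integral_indic// setIT EFinM; congr (_ * _)%E; exact: prE.
Qed.

Lemma pr_resample J A B : measurable A -> measurable B ->
  (forall z1 z2, B (mix J z1 z2) <-> B z1) ->
  pr L (B `&` A) = Ex L (fun z => \1_B z * pr L (mix J z @^-1` A)).
Proof.
move=> mA mB BJ; rewrite -ExM_indic//; apply: Ex_resample => //; first exact: bdd_indic.
by move=> z1 z2; rewrite !indicE; congr ((nat_of_bool _)%:R); apply/idP/idP => /set_mem/BJ/mem_set.
Qed.

Definition reindex (s : K -> K) (z : S) : S := sample_of (fun k => coord (s k) z).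

Lemma coord_reindex s k z : coord k (reindex s z) = coord (s k) z.
Proof. by []. Qed.

Lemma measurable_reindex s : measurable_fun setT (reindex s).
Proof. by apply: measurable_to_sample => k; exact: measurable_coord. Qed.

Section Exchange.
Variable s : K -> K.
Hypotheses (sK : involutive s) (mus : forall k, mu (s k) = mu k).

Let reindex_law B : (forall k, measurable (B k)) ->
  L (reindex s @^-1` box B) = (\prod_k pr (mu k) (B k))%:E.
Proof.
move=> mB; rewrite (_ : _ @^-1` _ = box (B \o s)); last first.
  apply/seteqP; split => [z zB k|z zB k] /=.
    by have := zB (s k); rewrite coord_reindex sK.
  by have := zB (s k); rewrite /= sK.
rewrite Lmu//=; congr _%:E.
rewrite (reindex_onto s s)/=; last by move=> k _; exact: sK.
by apply: eq_big => [k|k _]; rewrite ?sK ?eqxx// mus.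
Qed.

Lemma exchange_int (F : S -> \bar R) : measurable_fun setT F ->
  (forall z, 0 <= F z)%E -> (\int[L]_z F z = \int[L]_z F (reindex s z))%E.
Proof.
move=> mF F0; exact: (product_law_image_int (@measurable_reindex s) reindex_law mF F0).
Qed.

Lemma exchange_pr A : measurable A -> pr L A = pr L (reindex s @^-1` A).
Proof.
move=> mA; congr fine.
exact: (product_law_image (@measurable_reindex s) reindex_law mA).
Qed.

End Exchange.

Lemma marginal k A : measurable A -> L (coord k @^-1` A) = mu k A.
Proof.
move=> mA.
rewrite (_ : coord k @^-1` A = box (fun j => if j == k then A else setT)); last first.
  apply/seteqP; split => [z /= Az j|z /(_ k)]; last by rewrite eqxx.
  by case: eqP => // ->.
rewrite Lmu; last by move=> j; case: ifP.
rewrite (bigD1 k)//= eqxx big1 ?mulr1 -?prE// => j /negbTE ->; exact: prT.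
Qed.

Let coordm k : {mfun S >-> R} := HB.pack (coord k : S -> R)
  (isMeasurableFun.Build _ _ S R (coord k) (@measurable_coord K R k)).

Lemma marginal_int k (f : R -> \bar R) : measurable_fun setT f -> (forall x, 0 <= f x)%E ->
  (\int[L]_z f (coord k z) = \int[mu k]_x f x)%E.
Proof.
move=> mf f0; transitivity (\int[distribution L (coordm k)]_x f x)%E.
  by rewrite ge0_integral_distribution.
by apply: eq_measure_integral => A mA _; rewrite -[LHS]/(L (coord k @^-1` A)) marginal.
Qed.

Definition upd (z : S) (k : K) (x : R) : S :=
  sample_of (fun j => if j == k then x else coord j z).

Lemma coord_upd z k x j : coord j (upd z k x) = if j == k then x else coord j z.
Proof. by []. Qed.

Lemma measurable_upd : forall k, measurable_fun setT (fun zx : S * R => upd zx.1 k zx.2).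
Proof.
move=> k; apply: measurable_to_sample => j; rewrite /coord /upd /sample_of.
case: (j == k); first exact: measurable_snd.
exact: (measurableT_comp (@measurable_coord K R j) measurable_fst).
Qed.

Lemma resample1_int k (F : S -> \bar R) : measurable_fun setT F ->
  (forall z, 0 <= F z)%E ->
  (\int[L]_z F z = \int[L]_z \int[mu k]_x F (upd z k x))%E.
Proof.
move=> mF F0; rewrite (@resample_int (fun j => j != k))//.
apply: eq_integral => z _.
rewrite -(@marginal_int k (fun x => F (upd z k x)))//.
  apply: eq_integral => z2 _; congr F; apply/funext => j.
  rewrite -[LHS]/(coord j _) -[RHS]/(coord j _) coord_mix coord_upd.
  by case: eqP => //= ->.
apply: measurableT_comp => //.
apply: (@measurableT_comp _ _ _ _ _ _ (fun zx : S * R => upd zx.1 k zx.2) _ (fun x => (z, x))).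
  exact: measurable_upd.
exact: pair1_measurable.
Qed.

Lemma resample1_int_swap k (F : S -> \bar R) : measurable_fun setT F ->
  (forall z, 0 <= F z)%E ->
  (\int[L]_z F z = \int[mu k]_x \int[L]_z F (upd z k x))%E.
Proof.
move=> mF F0; rewrite (resample1_int k)//.
rewrite (fubini_tonelli (fun zx : S * R => F (upd zx.1 k zx.2)))//.
by apply: measurableT_comp => //; exact: measurable_upd.
Qed.

(** A weighted sum of independent coordinates is built up one coordinate at
    a time; [V l] is the potential that remains to be paid for the
    coordinates in [l]. *)
Lemma telescope_sum (a c : K -> R) (V : seq K -> R -> R) (l : seq K) (x : R) :
  uniq l ->
  (forall l', measurable_fun setT (V l')) -> (forall l' y, 0 <= V l' y) ->
  (forall k, 0 <= c k) ->
  (forall k l' y, k \in l ->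
    (\int[mu k]_w (V l' (y + a k * w))%:E <= (V (k :: l') y + c k)%:E)%E) ->
  (\int[L]_z (V [::] (x + \sum_(k <- l) a k * coord k z))%:E
    <= (V l x + \sum_(k <- l) c k)%:E)%E.
Proof.
move=> + mV V0 c0; elim: l x => [|k l IH] x.
  move=> _ _; rewrite big_nil addr0.
  under eq_integral do rewrite big_nil addr0.
  by rewrite integral_cst// [X in (_ * X)%E](@probability_setT _ _ _ L) mule1.
move=> /= /andP[kl ul] step.
rewrite (resample1_int_swap k)//; last 2 first.
- apply/measurable_EFinP; apply: measurableT_comp => //.
  apply: measurable_funD => //; apply: measurable_sum => j.
  by apply: measurable_funM => //; exact: measurable_coord.
- by move=> z; rewrite lee_fin.
have mVs j (y : R) : measurable_fun setT (fun w => V j (y + a k * w)).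
  by apply: measurableT_comp => //; exact: measurable_affine.
have E w : (\int[L]_z (V [::] (x + \sum_(j <- k :: l) a j * coord j (upd z k w)))%:E
    <= (V l (x + a k * w) + \sum_(j <- l) c j)%:E)%E.
  apply: le_trans (IH (x + a k * w) ul _); last first.
    by move=> j l' y jl; apply: step; rewrite inE jl orbT.
  rewrite le_eqVlt; apply/orP; left; apply/eqP.
  apply: eq_integral => z _; congr ((V _ _)%:E).
  rewrite big_cons coord_upd eqxx -!addrA; congr (_ + (_ + _)).
  apply: eq_big_seq => j jl; rewrite coord_upd; case: eqP => // jk.
  by move: kl; rewrite -jk jl.
apply: (@le_trans _ _ (\int[mu k]_w (V l (x + a k * w) + \sum_(j <- l) c j)%:E)%E).
  apply: ge0_le_integral => //.
  - by move=> w _; apply: integral_ge0 => z _; rewrite lee_fin.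
  - pose F (zw : S * R) := (V [::] (x + \sum_(j <- k :: l) a j * coord j (upd zw.1 k zw.2)))%:E.
    apply: (@measurable_fun_fubini_tonelli_G _ _ _ _ R L F).
      apply/measurable_EFinP; apply: measurableT_comp => //.
      apply: measurable_funD => //; apply: measurable_sum => j.
      apply: measurable_funM => //.
      by apply: measurableT_comp; [exact: measurable_coord|exact: measurable_upd].
    by move=> ?; rewrite lee_fin.
  - by apply/measurable_EFinP; apply: measurable_funD.
under eq_integral do rewrite EFinD.
have s0 : 0 <= \sum_(j <- l) c j by exact: sumr_ge0.
rewrite ge0_integralD//; [|by move=> ? _; rewrite lee_fin|exact/measurable_EFinP].
rewrite integral_cst// [X in (_ + _ * X)%E](@probability_setT _ _ _ (mu k)) mule1.
rewrite big_cons addrA !EFinD leeD2r// -EFinD.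
by apply: step; rewrite mem_head.
Qed.

End ProductLaw.

(** * Ridge regression: existence, stability and monotonicity *)

Section Dot.
Context {R : realType} {k : nat}.
Implicit Types u v w : 'cV[R]_k.

Lemma dotpC u v : dotp u v = dotp v u.
Proof. by apply: eq_bigr => j _; rewrite mulrC. Qed.

Lemma dotpDr u v w : dotp u (v + w) = dotp u v + dotp u w.
Proof. by rewrite -big_split; apply: eq_bigr => j _; rewrite mxE mulrDr. Qed.

Lemma dotpNr u v : dotp u (- v) = - dotp u v.
Proof. by rewrite -sumrN; apply: eq_bigr => j _; rewrite mxE mulrN. Qed.

Lemma dotpBr u v w : dotp u (v - w) = dotp u v - dotp u w.
Proof. by rewrite dotpDr dotpNr. Qed.

Lemma dotpZr a u v : dotp u (a *: v) = a * dotp u v.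
Proof. by rewrite mulr_sumr; apply: eq_bigr => j _; rewrite mxE mulrCA. Qed.

Lemma dotp0r u : dotp u 0 = 0.
Proof. by rewrite /dotp big1// => j _; rewrite mxE mulr0. Qed.

Lemma dotpDl u v w : dotp (v + w) u = dotp v u + dotp w u.
Proof. by rewrite !(dotpC _ u) dotpDr. Qed.

Lemma dotpBl u v w : dotp (v - w) u = dotp v u - dotp w u.
Proof. by rewrite !(dotpC _ u) dotpBr. Qed.

Lemma dotpZl a u v : dotp (a *: v) u = a * dotp v u.
Proof. by rewrite !(dotpC _ u) dotpZr. Qed.

Lemma dotp_ge0 u : 0 <= dotp u u.
Proof. by apply: sumr_ge0 => j _; rewrite -expr2 sqr_ge0. Qed.

Lemma dotp_eq0 u : dotp u u = 0 -> u = 0.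
Proof.
move=> /eqP; rewrite psumr_eq0 => [/allP u0|j _]; last by rewrite -expr2 sqr_ge0.
apply/colP => j; have := u0 j; rewrite mem_index_enum => /(_ isT).
by rewrite mulf_eq0 orbb mxE => /eqP.
Qed.

Lemma l2norm_sqr u : l2norm u ^+ 2 = dotp u u.
Proof.
rewrite /l2norm sqr_sqrtr; last by apply: sumr_ge0 => j _; exact: sqr_ge0.
by apply: eq_bigr => j _; rewrite expr2.
Qed.

Lemma dotp_mx u v : dotp u v = (u^T *m v) 0 0.
Proof. by rewrite mxE; apply: eq_bigr => j _; rewrite mxE. Qed.

Lemma dotp_delta u j : dotp u (delta_mx j 0) = u j 0.
Proof.
rewrite /dotp (bigD1 j)//= big1 ?addr0; first by rewrite mxE !eqxx mulr1.
by move=> i ij; rewrite mxE (negbTE ij) mulr0.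
Qed.

Lemma cauchy_schwarz u v : dotp u v ^+ 2 <= dotp u u * dotp v v.
Proof.
have := dotp_ge0 (dotp v v *: u - dotp u v *: v).
rewrite dotpBr !dotpBl !dotpZr !dotpZl (dotpC v u).
have := dotp_ge0 v; rewrite le_eqVlt => /predU1P[/esym v0|v_gt0 H].
  by move=> _; rewrite (dotp_eq0 v0) !dotp0r expr0n mulr0.
rewrite -(ler_pM2l v_gt0) -subr_ge0; apply: le_trans H _.
by rewrite le_eqVlt; apply/orP; left; apply/eqP; ring.
Qed.

Lemma sqr_coord_le_dotp u j : u j 0 ^+ 2 <= dotp u u.
Proof.
rewrite /dotp (bigD1 j)//= -expr2 lerDl; apply: sumr_ge0 => i _.
by rewrite -expr2 sqr_ge0.
Qed.
End Dot.

Lemma mulr_le_half_sqr (R : realFieldType) (a b : R) : a * b <= a ^+ 2 / 2 + b ^+ 2 / 2.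
Proof. by have := sqr_ge0 (a - b); rewrite sqrrB; lra. Qed.

Section RidgeTheory.
Context {R : realType} {k : nat} {I : finType}.
Implicit Types (m : pred I) (x : I -> 'cV[R]_k) (y : I -> R) (b v : 'cV[R]_k) (kap : R).

(** The normal equations of the ridge regression on the points selected by
    [m]; every property of the fit is derived from them. *)
Definition is_ridge kap m x y b := forall v,
  \sum_(i | m i) (y i - dotp (x i) b) * dotp (x i) v = kap * dotp b v.

Definition gram kap m x : 'M[R]_k := \sum_(i | m i) x i *m (x i)^T + kap%:M.

Definition ridge kap m x y : 'cV[R]_k :=
  invmx (gram kap m x) *m \sum_(i | m i) y i *: x i.

Definition ridge_obj kap m x y b : R :=
  \sum_(i | m i) (y i - dotp (x i) b) ^+ 2 + kap * dotp b b.

Lemma gram_quad kap m x u v :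
  (u^T *m gram kap m x *m v) 0 0 = \sum_(i | m i) dotp (x i) u * dotp (x i) v + kap * dotp u v.
Proof.
rewrite /gram mulmxDr mulmxDl mul_mx_scalar -scalemxAl mxE [X in _ + X]mxE -dotp_mx.
congr (_ + _); rewrite mulmx_sumr mulmx_suml summxE; apply: eq_bigr => i _.
rewrite mulmxA -mulmxA [(x i)^T *m v]mx11_scalar mul_mx_scalar mxE mulrC.
by rewrite -!dotp_mx (dotpC u).
Qed.

Lemma gram_unit kap m x : 0 < kap -> gram kap m x \in unitmx.
Proof.
move=> k0; rewrite -row_free_unit -kermx_eq0; apply/rowV0P => v /sub_kermxP vG.
have := gram_quad kap m x v^T v^T; rewrite trmxK vG mul0mx mxE => /esym/eqP.
rewrite paddr_eq0; last 2 first.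
- by apply: sumr_ge0 => i _; rewrite -expr2 sqr_ge0.
- by rewrite mulr_ge0 ?dotp_ge0// ltW.
move=> /andP[_]; rewrite mulf_eq0 gt_eqF//= => /eqP/dotp_eq0 v0.
by rewrite -[v]trmxK v0 trmx0.
Qed.

Lemma ridgeP kap m x y : 0 < kap -> is_ridge kap m x y (ridge kap m x y).
Proof.
move=> k0 v; set b := ridge _ _ _ _.
have Gb : gram kap m x *m b = \sum_(i | m i) y i *: x i by rewrite mulKVmx ?gram_unit.
have := gram_quad kap m x v b; rewrite -mulmxA Gb -dotp_mx (dotpC v b).
have -> : dotp v (\sum_(i | m i) y i *: x i) = \sum_(i | m i) y i * dotp (x i) v.
  rewrite (big_morph (dotp v) (dotpDr v) (dotp0r v)).
  by apply: eq_bigr => i _; rewrite dotpZr dotpC.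
move=> H; apply: (addIr (\sum_(i | m i) dotp (x i) v * dotp (x i) b)).
rewrite [RHS]addrC -H -big_split/=; apply: eq_bigr => i _; ring.
Qed.

Lemma ridge_objE kap m x y b b' : is_ridge kap m x y b ->
  ridge_obj kap m x y b' = ridge_obj kap m x y b
    + (\sum_(i | m i) dotp (x i) (b' - b) ^+ 2 + kap * dotp (b' - b) (b' - b)).
Proof.
move=> rb; rewrite /ridge_obj.
have -> : \sum_(i | m i) (y i - dotp (x i) b') ^+ 2 = \sum_(i | m i) (y i - dotp (x i) b) ^+ 2
    + \sum_(i | m i) dotp (x i) (b' - b) ^+ 2 - 2 * (kap * dotp b (b' - b)).
  rewrite -rb mulr_sumr -big_split/= -sumrB; apply: eq_bigr => i _.
  by rewrite dotpBr; ring.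
by rewrite !dotpBr !dotpBl (dotpC b' b); ring.
Qed.

(** The objective at the fit does not exceed the objective at zero. *)
Lemma ridge_residual_le kap m x y b : 0 <= kap -> is_ridge kap m x y b ->
  \sum_(i | m i) (y i - dotp (x i) b) ^+ 2 + kap * dotp b b <= \sum_(i | m i) y i ^+ 2.
Proof.
move=> k0 /(ridge_objE 0); rewrite {1}/ridge_obj dotp0r mulr0 addr0.
under eq_bigr do rewrite dotp0r subr0.
move=> ->; rewrite -[leLHS]/(ridge_obj kap m x y b) lerDl addr_ge0 ?mulr_ge0 ?dotp_ge0//.
by apply: sumr_ge0 => i _; exact: sqr_ge0.
Qed.

Lemma argmin_ridge kap m x y b (a : R) (f : 'cV[R]_k -> R) : 0 < kap -> 0 < a ->
  is_ridge kap m x y b -> (forall b', f b' = a * ridge_obj kap m x y b') -> argmin f = b.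
Proof.
move=> k0 a0 rb fE; rewrite /argmin.
have fmin b' : f b' = f b + a * (\sum_(i | m i) dotp (x i) (b' - b) ^+ 2
    + kap * dotp (b' - b) (b' - b)) by rewrite !fE (ridge_objE _ rb); ring.
have s0 b' : 0 <= \sum_(i | m i) dotp (x i) (b' - b) ^+ 2.
  by apply: sumr_ge0 => i _; exact: sqr_ge0.
apply: xget_unique => [b'|b' b'min].
  by rewrite (fmin b') lerDl mulr_ge0 ?(ltW a0)// addr_ge0// mulr_ge0 ?dotp_ge0// ltW.
have := b'min b; rewrite (fmin b') gerDl pmulr_rle0// => H.
have kd : kap * dotp (b' - b) (b' - b) <= 0.
  by apply: le_trans H; rewrite lerDr.
have : dotp (b' - b) (b' - b) = 0.
  by apply/eqP; rewrite eq_le dotp_ge0 andbT -(pmulr_rle0 _ k0).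
by move=> /dotp_eq0/eqP; rewrite subr_eq0 => /eqP.
Qed.

(** The change of fit is controlled by strong convexity alone: the residual
    of the deleted point in the fit that ignores it bounds the total squared
    change over all points, however many there are. *)
Lemma ridge_drop_stable kap kap' m x y b b' i : 0 < kap -> m i ->
  is_ridge kap m x y b -> is_ridge kap' (fun j => m j && (j != i)) x y b' ->
  \sum_(j | m j) dotp (x j) (b - b') ^+ 2
    <= (y i - dotp (x i) b') ^+ 2 + (kap - kap') ^+ 2 * dotp b' b' / kap.
Proof.
move=> k0 mi rb rb'; set D := b - b'.
have := rb D; have := rb' D => H' H.
pose s := dotp (x i) D; pose r' := y i - dotp (x i) b'.
have Q : \sum_(j | m j) dotp (x j) D ^+ 2 + kap * dotp D D
    = r' * s - (kap - kap') * dotp b' D.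
  have E : \sum_(j | m j) (y j - dotp (x j) b') * dotp (x j) D = r' * s + kap' * dotp b' D.
    by rewrite (bigD1 i)//= -H'.
  have -> : \sum_(j | m j) dotp (x j) D ^+ 2 =
      \sum_(j | m j) (y j - dotp (x j) b') * dotp (x j) D
      - \sum_(j | m j) (y j - dotp (x j) b) * dotp (x j) D.
    rewrite -sumrB; apply: eq_bigr => j _.
    by rewrite /D !dotpBr; ring.
  by rewrite E H /D !dotpBr !dotpBl (dotpC b' b); ring.
have s2 : s ^+ 2 <= \sum_(j | m j) dotp (x j) D ^+ 2.
  by rewrite (bigD1 i)//= lerDl sumr_ge0// => j _; exact: sqr_ge0.
have D0 := dotp_ge0 D; have b0 := dotp_ge0 b'.
set A := \sum_(j | m j) _ in Q s2 *; set e := kap - kap' in Q *.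
clearbody A e D.
have bD : - e * dotp b' D <= e ^+ 2 * dotp b' b' / kap / 2 + kap * dotp D D / 2.
  have := dotp_ge0 (e *: b' + kap *: D).
  rewrite dotpDr !dotpDl !dotpZr !dotpZl (dotpC D b') => H0.
  have : 0 <= (e * (e * dotp b' b' + kap * dotp b' D)
      + kap * (e * dotp b' D + kap * dotp D D)) / (2 * kap).
    apply: divr_ge0; last by rewrite mulr_ge0 ?ltW.
    by apply: le_trans H0 _; rewrite le_eqVlt; apply/orP; left; apply/eqP; ring.
  rewrite (_ : _ / _ = e ^+ 2 * dotp b' b' / kap / 2 + kap * dotp D D / 2 + e * dotp b' D).
    by move=> ?; lra.
  by field; rewrite gt_eqF.
have rs : r' * s <= r' ^+ 2 / 2 + s ^+ 2 / 2 by exact: mulr_le_half_sqr.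
have : 0 <= kap * dotp D D by rewrite mulr_ge0// ltW.
by rewrite -/r'; lra.
Qed.

(** Only the residual of [i] drives the change of the fit, so the fitted value
    at [i] moves by at most [dotp (x i) (x i) / kap] times the change of this
    residual. *)
Lemma ridge_residual_expands kap m x y y' b b' i : 0 < kap -> m i ->
  is_ridge kap m x y b -> is_ridge kap m x y' b' ->
  (forall j, j != i -> y j = y' j) ->
  `|y i - y' i| <= (1 + dotp (x i) (x i) / kap) *
     `|(y i - dotp (x i) b) - (y' i - dotp (x i) b')|.
Proof.
move=> k0 mi rb rb' yy'; set D := b - b'.
pose s := dotp (x i) D; pose h := y i - y' i.
have Q : \sum_(j | m j) dotp (x j) D ^+ 2 + kap * dotp D D = h * s.
  have -> : \sum_(j | m j) dotp (x j) D ^+ 2 = h * s +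
      \sum_(j | m j) (y' j - dotp (x j) b') * dotp (x j) D
      - \sum_(j | m j) (y j - dotp (x j) b) * dotp (x j) D.
    rewrite (bigD1 i)//= [X in h * s + X](bigD1 i)//= [X in _ - X](bigD1 i)//=.
    have -> : \sum_(j | m j && (j != i)) dotp (x j) D ^+ 2 =
      \sum_(j | m j && (j != i)) (y' j - dotp (x j) b') * dotp (x j) D
      - \sum_(j | m j && (j != i)) (y j - dotp (x j) b) * dotp (x j) D.
      rewrite -sumrB; apply: eq_bigr => j /andP[_ ji].
      by rewrite (yy' _ ji) /D !dotpBr; ring.
    by rewrite /h /s /D !dotpBr; ring.
  by rewrite rb rb' /D !dotpBr !dotpBl (dotpC b' b); ring.
have s2 : s ^+ 2 <= \sum_(j | m j) dotp (x j) D ^+ 2.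
  by rewrite (bigD1 i)//= lerDl sumr_ge0// => j _; exact: sqr_ge0.
have CS : s ^+ 2 <= dotp (x i) (x i) * dotp D D by exact: cauchy_schwarz.
have D0 := dotp_ge0 D; have X0 := dotp_ge0 (x i).
have -> : y i - dotp (x i) b - (y' i - dotp (x i) b') = h - s.
  by rewrite /h /s /D dotpBr; ring.
rewrite -/h; set X := dotp (x i) (x i) in CS X0 *; set d := dotp D D in CS D0 Q.
have hs : s ^+ 2 + kap * d <= h * s by rewrite -Q lerD2r.
have Xk : 0 <= X / kap by rewrite divr_ge0// ltW.
have kd : 0 <= kap * d by rewrite mulr_ge0// ltW.
have key : s ^+ 2 <= X / kap * (h * s - s ^+ 2).
  apply: le_trans CS _; rewrite mulrAC ler_pdivlMr// -mulrA ler_wpM2l//.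
  by rewrite mulrC; lra.
have [s0|s0|s0] := ltgtP s 0.
- have hs' : h <= s by rewrite -(ler_nM2r s0) -expr2; lra.
  have H : - s <= X / kap * (s - h).
    rewrite -(ler_nM2r s0); move: key; nra.
  by rewrite !ler0_norm; [nra|lra|lra].
- have hs' : s <= h by rewrite -(ler_pM2r s0) -expr2; lra.
  have H : s <= X / kap * (h - s).
    by rewrite -(ler_pM2r s0); move: key; nra.
  by rewrite !ger0_norm; [nra|lra|lra].
- by rewrite s0 subr0 ler_peMl ?normr_ge0// lerDl.
Qed.

Definition zero_coord (j : 'I_k) (v : 'cV[R]_k) : 'cV[R]_k :=
  \col_i (if i == j then 0 else v i 0).

Lemma dotp_zero_coord j u v : dotp u v = dotp (zero_coord j u) v + u j 0 * v j 0.
Proof.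
rewrite /dotp (bigD1 j)//= [in RHS](bigD1 j)//= mxE eqxx mul0r add0r addrC.
by congr (_ + _); apply: eq_bigr => i ij; rewrite mxE (negbTE ij).
Qed.

(** Leave-one-column-out: deleting feature [j], the error on coordinate [j]
    is bounded by an expression in which the deleted column meets residuals
    that were computed without it. *)
Lemma ridge_coord_error kap m x (e : I -> R) beta b bt j : 0 < kap ->
  is_ridge kap m x (fun i => dotp (x i) beta + e i) b ->
  is_ridge kap m (fun i => zero_coord j (x i))
    (fun i => dotp (zero_coord j (x i)) beta + e i) bt ->
  `|b j 0 - beta j 0| <= `|\sum_(i | m i) x i j 0 *
     (dotp (zero_coord j (x i)) beta + e i - dotp (zero_coord j (x i)) bt) / kap - beta j 0|.
Proof.
move=> k0 rb rt.
have bt0 : bt j 0 = 0.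
  have := rt (delta_mx j 0); rewrite big1 => [/esym/eqP|i _].
    by rewrite dotp_delta mulf_eq0 gt_eqF//= => /eqP.
  by rewrite dotp_delta mxE eqxx mulr0.
pose b' := bt + beta j 0 *: delta_mx j 0; pose D := b - b'.
pose rr i := dotp (zero_coord j (x i)) beta + e i - dotp (zero_coord j (x i)) bt.
have xb i : dotp (x i) b' = dotp (zero_coord j (x i)) bt + x i j 0 * beta j 0.
  by rewrite /b' dotpDr dotpZr dotp_delta (dotp_zero_coord j _ bt) bt0; ring.
have res i : dotp (x i) beta + e i - dotp (x i) b' = rr i.
  by rewrite xb /rr (dotp_zero_coord j (x i) beta); ring.
have Dj : D j 0 = b j 0 - beta j 0.
  by rewrite /D /b' !mxE bt0 !eqxx /= mulr1 add0r.
pose g := \sum_(i | m i) x i j 0 * rr i.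
have rD : \sum_(i | m i) rr i * dotp (x i) D = kap * dotp bt D + g * D j 0.
  rewrite -rt /g mulr_suml -big_split/=; apply: eq_bigr => i _.
  by rewrite /rr (dotp_zero_coord j (x i) D); ring.
have Q : kap * dotp D D <= (g - kap * beta j 0) * D j 0.
  have -> : (g - kap * beta j 0) * D j 0 = kap * dotp D D
      + \sum_(i | m i) dotp (x i) D ^+ 2.
    have -> : \sum_(i | m i) dotp (x i) D ^+ 2 = \sum_(i | m i) rr i * dotp (x i) D
       - \sum_(i | m i) (dotp (x i) beta + e i - dotp (x i) b) * dotp (x i) D.
      rewrite -sumrB; apply: eq_bigr => i _.
      by rewrite -res /D !dotpBr; ring.
    rewrite rD rb [X in kap * X + _](_ : _ = dotp b D - dotp bt D - beta j 0 * D j 0); last first.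
      rewrite {1}/D /b' dotpBl dotpDl dotpZl (dotpC (delta_mx j 0)) dotp_delta; ring.
    by ring.
  by rewrite lerDl sumr_ge0// => i _; exact: sqr_ge0.
have -> : \sum_(i | m i) x i j 0 * (dotp (zero_coord j (x i)) beta + e i
    - dotp (zero_coord j (x i)) bt) / kap = g / kap.
  by rewrite /g mulr_suml.
rewrite -Dj.
have Q2 : kap * D j 0 ^+ 2 <= `|g - kap * beta j 0| * `|D j 0|.
  apply: (@le_trans _ _ (kap * dotp D D)).
    by rewrite ler_pM2l// sqr_coord_le_dotp.
  by rewrite -normrM (le_trans Q)// ler_norm.
have [->|Dj0] := eqVneq (D j 0) 0; first by rewrite normr0 normr_ge0.
have Dp : 0 < `|D j 0| by rewrite normr_gt0.
rewrite -(ler_pM2r Dp) -normrM -expr2 ger0_norm ?sqr_ge0//.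
rewrite -(ler_pM2l k0) (le_trans Q2)// mulrA ler_wpM2r//.
have -> : g - kap * beta j 0 = kap * (g / kap - beta j 0) by field; rewrite gt_eqF.
by rewrite normrM gtr0_norm.
Qed.

End RidgeTheory.

(** * The standard normal law *)

Section Moments.
Context {R : realType}.
Variables (mu : probability R R) (C : R).
Hypothesis mu4 : (\int[mu]_x (x ^+ 4)%:E <= C%:E)%E.

Lemma fourth_moment_int : (\int[mu]_x (1 + x ^+ 4)%:E <= (1 + C)%:E)%E.
Proof.
under eq_integral do rewrite EFinD.
rewrite ge0_integralD//.
- rewrite integral_cst// [X in (_ * X + _)%E](@probability_setT _ _ _ mu) mule1 EFinD.
  by rewrite leeD2l.
- by move=> x _; rewrite lee_fin exprn_even_ge0.
- by apply/measurable_EFinP; apply: measurable_funX.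
Qed.

Lemma integrable_fourth (f : R -> R) : measurable_fun setT f ->
  (forall x, `|f x| <= 1 + x ^+ 4) -> mu.-integrable setT (EFin \o f).
Proof.
move=> mf fle; apply/integrableP; split; first exact/measurable_EFinP.
apply: (@le_lt_trans _ _ (1 + C)%:E); last by rewrite ltry.
apply: le_trans fourth_moment_int; apply: ge0_le_integral => //.
- by apply: measurableT_comp => //; exact/measurable_EFinP.
- by apply/measurable_EFinP; apply: measurable_funD => //; apply: measurable_funX.
- by move=> x _; rewrite lee_fin; exact: fle.
Qed.

Lemma fourth_norm (x : R) : x ^+ 4 = `|x| ^+ 4.
Proof. by rewrite (_ : 4%N = (2 * 2)%N)// !exprM real_normK ?num_real. Qed.

Lemma abs_le_fourth (x : R) : `|x| <= 1 + x ^+ 4.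
Proof.
rewrite fourth_norm; set y := `|x|; have y0 : 0 <= y by exact: normr_ge0.
have [y1|/ltW y1] := leP y 1; first by rewrite (le_trans y1)// lerDl exprn_ge0.
by rewrite ler_wpDl// exprS ler_peMr// exprn_ege1.
Qed.

Lemma sqr_le_fourth (x : R) : `|x ^+ 2| <= 1 + x ^+ 4.
Proof.
rewrite ger0_norm ?sqr_ge0//; have := sqr_ge0 (x ^+ 2 - 1).
by rewrite sqrrB -exprM; nra.
Qed.

Lemma cube_le_fourth (x : R) : `|x| ^+ 3 <= 1 + x ^+ 4.
Proof.
rewrite fourth_norm; set y := `|x|; have y0 : 0 <= y by exact: normr_ge0.
have [y1|/ltW y1] := leP y 1.
  by rewrite (le_trans (exprn_ile1 _ y0 y1))// lerDl exprn_ge0.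
by rewrite ler_wpDl// [leRHS]exprS ler_peMl// exprn_ge0.
Qed.

Lemma third_moment_int : (\int[mu]_x (`|x| ^+ 3)%:E <= (1 + C)%:E)%E.
Proof.
apply: le_trans fourth_moment_int; apply: ge0_le_integral => //.
- by apply/measurable_EFinP; apply: measurable_funX; exact: measurable_normr.
- by apply/measurable_EFinP; apply: measurable_funD => //; apply: measurable_funX.
- by move=> x _; rewrite lee_fin cube_le_fourth.
Qed.

Lemma integrable_id : mu.-integrable setT (EFin \o (fun x : R => x)).
Proof. by apply: integrable_fourth => //; exact: abs_le_fourth. Qed.

Lemma integrable_sqr : mu.-integrable setT (EFin \o (fun x : R => x ^+ 2)).
Proof.
by apply: integrable_fourth; [exact: measurable_funX|exact: sqr_le_fourth].
Qed.
End Moments.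

Section Gauss.
Context {R : realType}.
Notation leb := (@lebesgue_measure R).
Notation gpdf := (normal_pdf (0 : R) 1).

(** [normal_prob] lives on the real line presented as a generated
    sigma-algebra; the identity transports it to the canonical presentation. *)
Definition recast (x : measurableTypeR R) : R := x.

Lemma measurable_recast : measurable_fun setT recast.
Proof. by move=> _ B mB; rewrite setTI. Qed.

HB.instance Definition _ := isMeasurableFun.Build _ _ _ _ recast measurable_recast.

Definition gauss : probability R R := distribution (normal_prob (0 : R) 1) recast.

Lemma gauss_int (f : R -> \bar R) : measurable_fun setT f -> (forall x, 0 <= f x)%E ->
  (\int[gauss]_x f x = \int[leb]_x (f x * (gpdf x)%:E))%E.
Proof.
move=> mf f0; have dom := normal_prob_dominates (0 : R) 1.
transitivity (\int[normal_prob (0 : R) 1]_x f x)%E.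
  exact: ge0_integral_distribution.
have mf' : measurable_fun [set: measurableTypeR R] f by exact: mf.
rewrite -(Radon_Nikodym_SigmaFinite.change_of_variables dom)//.
apply: ae_eq_integral => //.
- apply: emeasurable_funM => //; apply: (measurable_int leb).
  exact: Radon_Nikodym_SigmaFinite.f_integrable.
- apply: emeasurable_funM => //=; apply/measurableT_comp => //=.
  exact: measurable_normal_pdf.
- apply: ae_eqe_mul2l => /=.
  apply: integral_ae_eq => //=.
  + exact: Radon_Nikodym_SigmaFinite.f_integrable.
  + by apply/measurableT_comp =>//; exact: measurable_normal_pdf.
  + by move=> E E01 mE; rewrite -Radon_Nikodym_SigmaFinite.f_integral.
Qed.

Lemma normal_pdf_formula (m s x : R) : s != 0 ->
  normal_pdf m s x = normal_peak s * expR (- (x - m) ^+ 2 / (s ^+ 2 *+ 2)).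
Proof. by move=> s0; rewrite normal_pdfE. Qed.

Lemma normal_peak_scale (s : R) : 0 < s -> normal_peak s = normal_peak 1 / s.
Proof.
move=> s0; rewrite /normal_peak expr1n mul1r -mulrnAr sqrtrM ?sqr_ge0//.
by rewrite sqrtr_sqr gtr0_norm// invfM mulrC.
Qed.

Lemma affine_subst (G : R -> R) (a y : R) : 0 < a -> continuous G -> (forall x, 0 <= G x) ->
  (\int[leb]_x (G x)%:E = \int[leb]_x (G (a * x + y) * a)%:E)%E.
Proof.
move=> a0 cG G0; pose F (x : R) : R := a * x + y.
have dF (x : R) : is_derive x 1 F a.
  have H : is_derive x 1 ((a *: (@id R^o) + cst y) : R^o -> R^o) (a *: 1 + 0).
    exact: is_deriveD.
  by rewrite addr0 /GRing.scale/= mulr1 in H.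
have F' : F^`()%classic = cst a.
  by apply/funext => x; rewrite derive1E; exact: derive_val.
rewrite (increasing_ge0_integration_by_substitutionT (F := F)) ?F'//.
- by move=> u v uv; rewrite /F ltrD2r ltr_pM2l.
- by move=> ?; exact: cvg_cst.
- exact: is_cvg_cst.
- exact: is_cvg_cst.
- rewrite /F; apply: (@cvg_comp _ _ _ (fun x => a * x) (fun x => x + y)); last exact: cvg_addrr_Ny.
  exact: gt0_cvgMrNy.
- rewrite /F; apply: (@cvg_comp _ _ _ (fun x => a * x) (fun x => x + y)); last exact: cvg_addrr.
  exact: gt0_cvgMry.
Qed.


Lemma gpdfE (x : R) : gpdf x = normal_peak 1 * expR (- (x ^+ 2 / 2)).
Proof. by rewrite normal_pdf_formula ?oner_eq0// subr0 expr1n mulNr. Qed.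

Lemma gpdf_ge0 (x : R) : 0 <= gpdf x. Proof. exact: normal_pdf_ge0. Qed.

Lemma continuous_gpdf : continuous gpdf.
Proof. by apply: continuous_normal_pdf; exact: oner_neq0. Qed.

Lemma normal_pdf_tilt (m s x : R) : 0 < s ->
  normal_pdf m s x = gpdf x * (s^-1 * expR (x ^+ 2 / 2 - (x - m) ^+ 2 / (2 * s ^+ 2))).
Proof.
move=> s0; rewrite gpdfE normal_pdf_formula ?gt_eqF// normal_peak_scale//.
rewrite [RHS]mulrACA -expRD mulNr; congr (_ * expR _).
by rewrite -mulr_natl; ring.
Qed.

Lemma measurable_tilt (m s : R) : measurable_fun [set: R]
  (fun x : R => s^-1 * expR (x ^+ 2 / 2 - (x - m) ^+ 2 / (2 * s ^+ 2))).
Proof.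
apply: measurable_funM => //; apply: measurableT_comp => //.
by apply: measurable_funB; apply: measurable_funM => //; apply: measurable_funX => //;
  exact: measurable_funB.
Qed.

Lemma gauss_tilt (m s : R) : 0 < s ->
  (\int[gauss]_x (s^-1 * expR (x ^+ 2 / 2 - (x - m) ^+ 2 / (2 * s ^+ 2)))%:E = 1)%E.
Proof.
move=> s0; rewrite gauss_int.
- rewrite -(integral_normal_pdf m s); apply: eq_integral => x _.
  by rewrite -EFinM (normal_pdf_tilt m x s0) mulrC.
- by apply/measurable_EFinP; exact: measurable_tilt.
- by move=> x; rewrite lee_fin mulr_ge0 ?expR_ge0// invr_ge0 ltW.
Qed.

(** The fourth power is dominated by the integrand of [gauss_tilt], whose mean is
    known for all shifts and scales. *)
Lemma gauss_fourth_moment : exists C : R, (\int[gauss]_x (x ^+ 4)%:E <= C%:E)%E.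
Proof.
pose s : R := Num.sqrt 2; have s0 : 0 < s by rewrite sqrtr_gt0.
have s2 : s ^+ 2 = 2 by rewrite sqr_sqrtr.
exists (32 * s); rewrite -[X in (_ <= X)%E]mule1 -(gauss_tilt 0 s0).
rewrite -ge0_integralZl//; last 3 first.
- by apply/measurable_EFinP; exact: measurable_tilt.
- by move=> x _; rewrite lee_fin mulr_ge0 ?expR_ge0// invr_ge0 ltW.
- by rewrite lee_fin mulr_ge0// ltW.
apply: ge0_le_integral => //.
- by move=> x _; rewrite lee_fin exprn_even_ge0.
- by apply/measurable_EFinP; apply: measurable_funX.
- by apply/measurable_EFinP; apply: measurable_funM => //; exact: measurable_tilt.
- move=> x _; rewrite -EFinM lee_fin s2 subr0 -mulrA mulVKf ?gt_eqF//.
  rewrite (_ : x ^+ 2 / 2 - _ = x ^+ 2 / 4); last by field.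
  have y0 : 0 <= x ^+ 2 / 4 by rewrite divr_ge0 ?sqr_ge0.
  have := expR_ge1Dxn 1 y0.
  rewrite (_ : (x ^+ 2 / 4) ^+ 2 / 2`!%:R = x ^+ 4 / 32); last by rewrite (_ : 2`! = 2)//; field.
  by lra.
Qed.


Lemma gauss_mean : Ex gauss (fun x => x) = 0.
Proof.
have [C C4] := gauss_fourth_moment; set E := Ex _ _.
have key (m : R) : m * E <= m ^+ 2 / 2.
  have := gauss_tilt m (@ltr01 R).
  under eq_integral do rewrite invr1 mul1r expr1n mulr1.
  move=> I1.
  have : (\int[gauss]_x ((1 - m ^+ 2 / 2) + m * x)%:E <= 1)%E.
    have i0 : gauss.-integrable setT (EFin \o (fun x : R => (1 - m ^+ 2 / 2) + m * x)).
      rewrite (_ : EFin \o _ = (EFin \o cst (1 - m ^+ 2 / 2)) \+ (fun x => m%:E * (EFin \o (fun x => x)) x)%E)//.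
      apply: integrableD => //; first by apply: finite_measure_integrable_cst.
      exact/integrableZl/(integrable_id C4).
    rewrite -I1; apply: le_integral => //.
      apply/integrableP; split; last first.
        under eq_integral do rewrite /= ger0_norm ?expR_ge0//.
        by rewrite I1 ltry.
      apply/measurable_EFinP; apply: measurableT_comp => //.
      apply: measurable_funB; first by apply: measurable_funM => //; apply: measurable_funX.
      by apply: measurable_funM => //; apply: measurable_funX; exact: measurable_funB.
    move=> x _; rewrite lee_fin; apply: le_trans (expR_ge1Dx _).
    by rewrite le_eqVlt; apply/orP; left; apply/eqP; field.
  under eq_integral do rewrite EFinD.
  rewrite integralD//=.
  - rewrite integral_cst// [X in (_ * X + _)%E](@probability_setT _ _ _ gauss) mule1.
    under eq_integral do rewrite EFinM.
    rewrite integralZl//; last exact: integrable_id C4.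
    rewrite -(fineK (integrable_fin_num measurableT (integrable_id C4))) -EFinM -EFinD lee_fin.
    by rewrite -/(Ex gauss (fun x => x)) -/E; lra.
  - exact: finite_measure_integrable_cst.
  - rewrite (_ : (fun x => _) = (fun x => m%:E * (EFin \o (fun x => x)) x)%E)//.
    exact/integrableZl/(integrable_id C4).
apply/eqP/negP => /negP E0.
have := key E; rewrite -expr2 => H; have : 0 < E ^+ 2 by rewrite exprn_even_gt0.
by lra.
Qed.

Lemma gauss_var : Ex gauss (fun x => x ^+ 2) = 1.
Proof.
have [C C4] := gauss_fourth_moment; set v := Ex _ _.
have key (s : R) : 0 < s -> 1 + (1 - s ^- 2) / 2 * v <= s.
  move=> s0; have := gauss_tilt 0 s0.
  under eq_integral do rewrite subr0 EFinM.
  have mE : measurable_fun setT (fun x : R => expR (x ^+ 2 / 2 - x ^+ 2 / (2 * s ^+ 2))).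
    apply: measurableT_comp => //; apply: measurable_funB; apply: measurable_funM => //;
    by apply: measurable_funX.
  rewrite ge0_integralZl//; [|exact/measurable_EFinP|by rewrite lee_fin invr_ge0 ltW].
  move=> I1.
  have {}I1 : (\int[gauss]_x (expR (x ^+ 2 / 2 - x ^+ 2 / (2 * s ^+ 2)))%:E = s%:E)%E.
    have sn0 : s != 0 by rewrite gt_eqF.
    by rewrite -[RHS]mule1 -I1 muleA -EFinM mulfV// mul1e.
  have i2 : gauss.-integrable setT (fun x => ((1 - s ^- 2) / 2)%:E * (EFin \o (fun x => (x ^+ 2)%R)) x)%E.
    exact/integrableZl/(integrable_sqr C4).
  have : (\int[gauss]_x (1 + (1 - s ^- 2) / 2 * x ^+ 2)%:E <= s%:E)%E.
    rewrite -I1; apply: le_integral => //.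
    - have := integrableD measurableT (finite_measure_integrable_cst gauss 1 measurableT) i2.
      exact.
    - apply/integrableP; split; first exact/measurable_EFinP.
      under eq_integral do rewrite /= ger0_norm ?expR_ge0//.
      by rewrite I1 ltry.
    move=> x _; rewrite lee_fin; apply: le_trans (expR_ge1Dx _).
    by rewrite le_eqVlt; apply/orP; left; apply/eqP; field; rewrite gt_eqF.
  under eq_integral do rewrite EFinD.
  rewrite integralD//=; last exact: finite_measure_integrable_cst.
  rewrite integral_cst// [X in (_ * X + _)%E](@probability_setT _ _ _ gauss) mule1.
  under eq_integral do rewrite EFinM.
  rewrite integralZl//; last exact: integrable_sqr C4.
  rewrite -(fineK (integrable_fin_num measurableT (integrable_sqr C4))) -EFinM -EFinD lee_fin.
  by rewrite -/(Ex gauss (fun x => x ^+ 2)) -/v.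
have v0 : 0 <= v by apply: Ex_ge0 => x; exact: sqr_ge0.
have key2 (s : R) : 0 < s -> (s ^+ 2 - 1) * v <= 2 * s ^+ 2 * (s - 1).
  move=> s0; have := key _ s0; rewrite -(@ler_pM2r _ (2 * s ^+ 2)) ?mulr_gt0 ?exprn_gt0//.
  move=> H; have -> : (s ^+ 2 - 1) * v = (1 + (1 - s ^- 2) / 2 * v) * (2 * s ^+ 2) - 2 * s ^+ 2.
    by field; rewrite gt_eqF.
  by move: H; lra.
have up : v <= 1.
  apply/ler_addgt0Pr => e e0.
  pose d := Num.min 1 (e / 3); have d0 : 0 < d by rewrite lt_min ltr01 divr_gt0.
  have d1 : d <= 1 by rewrite ge_min lexx.
  have de : d <= e / 3 by rewrite ge_min lexx orbT.
  have := key2 (1 + d) (addr_gt0 ltr01 d0).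
  rewrite (_ : (1 + d) ^+ 2 - 1 = d * (2 + d)); last by ring.
  rewrite (_ : 2 * (1 + d) ^+ 2 * (1 + d - 1) = d * (2 * (1 + d) ^+ 2)); last by ring.
  rewrite -mulrA ler_pM2l// => H.
  suff : v <= 1 + 3 * d by lra.
  by nra.
have dn : 1 <= v.
  apply/ler_addgt0Pr => e e0.
  pose d := Num.min (1/2) (e / 2); have d0 : 0 < d by rewrite lt_min !divr_gt0.
  have d1 : d <= 1/2 by rewrite ge_min lexx.
  have de : d <= e / 2 by rewrite ge_min lexx orbT.
  have d2 : 0 < 1 - d by lra.
  have := key2 (1 - d) d2.
  rewrite (_ : (1 - d) ^+ 2 - 1 = - d * (2 - d)); last by ring.
  rewrite (_ : 2 * (1 - d) ^+ 2 * (1 - d - 1) = - d * (2 * (1 - d) ^+ 2)); last by ring.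
  rewrite -mulrA ler_nM2l ?oppr_lt0// => H.
  suff : 1 - 2 * d <= v by lra.
  by nra.
by apply/eqP; rewrite eq_le up dn.
Qed.

End Gauss.

Section GaussConv.
Context {R : realType}.
Notation leb := (@lebesgue_measure R).
Notation gpdf := (normal_pdf (0 : R) 1).

(** Completing the square. *)
Lemma gpdf_conv (s u v w : R) : 0 < s -> 0 < u ->
  let sg := Num.sqrt (s ^+ 2 + u ^+ 2) in
  gpdf (sg / s * v + - (u / s) * w) * (sg / s) * gpdf w
  = gpdf v * normal_pdf (u / sg * v) (s / sg) w.
Proof.
move=> s0 u0 sg.
have q0 : 0 < s ^+ 2 + u ^+ 2 by rewrite addr_gt0 ?exprn_gt0.
have sg0 : 0 < sg by rewrite sqrtr_gt0.
have sg2 : sg ^+ 2 = s ^+ 2 + u ^+ 2 by rewrite sqr_sqrtr// ltW.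
rewrite (@normal_pdf_tilt _ (u / sg * v) (s / sg) w) ?divr_gt0// !gpdfE.
rewrite (_ : normal_peak 1 * expR (- ((sg / s * v + - (u / s) * w) ^+ 2 / 2)) * (sg / s) *
  (normal_peak 1 * expR (- (w ^+ 2 / 2))) = normal_peak 1 * normal_peak 1 * (sg / s) *
  (expR (- ((sg / s * v + - (u / s) * w) ^+ 2 / 2)) * expR (- (w ^+ 2 / 2)))); last by ring.
rewrite invf_div (_ : normal_peak 1 * expR (- (v ^+ 2 / 2)) * (normal_peak 1 *
   expR (- (w ^+ 2 / 2)) * (sg / s * expR (w ^+ 2 / 2 - (w - u / sg * v) ^+ 2 / (2 * (s / sg) ^+ 2))))
  = normal_peak 1 * normal_peak 1 * (sg / s) * (expR (- (v ^+ 2 / 2)) * (expR (- (w ^+ 2 / 2)) *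
   expR (w ^+ 2 / 2 - (w - u / sg * v) ^+ 2 / (2 * (s / sg) ^+ 2))))); last by ring.
congr (_ * _); rewrite -!expRD; congr expR.
have -> : (sg / s * v + - (u / s) * w) ^+ 2 =
   (sg ^+ 2 * v ^+ 2 - 2 * sg * u * v * w + u ^+ 2 * w ^+ 2) / s ^+ 2.
  by field; rewrite gt_eqF.
have -> : (w - u / sg * v) ^+ 2 / (2 * (s / sg) ^+ 2) =
  (sg ^+ 2 * w ^+ 2 - 2 * sg * u * v * w + u ^+ 2 * v ^+ 2) / (2 * s ^+ 2).
  by field; rewrite !gt_eqF.
by rewrite sg2; field; rewrite gt_eqF.
Qed.

Lemma continuous_affine_comp (f : R -> R) (x a : R) : continuous f ->
  continuous (fun z => f (x + a * z)).
Proof.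
move=> cf z; apply: (@continuous_comp _ _ _ (fun z => x + a * z) f); last exact: cf.
apply: (@continuousD _ R^o); first exact: cst_continuous.
by apply: (@continuousM R); [exact: cst_continuous|].
Qed.

(** Two independent normal summands merge into one, so that the replacement of
    summands one at a time only has to carry a single normal variable. *)
Lemma gauss_conv (f : R -> R) (x s u : R) : continuous f -> (forall y, 0 <= f y) ->
  0 <= s -> 0 <= u ->
  (\int[gauss]_w \int[gauss]_z (f (x + s * z + u * w))%:E
   = \int[gauss]_v (f (x + Num.sqrt (s ^+ 2 + u ^+ 2) * v))%:E)%E.
Proof.
move=> cf f0; rewrite le_eqVlt => /predU1P[<-|s0] u_ge0.
  under eq_integral do under eq_integral do rewrite mul0r addr0.
  rewrite expr0n add0r sqrtr_sqr ger0_norm//; apply: eq_integral => w _.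
  by rewrite integral_cst// [X in (_ * X)%E](@probability_setT _ _ _ gauss) mule1.
move: u_ge0; rewrite le_eqVlt => /predU1P[<-|u0].
  under eq_integral do under eq_integral do rewrite mul0r addr0.
  rewrite integral_cst// [X in (_ * X)%E](@probability_setT _ _ _ gauss) mule1.
  by rewrite expr0n addr0 sqrtr_sqr gtr0_norm.
set sg := Num.sqrt _.
have q0 : 0 < s ^+ 2 + u ^+ 2 by rewrite addr_gt0 ?exprn_gt0.
have sg0 : 0 < sg by rewrite sqrtr_gt0.
have mf : measurable_fun setT f by exact: continuous_measurable_fun.
have mp : measurable_fun [set: R] gpdf by exact: measurable_normal_pdf.
pose a := sg / s; have a0 : 0 < a by rewrite divr_gt0.
have inner w : (\int[gauss]_z (f (x + s * z + u * w))%:E =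
    \int[leb]_v (f (x + sg * v) * (gpdf (a * v + - (u / s) * w) * a))%:E)%E.
  have mfw : measurable_fun setT (fun z => (f (x + s * z + u * w))%:E).
    apply/measurable_EFinP; apply: measurableT_comp => //.
    by apply: measurable_funD => //; exact: measurable_affine.
  rewrite (gauss_int mfw); last by move=> z; rewrite lee_fin.
  under eq_integral do rewrite -EFinM.
  rewrite (affine_subst (G := fun z => f (x + s * z + u * w) * gpdf z) (- (u / s) * w) a0).
  - apply: eq_integral => v _; congr (_%:E); rewrite /= -mulrA; congr (f _ * _).
    by rewrite /a; field; rewrite gt_eqF.
  - move=> z; apply: (@continuousM R); last exact: continuous_gpdf.
    rewrite (_ : (fun z => _) = (fun z => f (x + u * w + s * z))); last first.
      by apply/funext => t; rewrite addrAC.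
    exact: continuous_affine_comp.
  - by move=> z; rewrite mulr_ge0 ?gpdf_ge0.
pose Phi w := (\int[gauss]_z (f (x + s * z + u * w))%:E)%E.
have mPhi : measurable_fun setT Phi.
  apply: (@measurable_fun_fubini_tonelli_F _ _ _ _ R gauss
    (fun wz : R * R => (f (x + s * wz.2 + u * wz.1))%:E)); last by move=> wz; rewrite lee_fin.
  apply/measurable_EFinP; apply: measurableT_comp => //; apply: measurable_funD.
    exact: (measurableT_comp (measurable_affine x s)).
  by apply: (measurableT_comp (mulrl_measurable u)).
have Phi0 w : (0 <= Phi w)%E by apply: integral_ge0 => z _; rewrite lee_fin.
transitivity (\int[gauss]_w Phi w)%E; first by [].
rewrite (gauss_int mPhi Phi0).
pose H (wv : measurableTypeR R * measurableTypeR R) : \bar R :=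
  (f (x + sg * wv.2) * (gpdf (a * wv.2 + - (u / s) * wv.1) * a) * gpdf wv.1)%:E.
have mH : measurable_fun setT H.
  apply/measurable_EFinP; apply: measurable_funM; first apply: measurable_funM.
  - apply: measurableT_comp => //; exact: (measurableT_comp (measurable_affine x sg)).
  - apply: measurable_funM => //; apply: measurableT_comp => //.
    apply: measurable_funD.
      exact: (measurableT_comp (mulrl_measurable a)).
    exact: (measurableT_comp (mulrl_measurable (- (u / s)))).
  - have mp' : measurable_fun [set: measurableTypeR R] gpdf by exact: mp.
    exact: (measurableT_comp mp' measurable_fst).
have H0 wv : (0 <= H wv)%E.
  rewrite /H lee_fin; apply: mulr_ge0; last exact: gpdf_ge0.
  by apply: mulr_ge0; [exact: f0|apply: mulr_ge0; [exact: gpdf_ge0|exact: ltW]].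
transitivity (\int[leb]_w \int[leb]_v H (w, v))%E.
  apply: eq_integral => w _; rewrite /Phi inner /H/= -ge0_integralZr//.
  - apply/measurable_EFinP; apply: measurable_funM.
      by apply: measurableT_comp => //; exact: measurable_affine.
    apply: measurable_funM => //; apply: measurableT_comp => //.
    by apply: measurable_funD => //; exact: mulrl_measurable.
  - move=> v _; rewrite lee_fin.
    by apply: mulr_ge0; [exact: f0|apply: mulr_ge0; [exact: gpdf_ge0|exact: ltW]].
  - by rewrite lee_fin gpdf_ge0.
rewrite (fubini_tonelli H mH H0) gauss_int//; last first.
- by move=> v; rewrite lee_fin.
- apply/measurable_EFinP; apply: measurableT_comp => //; exact: measurable_affine.
apply: eq_integral => v _.
transitivity (\int[leb]_w ((f (x + sg * v) * gpdf v)%:E *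
   (normal_pdf (u / sg * v) (s / sg) w)%:E))%E.
  apply: eq_integral => w _; rewrite /H/= -EFinM; congr _%:E.
  by have := gpdf_conv v w s0 u0; rewrite -/sg /= -/sg -/a => E; rewrite -[LHS]mulrA E mulrA.
rewrite ge0_integralZl//.
- by rewrite integral_normal_pdf mule1 EFinM.
- by apply/measurable_EFinP; exact: measurable_normal_pdf.
- by move=> w _; rewrite lee_fin normal_pdf_ge0.
- by rewrite lee_fin mulr_ge0 ?gpdf_ge0.
Qed.

Lemma gauss_itv_gt0 (a b : R) : a < b -> 0 < pr gauss [set z | a < z < b].
Proof.
move=> ab; pose m := Num.max `|a| `|b|.
pose c : R := normal_peak 1 * expR (- (m ^+ 2 / 2)).
have c0 : 0 < c by rewrite mulr_gt0 ?expR_gt0// normal_peak_gt0 ?oner_neq0.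
have E : [set z | a < z < b] = `]a, b[%classic by apply/seteqP; split => z /=; rewrite in_itv.
have mA : measurable `]a, b[%classic by exact: measurable_itv.
apply: (@lt_le_trans _ _ (c * (b - a))); first by rewrite mulr_gt0// subr_gt0.
rewrite -lee_fin E -prE//.
rewrite -[leRHS]/(\int[leb]_(z in `]a, b[) (gpdf z)%:E)%E.
apply: (@le_trans _ _ (\int[leb]_(z in `]a, b[) c%:E)%E).
  by rewrite integral_cst//= lebesgue_measure_itv/= lte_fin ab -EFinB.
apply: ge0_le_integral => //.
- by move=> z _; rewrite lee_fin ltW.
- by apply/measurable_EFinP; apply: measurable_funTS; exact: measurable_normal_pdf.
- move=> z /=; rewrite in_itv/= => /andP[az zb]; rewrite lee_fin gpdfE ler_pM2l; last first.
    by rewrite normal_peak_gt0 ?oner_neq0.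
  rewrite ler_expR lerN2 ler_pM2r// -(real_normK (num_real z)) ler_sqr ?nnegrE//.
  rewrite le_max; have [z0|z0] := leP 0 z; apply/orP; [right|left].
    by rewrite !ger0_norm ?(ltW zb)// (le_trans z0)// ltW.
  by rewrite !ltr0_norm// ?lerN2 ?(ltW az)// (lt_trans az).
by rewrite /m le_max normr_ge0.
Qed.

End GaussConv.

(** * A central limit theorem for smoothed interval probabilities *)

(** Expansion to second order, with cubic remainder. *)
Definition cubic_at {R : realType} (f : R -> R) (C s p q : R) :=
  forall h, `|f (s + h) - f s - h * p - h ^+ 2 * q| <= C * `|h| ^+ 3.

Definition cubic {R : realType} (C : R) (f : R -> R) :=
  forall s, exists p q, cubic_at f C s p q.

Definition std_law {R : realType} (mu : probability R R) (m : R) :=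
  [/\ mu.-integrable setT (EFin \o (fun x : R => x)),
      mu.-integrable setT (EFin \o (fun x : R => x ^+ 2)),
      Ex mu (fun x => x) = 0, Ex mu (fun x => x ^+ 2) = 1 &
      (\int[mu]_x (`|x| ^+ 3)%:E <= m%:E)%E].

Lemma cubic_continuous {R : realType} (C : R) (f : R -> R) : 0 <= C ->
  cubic C f -> continuous f.
Proof.
move=> C0 cf s; have [p [q H]] := cf s.
apply/cvgrPdist_lt => e e0.
pose K := `|p| + `|q| + C + 1; have K0 : 0 < K by rewrite ltr_pwDr// !addr_ge0.
have d0 : 0 < Num.min 1 (e / K) by rewrite lt_min ltr01 divr_gt0.
apply/nbhs_ballP; exists (Num.min 1 (e / K)) => // y sy.
have : `|s - y| < Num.min 1 (e / K) by exact: sy.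
rewrite distrC lt_min => /andP[/ltW]; set h := y - s => h1 he.
have := H h; rewrite (_ : s + h = y); last by rewrite /h addrC subrK.
move=> H1; rewrite distrC.
have : `|f y - f s| <= `|h| * K.
  have -> : f y - f s = (f y - f s - h * p - h ^+ 2 * q) + h * p + h ^+ 2 * q by ring.
  apply: (le_trans (ler_normD _ _)); apply: (@le_trans _ _ (C * `|h| ^+ 3 + `|h| * `|p| + `|h| * `|q|)).
    apply: lerD.
      by apply: (le_trans (ler_normD _ _)); rewrite normrM lerD2r.
    rewrite normrM normrX ler_wpM2r// expr2 ler_piMl//.
  rewrite /K; have : `|h| ^+ 3 <= `|h| by rewrite exprS ler_piMr// exprn_ile1.
  by move=> H3; have := ler_wpM2l C0 H3; have := normr_ge0 h; lra.
by move/le_lt_trans; apply; rewrite -ltr_pdivlMr.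
Qed.

Section OneStep.
Context {R : realType}.
Implicit Types (mu : probability R R) (f : R -> R).

Lemma bdd_comp_affine f (y a : R) : measurable_fun setT f -> (forall x, 0 <= f x <= 1) ->
  bdd_meas (fun w : R => f (y + a * w)).
Proof.
move=> mf f01; split; first by apply: measurableT_comp => //; exact: measurable_affine.
by exists 1 => w; have /andP[? ?] := f01 (y + a * w); rewrite ger0_norm.
Qed.

(** The linear term has mean zero and the quadratic one depends on the law only
    through its variance, so two standard laws differ by the cubic remainder. *)
Lemma cubic_std_law mu (m C : R) f (y a p q : R) : 0 <= C -> std_law mu m ->
  measurable_fun setT f -> (forall x, 0 <= f x <= 1) -> cubic_at f C y p q ->
  `|Ex mu (fun w => f (y + a * w)) - (f y + a ^+ 2 * q)| <= C * `|a| ^+ 3 * m.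
Proof.
move=> C0 [i1 i2 e1 e2 i3] mf f01 H.
have bf := bdd_int mu (bdd_comp_affine y a mf f01).
have m0 : 0 <= m by rewrite -lee_fin (le_trans _ i3)//; apply: integral_ge0 => x _; rewrite lee_fin exprn_ge0.
have j1 : mu.-integrable setT (EFin \o (fun w : R => (a * p) * w)).
  exact: (integrableZl measurableT (a * p) i1).
have j2 : mu.-integrable setT (EFin \o (fun w : R => (a ^+ 2 * q) * w ^+ 2)).
  exact: (integrableZl measurableT (a ^+ 2 * q) i2).
have j0 : mu.-integrable setT (EFin \o (fun w : R => f y)).
  exact: finite_measure_integrable_cst.
pose g w := ((f (y + a * w) - f y) - (a * p) * w) - (a ^+ 2 * q) * w ^+ 2.
have jfy : mu.-integrable setT (EFin \o (fun w => f (y + a * w) - f y)).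
  exact: (integrableB measurableT bf j0).
have jfy1 : mu.-integrable setT (EFin \o (fun w => f (y + a * w) - f y - (a * p) * w)).
  exact: (integrableB measurableT jfy j1).
have jg : mu.-integrable setT (EFin \o g) by exact: (integrableB measurableT jfy1 j2).
have -> : Ex mu (fun w => f (y + a * w)) - (f y + a ^+ 2 * q) = Rintegral mu setT g.
  rewrite /g !RintegralB// !RintegralZl// -[Rintegral mu setT (fun x => x ^+ 2)]/(Ex mu (fun x => x ^+ 2)) e2.
  rewrite -[Rintegral mu setT (fun x => x)]/(Ex mu (fun x => x)) e1.
  rewrite -[X in _ = _ - X - _ - _]/(Ex mu (fun=> f y)) Ex_cst.
  by rewrite -[X in _ = X - _ - _ - _]/(Ex mu (fun w => f (y + a * w))); ring.
rewrite -lee_fin (EFin_normr_Rintegral measurableT jg).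
apply: (le_trans (le_abse_integral _ _ _)) => //.
  by apply/measurable_EFinP; apply/measurable_EFinP; exact: measurable_int jg.
apply: (@le_trans _ _ (\int[mu]_w ((C * `|a| ^+ 3)%:E * (`|w| ^+ 3)%:E))%E).
  apply: ge0_le_integral => //.
  - apply: measurableT_comp => //.
    by apply/measurable_EFinP; apply/measurable_EFinP; exact: measurable_int jg.
  - apply/measurable_EFinP; apply: measurable_funM => //; apply: measurable_funX.
    exact: measurable_normr.
  - move=> w _; rewrite -EFinM lee_fin -mulrA -exprMn -normrM.
    rewrite (_ : g w = f (y + a * w) - f y - (a * w) * p - (a * w) ^+ 2 * q); first exact: H.
    by rewrite /g; ring.
rewrite ge0_integralZl//.
- by rewrite [leRHS]EFinM lee_wpmul2l// lee_fin mulr_ge0// exprn_ge0.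
- by apply/measurable_EFinP; apply: measurable_funX; exact: measurable_normr.
- by rewrite lee_fin mulr_ge0// exprn_ge0.
Qed.

Lemma cubic_swap mu nu (m m' C : R) f (y a b : R) : 0 <= C -> std_law mu m -> std_law nu m' ->
  measurable_fun setT f -> (forall x, 0 <= f x <= 1) -> cubic C f -> `|a| = b ->
  Ex mu (fun w => f (y + a * w)) <= Ex nu (fun w => f (y + b * w)) + C * `|a| ^+ 3 * (m + m').
Proof.
move=> C0 smu snu mf f01 cf ab; have [p [q H]] := cf y.
have := cubic_std_law a C0 smu mf f01 H; have := cubic_std_law b C0 snu mf f01 H.
have -> : b ^+ 2 = a ^+ 2 by rewrite -ab real_normK ?num_real.
have -> : `|b| ^+ 3 = `|a| ^+ 3 by rewrite -ab normr_id.
by rewrite !ler_norml => /andP[? ?] /andP[? ?]; lra.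
Qed.
End OneStep.

Lemma gauss_std_law {R : realType} : exists m : R, 0 <= m /\ std_law gauss m.
Proof.
have [C C4] := @gauss_fourth_moment R; exists (1 + C); split.
  rewrite -lee_fin; apply: le_trans (fourth_moment_int C4).
  by apply: integral_ge0 => x _; rewrite lee_fin addr_ge0// exprn_even_ge0.
split; [exact: integrable_id C4|exact: integrable_sqr C4|exact: gauss_mean|exact: gauss_var|].
exact: third_moment_int.
Qed.

Section Lindeberg.
Context {K : finType} {R : realType}.
Variables (mu : K -> probability R R) (L : probability (sample K R) R).
Hypothesis Lmu : product_law mu L.
Variables (l : seq K) (a : K -> R) (m m' C : R).
Hypotheses (ul : uniq l) (C0 : 0 <= C) (m0 : 0 <= m) (m'0 : 0 <= m').
Hypotheses (std_mu : forall k, k \in l -> std_law (mu k) m) (std_gauss : std_law (@gauss R) m').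

Definition l2weight (a : K -> R) (l : seq K) : R := Num.sqrt (\sum_(k <- l) a k ^+ 2).

Let wsum_meas : measurable_fun setT (fun z : sample K R => \sum_(k <- l) a k * coord k z).
Proof.
apply: measurable_sum => k; apply: measurable_funM => //; exact: measurable_coord.
Qed.

(** Swap the summands one at a time for normal ones of the same variance: the
    potential is the expectation of [f] once the remaining ones are normal. *)
Lemma lindeberg_le (f : R -> R) : (forall x, 0 <= f x <= 1) -> cubic C f ->
  Ex L (fun z => f (\sum_(k <- l) a k * coord k z))
    <= Ex gauss (fun z => f (l2weight a l * z)) + C * (m + m') * \sum_(k <- l) `|a k| ^+ 3.
Proof.
move=> f01 cf; have cont := cubic_continuous C0 cf.
have mf : measurable_fun setT f by exact: continuous_measurable_fun.
have f0 x : 0 <= f x by have /andP[] := f01 x.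
pose V l' (y : R) := Ex gauss (fun z => f (y + l2weight a l' * z)).
have VE l' y : (V l' y)%:E = (\int[gauss]_z (f (y + l2weight a l' * z))%:E)%E.
  by rewrite /V ExE//; exact: bdd_comp_affine.
have Vnil y : V [::] y = f y.
  rewrite /V /l2weight big_nil sqrtr0 -[RHS](Ex_cst gauss); apply: eq_Ex => z.
  by rewrite mul0r addr0.
pose c k := C * `|a k| ^+ 3 * (m + m').
have c0 k : 0 <= c k by rewrite !mulr_ge0 ?addr_ge0.
have mV l' : measurable_fun setT (V l').
  apply/measurable_EFinP; rewrite (_ : EFin \o _ = fun y => (\int[gauss]_z (f (y + l2weight a l' * z))%:E)%E); last first.
    by apply/funext => y /=; rewrite VE.
  apply: (@measurable_fun_fubini_tonelli_F _ _ _ _ R gauss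
    (fun yz : R * R => (f (yz.1 + l2weight a l' * yz.2))%:E)).
    apply/measurable_EFinP; apply: measurableT_comp => //; apply: measurable_funD => //.
    exact: (measurableT_comp (mulrl_measurable _)).
  by move=> ?; rewrite lee_fin.
have step k l' y : k \in l ->
    (\int[mu k]_w (V l' (y + a k * w))%:E <= (V (k :: l') y + c k)%:E)%E.
  move=> kl; under eq_integral do rewrite VE.
  set s := l2weight a l'; have s0 : 0 <= s by rewrite sqrtr_ge0.
  pose F (wz : R * R) : \bar R := (f (y + a k * wz.1 + s * wz.2))%:E.
  have mF : measurable_fun setT F.
    apply/measurable_EFinP; apply: measurableT_comp => //; apply: measurable_funD => //.
      exact: (measurableT_comp (measurable_affine y (a k))).
    exact: (measurableT_comp (mulrl_measurable s)).
  have F0 wz : (0 <= F wz)%E by rewrite lee_fin.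
  rewrite (fubini_tonelli F mF F0).
  pose G z := Ex gauss (fun v => f ((y + s * z) + `|a k| * v)).
  have GE z : (G z)%:E = (\int[gauss]_v (f (y + `|a k| * v + s * z))%:E)%E.
    rewrite /G -ExE; last exact: bdd_comp_affine.
    by apply: eq_integral => v _; rewrite addrAC.
  have mG : measurable_fun setT (fun z => (G z)%:E).
    rewrite (_ : (fun z => _) = fun z => (\int[gauss]_v (f (y + `|a k| * v + s * z))%:E)%E); last first.
      by apply/funext => z; rewrite GE.
    apply: (@measurable_fun_fubini_tonelli_F _ _ _ _ R gauss
      (fun zv : R * R => (f (y + `|a k| * zv.2 + s * zv.1))%:E)).
      apply/measurable_EFinP; apply: measurableT_comp => //; apply: measurable_funD => //.
        exact: (measurableT_comp (measurable_affine y _)).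
      exact: (measurableT_comp (mulrl_measurable s)).
    by move=> ?; rewrite lee_fin.
  have G0 z : 0 <= G z by exact: Ex_ge0.
  apply: (@le_trans _ _ (\int[gauss]_z (G z + c k)%:E)%E).
    apply: ge0_le_integral => //.
    - by move=> z _; apply: integral_ge0 => w _; rewrite lee_fin.
    - exact: (@measurable_fun_fubini_tonelli_G _ _ _ _ R (mu k) F mF F0).
    - by apply/measurable_EFinP; apply: measurable_funD => //; exact/measurable_EFinP.
    - move=> z _; rewrite (_ : (\int[mu k]_w F (w, z))%E =
        (\int[mu k]_w (f ((y + s * z) + a k * w))%:E)%E); last first.
        by apply: eq_integral => w _; rewrite /F/= addrAC.
      rewrite ExE; last exact: bdd_comp_affine.
      rewrite lee_fin; apply: (cubic_swap _ C0 (std_mu kl) std_gauss) => //.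
  under eq_integral do rewrite EFinD.
  rewrite ge0_integralD//; [|by move=> z _; rewrite lee_fin|by move=> z _; rewrite lee_fin].
  rewrite integral_cst// [X in (_ + _ * X)%E](@probability_setT _ _ _ gauss) mule1 EFinD leeD2r//.
  under eq_integral do rewrite GE.
  rewrite gauss_conv// VE /l2weight big_cons sqr_sqrtr ?sumr_ge0// => [|i _]; last exact: sqr_ge0.
  by rewrite real_normK ?num_real.
have V0 l' y : 0 <= V l' y by exact: Ex_ge0.
have := telescope_sum Lmu 0 ul mV V0 c0 step.
under eq_integral do rewrite Vnil add0r.
rewrite ExE; last first.
  split; first exact: measurableT_comp.
  by exists 1 => z; rewrite ger0_norm//; have /andP[] := f01 (\sum_(k <- l) a k * coord k z).
rewrite lee_fin => H; apply: (le_trans H).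
rewrite /V (@eq_Ex _ _ _ _ _ (fun z => f (l2weight a l * z))); last by move=> z; rewrite add0r.
rewrite lerD2l mulr_sumr le_eqVlt; apply/orP; left; apply/eqP; apply: eq_bigr => k _.
by rewrite /c; ring.
Qed.

Lemma lindeberg (f : R -> R) : (forall x, 0 <= f x <= 1) -> cubic C f ->
  `|Ex L (fun z => f (\sum_(k <- l) a k * coord k z))
     - Ex gauss (fun z => f (l2weight a l * z))| <= C * (m + m') * \sum_(k <- l) `|a k| ^+ 3.
Proof.
move=> f01 cf; have cont := cubic_continuous C0 cf.
have mf : measurable_fun setT f by exact: continuous_measurable_fun.
have g01 x : 0 <= 1 - f x <= 1 by have /andP[? ?] := f01 x; apply/andP; split; lra.
have cg : cubic C (fun x => 1 - f x).
  move=> s; have [p [q H]] := cf s; exists (- p), (- q) => h.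
  rewrite (_ : 1 - _ - _ - _ - _ = - (f (s + h) - f s - h * p - h ^+ 2 * q)); last by ring.
  by rewrite normrN.
have b1 : bdd_meas (fun z : sample K R => f (\sum_(k <- l) a k * coord k z)).
  split; first exact: measurableT_comp.
  by exists 1 => z; have /andP[? ?] := f01 (\sum_(k <- l) a k * coord k z); rewrite ger0_norm.
have b2 : bdd_meas (fun z : R => f (l2weight a l * z)).
  have := bdd_comp_affine 0 (l2weight a l) mf f01.
  by under eq_fun do rewrite add0r.
have := lindeberg_le f01 cf; have := lindeberg_le g01 cg.
rewrite !ExB//; try exact: bdd_cst.
by rewrite !Ex_cst ler_norml => ? ?; apply/andP; split; lra.
Qed.
End Lindeberg.

Section Huber.
Context {R : realType}.
Variable t : R.
Hypothesis t0 : 0 <= t.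
Implicit Types v w h : R.

(** The derivative and the value of the Huber function: its second derivative
    is the indicator of [-t, t], so its second differences are smoothed
    versions of that indicator. *)
Definition clamp (v : R) : R := Num.max (- t) (Num.min v t).
Definition huber (v : R) : R := clamp v * v - clamp v ^+ 2 / 2.
Definition in_band (v : R) : R := (`|v| <= t)%R%:R.

Lemma clamp_high v : t <= v -> clamp v = t.
Proof. by move=> tv; rewrite /clamp (min_r tv) max_r// ge0_cp. Qed.

Lemma clamp_low v : v <= - t -> clamp v = - t.
Proof. by move=> vt; rewrite /clamp max_l// ge_min vt. Qed.

Lemma clamp_mid v : - t <= v -> v <= t -> clamp v = v.
Proof. by move=> tv vt; rewrite /clamp (min_l vt) max_r. Qed.

Lemma clampP v : [\/ v <= - t /\ clamp v = - t, (- t <= v /\ v <= t) /\ clamp v = v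
  | t <= v /\ clamp v = t].
Proof.
have [vt|/ltW tv] := leP v t; last by constructor 3; rewrite clamp_high.
have [vt'|/ltW vt'] := leP (- t) v; last by constructor 1; rewrite clamp_low.
by constructor 2; rewrite clamp_mid.
Qed.

Lemma in_band01 v : 0 <= in_band v <= 1.
Proof. by rewrite /in_band; case: (`|v| <= t); rewrite ?lexx ?ler01. Qed.

(* The variational inequality of the projection onto [-t, t]. *)
Lemma clamp_variational v w : 0 <= (clamp w - clamp v) * (w - clamp w).
Proof.
have t_ge0 := t0.
have H : - t <= clamp v /\ clamp v <= t by have [[? ->]|[[? ?] ->]|[? ->]] := clampP v; split; lra.
case: H; set c := clamp v => c1 c2.
have [[? ->]|[_ ->]|[? ->]] := clampP w.
- by rewrite -mulrNN mulr_ge0//; lra.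
- by rewrite subrr mulr0.
- by rewrite mulr_ge0//; lra.
Qed.

Lemma huber_convex v h : 0 <= huber (v + h) - huber v - h * clamp v <= h ^+ 2 / 2.
Proof.
have := clamp_variational v (v + h); have := clamp_variational (v + h) v.
rewrite /huber; set c := clamp v; set c' := clamp (v + h) => i1 i2.
have := sqr_ge0 (c' - c); have := sqr_ge0 (v + h - c' - (v - c)) => s1 s2.
by apply/andP; split; nra.
Qed.

Lemma huber_local v h : `|h| < `| `|v| - t| ->
  huber (v + h) - huber v - h * clamp v = h ^+ 2 / 2 * in_band v.
Proof.
have t_ge0 := t0; rewrite /huber /in_band; have [vt|vt] := leP `|v| t.
  rewrite [ltRHS]ler0_norm ?subr_le0// => H; move: vt; rewrite ler_norml => /andP[v1 v2].
  have H2 : `|v + h| <= t by rewrite (le_trans (ler_normD _ _))//; lra.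
  move: H2; rewrite ler_norml => /andP[w1 w2].
  by rewrite (clamp_mid v1 v2) (clamp_mid w1 w2) mulr1; field.
rewrite [ltRHS]gtr0_norm ?subr_gt0// mulr0 => H.
have [v0|v0] := leP 0 v.
  rewrite (ger0_norm v0) in H vt; move: H; rewrite ltr_norml => /andP[h1 h2].
  have w1 : t <= v + h by lra.
  by rewrite (clamp_high w1) (clamp_high (ltW vt)); ring.
rewrite (ltr0_norm v0) in H vt; move: H; rewrite ltr_norml => /andP[h1 h2].
have w1 : v + h <= - t by lra.
have w2 : v <= - t by lra.
by rewrite (clamp_low w1) (clamp_low w2); ring.
Qed.

Lemma measurable_clamp : measurable_fun setT clamp.
Proof. by apply: measurable_maxr => //; apply: measurable_minr. Qed.

Lemma measurable_huber : measurable_fun setT huber.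
Proof.
apply: measurable_funB; first by apply: measurable_funM => //; exact: measurable_clamp.
by apply: measurable_funM => //; apply: measurable_funX; exact: measurable_clamp.
Qed.

Lemma measurable_in_band : measurable_fun setT in_band.
Proof.
rewrite (_ : in_band = \1_[set v | `|v| <= t]).
  by apply: measurable_indic; apply: measurable_ler => //; exact: measurable_normr.
apply/funext => v; rewrite indicE /in_band; congr (nat_of_bool _)%:R.
by apply/idP/idP; rewrite inE.
Qed.

Variable eta : R.
Hypothesis eta0 : 0 < eta.

Definition second_diff (f : R -> R) (v : R) : R :=
  (f (v + 2 * eta) - 2 * f (v + eta) + f v) / eta ^+ 2.

Lemma smoothed_band01 v : 0 <= second_diff huber v <= 1.
Proof.
have e_gt0 := eta0; have /andP[a1 a2] := huber_convex (v + eta) eta.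
have /andP[b1 b2] := huber_convex (v + eta) (- eta).
have E1 : v + eta + eta = v + 2 * eta by ring.
rewrite /second_diff; rewrite E1 in a1 a2; rewrite addrK in b1 b2.
have e2 : 0 < eta ^+ 2 by rewrite exprn_gt0.
apply/andP; split; first by rewrite divr_ge0 ?(ltW e2)//; lra.
by rewrite ler_pdivrMr// mul1r; rewrite sqrrN in b2; lra.
Qed.

(** Away from the endpoints the Huber function is quadratic or affine at the
    scale of the difference. *)
Lemma smoothed_band_eq v : 2 * eta < `| `|v| - t| -> second_diff huber v = in_band v.
Proof.
move=> H; have e_gt0 := eta0; have h2 : `|2 * eta| < `| `|v| - t| by rewrite gtr0_norm// mulr_gt0.
have h1 : `|eta| < `| `|v| - t| by rewrite gtr0_norm//; lra.
have := huber_local h1; have := huber_local h2; rewrite /second_diff => E2 E1.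
have -> : huber (v + 2 * eta) - 2 * huber (v + eta) + huber v = eta ^+ 2 * in_band v.
  by lra.
by rewrite mulrC mulKf// expf_neq0// gt_eqF.
Qed.

Definition expansion_error (v h : R) : R :=
  huber (v + h) - huber v - h * clamp v - h ^+ 2 / 2 * in_band v.

Lemma expansion_error_le v h : `|expansion_error v h| <=
  h ^+ 2 / 2 * \1_[set v | `| `|v| - t| <= `|h|] v.
Proof.
rewrite indicE; have [|/negP H] := boolP (v \in _); last first.
  rewrite mulr0 /expansion_error huber_local ?subrr ?normr0//.
  by rewrite ltNge; apply/negP => H1; apply: H; rewrite inE.
move=> _; rewrite mulr1 /expansion_error.
have /andP[a1 a2] := huber_convex v h; have /andP[i1 i2] := in_band01 v.
have h0 : 0 <= h ^+ 2 / 2 by rewrite divr_ge0 ?sqr_ge0.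
by rewrite ler_norml; apply/andP; split; nra.
Qed.

Lemma second_diff_expansion v h :
  second_diff huber (v + h) - second_diff huber v - h * second_diff clamp v
    - h ^+ 2 * (second_diff in_band v / 2)
  = second_diff (expansion_error ^~ h) v.
Proof.
rewrite /second_diff /expansion_error.
have -> : v + h + 2 * eta = v + 2 * eta + h by ring.
have -> : v + h + eta = v + eta + h by ring.
by field; rewrite gt_eqF.
Qed.

End Huber.

Lemma dist_unit (R : realDomainType) (a b : R) : 0 <= a <= 1 -> 0 <= b <= 1 -> `|a - b| <= 1.
Proof. by move=> /andP[? ?] /andP[? ?]; rewrite ler_norml; apply/andP; split; lra. Qed.

Section IntervalCLT.
Context {R : realType}.
Variables (nu : probability R R) (M : R).
Hypotheses (M0 : 0 <= M)
  (window : forall c r : R, 0 <= r -> pr nu [set e : R | `|e - c| <= r] <= 2 * M * r).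

Implicit Types s r c h : R.

Definition interval_prob (t s : R) : R := pr nu [set e : R | `|e + s| <= t].

Let shift_meas (s : R) : measurable_fun setT (fun e : R => e + s).
Proof. exact: measurable_funD. Qed.

Lemma window_norm_meas (t s r : R) : measurable [set e : R | `| `|e + s| - t| <= r].
Proof.
apply: measurable_ler => //; apply: measurable_normr; apply: measurable_funB => //.
exact: measurable_normr.
Qed.

Lemma window_meas (c r : R) : measurable [set e : R | `|e - c| <= r].
Proof. by apply: measurable_ler => //; apply: measurable_normr; exact: measurable_funB. Qed.

Lemma window_norm (t s r : R) : 0 <= r -> pr nu [set e : R | `| `|e + s| - t| <= r] <= 4 * M * r.
Proof.
have M_ge0 := M0; move=> r0; have := window (t - s) r0; have := window (- t - s) r0 => h1 h2.
apply: (@le_trans _ _ (2 * M * r + 2 * M * r)); last by lra.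
apply: le_trans (lerD h2 h1); apply: pr_sub2; [exact: window_norm_meas|exact: window_meas..|].
move=> e /=; rewrite !ler_norml => /andP[a b].
have [es|es] := leP 0 (e + s).
  by left; rewrite ger0_norm// in a b; apply/andP; split; lra.
by right; rewrite (ltr0_norm es) in a b; apply/andP; split; lra.
Qed.

Lemma interval_prob_meas (t s : R) : measurable [set e : R | `|e + s| <= t].
Proof. by apply: measurable_ler => //; exact: measurable_normr. Qed.

(** The interval moves by [s - s'], and only a window of this width around its
    endpoints matters. *)
Lemma interval_prob_lip t s s' : `|interval_prob t s - interval_prob t s'| <= 4 * M * `|s - s'|.
Proof.
apply: le_trans (window_norm t s (normr_ge0 _)); apply: pr_close;
  [exact: interval_prob_meas|exact: interval_prob_meas|exact: window_norm_meas|..].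
- move=> e /= es; have [es'|es'] := leP `|e + s'| t; [by left|right].
  have := ler_dist_dist (e + s') (e + s); rewrite (_ : e + s' - _ = - (s - s')); last by ring.
  by rewrite normrN !ler_norml => /andP[? ?]; apply/andP; split; lra.
- move=> e /= es; have [es'|es'] := leP `|e + s| t; [by left|right].
  have := ler_dist_dist (e + s') (e + s); rewrite (_ : e + s' - _ = - (s - s')); last by ring.
  by rewrite normrN !ler_norml => /andP[? ?]; apply/andP; split; lra.
Qed.

Lemma interval_prob01 t s : 0 <= interval_prob t s <= 1.
Proof. by rewrite pr_ge0 pr_le1//; exact: interval_prob_meas. Qed.

Lemma interval_prob_continuous t : continuous (interval_prob t).
Proof.
move=> s; apply/cvgrPdist_lt => e e0.
have K0 : 0 < 4 * M + 1 by rewrite ltr_wpDl// mulr_ge0.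
apply/nbhs_ballP; exists (e / (4 * M + 1)); first exact: divr_gt0.
move=> y sy; have {}sy : `|s - y| < e / (4 * M + 1) by exact: sy.
apply: (le_lt_trans (interval_prob_lip t s y)); move: sy; rewrite ltr_pdivlMr//.
by have := normr_ge0 (s - y); nra.
Qed.

Variables (t eta : R).
Hypotheses (t0 : 0 <= t) (eta0 : 0 < eta).

Definition smooth_interval (s : R) : R := Ex nu (fun e : R => second_diff eta (huber t) (e + s)).

Let sd_meas (f : R -> R) (s : R) : measurable_fun setT f ->
  measurable_fun setT (fun e : R => second_diff eta f (e + s)).
Proof.
move=> mf; apply: measurable_funM => //; apply: measurable_funD; last exact: measurableT_comp.
apply: measurable_funB; last apply: measurable_funM => //.
  by apply: measurableT_comp => //; apply: measurable_funD.
by apply: measurableT_comp => //; apply: measurable_funD.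
Qed.

Let bdd_huber s : bdd_meas (fun e : R => second_diff eta (huber t) (e + s)).
Proof.
split; first by apply: sd_meas; exact: measurable_huber.
by exists 1 => e; have /andP[? ?] := smoothed_band01 t0 eta0 (e + s); rewrite ger0_norm.
Qed.

Let bdd_sd (f : R -> R) (C s : R) : measurable_fun setT f -> (forall v, `|f v| <= C) ->
  bdd_meas (fun e : R => second_diff eta f (e + s)).
Proof.
move=> mf fC; split; first exact: sd_meas.
exists (4 * C / eta ^+ 2) => e; rewrite /second_diff normrM normfV.
rewrite (ger0_norm (sqr_ge0 eta)) ler_pM2r ?invr_gt0 ?exprn_gt0//.
have := fC (e + s); have := fC (e + s + eta); have := fC (e + s + 2 * eta).
by rewrite !ler_norml => /andP[? ?] /andP[? ?] /andP[? ?]; apply/andP; split; lra.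
Qed.

Let in_band_norm v : `|in_band t v| <= 1.
Proof. by have /andP[? ?] := in_band01 t v; rewrite ger0_norm. Qed.

Let clamp_norm v : `|clamp t v| <= t.
Proof.
have t_ge0 := t0; rewrite ler_norml; have [[? ->]|[[? ?] ->]|[? ->]] := clampP t0 v; apply/andP; split; lra.
Qed.

Lemma smooth_interval01 s : 0 <= smooth_interval s <= 1.
Proof.
apply/andP; split.
  by apply: Ex_ge0 => e; have /andP[] := smoothed_band01 t0 eta0 (e + s).
rewrite -[leRHS](Ex_cst nu); apply: le_Ex => //; first exact: bdd_cst.
by move=> e; have /andP[] := smoothed_band01 t0 eta0 (e + s).
Qed.

Lemma smooth_interval_close s : `|smooth_interval s - interval_prob t s| <= 8 * M * eta.
Proof.
have M_ge0 := M0; have e_gt0 := eta0; have mI := interval_prob_meas t s.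
rewrite /interval_prob -Ex_indic// -ExB//; last exact: bdd_indic.
have e2 : 0 <= 2 * eta by rewrite mulr_ge0// ltW.
apply: (@le_trans _ _ (pr nu [set e : R | `| `|e + s| - t| <= 2 * eta])); last first.
  by apply: le_trans (window_norm t s e2) _; nra.
have bd : bdd_meas (fun e : R => second_diff eta (huber t) (e + s) - \1_[set e : R | `|e + s| <= t] e).
  by apply: bddB => //; exact: bdd_indic.
apply: (le_trans (Ex_norm nu bd)).
rewrite -Ex_indic; last exact: window_norm_meas.
apply: le_Ex; [exact: bdd_norm|by apply: bdd_indic; exact: window_norm_meas|].
have E e : \1_[set e : R | `|e + s| <= t] e = in_band t (e + s).
  by rewrite indicE /in_band; congr (nat_of_bool _)%:R; apply/idP/idP; rewrite inE.
move=> e; rewrite E indicE; have [_|/negP H] := boolP (e \in _).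
  exact: dist_unit (smoothed_band01 t0 eta0 (e + s)) (in_band01 t (e + s)).
rewrite smoothed_band_eq// ?subrr ?normr0//.
by rewrite ltNge; apply/negP => H1; apply: H; rewrite inE.
Qed.

(** Averaging over the noise turns the jumps of the smoothed indicator's second
    derivative, which sit at the endpoints, into a cubic remainder, since the
    noise is within [`|h|] of an endpoint with probability of order [`|h|]. *)
Lemma smooth_interval_cubic : cubic (8 * M / eta ^+ 2) smooth_interval.
Proof.
move=> s; exists (Ex nu (fun e : R => second_diff eta (clamp t) (e + s))),
  (Ex nu (fun e : R => second_diff eta (in_band t) (e + s) / 2)) => h.
have bc := bdd_sd s (measurable_clamp t) clamp_norm.
have bi : bdd_meas (fun e : R => second_diff eta (in_band t) (e + s) / 2).
  by apply: bddM; [exact: bdd_sd (measurable_in_band t) in_band_norm|exact: bdd_cst].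
have bh1 : bdd_meas (fun e : R => second_diff eta (huber t) (e + s + h)).
  by have := bdd_huber (s + h); under eq_fun do rewrite addrA.
rewrite /smooth_interval (@eq_Ex _ _ _ _ _ (fun e : R => second_diff eta (huber t) (e + s + h))); last first.
  by move=> e; rewrite addrA.
have bB : bdd_meas (fun e : R => second_diff eta (huber t) (e + s + h) - second_diff eta (huber t) (e + s)).
  exact: bddB.
have bch : bdd_meas (fun e : R => h * second_diff eta (clamp t) (e + s)) by apply: bddM => //; exact: bdd_cst.
have bih : bdd_meas (fun e : R => h ^+ 2 * (second_diff eta (in_band t) (e + s) / 2)).
  by apply: bddM => //; exact: bdd_cst.
rewrite -ExB// -ExZ// -ExB// -ExZ// -ExB//; last exact: bddB.
rewrite (@eq_Ex _ _ _ _ _ (fun e : R => second_diff eta ((expansion_error t) ^~ h) (e + s))); last first.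
  by move=> e; rewrite second_diff_expansion.
have me : measurable_fun setT ((expansion_error t) ^~ h).
  apply: measurable_funB; last by apply: measurable_funM => //; exact: measurable_in_band.
  apply: measurable_funB; last by apply: measurable_funM => //; exact: measurable_clamp.
  apply: measurable_funB; last exact: measurable_huber.
  by apply: measurableT_comp; [exact: measurable_huber|exact: measurable_funD].
have ele v : `|expansion_error t v h| <= h ^+ 2 / 2.
  apply: (le_trans (expansion_error_le t0 v h)).
  have i1 (b : bool) : b%:R <= 1 :> R by case: b.
  by rewrite indicE ler_piMr// divr_ge0// sqr_ge0.
have be := bdd_sd s me ele.
apply: (le_trans (Ex_norm nu be)).
pose W s' e : R := h ^+ 2 / 2 * \1_[set e : R | `| `|e + s'| - t| <= `|h|] e.
have bW s' : bdd_meas (W s').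
  by apply: bddM; [exact: bdd_cst|apply: bdd_indic; exact: window_norm_meas].
have EW s' : Ex nu (W s') <= 2 * M * `|h| ^+ 3.
  rewrite ExZ; last by apply: bdd_indic; exact: window_norm_meas.
  rewrite Ex_indic; last exact: window_norm_meas.
  have := window_norm t s' (normr_ge0 h); rewrite -(real_normK (num_real h)) => H.
  apply: (@le_trans _ _ (`|h| ^+ 2 / 2 * (4 * M * `|h|))).
    by rewrite ler_wpM2l ?divr_ge0 ?sqr_ge0.
  by rewrite le_eqVlt; apply/orP; left; apply/eqP; field.
have We e s' : `|expansion_error t (e + s') h| <= W s' e.
  apply: (le_trans (expansion_error_le t0 _ _)); rewrite le_eqVlt; apply/orP; left; apply/eqP.
  by rewrite /W !indicE; congr (_ * (nat_of_bool _)%:R); apply/idP/idP; rewrite !inE.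
have e2 : 0 < eta ^+ 2 by rewrite exprn_gt0.
pose U e := (W (s + 2 * eta) e + 2 * W (s + eta) e + W s e) * (eta ^+ 2)^-1.
have bU : bdd_meas U.
  apply: bddM; last exact: bdd_cst.
  by apply: bddD => //; apply: bddD => //; apply: bddM => //; exact: bdd_cst.
apply: (@le_trans _ _ (Ex nu U)).
  apply: le_Ex => //; first exact: bdd_norm.
  move=> e; rewrite /second_diff normrM normfV (gtr0_norm e2) ler_pM2r ?invr_gt0//.
  apply: (le_trans (ler_normD _ _)); apply: lerD; last exact: We.
  apply: (le_trans (ler_normB _ _)); apply: lerD; first by rewrite -addrA.
  by rewrite normrM ger0_norm// ler_wpM2l// -addrA.
have -> : Ex nu U = (Ex nu (W (s + 2 * eta)) + 2 * Ex nu (W (s + eta)) + Ex nu (W s)) * (eta ^+ 2)^-1.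
  have b2 : bdd_meas (fun e : R => 2 * W (s + eta) e) by apply: bddM => //; exact: bdd_cst.
  have b3 : bdd_meas (fun e : R => W (s + 2 * eta) e + 2 * W (s + eta) e) by exact: bddD.
  rewrite -ExZ// -ExD// -ExD// mulrC -ExZ//; last exact: bddD.
  by apply: eq_Ex => e; rewrite /U mulrC.
have := EW s; have := EW (s + eta); have := EW (s + 2 * eta) => h1 h2 h3.
rewrite mulrAC ler_pM2r ?invr_gt0//; lra.
Qed.

End IntervalCLT.

Section IntervalLimit.
Context {K : finType} {R : realType}.
Variables (mu : K -> probability R R) (L : probability (sample K R) R).
Hypothesis Lmu : product_law mu L.
Variables (nu : probability R R) (M : R).
Hypotheses (M0 : 0 <= M)
  (window : forall c r : R, 0 <= r -> pr nu [set e : R | `|e - c| <= r] <= 2 * M * r).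

Let interval_prob_meas_fun (t : R) : measurable_fun setT (interval_prob nu t).
Proof. apply: continuous_measurable_fun; exact: (interval_prob_continuous M0 window). Qed.

Let bdd_interval_comp d (T : measurableType d) (t : R) (h : T -> R) : measurable_fun setT h ->
  bdd_meas (fun x => interval_prob nu t (h x)).
Proof.
move=> mh; split; first exact: measurableT_comp.
by exists 1 => x; have /andP[? ?] := interval_prob01 nu t (h x); rewrite ger0_norm.
Qed.

Lemma interval_prob_lt0 (t s : R) : t < 0 -> interval_prob nu t s = 0.
Proof.
move=> t0; rewrite /interval_prob (_ : [set e : R | _] = set0) ?/pr ?measure0//.
by apply/seteqP; split => e //= /(le_lt_trans)/(_ t0); rewrite normr_lt0.
Qed.

Lemma interval_prob_gauss_scale (t s s' : R) :
  `|Ex gauss (fun z => interval_prob nu t (s * z)) - Ex gauss (fun z => interval_prob nu t (s' * z))|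
   <= 4 * M * `|s - s'|.
Proof.
have [C C4] := @gauss_fourth_moment R.
have ms (c : R) : measurable_fun setT (fun z : R => c * z) by exact: mulrl_measurable.
have b1 := bdd_interval_comp t (ms s); have b2 := bdd_interval_comp t (ms s').
have bb := bddB b1 b2; rewrite -ExB//; apply: (le_trans (Ex_norm gauss bb)).
pose D := 4 * M * `|s - s'| / 2.
have D0 : 0 <= D by rewrite divr_ge0// !mulr_ge0.
have i1 : gauss.-integrable setT (EFin \o (fun z : R => D)).
  exact: finite_measure_integrable_cst.
have i2 : gauss.-integrable setT (EFin \o (fun z : R => D * z ^+ 2)).
  exact: (integrableZl measurableT D (integrable_sqr C4)).
apply: (@le_trans _ _ (Rintegral gauss setT (fun z : R => D + D * z ^+ 2))).
  apply: le_Rintegral => //; first exact: bdd_int (bdd_norm bb).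
    exact: (integrableD measurableT i1 i2).
  move=> z _; apply: (le_trans (interval_prob_lip M0 window t _ _)).
  rewrite -mulrBl normrM /D mulrA; have -> : 4 * M * `|s - s'| / 2 + 4 * M * `|s - s'| / 2 * z ^+ 2 =
    4 * M * `|s - s'| * ((1 + z ^+ 2) / 2) by field.
  rewrite ler_wpM2l ?mulr_ge0//.
  by have := sqr_ge0 (`|z| - 1); rewrite sqrrB real_normK ?num_real//; lra.
rewrite RintegralD// RintegralZl//; last exact: integrable_sqr C4.
rewrite -[Rintegral gauss setT (fun z => z ^+ 2)]/(Ex gauss (fun z => z ^+ 2)) gauss_var.
rewrite -[X in X + _]/(Ex gauss (fun=> D)) Ex_cst /D.
by rewrite le_eqVlt; apply/orP; left; apply/eqP; field.
Qed.

Variables (l : seq K) (a : K -> R) (m m' eta : R).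
Hypotheses (ul : uniq l) (m0 : 0 <= m) (m'0 : 0 <= m') (eta0 : 0 < eta).
Hypotheses (std_mu : forall k, k \in l -> std_law (mu k) m) (std_gauss : std_law (@gauss R) m').

(** The terms come from smoothing the interval at scale [eta], from the
    Lindeberg replacement for the smoothed function, and from changing the
    standard deviation. *)
Lemma interval_clt (t s : R) :
  `|Ex L (fun z => interval_prob nu t (\sum_(k <- l) a k * coord k z))
    - Ex gauss (fun z => interval_prob nu t (s * z))|
  <= 16 * M * eta + 8 * M / eta ^+ 2 * (m + m') * \sum_(k <- l) `|a k| ^+ 3
     + 4 * M * `|l2weight a l - s|.
Proof.
have [t0|t0] := leP 0 t; last first.
  rewrite (@eq_Ex _ _ _ _ _ (fun=> 0)); last by move=> z; rewrite interval_prob_lt0.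
  rewrite (@eq_Ex _ _ _ gauss _ (fun=> 0)); last by move=> z; rewrite interval_prob_lt0.
  rewrite !Ex_cst subrr normr0 !addr_ge0 ?mulr_ge0 ?addr_ge0 ?invr_ge0 ?sqr_ge0 ?(ltW eta0)//.
  by apply: sumr_ge0 => k _; exact: exprn_ge0.
pose f := smooth_interval nu t eta.
have C0 : 0 <= 8 * M / eta ^+ 2.
  by apply: divr_ge0; [exact: mulr_ge0|exact: sqr_ge0].
have cf := smooth_interval_cubic M0 window t0 eta0.
have f01 := smooth_interval01 nu t0 eta0.
have mf : measurable_fun setT f by apply: continuous_measurable_fun; exact: cubic_continuous C0 cf.
have H := lindeberg Lmu a ul C0 m0 m'0 std_mu std_gauss f01 cf.
have mS : measurable_fun setT (fun z : sample K R => \sum_(k <- l) a k * coord k z).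
  by apply: measurable_sum => k; apply: measurable_funM => //; exact: measurable_coord.
have mG (c : R) : measurable_fun setT (fun z : R => c * z) by exact: mulrl_measurable.
have bf d (T : measurableType d) (h : T -> R) : measurable_fun setT h -> bdd_meas (fun x => f (h x)).
  move=> mh; split; first exact: measurableT_comp.
  by exists 1 => x; have /andP[? ?] := f01 (h x); rewrite ger0_norm.
have cl d (T : measurableType d) (Q : probability T R) (h : T -> R) : measurable_fun setT h ->
    `|Ex Q (fun x => interval_prob nu t (h x)) - Ex Q (fun x => f (h x))| <= 8 * M * eta.
  move=> mh; have b1 := bdd_interval_comp t mh; have b2 := bf _ _ _ mh; have bb := bddB b1 b2.
  rewrite -ExB//; apply: (le_trans (Ex_norm Q bb)).
  rewrite -[leRHS](Ex_cst Q); apply: le_Ex; [exact: bdd_norm|exact: bdd_cst|].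
  by move=> x; rewrite distrC; exact: smooth_interval_close.
have H1 := cl _ _ L _ mS; have H2 := cl _ _ gauss _ (mG (l2weight a l)).
have H3 := interval_prob_gauss_scale t (l2weight a l) s.
move: H H1 H2 H3; rewrite -/f.
set A := Ex L _; set B := Ex gauss _; set A' := Ex L _; set B' := Ex gauss _; set B'' := Ex gauss _.
set c := 8 * M / _ * _ * _.
rewrite !ler_norml => /andP[? ?] /andP[? ?] /andP[? ?] /andP[? ?]; apply/andP; split; lra.
Qed.

End IntervalLimit.

(** * Moments of weighted sums *)

Section WeightedMoments.
Context {K : finType} {R : realType}.
Variables (mu : K -> probability R R) (L : probability (sample K R) R).
Hypothesis Lmu : product_law mu L.
Variables (l : seq K) (a : K -> R) (C : R).
Hypotheses (ul : uniq l).
Hypotheses (mu_mean : forall k, k \in l -> Ex (mu k) (fun x => x) = 0)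
  (mu_var : forall k, k \in l -> Ex (mu k) (fun x => x ^+ 2) = 1)
  (mu_fourth : forall k, k \in l -> (\int[mu k]_x (x ^+ 4)%:E <= C%:E)%E).

Let mpoly2 (y b : R) : measurable_fun setT (fun w : R => (y + b * w) ^+ 2).
Proof. by apply: measurable_funX; exact: measurable_affine. Qed.

Lemma sqr_step k (y b : R) : k \in l ->
  (\int[mu k]_w ((y + b * w) ^+ 2)%:E = (y ^+ 2 + b ^+ 2)%:E)%E.
Proof.
move=> kl; have i1 := integrable_id (mu_fourth kl); have i2 := integrable_sqr (mu_fourth kl).
have i0 : (mu k).-integrable setT (EFin \o (fun w : R => y ^+ 2)).
  exact: finite_measure_integrable_cst.
have j1 : (mu k).-integrable setT (EFin \o (fun w : R => (2 * y * b) * w)).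
  exact: (integrableZl measurableT _ i1).
have j2 : (mu k).-integrable setT (EFin \o (fun w : R => b ^+ 2 * w ^+ 2)).
  exact: (integrableZl measurableT _ i2).
have j01 : (mu k).-integrable setT (EFin \o (fun w : R => y ^+ 2 + (2 * y * b) * w)).
  exact: (integrableD measurableT i0 j1).
have E : (fun w : R => (y + b * w) ^+ 2) = (fun w => y ^+ 2 + (2 * y * b) * w + b ^+ 2 * w ^+ 2).
  by apply/funext => w; ring.
have jE : (mu k).-integrable setT (EFin \o (fun w : R => (y + b * w) ^+ 2)).
  by rewrite E; exact: (integrableD measurableT j01 j2).
rewrite -[LHS]fineK; last exact: integrable_fin_num.
have e0 c : Rintegral (mu k) setT (fun=> c) = c by exact: Ex_cst.
congr _%:E; rewrite -[LHS]/(Rintegral (mu k) setT _) E !RintegralD// e0 !RintegralZl//.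
have e1 : Rintegral (mu k) setT (fun x => x) = 0 by exact: mu_mean.
have e2 : Rintegral (mu k) setT (fun x => x ^+ 2) = 1 by exact: mu_var.
by rewrite e1 e2; ring.
Qed.

Lemma weighted_second_moment (x : R) :
  (\int[L]_z ((x + \sum_(k <- l) a k * coord k z) ^+ 2)%:E <= (x ^+ 2 + \sum_(k <- l) a k ^+ 2)%:E)%E.
Proof.
pose V (l' : seq K) (y : R) := y ^+ 2 + \sum_(k <- l') a k ^+ 2.
have A0 l' : 0 <= \sum_(k <- l') a k ^+ 2 by rewrite sumr_ge0// => i _; exact: sqr_ge0.
have mV l' : measurable_fun setT (V l').
  by apply: measurable_funD => //; apply: measurable_funX.
have V0 l' y : 0 <= V l' y by rewrite addr_ge0 ?sqr_ge0.
have step k l' y : k \in l -> (\int[mu k]_w (V l' (y + a k * w))%:E <= (V (k :: l') y + 0)%:E)%E.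
  move=> kl; under eq_integral do rewrite /V EFinD.
  rewrite ge0_integralD//;
    [|by move=> w _; rewrite lee_fin ?sqr_ge0|exact/measurable_EFinP|by move=> w _; rewrite lee_fin].
  rewrite sqr_step// integral_cst// [X in (_ + _ * X)%E](@probability_setT _ _ _ (mu k)) mule1.
  by rewrite -EFinD lee_fin /V big_cons addr0 addrA.
have := @telescope_sum _ _ _ _ Lmu a (fun=> 0) V l x ul mV V0 (fun=> lexx 0) step.
rewrite big1// addr0 {2}/V => H; apply: le_trans H.
rewrite le_eqVlt; apply/orP; left; apply/eqP; apply: eq_integral => z _; congr _%:E.
by rewrite /V big_nil addr0.
Qed.

Lemma fourth_step k (y b : R) : k \in l ->
  (\int[mu k]_w ((y + b * w) ^+ 4)%:E <= (y ^+ 4 + 8 * y ^+ 2 * b ^+ 2 + (3 * C) * b ^+ 4)%:E)%E.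
Proof.
move=> kl; have m4 := mu_fourth kl.
have i1 := integrable_id m4; have i2 := integrable_sqr m4.
have i4 : (mu k).-integrable setT (EFin \o (fun w : R => w ^+ 4)).
  apply: (integrable_fourth m4); first exact: measurable_funX.
  by move=> x; rewrite ger0_norm ?lerDr// exprn_even_ge0.
have i0 : (mu k).-integrable setT (EFin \o (fun w : R => y ^+ 4)).
  exact: finite_measure_integrable_cst.
have j1 : (mu k).-integrable setT (EFin \o (fun w : R => (4 * y ^+ 3 * b) * w)).
  exact: (integrableZl measurableT _ i1).
have j2 : (mu k).-integrable setT (EFin \o (fun w : R => (8 * y ^+ 2 * b ^+ 2) * w ^+ 2)).
  exact: (integrableZl measurableT _ i2).
have j4 : (mu k).-integrable setT (EFin \o (fun w : R => (3 * b ^+ 4) * w ^+ 4)).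
  exact: (integrableZl measurableT _ i4).
pose g w := y ^+ 4 + (4 * y ^+ 3 * b) * w + (8 * y ^+ 2 * b ^+ 2) * w ^+ 2 + (3 * b ^+ 4) * w ^+ 4.
have j01 : (mu k).-integrable setT (EFin \o (fun w : R => y ^+ 4 + (4 * y ^+ 3 * b) * w)).
  exact: (integrableD measurableT i0 j1).
have j012 : (mu k).-integrable setT (EFin \o (fun w : R => y ^+ 4 + (4 * y ^+ 3 * b) * w
    + (8 * y ^+ 2 * b ^+ 2) * w ^+ 2)).
  exact: (integrableD measurableT j01 j2).
have jg : (mu k).-integrable setT (EFin \o g) by exact: (integrableD measurableT j012 j4).
have gE w : (y + b * w) ^+ 4 <= g w.
  rewrite /g -subr_ge0.
  have -> : y ^+ 4 + 4 * y ^+ 3 * b * w + 8 * y ^+ 2 * b ^+ 2 * w ^+ 2 + 3 * b ^+ 4 * w ^+ 4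
     - (y + b * w) ^+ 4 = 2 * (y * (b * w) - (b * w) ^+ 2) ^+ 2 by ring.
  by rewrite mulr_ge0// sqr_ge0.
apply: (@le_trans _ _ (\int[mu k]_w (g w)%:E)%E).
  apply: ge0_le_integral => //.
  - by move=> w _; rewrite lee_fin exprn_even_ge0.
  - by apply/measurable_EFinP; apply: measurable_funX; exact: measurable_affine.
  - exact: measurable_int jg.
  - by move=> w _; rewrite lee_fin.
rewrite (_ : (\int[mu k]_w (g w)%:E)%E = (Rintegral (mu k) setT g)%:E); last first.
  by rewrite fineK//; exact: integrable_fin_num.
have e0 c : Rintegral (mu k) setT (fun=> c) = c by exact: Ex_cst.
rewrite lee_fin /g !RintegralD// e0 !RintegralZl//.
have e1 : Rintegral (mu k) setT (fun x => x) = 0 by exact: mu_mean.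
have e2 : Rintegral (mu k) setT (fun x => x ^+ 2) = 1 by exact: mu_var.
rewrite e1 e2.
have H : Rintegral (mu k) setT (fun x => x ^+ 4) <= C.
  by rewrite -lee_fin [leLHS]fineK//; exact: integrable_fin_num.
have b4 : 0 <= 3 * b ^+ 4 by rewrite mulr_ge0// exprn_even_ge0.
by have := ler_wpM2l b4 H; lra.
Qed.

Hypothesis C0 : 0 <= C.

(** The potential [y^4 + 8 y^2 A + K A^2] decreases when a summand of variance
    at most the corresponding part of [A] is absorbed. *)
Lemma weighted_fourth_moment :
  (\int[L]_z ((\sum_(k <- l) a k * coord k z) ^+ 4)%:E
    <= ((3 * C + 4) * (\sum_(k <- l) a k ^+ 2) ^+ 2)%:E)%E.
Proof.
pose A (l' : seq K) := \sum_(k <- l') a k ^+ 2.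
have A0 l' : 0 <= A l' by rewrite sumr_ge0// => i _; exact: sqr_ge0.
have C_ge0 := C0.
pose Kc := 3 * C + 4; have K0 : 0 <= Kc by rewrite /Kc; lra.
pose V (l' : seq K) (y : R) := y ^+ 4 + 8 * A l' * y ^+ 2 + Kc * A l' ^+ 2.
have V0 l' y : 0 <= V l' y.
  rewrite /V; apply: addr_ge0; last by apply: mulr_ge0 => //; exact: sqr_ge0.
  apply: addr_ge0; first exact: exprn_even_ge0.
  by apply: mulr_ge0; [exact: mulr_ge0|exact: sqr_ge0].
have mV l' : measurable_fun setT (V l').
  apply: measurable_funD => //; apply: measurable_funD; first exact: measurable_funX.
  by apply: measurable_funM => //; apply: measurable_funX.
have step k l' y : k \in l -> (\int[mu k]_w (V l' (y + a k * w))%:E <= (V (k :: l') y + 0)%:E)%E.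
  move=> kl; have := fourth_step y (a k) kl; have := sqr_step y (a k) kl.
  move=> h2 h4; under eq_integral do rewrite /V EFinD EFinD EFinM.
  have e2 : measurable_fun setT (fun w : R => ((y + a k * w) ^+ 2)%:E) by exact/measurable_EFinP.
  have e4 : measurable_fun setT (fun w : R => ((y + a k * w) ^+ 4)%:E).
    by apply/measurable_EFinP; apply: measurable_funX; exact: measurable_affine.
  have n2 w : (0 <= (8 * A l')%:E * ((y + a k * w) ^+ 2)%:E)%E.
    by rewrite -EFinM lee_fin; apply: mulr_ge0; [exact: mulr_ge0|exact: sqr_ge0].
  have n4 w : (0 <= ((y + a k * w) ^+ 4)%:E)%E by rewrite lee_fin exprn_even_ge0.
  have n3 : (0 <= (Kc * A l' ^+ 2)%:E)%E by rewrite lee_fin; apply: mulr_ge0 => //; exact: sqr_ge0.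
  have m2' : measurable_fun setT (fun w : R => ((8 * A l')%:E * ((y + a k * w) ^+ 2)%:E)%E).
    exact: measurable_funeM.
  have m42 := emeasurable_funD e4 m2'.
  have n42 w : (0 <= ((y + a k * w) ^+ 4)%:E + (8 * A l')%:E * ((y + a k * w) ^+ 2)%:E)%E.
    exact: adde_ge0.
  rewrite (ge0_integralD (mu k) measurableT (fun w _ => n42 w) m42 (fun w _ => n3) (measurable_cst _)).
  rewrite (ge0_integralD (mu k) measurableT (fun w _ => n4 w) e4 (fun w _ => n2 w) m2').
  rewrite ge0_integralZl//; [|by move=> w _; rewrite lee_fin; exact: sqr_ge0|by rewrite lee_fin; exact: mulr_ge0].
  rewrite h2 integral_cst// [X in (_ + _ * X)%E](@probability_setT _ _ _ (mu k)) mule1 addr0.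
  apply: (@le_trans _ _ ((y ^+ 4 + 8 * y ^+ 2 * a k ^+ 2 + 3 * C * a k ^+ 4)%:E
     + (8 * A l')%:E * (y ^+ 2 + a k ^+ 2)%:E + (Kc * A l' ^+ 2)%:E)%E).
    by rewrite leeD2r// leeD2r.
  rewrite -EFinM -!EFinD lee_fin /V /A big_cons -/(A l').
  have := A0 l'; have := sqr_ge0 (a k); set s := a k ^+ 2; set B := A l' => s0 B0.
  have -> : a k ^+ 4 = s ^+ 2 by rewrite /s -exprM.
  have sB : 0 <= s * B by rewrite mulr_ge0.
  have CsB : 0 <= C * (s * B) by rewrite mulr_ge0.
  by rewrite /Kc; have := sqr_ge0 s; nra.
have := @telescope_sum _ _ _ _ Lmu a (fun=> 0) V l 0 ul mV V0 (fun=> lexx 0) step.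
rewrite (_ : V l 0 + \sum_(k <- l) 0 = Kc * A l ^+ 2); last first.
  by rewrite big1// /V !expr0n/= mulr0 !add0r addr0.
move=> H; apply: le_trans H.
rewrite le_eqVlt; apply/orP; left; apply/eqP; apply: eq_integral => z _; congr _%:E.
by rewrite /V /A big_nil mulr0 mul0r add0r expr0n/= mulr0 !addr0.
Qed.

End WeightedMoments.

Section BlockMoments.
Context {K : finType} {R : realType}.
Notation S := (sample K R).
Variables (mu : K -> probability R R) (L : probability S R).
Hypothesis Lmu : product_law mu L.
Variables (J : pred K) (l : seq K) (u : K -> S -> R) (C : R).
Hypotheses (ul : uniq l) (lJ : forall q, q \in l -> ~~ J q)
  (mu_u : forall q, measurable_fun setT (u q))
  (uJ : forall q z1 z2, u q (mix J z1 z2) = u q z1).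
Hypotheses (mu_mean : forall q, q \in l -> Ex (mu q) (fun x => x) = 0)
  (mu_var : forall q, q \in l -> Ex (mu q) (fun x => x ^+ 2) = 1)
  (mu_fourth : forall q, q \in l -> (\int[mu q]_x (x ^+ 4)%:E <= C%:E)%E) (C0 : 0 <= C).

Lemma mean_le_resample (F g : S -> R) (a : R) : nneg_meas F -> nneg_meas g ->
  (forall z1, mean_le L (fun z2 => F (mix J z1 z2)) (g z1)) -> mean_le L g a -> mean_le L F a.
Proof.
move=> [mF F0] [mg g0] Fg; apply: le_trans.
rewrite (resample_int Lmu J); [|exact/measurable_EFinP|by move=> z; rewrite lee_fin].
apply: ge0_le_integral => //.
- by move=> z _; apply: integral_ge0 => z2 _; rewrite lee_fin.
- pose G (z : S * S) := (F (mix J z.1 z.2))%:E.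
  apply: (@measurable_fun_fubini_tonelli_F _ _ _ _ R L G); last by move=> z; rewrite lee_fin.
  by apply/measurable_EFinP; apply: measurableT_comp => //; exact: measurable_mix.
- exact/measurable_EFinP.
- by move=> z1 _; exact: Fg.
Qed.

Let wsum_mix z1 z2 : \sum_(q <- l) u q (mix J z1 z2) * coord q (mix J z1 z2)
  = \sum_(q <- l) u q z1 * coord q z2.
Proof.
by apply: eq_big_seq => q ql; rewrite uJ coord_mix (negbTE (lJ ql)).
Qed.

Let wsum_meas : measurable_fun setT (fun z : S => \sum_(q <- l) u q z * coord q z).
Proof. by apply: measurable_sum => q; apply: measurable_funM => //; exact: measurable_coord. Qed.

Let nn_wsqr : nneg_meas (fun z : S => \sum_(q <- l) u q z ^+ 2).
Proof. by apply: nn_sum => q; exact: nn_sqr. Qed.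

Lemma block_fourth_moment (a : R) : mean_le L (fun z => (\sum_(q <- l) u q z ^+ 2) ^+ 2) a ->
  mean_le L (fun z => (\sum_(q <- l) u q z * coord q z) ^+ 4) ((3 * C + 4) * a).
Proof.
have c0 := C0; have c1 : 0 <= 3 * C + 4 by lra.
have nq : nneg_meas (fun z : S => (\sum_(q <- l) u q z ^+ 2) ^+ 2).
  by apply: nn_sqr; case: nn_wsqr.
move=> ha; have := mean_leZ nq c1 ha; apply: mean_le_resample.
- exact: nn_fourth.
- exact: nnZ.
- move=> z1; rewrite /mean_le; under eq_integral do rewrite wsum_mix.
  exact: (@weighted_fourth_moment _ _ _ _ Lmu l (u ^~ z1) C ul mu_mean mu_var mu_fourth c0).
Qed.

Lemma block_second_moment (x : S -> R) (a : R) : measurable_fun setT x ->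
  (forall z1 z2, x (mix J z1 z2) = x z1) ->
  mean_le L (fun z => x z ^+ 2 + \sum_(q <- l) u q z ^+ 2) a ->
  mean_le L (fun z => (x z + \sum_(q <- l) u q z * coord q z) ^+ 2) a.
Proof.
move=> mx xJ; apply: mean_le_resample.
- by apply: nn_sqr; exact: measurable_funD.
- by apply: nnD => //; exact: nn_sqr.
- move=> z1; rewrite /mean_le; under eq_integral do rewrite wsum_mix xJ.
  exact: (@weighted_second_moment _ _ _ _ Lmu l (u ^~ z1) C ul mu_mean mu_var mu_fourth (x z1)).
Qed.

Lemma pr_le_fiber q (A : set S) (g : S -> R) (a : R) : measurable A -> nneg_meas g ->
  (forall z, pr (mu q) [set x | A (upd z q x)] <= g z) -> mean_le L g a -> pr L A <= a.
Proof.
move=> mA [mg g0] Ag ga; rewrite -lee_fin -prE//; apply: le_trans ga.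
rewrite -[in leLHS](setIT A) -integral_indic//.
have mI : measurable_fun setT (fun z : S => (\1_A z)%:E : \bar R).
  by apply/measurable_EFinP; exact: measurable_indic.
have mU : measurable_fun setT (fun zx : S * R => upd zx.1 q zx.2) by exact: measurable_upd.
rewrite [leLHS](resample1_int Lmu q)//.
have E z : (\int[mu q]_x ((\1_A (upd z q x))%:E : \bar R) = (pr (mu q) [set x | A (upd z q x)])%:E)%E.
  have mz : measurable [set x | A (upd z q x)].
    have := measurableT_comp mU (measurable_pair1 z) measurableT mA.
    by rewrite setTI.
  rewrite -prE// -[in RHS](setIT [set x | _]) -integral_indic//.
apply: ge0_le_integral => //.
- by move=> z _; apply: integral_ge0 => x _; rewrite lee_fin.
- pose G (zx : S * R) := (\1_A (upd zx.1 q zx.2))%:E : \bar R.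
  apply: (@measurable_fun_fubini_tonelli_F _ _ _ _ R (mu q) G); last by move=> zx; rewrite lee_fin.
  by apply: (measurableT_comp mI).
- exact/measurable_EFinP.
- by move=> z _; rewrite E lee_fin.
Qed.
End BlockMoments.

(** * The model on the canonical sample space *)

Section MatrixMeasurability.
Context d (T : measurableType d) (R : realType).

Definition mx_meas (m n : nat) (A : T -> 'M[R]_(m, n)) :=
  forall i j, measurable_fun setT (fun w => A w i j).

Lemma measurable_inv (f : T -> R) : measurable_fun setT f -> (forall w, f w != 0) ->
  measurable_fun setT (fun w => (f w)^-1).
Proof.
move=> mf f0.
have op : open [set x : R | x != 0] by exact: open_neq.
apply: (@measurable_comp _ _ _ _ _ _ [set x : R | x != 0] (@GRing.inv R)) => //.
- exact: open_measurable.
- by move=> _ [w _ <-]; exact: f0.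
- apply: open_continuous_measurable_fun => //; apply/in_setP => x /= x0.
  exact: inv_continuous.
Qed.

Lemma measurable_det n (A : T -> 'M[R]_n) : mx_meas A -> measurable_fun setT (fun w => \det (A w)).
Proof.
move=> mA; apply: measurable_sum => s; apply: measurable_funM => //.
by apply: measurable_prod => i _; exact: mA.
Qed.

Lemma mx_meas_adj n (A : T -> 'M[R]_n) : mx_meas A -> mx_meas (fun w => \adj (A w)).
Proof.
move=> mA i j; rewrite [X in measurable_fun _ X](_ : _ = (fun w => cofactor (A w) j i)); last first.
  by apply/funext => w; rewrite mxE.
apply: measurable_funM => //; apply: measurable_det => a b.
rewrite [X in measurable_fun _ X](_ : _ = (fun w => A w (lift j a) (lift i b))); last first.
  by apply/funext => w; rewrite !mxE.
exact: mA.
Qed.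

Lemma mx_meas_inv n (A : T -> 'M[R]_n) : mx_meas A -> (forall w, A w \in unitmx) ->
  mx_meas (fun w => invmx (A w)).
Proof.
move=> mA uA i j.
rewrite [X in measurable_fun _ X](_ : _ = (fun w => (\det (A w))^-1 * (\adj (A w)) i j)); last first.
  by apply/funext => w; rewrite /invmx uA mxE.
apply: measurable_funM; last exact: mx_meas_adj.
apply: measurable_inv; first exact: measurable_det.
by move=> w; have := uA w; rewrite unitmxE unitfE.
Qed.

Lemma mx_meas_mul m n p (A : T -> 'M[R]_(m, n)) (B : T -> 'M[R]_(n, p)) :
  mx_meas A -> mx_meas B -> mx_meas (fun w => A w *m B w).
Proof.
move=> mA mB i j; rewrite [X in measurable_fun _ X](_ : _ = (fun w => \sum_l A w i l * B w l j)); last first.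
  by apply/funext => w; rewrite mxE.
by apply: measurable_sum => l; apply: measurable_funM; [exact: mA|exact: mB].
Qed.

Lemma measurable_sum_cond (I : Type) (r : seq I) (P : pred I) (f : I -> T -> R) :
  (forall i, P i -> measurable_fun setT (f i)) ->
  measurable_fun setT (fun w => \sum_(i <- r | P i) f i w).
Proof.
move=> mf; rewrite [X in measurable_fun _ X](_ : _ = (fun w => \sum_(i <- r) (if P i then f i w else 0))).
  by apply: measurable_sum => i; have [/mf|_] := boolP (P i).
by apply/funext => w; rewrite big_mkcond.
Qed.

Lemma measurable_dotp k (u v : T -> 'cV[R]_k) : mx_meas u -> mx_meas v ->
  measurable_fun setT (fun w => dotp (u w) (v w)).
Proof.
by move=> mu mv; apply: measurable_sum => j; apply: measurable_funM; [exact: mu|exact: mv].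
Qed.

Lemma mx_meas_ridge k (I : finType) (kap : R) (m : pred I) (x : I -> T -> 'cV[R]_k)
    (y : I -> T -> R) : 0 < kap -> (forall i, m i -> mx_meas (x i)) ->
  (forall i, m i -> measurable_fun setT (y i)) ->
  mx_meas (fun w => ridge kap m (x ^~ w) (y ^~ w)).
Proof.
move=> k0 mx my; apply: mx_meas_mul.
  apply: mx_meas_inv => [i j|w]; last exact: gram_unit.
  rewrite [X in measurable_fun _ X](_ : _ = (fun w => \sum_(l | m l) (x l w *m (x l w)^T) i j + (kap%:M : 'M[R]_k) i j)).
    apply: measurable_funD => //; apply: measurable_sum_cond => l ml.
    apply: mx_meas_mul => a b; first exact: mx.
    rewrite [X in measurable_fun _ X](_ : _ = (fun w => x l w b a)); first exact: mx.
    by apply/funext => w; rewrite mxE.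
  by apply/funext => w; rewrite mxE summxE.
move=> i j; rewrite [X in measurable_fun _ X](_ : _ = (fun w => \sum_(l | m l) y l w * x l w i j)).
  by apply: measurable_sum_cond => l ml; apply: measurable_funM; [exact: my|exact: mx].
by apply/funext => w; rewrite summxE; apply: eq_bigr => l _; rewrite mxE.
Qed.

End MatrixMeasurability.

Lemma eq_ridge (R : realType) k (I : finType) (kap : R) (m : pred I) (x x' : I -> 'cV[R]_k)
    (y y' : I -> R) : (forall i, m i -> x i = x' i) -> (forall i, m i -> y i = y' i) ->
  ridge kap m x y = ridge kap m x' y'.
Proof.
move=> xx yy; rewrite /ridge /gram.
have -> : \sum_(i | m i) x i *m (x i)^T = \sum_(i | m i) x' i *m (x' i)^T.
  by apply: eq_bigr => i /xx ->.
by congr (_ *m _); apply: eq_bigr => i mi; rewrite xx// yy.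
Qed.

Lemma ridge_reindex (R : realType) k (I : finType) (kap : R) (m : pred I) (x : I -> 'cV[R]_k)
    (y : I -> R) (s : I -> I) : involutive s ->
  ridge kap (fun i => m (s i)) (fun i => x (s i)) (fun i => y (s i)) = ridge kap m x y.
Proof.
move=> sK; have sI := inv_inj sK; rewrite /ridge /gram.
by rewrite [in RHS](reindex_inj sI) [X in _ = _ *m X](reindex_inj sI).
Qed.

(** The primitive variables: scales, entries of the [W i], noises, coefficients. *)
Notation idx n k := ('I_n.+1 + 'I_n.+1 * 'I_k + 'I_n.+1 + 'I_k)%type.

Section Model.
Context {R : realType} {n k : nat}.
Notation K := (idx n k).
Notation S := (sample K R).
Implicit Types (i j : 'I_n.+1) (c : 'I_k) (z : S).

Definition kL i : K := inl (inl (inl i)).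
Definition kW i c : K := inl (inl (inr (i, c))).
Definition kE i : K := inl (inr i).
Definition kB c : K := inr c.

Definition slam i z : R := coord (kL i) z.
Definition sW i c z : R := coord (kW i c) z.
Definition seps i z : R := coord (kE i) z.
Definition sbst c z : R := coord (kB c) z / Num.sqrt k%:R.

Definition px i z : 'cV[R]_k := covariate slam sW i z.
Definition py i z : R := response slam sW seps sbst i z.
Definition pbeta z : 'cV[R]_k := bstar_vec sbst z.

Lemma meas_px i : mx_meas (px i).
Proof.
move=> c e; rewrite [X in measurable_fun _ X](_ : _ = (fun z => slam i z * sW i c z)).
  by apply: measurable_funM; exact: measurable_coord.
by apply/funext => z; rewrite mxE.
Qed.

Lemma meas_pbeta : mx_meas pbeta.
Proof.
move=> c e; rewrite [X in measurable_fun _ X](_ : _ = sbst c).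
  by apply: measurable_funM => //; exact: measurable_coord.
by apply/funext => z; rewrite mxE.
Qed.

Lemma meas_py i : measurable_fun setT (py i).
Proof.
apply: measurable_funD; last exact: measurable_coord.
by apply: measurable_dotp; [exact: meas_px|exact: meas_pbeta].
Qed.

Variable tau : R.
Hypothesis tau0 : 0 < tau.

Definition bfull z := ridge (n.+1%:R * tau) predT (px ^~ z) (py ^~ z).
Definition bdrop i z := ridge (n%:R * tau) (fun j => j != i) (px ^~ z) (py ^~ z).
Definition rfull j z := py j z - dotp (px j z) (bfull z).
Definition rdrop i j z := py j z - dotp (px j z) (bdrop i z).

Hypothesis n0 : (0 < n)%N.

Lemma kap_full_gt0 : 0 < n.+1%:R * tau. Proof. by rewrite mulr_gt0. Qed.
Lemma kap_drop_gt0 : 0 < n%:R * tau. Proof. by rewrite mulr_gt0// ltr0n. Qed.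

Lemma meas_bfull : mx_meas bfull.
Proof.
by apply: mx_meas_ridge => [|i _|i _]; [exact: kap_full_gt0|exact: meas_px|exact: meas_py].
Qed.

Lemma meas_bdrop i : mx_meas (bdrop i).
Proof.
by apply: mx_meas_ridge => [|j _|j _]; [exact: kap_drop_gt0|exact: meas_px|exact: meas_py].
Qed.

Lemma meas_rfull j : measurable_fun setT (rfull j).
Proof.
apply: measurable_funB; first exact: meas_py.
by apply: measurable_dotp; [exact: meas_px|exact: meas_bfull].
Qed.

Lemma meas_rdrop i j : measurable_fun setT (rdrop i j).
Proof.
apply: measurable_funB; first exact: meas_py.
by apply: measurable_dotp; [exact: meas_px|exact: meas_bdrop].
Qed.

Definition swap_idx (s : 'I_n.+1 -> 'I_n.+1) (q : K) : K :=
  match q with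
  | inl (inl (inl i)) => kL (s i)
  | inl (inl (inr (i, c))) => kW (s i) c
  | inl (inr i) => kE (s i)
  | inr c => kB c
  end.

Lemma swap_idxK s : involutive s -> involutive (swap_idx s).
Proof. by move=> sK [[[i|[i c]]|i]|c] /=; rewrite /kL /kW /kE ?sK. Qed.

Lemma px_swap s i z : px i (reindex (swap_idx s) z) = px (s i) z.
Proof. by apply/colP => c; rewrite !mxE. Qed.

Lemma pbeta_swap s z : pbeta (reindex (swap_idx s) z) = pbeta z.
Proof. by apply/colP => c; rewrite !mxE. Qed.

Lemma py_swap s i z : py i (reindex (swap_idx s) z) = py (s i) z.
Proof. by rewrite /py /response -/(px i _) -/(pbeta _) px_swap pbeta_swap. Qed.

Lemma bfull_swap s z : involutive s -> bfull (reindex (swap_idx s) z) = bfull z.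
Proof.
move=> sK; rewrite /bfull -[RHS](ridge_reindex _ predT _ _ sK).
by apply: eq_ridge => i _; rewrite ?px_swap ?py_swap.
Qed.

Lemma bdrop_swap s i z : involutive s -> bdrop i (reindex (swap_idx s) z) = bdrop (s i) z.
Proof.
move=> sK; rewrite /bdrop -[RHS](ridge_reindex _ (fun j => j != s i) _ _ sK).
rewrite (_ : (fun j => s j != s i) = (fun j => j != i)); last first.
  by apply/funext => j; rewrite (inj_eq (inv_inj sK)).
by apply: eq_ridge => j _; rewrite ?px_swap ?py_swap.
Qed.

Lemma rfull_swap s j z : involutive s -> rfull j (reindex (swap_idx s) z) = rfull (s j) z.
Proof. by move=> sK; rewrite /rfull py_swap px_swap bfull_swap. Qed.

Lemma rdrop_swap s i j z : involutive s ->
  rdrop i j (reindex (swap_idx s) z) = rdrop (s i) (s j) z.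
Proof. by move=> sK; rewrite /rdrop py_swap px_swap bdrop_swap. Qed.

Definition keeps_point (J : pred K) i := J (kL i) && [forall c, J (kW i c)].
Definition keeps_beta (J : pred K) := [forall c, J (kB c)].

Lemma px_mix J i z1 z2 : keeps_point J i -> px i (mix J z1 z2) = px i z1.
Proof.
move=> /andP[JL /forallP JW]; apply/colP => c; rewrite !mxE /slam /sW !coord_mix.
by rewrite JL JW.
Qed.

Lemma pbeta_mix J z1 z2 : keeps_beta J -> pbeta (mix J z1 z2) = pbeta z1.
Proof. by move=> /forallP JB; apply/colP => c; rewrite !mxE /sbst coord_mix JB. Qed.

Lemma py_mix J i z1 z2 : keeps_point J i -> J (kE i) -> keeps_beta J ->
  py i (mix J z1 z2) = py i z1.
Proof.
move=> Ji JE JB; rewrite /py /response -/(px i _) -/(pbeta _) px_mix// pbeta_mix//.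
by rewrite /seps coord_mix JE.
Qed.

Definition off_points (A : pred 'I_n.+1) (q : K) : bool :=
  match q with
  | inl (inl (inl i)) => ~~ A i
  | inl (inl (inr ic)) => ~~ A ic.1
  | inl (inr i) => ~~ A i
  | inr c => true
  end.

Lemma off_points_keeps A i : ~~ A i -> keeps_point (off_points A) i.
Proof. by move=> Ai; apply/andP; split => //; apply/forallP. Qed.

Lemma off_points_beta A : keeps_beta (off_points A).
Proof. exact/forallP. Qed.

Lemma bdrop_keep (J : pred K) i z1 z2 : keeps_beta J ->
  (forall j, j != i -> keeps_point J j && J (kE j)) -> bdrop i (mix J z1 z2) = bdrop i z1.
Proof.
by move=> JB Ji; apply: eq_ridge => j /Ji/andP[Jj JE]; rewrite ?px_mix ?py_mix.
Qed.

Lemma bdrop_mix (A : pred 'I_n.+1) i z1 z2 : (forall j, A j -> j = i) ->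
  bdrop i (mix (off_points A) z1 z2) = bdrop i z1.
Proof.
move=> Ai; apply: bdrop_keep => [|j ji]; first exact: off_points_beta.
have jA : ~~ A j by apply: contra ji => /Ai ->.
by rewrite off_points_keeps.
Qed.

End Model.

(** * Moment bounds in the model *)

Lemma dist_center (R : realDomainType) (u v t r : R) :
  `|u - t| <= r -> `|v - t| <= r -> `|u - v| <= 2 * r.
Proof. by move=> ut; rewrite distrC => tv; have := ler_distD t u v; lra. Qed.

Lemma norm_opp_sub (R : realDomainType) (u v : R) : `|- u - v| = `|u - - v|.
Proof. by rewrite -normrN; congr `|_|; ring. Qed.

Lemma sqr_sum_le (R : realFieldType) (I : finType) (p : pred I) (x : I -> R) :
  (\sum_(i | p i) x i) ^+ 2 <= #|I|%:R * \sum_(i | p i) x i ^+ 2.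
Proof.
rewrite big_mkcond [X in _ <= _ * X]big_mkcond.
pose y i := if p i then x i else 0.
rewrite (eq_bigr y)// [X in _ <= _ * X](eq_bigr (fun i => y i ^+ 2)); last first.
  by move=> i _; rewrite /y; case: (p i); rewrite ?expr0n.
have [I0|I0] := posnP #|I|.
  by rewrite I0 mul0r big1 ?expr0n//= => i _; move: (card0_eq I0 i); rewrite inE.
set s := \sum_i y i; set N : R := #|I|%:R.
have N0 : 0 < N by rewrite ltr0n.
have : 0 <= \sum_i (N * y i - s) ^+ 2 by apply: sumr_ge0 => i _; exact: sqr_ge0.
have -> : \sum_i (N * y i - s) ^+ 2 = N * (N * \sum_i y i ^+ 2 - s ^+ 2).
  transitivity (\sum_i (N ^+ 2 * y i ^+ 2 + (- (2 * N * s) * y i + s ^+ 2))).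
    by apply: eq_bigr => i _; ring.
  rewrite !big_split/= -!mulr_sumr sumr_const -/s -mulr_natr -/N; ring.
by rewrite pmulr_rge0// subr_ge0.
Qed.

Lemma add_fourth (R : realFieldType) (x y : R) : (x + y) ^+ 4 <= 8 * (x ^+ 4 + y ^+ 4).
Proof.
have -> : (4 = 2 * 2)%N by []; rewrite !exprM.
have h : (x + y) ^+ 2 <= 2 * (x ^+ 2 + y ^+ 2) by have := sqr_ge0 (x - y); nra.
have h0 := sqr_ge0 (x + y).
apply: (@le_trans _ _ ((2 * (x ^+ 2 + y ^+ 2)) ^+ 2)).
  by rewrite ler_sqr ?nnegrE// (le_trans h0).
by have := sqr_ge0 (x ^+ 2 - y ^+ 2); nra.
Qed.


Section MeanLeMore.
Context {d : measure_display} {T : measurableType d} {R : realType}.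
Variable P : probability T R.

Lemma mean_le_sum_cond (I : Type) (r : seq I) (p : pred I) (f : I -> T -> R) (a : I -> R) :
  (forall i, nneg_meas (f i)) -> (forall i, mean_le P (f i) (a i)) ->
  mean_le P (fun x => \sum_(i <- r | p i) f i x) (\sum_(i <- r | p i) a i).
Proof.
move=> nf fa; rewrite -big_filter /mean_le; under eq_integral do rewrite -big_filter.
exact: mean_le_sum.
Qed.

(** Exchangeable terms share the mean of their sum equally. *)
Lemma mean_le_equal_share (I : finType) (p : pred I) (f : I -> T -> R) (a : R) (j : I) :
  p j -> (forall i, nneg_meas (f i)) ->
  (forall i, p i -> (\int[P]_x (f i x)%:E = \int[P]_x (f j x)%:E)%E) ->
  mean_le P (fun x => \sum_(i | p i) f i x) a -> mean_le P (f j) (a / #|p|%:R).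
Proof.
move=> pj nf fj; rewrite /mean_le.
have E x : ((\sum_(i | p i) f i x)%:E = \sum_(i <- enum p) (f i x)%:E)%E.
  by rewrite sumEFin big_enum.
under eq_integral do rewrite E.
rewrite ge0_integral_sum//; last 2 first.
- by move=> i; apply/measurable_EFinP; have [] := nf i.
- by move=> i x _; rewrite lee_fin; have [_ ->] := nf i.
rewrite (eq_big_seq (fun=> \int[P]_x (f j x)%:E)%E); last first.
  by move=> i; rewrite mem_enum => /fj.
have sum_cst (s : seq I) (x : \bar R) : (\sum_(i <- s) x = (size s)%:R%:E * x)%E.
  elim: s => [|y s IH]; first by rewrite big_nil mul0e.
  by rewrite big_cons IH /= -natr1 addrC EFinD ge0_muleDl ?lee_fin// mul1e.
rewrite sum_cst -cardE.
have p0 : 0 < #|p|%:R :> R by rewrite ltr0n; apply/card_gt0P; exists j.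
by move=> h; rewrite mulrC EFinM lee_pdivlMl.
Qed.

End MeanLeMore.

Section ModelLaw.
Context {R : realType} {n k : nat}.
Notation K := (idx n k).
Notation S := (sample K R).
Variables muL muW muE muB : probability R R.
Implicit Types (i j a : 'I_n.+1) (c : 'I_k) (z : S).

Definition model_law (q : K) : probability R R :=
  match q with
  | inl (inl (inl _)) => muL
  | inl (inl (inr _)) => muW
  | inl (inr _) => muE
  | inr _ => muB
  end.

Lemma model_law_swap s q : model_law (swap_idx s q) = model_law q.
Proof. by case: q => [[[i|[i c]]|i]|c]. Qed.

Variable L : probability S R.
Hypothesis Lmu : product_law model_law L.

Lemma mean_coord q (f : R -> R) (a : R) : measurable_fun setT f -> (forall x, 0 <= f x) ->
  (\int[model_law q]_x (f x)%:E <= a%:E)%E -> mean_le L (fun z => f (coord q z)) a.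
Proof.
move=> mf f0; rewrite /mean_le (marginal_int Lmu q (f := EFin \o f))//.
exact/measurable_EFinP.
Qed.

Variables (B CW CE CB tau : R).
Hypotheses (B0 : 0 < B) (muL_bound : muL [set x : R | 0 < x <= B] = 1%E).
Hypotheses (CW0 : 0 <= CW) (W4 : (\int[muW]_x (x ^+ 4)%:E <= CW%:E)%E)
  (W1 : Ex muW (fun x => x) = 0) (W2 : Ex muW (fun x => x ^+ 2) = 1).
Hypotheses (E4 : (\int[muE]_x (x ^+ 4)%:E <= CE%:E)%E)
  (B4 : (\int[muB]_x (x ^+ 4)%:E <= CB%:E)%E).
Hypotheses (n0 : (0 < n)%N) (k0 : (0 < k)%N) (tau0 : 0 < tau).

Definition good (z : S) : Prop := forall i, 0 < slam i z <= B.

Let meas_range : measurable [set x : R | 0 < x <= B].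
Proof.
rewrite (_ : [set x : R | _] = `]0, B]%classic); first exact: measurable_itv.
by apply/seteqP; split => x /=; rewrite in_itv.
Qed.

Lemma good_ae : {ae L, forall z, good z}.
Proof.
apply: filter_forall => i.
pose bad : set S := coord (kL i) @^-1` (~` [set x : R | 0 < x <= B]).
exists bad; split.
- by rewrite -[X in measurable X]setTI; apply: measurable_coord => //; exact: measurableC.
- rewrite /bad (marginal Lmu)/=; last exact: measurableC.
  by rewrite probability_setC// muL_bound subee.
- by move=> z /= /negP zB /=; rewrite /slam in zB; apply/negP.
Qed.

Lemma mean_le_good (f g : S -> R) (a : R) : nneg_meas f -> nneg_meas g ->
  (forall z, good z -> f z <= g z) -> mean_le L g a -> mean_le L f a.
Proof.
by move=> nf ng fg; apply: mean_le_ae => //; apply: filterS good_ae.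
Qed.

Lemma meas_slam i : measurable_fun setT (slam i : S -> R). Proof. exact: measurable_coord. Qed.
Lemma meas_sW i c : measurable_fun setT (sW i c : S -> R). Proof. exact: measurable_coord. Qed.
Lemma meas_seps i : measurable_fun setT (seps i : S -> R). Proof. exact: measurable_coord. Qed.
Lemma meas_sbst c : measurable_fun setT (sbst c : S -> R).
Proof. by apply: measurable_funM => //; exact: measurable_coord. Qed.

Lemma mean_seps_fourth i : mean_le L (fun z => seps i z ^+ 4) CE.
Proof.
apply: (@mean_coord (kE i) (fun x => x ^+ 4)) => // x.
by rewrite exprn_even_ge0.
Qed.

Lemma mean_sbst_fourth c : mean_le L (fun z => sbst c z ^+ 4) (k%:R ^- 2 * CB).
Proof.
have kk : (0 : R) < k%:R by rewrite ltr0n.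
have E z : sbst c z ^+ 4 = k%:R ^- 2 * coord (kB c) z ^+ 4.
  have -> : (4 = 2 * 2)%N by [].
  by rewrite /sbst exprMn !exprM exprVn sqr_sqrtr ?ler0n// mulrC exprVn.
rewrite /mean_le; under eq_integral do rewrite E.
apply: mean_leZ.
- by apply: nn_fourth; exact: measurable_coord.
- by rewrite invr_ge0 exprn_ge0// ltW.
- apply: (@mean_coord (kB c) (fun x => x ^+ 4)) => // x.
  by rewrite exprn_even_ge0.
Qed.

(** Integrating out the entries of [W i] leaves everything else fixed. *)
Definition off_row i (q : K) : bool := if q is inl (inl (inr ic)) then ic.1 != i else true.

Definition row_idx i (p : pred 'I_k) : seq K := [seq kW i c | c <- enum 'I_k & p c].

Lemma row_idx_uniq i p : uniq (row_idx i p).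
Proof. by rewrite map_inj_uniq; [exact/filter_uniq/enum_uniq|move=> c c' [->]]. Qed.

Lemma row_idxP i p q : q \in row_idx i p -> exists c, q = kW i c.
Proof. by move=> /mapP[c _ ->]; exists c. Qed.

Lemma sum_row_idx i p (f : K -> R) : \sum_(q <- row_idx i p) f q = \sum_(c | p c) f (kW i c).
Proof. by rewrite big_map big_filter big_enum_cond. Qed.

Definition row_coef i (v : 'I_k -> S -> R) (q : K) z : R :=
  if q is inl (inl (inr ic)) then slam i z * v ic.2 z else 0.

Section Row.
Variables (i : 'I_n.+1) (p : pred 'I_k) (v : 'I_k -> S -> R).
Hypotheses (mv : forall c, measurable_fun setT (v c))
  (vJ : forall c z1 z2, v c (mix (off_row i) z1 z2) = v c z1).

Let mu_u q : measurable_fun setT (row_coef i v q).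
Proof.
case: q => [[[j|[j c]]|j]|c]; try exact: measurable_cst.
exact: (measurable_funM (meas_slam i) (mv c)).
Qed.
Let uJ q z1 z2 : row_coef i v q (mix (off_row i) z1 z2) = row_coef i v q z1.
Proof. by case: q => [[[j|[j c]]|j]|c] //=; rewrite vJ /slam coord_mix. Qed.
Let lJ q : q \in row_idx i p -> ~~ off_row i q.
Proof. by move=> /row_idxP[c ->] /=; rewrite negbK. Qed.
Let l1 q : q \in row_idx i p -> Ex (model_law q) (fun x => x) = 0.
Proof. by move=> /row_idxP[c ->]. Qed.
Let l2 q : q \in row_idx i p -> Ex (model_law q) (fun x => x ^+ 2) = 1.
Proof. by move=> /row_idxP[c ->]. Qed.
Let l4 q : q \in row_idx i p -> (\int[model_law q]_x (x ^+ 4)%:E <= CW%:E)%E.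
Proof. by move=> /row_idxP[c ->]. Qed.

Definition row_sum z : R := slam i z * \sum_(c | p c) v c z * sW i c z.

Let row_sumE z : row_sum z = \sum_(q <- row_idx i p) row_coef i v q z * coord q z.
Proof.
by rewrite sum_row_idx /row_sum mulr_sumr; apply: eq_bigr => c _ /=; rewrite mulrA.
Qed.

Let sqrE z : \sum_(q <- row_idx i p) row_coef i v q z ^+ 2
  = slam i z ^+ 2 * \sum_(c | p c) v c z ^+ 2.
Proof.
by rewrite sum_row_idx mulr_sumr; apply: eq_bigr => c _ /=; rewrite exprMn.
Qed.

Let nn_v : nneg_meas (fun z => \sum_(c | p c) v c z ^+ 2).
Proof. by apply: nn_sum => c; exact: nn_sqr. Qed.

Lemma meas_row_sum : measurable_fun setT row_sum.
Proof.
apply: measurable_funM; first exact: meas_slam.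
by apply: measurable_sum_cond => c _; apply: measurable_funM => //; exact: meas_sW.
Qed.

Let slam_sqr_le z : good z -> slam i z ^+ 2 <= B ^+ 2.
Proof.
move=> /(_ i)/andP[l0 lB]; rewrite ler_sqr ?nnegrE ?(ltW l0)//.
exact: le_trans (ltW l0) lB.
Qed.

Lemma row_fourth (a : R) : mean_le L (fun z => (\sum_(c | p c) v c z ^+ 2) ^+ 2) a ->
  mean_le L (fun z => row_sum z ^+ 4) ((3 * CW + 4) * (B ^+ 4 * a)).
Proof.
have c0 := CW0; move=> ha; rewrite /mean_le; under eq_integral do rewrite row_sumE.
have [mvs vs0] := nn_v.
apply: (block_fourth_moment Lmu (row_idx_uniq i p) lJ mu_u uJ l1 l2 l4 c0).
apply: (@mean_le_good _ (fun z => B ^+ 4 * (\sum_(c | p c) v c z ^+ 2) ^+ 2)).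
- by apply: nn_sqr; apply: measurable_sum => q; apply: measurable_funX; exact: mu_u.
- by apply: nnZ; [exact: nn_sqr|rewrite exprn_ge0// ltW].
- move=> z gz; rewrite sqrE exprMn; apply: ler_wpM2r; first exact: sqr_ge0.
  rewrite (_ : B ^+ 4 = (B ^+ 2) ^+ 2); last by rewrite -exprM.
  by rewrite ler_sqr ?nnegrE ?sqr_ge0//; exact: slam_sqr_le.
- by apply: mean_leZ => //; [exact: nn_sqr|rewrite exprn_ge0// ltW].
Qed.

Lemma row_second (a : R) : mean_le L (fun z => \sum_(c | p c) v c z ^+ 2) a ->
  mean_le L (fun z => (seps i z + row_sum z) ^+ 2) ((1 + CE) + B ^+ 2 * a).
Proof.
move=> ha; rewrite /mean_le; under eq_integral do rewrite row_sumE.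
have [mvs vs0] := nn_v.
have sJ z1 z2 : seps i (mix (off_row i) z1 z2) = seps i z1 by rewrite /seps coord_mix.
apply: (block_second_moment Lmu (row_idx_uniq i p) lJ mu_u uJ l1 l2 l4 (meas_seps i) sJ).
apply: (@mean_le_good _ (fun z => seps i z ^+ 2 + B ^+ 2 * (\sum_(c | p c) v c z ^+ 2))).
- apply: nnD; first by apply: nn_sqr; exact: meas_seps.
  by apply: nn_sum => q; exact: nn_sqr.
- apply: nnD; first by apply: nn_sqr; exact: meas_seps.
  by apply: nnZ => //; exact: sqr_ge0.
- move=> z gz; rewrite sqrE lerD2l; apply: ler_wpM2r => //; exact: slam_sqr_le.
- apply: mean_leD.
  + by apply: nn_sqr; exact: meas_seps.
  + by apply: nnZ => //; exact: sqr_ge0.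
  + by apply: mean_le_sqr; [exact: meas_seps|exact: mean_seps_fourth].
  + by apply: mean_leZ => //; exact: sqr_ge0.
Qed.
End Row.

Lemma dotp_px i z (v : 'cV[R]_k) : dotp (px i z) v = slam i z * \sum_c v c 0 * sW i c z.
Proof. by rewrite mulr_sumr; apply: eq_bigr => c _; rewrite mxE -mulrA [v c 0 * _]mulrC. Qed.

Lemma sbst_mix_row i c z1 z2 : sbst c (mix (off_row i) z1 z2) = sbst c z1.
Proof. by rewrite /sbst coord_mix. Qed.

Lemma mean_beta_sqr_sqr (p : pred 'I_k) :
  mean_le L (fun z => (\sum_(c | p c) sbst c z ^+ 2) ^+ 2) CB.
Proof.
have kk : (0 : R) < k%:R by rewrite ltr0n.
apply: (@mean_le_mono _ _ _ _ _ (fun z => k%:R * \sum_c sbst c z ^+ 4)).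
- by apply: nn_sqr; apply: measurable_sum_cond => c _; apply: measurable_funX; exact: meas_sbst.
- by apply: nnZ => //; apply: nn_sum => c; apply: nn_fourth; exact: meas_sbst.
- move=> z; apply: (le_trans (sqr_sum_le _ _)); rewrite card_ord; apply: ler_wpM2l; first exact: ltW.
  rewrite big_mkcond; apply: ler_sum => c _; rewrite -exprM.
  by case: (p c) => //; rewrite exprn_even_ge0.
- have H : mean_le L (fun z => \sum_c sbst c z ^+ 4) (\sum_(c < k) k%:R ^- 2 * CB).
    apply: mean_le_sum => c; [by apply: nn_fourth; exact: meas_sbst|exact: mean_sbst_fourth].
  have -> : CB = k%:R * (\sum_(c < k) k%:R ^- 2 * CB).
    rewrite sumr_const card_ord -mulr_natr; field.
    by rewrite lt0r_neq0.
  have nb : nneg_meas (fun z => \sum_c sbst c z ^+ 4).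
    by apply: nn_sum => c; apply: nn_fourth; exact: meas_sbst.
  exact: (mean_leZ nb (ltW kk) H).
Qed.

(** A common bound for the fourth moments of a response and of a response from
    which columns have been removed. *)
Definition response_const : R := 8 * ((3 * CW + 4) * (B ^+ 4 * CB) + CE).

Lemma mean_response_fourth i (p : pred 'I_k) :
  mean_le L (fun z => (row_sum i p sbst z + seps i z) ^+ 4) response_const.
Proof.
have mr : measurable_fun setT (row_sum i p sbst) by apply: meas_row_sum => c; exact: meas_sbst.
have ms := @meas_seps i.
apply: (@mean_le_mono _ _ _ _ _ (fun z => 8 * (row_sum i p sbst z ^+ 4 + seps i z ^+ 4))).
- by apply: nn_fourth; exact: measurable_funD.
- by apply: nnZ => //; apply: nnD; exact: nn_fourth.
- by move=> z; exact: add_fourth.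
- apply: mean_leZ => //; first by apply: nnD; exact: nn_fourth.
  apply: mean_leD; try exact: nn_fourth; last exact: mean_seps_fourth.
  apply: row_fourth; [by move=> c; exact: meas_sbst|by move=> *; rewrite sbst_mix_row|].
  exact: mean_beta_sqr_sqr.
Qed.

Lemma pyE i z : py i z = row_sum i predT sbst z + seps i z.
Proof.
by rewrite /py /response -/(px i z) dotp_px; congr (_ * _ + _); apply: eq_bigr => c _; rewrite mxE.
Qed.

Lemma mean_py_fourth i : mean_le L (fun z => py i z ^+ 4) response_const.
Proof.
by rewrite /mean_le; under eq_integral do rewrite pyE; exact: mean_response_fourth.
Qed.


Lemma mean_pbeta_sqr : mean_le L (fun z => dotp (pbeta z) (pbeta z)) (1 + CB).
Proof.
have ms : measurable_fun setT (fun z : S => \sum_(c < k) sbst c z ^+ 2).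
  by apply: measurable_sum => c; apply: measurable_funX; exact: meas_sbst.
apply: (@mean_le_mono _ _ _ _ _ (fun z => 1 + (\sum_c sbst c z ^+ 2) ^+ 2)).
- split; first by apply: measurable_dotp; exact: meas_pbeta.
  by move=> z; exact: dotp_ge0.
- by apply: nnD; [split|exact: nn_sqr].
- move=> z; rewrite (_ : dotp _ _ = \sum_c sbst c z ^+ 2); last first.
    by apply: eq_bigr => c _; rewrite mxE expr2.
  by have := sqr_ge0 (\sum_c sbst c z ^+ 2 - 1); nra.
- apply: mean_leD => //; [exact: nn_sqr|exact: mean_le_cst|exact: mean_beta_sqr_sqr].
Qed.

Lemma mean_px_sqr i : mean_le L (fun z => dotp (px i z) (px i z)) (B ^+ 2 * k%:R).
Proof.
have W2' : (\int[muW]_x (x ^+ 2)%:E <= 1%:E)%E.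
  have h := W2; rewrite -h /Ex fineK//.
  have := integrable_fin_num measurableT (integrable_sqr W4); exact.
have nW : nneg_meas (fun z : S => \sum_c sW i c z ^+ 2).
  by apply: nn_sum => c; apply: nn_sqr; exact: meas_sW.
apply: (@mean_le_good _ (fun z => B ^+ 2 * \sum_c sW i c z ^+ 2)).
- split; first by apply: measurable_dotp; exact: meas_px.
  by move=> z; exact: dotp_ge0.
- by apply: nnZ => //; exact: sqr_ge0.
- move=> z gz; rewrite (_ : dotp _ _ = slam i z ^+ 2 * \sum_c sW i c z ^+ 2).
    apply: ler_wpM2r; first by apply: sumr_ge0 => c _; exact: sqr_ge0.
    have /andP[l0 lB] := gz i; rewrite ler_sqr ?nnegrE ?(ltW l0)//.
    exact: le_trans (ltW l0) lB.
  by rewrite mulr_sumr; apply: eq_bigr => c _; rewrite mxE -exprMn expr2.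
- have H : mean_le L (fun z => \sum_c sW i c z ^+ 2) (\sum_(c < k) 1).
    apply: mean_le_sum => c; first by apply: nn_sqr; exact: meas_sW.
    apply: (@mean_coord (kW i c) (fun x => x ^+ 2)) => // x.
    exact: sqr_ge0.
  rewrite sumr_const card_ord in H.
  by apply: mean_leZ => //; exact: sqr_ge0.
Qed.

Notation bdrop := (bdrop tau).
Notation rdrop := (rdrop tau).
Notation rfull := (rfull tau).

Lemma card_others (i : 'I_n.+1) : #|[pred j | j != i]| = n.
Proof. by transitivity #|predC1 i|; [exact: eq_card|rewrite cardC1 card_ord]. Qed.

Lemma sum_others (i : 'I_n.+1) (x : R) : \sum_(j < n.+1 | j != i) x = n%:R * x.
Proof.
by rewrite sumr_const card_others mulr_natl.
Qed.

Lemma nn_bdrop_sqr i : nneg_meas (fun z : S => dotp (bdrop i z) (bdrop i z)).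
Proof.
split; last by move=> z; exact: dotp_ge0.
by apply: measurable_dotp; exact: meas_bdrop.
Qed.

Lemma mean_bdrop_sqr i : mean_le L (fun z => dotp (bdrop i z) (bdrop i z)) ((1 + response_const) / tau).
Proof.
have nR : (0 : R) < n%:R by rewrite ltr0n.
have t0 := tau0; have kap0 : 0 < n%:R * tau by exact: kap_drop_gt0.
apply: (@mean_le_mono _ _ _ _ _ (fun z => (n%:R * tau)^-1 * \sum_(j | j != i) py j z ^+ 2)).
- exact: nn_bdrop_sqr.
- by apply: nnZ; [apply: nn_sum => j; apply: nn_sqr; exact: meas_py|rewrite invr_ge0 ltW].
- move=> z; rewrite ler_pdivlMl//.
  have := ridge_residual_le (ltW kap0) (ridgeP (fun j => j != i) (px ^~ z) (py ^~ z) kap0).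
  apply: le_trans; rewrite lerDr; apply: sumr_ge0 => j _; exact: sqr_ge0.
- have -> : (1 + response_const) / tau = (n%:R * tau)^-1 * \sum_(j < n.+1 | j != i) (1 + response_const).
    by rewrite sum_others; field; rewrite !lt0r_neq0.
  apply: mean_leZ; first by apply: nn_sum => j; apply: nn_sqr; exact: meas_py.
    by rewrite invr_ge0 ltW.
  apply: mean_le_sum_cond => j; first by apply: nn_sqr; exact: meas_py.
  by apply: mean_le_sqr; [exact: meas_py|exact: mean_py_fourth].
Qed.

Definition error_const : R := 2 * (1 + CB) + 2 * ((1 + response_const) / tau).

Lemma mean_error_sqr i :
  mean_le L (fun z => dotp (pbeta z - bdrop i z) (pbeta z - bdrop i z)) error_const.
Proof.
have n1 : nneg_meas (fun z : S => dotp (pbeta z) (pbeta z)).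
  by split=> [|z]; [apply: measurable_dotp; exact: meas_pbeta|exact: dotp_ge0].
have n2 := nn_bdrop_sqr i.
apply: (@mean_le_mono _ _ _ _ _ (fun z => 2 * dotp (pbeta z) (pbeta z) + 2 * dotp (bdrop i z) (bdrop i z))).
- split; last by move=> z; exact: dotp_ge0.
  have mm : mx_meas (fun z : S => pbeta z - bdrop i z).
    move=> c e; rewrite [X in measurable_fun _ X](_ : _ = (fun z => pbeta z c e - bdrop i z c e)).
      by apply: measurable_funB; [exact: meas_pbeta|exact: meas_bdrop].
    by apply/funext => z; rewrite !mxE.
  exact: measurable_dotp.
- by apply: nnD; exact: nnZ.
- move=> z; have := dotp_ge0 (pbeta z + bdrop i z).
  by rewrite !(dotpBr, dotpBl, dotpDr, dotpDl) (dotpC (bdrop i z) (pbeta z)); lra.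
- apply: mean_leD; try exact: nnZ.
    by apply: mean_leZ => //; exact: mean_pbeta_sqr.
  by apply: mean_leZ => //; exact: mean_bdrop_sqr.
Qed.

Definition err i c z : R := pbeta z c 0 - bdrop i z c 0.

Lemma errE i c z : (pbeta z - bdrop i z) c 0 = err i c z.
Proof. by rewrite /err [LHS]mxE; congr (_ + _); rewrite mxE. Qed.

Lemma meas_err i c : measurable_fun setT (err i c).
Proof. by apply: measurable_funB; [exact: meas_pbeta|exact: meas_bdrop]. Qed.

Lemma err_mix_row i c z1 z2 : err i c (mix (off_row i) z1 z2) = err i c z1.
Proof.
have kb : keeps_beta (off_row i : pred K) by apply/forallP.
rewrite /err pbeta_mix// bdrop_keep// => j ji.
by rewrite /keeps_point /= andbT; apply/forallP => c'.
Qed.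

Lemma rdropE i z : rdrop i i z = seps i z + row_sum i predT (err i) z.
Proof.
rewrite /rdrop /py /response -/(px i z) -/(pbeta z) addrAC -dotpBr dotp_px addrC.
by congr (_ + _ * _); apply: eq_bigr => c _; rewrite errE.
Qed.

Definition loo_residual_const : R := (1 + CE) + B ^+ 2 * error_const.

Lemma mean_rdrop_sqr i : mean_le L (fun z => rdrop i i z ^+ 2) loo_residual_const.
Proof.
rewrite /mean_le; under eq_integral do rewrite rdropE.
apply: row_second; [exact: meas_err|exact: err_mix_row|].
have E z : \sum_c err i c z ^+ 2 = dotp (pbeta z - bdrop i z) (pbeta z - bdrop i z).
  by apply: eq_bigr => c _; rewrite errE expr2.
by rewrite /mean_le; under eq_integral do rewrite E; exact: mean_error_sqr.
Qed.

Definition stability_sum : R := loo_residual_const + (1 + response_const).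

Let meas_gap i j : measurable_fun setT (fun z : S => rfull j z - rdrop i j z).
Proof. by apply: measurable_funB; [exact: meas_rfull|exact: meas_rdrop]. Qed.

(** The deleted point's own leave-one-out residual has a bounded second moment,
    and the change of the penalty from [n%:R * tau] to [n.+1%:R * tau] is
    absorbed by the norm of the fit. *)
Lemma mean_stability i :
  mean_le L (fun z => \sum_j (rfull j z - rdrop i j z) ^+ 2) stability_sum.
Proof.
have t0 := tau0; have nR : (0 : R) < n%:R by rewrite ltr0n.
have kap0 : 0 < n.+1%:R * tau by rewrite mulr_gt0.
have nr : nneg_meas (fun z : S => rdrop i i z ^+ 2) by apply: nn_sqr; exact: meas_rdrop.
have nb := nn_bdrop_sqr i.
apply: (@mean_le_mono _ _ _ _ _ (fun z => rdrop i i z ^+ 2 + tau * dotp (bdrop i z) (bdrop i z))).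
- by apply: nn_sum => j; apply: nn_sqr; exact: meas_gap.
- by apply: nnD => //; apply: nnZ => //; exact: ltW.
- move=> z; have h1 := ridgeP predT (px ^~ z) (py ^~ z) kap0.
  have h2 := ridgeP (fun j => j != i) (px ^~ z) (py ^~ z) (kap_drop_gt0 t0 n0).
  have := ridge_drop_stable kap0 (isT : predT i) h1 h2.
  rewrite -/(bfull tau z) -/(bdrop i z) => h.
  have -> : \sum_j (rfull j z - rdrop i j z) ^+ 2 = \sum_j dotp (px j z) (bfull tau z - bdrop i z) ^+ 2.
    apply: eq_bigr => j _; rewrite -sqrrN; congr (_ ^+ 2).
    by rewrite dotpBr /rfull /rdrop; ring.
  apply: (le_trans h); rewrite lerD2l.
  have -> : n.+1%:R * tau - n%:R * tau = tau :> R by rewrite -mulrBl -natrB// subSnn mul1r.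
  rewrite mulrAC; apply: ler_wpM2r; first exact: dotp_ge0.
  rewrite ler_pdivrMr// mulrCA expr2 ler_peMl ?mulr_ge0 ?(ltW t0)//.
  by rewrite ler1n.
- have -> : stability_sum = loo_residual_const + tau * ((1 + response_const) / tau) by rewrite /stability_sum; congr (_ + _); field; rewrite lt0r_neq0.
  apply: mean_leD => //; first by apply: nnZ => //; exact: ltW.
    exact: mean_rdrop_sqr.
  by apply: mean_leZ => //; [exact: ltW|exact: mean_bdrop_sqr].
Qed.

(** The total displacement of the residuals is bounded and exchangeable, so
    that each single residual moves by a vanishing amount. *)
Lemma mean_stability_one i j : j != i ->
  mean_le L (fun z => (rfull j z - rdrop i j z) ^+ 2) (stability_sum / n%:R).
Proof.
move=> ji.
rewrite -[in X in mean_le _ _ X](card_others i).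
have nf l : nneg_meas (fun z : S => (rfull l z - rdrop i l z) ^+ 2) by apply: nn_sqr; exact: meas_gap.
apply: (@mean_le_equal_share _ _ _ _ _ _ (fun l z => (rfull l z - rdrop i l z) ^+ 2)) => //.
- move=> l li; pose s x := perm.fun_of_perm (perm.tperm j l) x.
  have sK : involutive s by exact: perm.tpermK.
  rewrite [RHS](exchange_int Lmu (swap_idxK sK) (model_law_swap s)); last 2 first.
  + by apply/measurable_EFinP; have [] := nf j.
  + by move=> z; rewrite lee_fin sqr_ge0.
  apply: eq_integral => z _; rewrite rfull_swap// rdrop_swap// /s perm.tpermL.
  by rewrite perm.tpermD// 1?eq_sym.
- apply: mean_le_mono (mean_stability i).
  + exact: nn_sum.
  + exact: nn_sum.
  + move=> z; rewrite [leRHS](bigID (fun l => l != i))/= lerDl.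
    by apply: sumr_ge0 => l _; exact: sqr_ge0.
Qed.

Lemma pr_stability i j (delta : R) : j != i -> 0 < delta ->
  pr L [set z | delta <= `|rfull j z - rdrop i j z|] <= stability_sum / (n%:R * delta ^+ 2).
Proof.
move=> ji d0.
have E z : (delta <= `|rfull j z - rdrop i j z|) = (delta ^+ 2 <= (rfull j z - rdrop i j z) ^+ 2).
  by rewrite -[X in _ = (_ <= X)]real_normK ?num_real// ler_sqr ?nnegrE ?(ltW d0).
rewrite (_ : [set z | _] = [set z | delta ^+ 2 <= (rfull j z - rdrop i j z) ^+ 2]); last first.
  by apply/funext => z; rewrite /mkset E.
rewrite invfM mulrA; apply: pr_mean_le.
- by apply: nn_sqr; exact: meas_gap.
- by rewrite exprn_gt0.
- exact: mean_stability_one.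
Qed.


(** The noise [eps i] moves the residual of the point [i] at a rate bounded from
    below, so this residual has a bounded density given everything else. *)
Section AntiConcentration.
Variable M : R.
Hypotheses (M0 : 0 <= M)
  (window : forall c r : R, 0 <= r -> pr muE [set e : R | `|e - c| <= r] <= 2 * M * r).

Let slope i z : R := 1 + dotp (px i z) (px i z) / (n.+1%:R * tau).

Lemma px_upd i j z x : px i (upd z (kE j) x) = px i z.
Proof. by apply/colP => c; rewrite !mxE /slam /sW !coord_upd. Qed.

Lemma pbeta_upd i z x : pbeta (upd z (kE i) x) = pbeta z.
Proof. by apply/colP => c; rewrite !mxE /sbst coord_upd. Qed.

Lemma py_upd i j z x : j != i -> py j (upd z (kE i) x) = py j z.
Proof.
move=> ji; rewrite /py /response -/(px j _) -/(px j z) -/(pbeta _) -/(pbeta z) px_upd pbeta_upd; congr (_ + _).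
by rewrite /seps coord_upd; case: eqP => // -[] /eqP; rewrite (negbTE ji).
Qed.

Lemma py_upd_self i z x : py i (upd z (kE i) x) = dotp (px i z) (pbeta z) + x.
Proof.
rewrite /py /response -/(px i _) -/(pbeta _) px_upd pbeta_upd; congr (_ + _).
by rewrite /seps coord_upd eqxx.
Qed.

Lemma residual_expands i z (x x' : R) :
  `|x - x'| <= slope i z * `|rfull i (upd z (kE i) x) - rfull i (upd z (kE i) x')|.
Proof.
have kap0 : 0 < n.+1%:R * tau by exact: kap_full_gt0.
have H w : is_ridge (n.+1%:R * tau) predT (px ^~ z) (py ^~ (upd z (kE i) w)) (bfull tau (upd z (kE i) w)).
  have -> : bfull tau (upd z (kE i) w) = ridge (n.+1%:R * tau) predT (px ^~ z) (py ^~ (upd z (kE i) w)).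
    by apply: eq_ridge => j _ //; rewrite px_upd.
  exact: ridgeP.
have := ridge_residual_expands kap0 (isT : predT i) (H x) (H x').
rewrite /rfull !px_upd !py_upd_self (_ : _ + x - _ = x - x'); last by ring.
by apply => j ji; rewrite !py_upd.
Qed.

Let meas_upd_full i z : measurable_fun setT (fun x => rfull i (upd z (kE i) x)).
Proof.
apply: measurableT_comp; first exact: meas_rfull.
exact: (measurableT_comp (@measurable_upd K R (kE i)) (measurable_pair1 z)).
Qed.

Let slope_ge0 i z : 0 <= slope i z.
Proof.
have t0 := ltW tau0.
by apply: addr_ge0 => //; apply: divr_ge0; [exact: dotp_ge0|exact: mulr_ge0].
Qed.

Let narrow i z (t delta : R) : 0 <= delta ->
  exists m : R, [set x | `|rfull i (upd z (kE i) x) - t| <= delta]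
     `<=` [set x : R | `|x - m| <= slope i z * (2 * delta)].
Proof.
move=> d0.
have [[m mP]|H] := pselect (exists x : R, `|rfull i (upd z (kE i) x) - t| <= delta).
  exists m => x /= xP; apply: (le_trans (residual_expands i z x m)); apply: ler_wpM2l => //.
  exact: dist_center xP mP.
by exists 0 => x xP; case: H; exists x.
Qed.

Lemma pr_residual_window i z (t delta : R) : 0 <= delta ->
  pr muE [set x | `| `|rfull i (upd z (kE i) x)| - t| <= delta] <= 8 * M * delta * slope i z.
Proof.
move=> d0; have [c1 n1] := narrow i z t d0; have [c2 n2] := narrow i z (- t) d0.
have s0 := slope_ge0 i z.
have r0 : 0 <= slope i z * (2 * delta) by rewrite !mulr_ge0.
have w1 := window c1 r0; have w2 := window c2 r0.
apply: (@le_trans _ _ (pr muE [set x : R | `|x - c1| <= slope i z * (2 * delta)]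
    + pr muE [set x : R | `|x - c2| <= slope i z * (2 * delta)])); last first.
  by apply: (le_trans (lerD w1 w2)); rewrite le_eqVlt; apply/orP; left; apply/eqP; ring.
apply: pr_sub2; try exact: window_meas.
- apply: measurable_ler => //; apply: measurable_normr; apply: measurable_funB => //.
  exact: measurable_normr.
move=> x /= H; case: (lerP 0 (rfull i (upd z (kE i) x))) => r.
  by left; apply: n1; move: H => /=; rewrite (ger0_norm r).
by right; apply: n2 => /=; move: H; rewrite (ltr0_norm r) norm_opp_sub.
Qed.

Lemma anti_concentration i (t : S -> R) (delta : R) : measurable_fun setT t ->
  (forall z x, t (upd z (kE i) x) = t z) -> 0 <= delta ->
  pr L [set z | `| `|rfull i z| - t z| <= delta]
    <= 8 * M * delta * (1 + B ^+ 2 * k%:R / (n.+1%:R * tau)).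
Proof.
move=> mt tJ d0; have t0 := tau0.
have kap0 : 0 < n.+1%:R * tau by exact: kap_full_gt0.
have mA : measurable [set z | `| `|rfull i z| - t z| <= delta].
  apply: measurable_ler => //; apply: measurable_normr; apply: measurable_funB => //.
  by apply: measurable_normr; exact: meas_rfull.
have nx : nneg_meas (fun z : S => dotp (px i z) (px i z)).
  by split=> [|z]; [apply: measurable_dotp; exact: meas_px|exact: dotp_ge0].
have M8 : 0 <= 8 * M * delta by have h := M0; rewrite !mulr_ge0.
have ki : 0 <= (n.+1%:R * tau)^-1 by rewrite invr_ge0 ltW.
have H : mean_le L (fun z => 8 * M * delta * (1 + (n.+1%:R * tau)^-1 * dotp (px i z) (px i z)))
     (8 * M * delta * (1 + (n.+1%:R * tau)^-1 * (B ^+ 2 * k%:R))).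
  apply: mean_leZ => //; first by apply: nnD; [split|exact: nnZ].
  apply: mean_leD; [by split|exact: nnZ|exact: mean_le_cst|].
  by apply: mean_leZ => //; exact: mean_px_sqr.
rewrite [_ / (n.+1%:R * tau)]mulrC; apply: (@pr_le_fiber _ _ _ _ Lmu (kE i)) H => //.
- by apply: nnZ => //; apply: nnD; [split|exact: nnZ].
- move=> z; rewrite [_^-1 * _]mulrC.
  rewrite (_ : [set x | _] = [set x | `| `|rfull i (upd z (kE i) x)| - t z| <= delta]).
    exact: pr_residual_window.
  by apply/funext => x /=; rewrite tJ.
Qed.

End AntiConcentration.


(** A single coordinate of the fit is compared with a sum over the points of
    the entries of one column of the design, weighted by residuals of the fit
    without this column, which are independent of it. *)
Section Column.
Variables (a : 'I_n.+1) (c : 'I_k).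
Notation kap := (n%:R * tau).

Let xt i z : 'cV[R]_k := zero_coord c (px i z).
Let yt i z : R := dotp (xt i z) (pbeta z) + seps i z.
Let bt z := ridge kap (fun i => i != a) (xt ^~ z) (yt ^~ z).
Let rt i z := yt i z - dotp (xt i z) (bt z).

Let kap0 : 0 < kap. Proof. exact: kap_drop_gt0. Qed.

Let meas_xt i : mx_meas (xt i).
Proof.
move=> c' e; rewrite [X in measurable_fun _ X](_ : _ = (fun z => if c' == c then 0 else px i z c' 0)).
  by case: (c' == c) => //; exact: meas_px.
by apply/funext => z; rewrite mxE.
Qed.

Let meas_yt i : measurable_fun setT (yt i).
Proof.
apply: measurable_funD; last exact: meas_seps.
by apply: measurable_dotp; [exact: meas_xt|exact: meas_pbeta].
Qed.

Let meas_rt i : measurable_fun setT (rt i).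
Proof.
apply: measurable_funB; first exact: meas_yt.
apply: measurable_dotp; first exact: meas_xt.
by apply: mx_meas_ridge => [|j _|j _]; [exact: kap0|exact: meas_xt|exact: meas_yt].
Qed.

Let off_col (q : K) : bool := if q is inl (inl (inr ic)) then ic.2 != c else true.

Let xt_mix i z1 z2 : xt i (mix off_col z1 z2) = xt i z1.
Proof.
apply/colP => c'; rewrite !mxE; case: eqP => // /eqP cc.
by rewrite /slam /sW !coord_mix /= cc.
Qed.

Let yt_mix i z1 z2 : yt i (mix off_col z1 z2) = yt i z1.
Proof.
rewrite /yt xt_mix pbeta_mix; last by apply/forallP.
by rewrite /seps coord_mix.
Qed.

Let rt_mix i z1 z2 : rt i (mix off_col z1 z2) = rt i z1.
Proof.
rewrite /rt yt_mix xt_mix; congr (_ - dotp _ _).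
by apply: eq_ridge => j _; rewrite ?xt_mix ?yt_mix.
Qed.

Let ytE i z : yt i z = row_sum i (predC1 c) sbst z + seps i z.
Proof.
rewrite /yt; congr (_ + _); rewrite /row_sum mulr_sumr [RHS]big_mkcond /=.
apply: eq_bigr => c' _; rewrite !mxE.
case: eqP => [_|_] /=; first by rewrite mul0r.
by rewrite -mulrA [sbst _ _ * _]mulrC.
Qed.

Let nn_yt i : nneg_meas (fun z => yt i z ^+ 4). Proof. exact: nn_fourth. Qed.

Let sum_rt_le z : \sum_(i | i != a) rt i z ^+ 2 <= \sum_(i | i != a) yt i z ^+ 2.
Proof.
have := ridge_residual_le (ltW kap0) (ridgeP (fun i => i != a) (xt ^~ z) (yt ^~ z) kap0).
by apply: le_trans; rewrite lerDl mulr_ge0 ?dotp_ge0// ltW.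
Qed.

Let coef (q : K) z : R := if q is inl (inl (inr ic)) then slam ic.1 z * rt ic.1 z / kap else 0.
Let col_idx : seq K := [seq kW i c | i <- enum 'I_n.+1 & i != a].

Let sum_col (f : K -> R) : \sum_(q <- col_idx) f q = \sum_(i | i != a) f (kW i c).
Proof. by rewrite big_map big_filter big_enum_cond. Qed.

Let col_idxP q : q \in col_idx -> exists i, q = kW i c.
Proof. by move=> /mapP[i _ ->]; exists i. Qed.

Let coef_meas q : measurable_fun setT (coef q).
Proof.
case: q => [[[j|[j c']]|j]|c']; try exact: measurable_cst.
by apply: (@measurable_funM _ _ _ _ (fun z => slam j z * rt j z) (fun=> kap^-1)) => //;
  exact: (measurable_funM (meas_slam j) (meas_rt j)).
Qed.

Let coef_sqr z : good z -> \sum_(q <- col_idx) coef q z ^+ 2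
  <= B ^+ 2 / kap ^+ 2 * \sum_(i | i != a) yt i z ^+ 2.
Proof.
move=> gz; rewrite sum_col.
apply: (@le_trans _ _ (B ^+ 2 / kap ^+ 2 * \sum_(i | i != a) rt i z ^+ 2)); last first.
  by apply: ler_wpM2l (sum_rt_le z); rewrite divr_ge0 ?sqr_ge0.
rewrite mulr_sumr; apply: ler_sum => i _ /=; have /andP[l0 lB] := gz i.
rewrite expr_div_n exprMn mulrAC; apply: ler_wpM2r; first exact: sqr_ge0.
apply: ler_wpM2r; first by rewrite invr_ge0 sqr_ge0.
by rewrite ler_sqr ?nnegrE ?(ltW l0) ?(ltW B0).
Qed.

Let mean_column : mean_le L (fun z => (\sum_(q <- col_idx) coef q z * coord q z) ^+ 4)
  ((3 * CW + 4) * (B ^+ 4 * (2 * response_const) / (n%:R ^+ 2 * tau ^+ 4))).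
Proof.
have nR : (0 : R) < n%:R by rewrite ltr0n.
have t0 := tau0; have b0 := B0; have c0 := CW0; have k1 := kap0.
have D0 : 0 <= B ^+ 4 / kap ^+ 4 * n.+1%:R by rewrite mulr_ge0// divr_ge0// exprn_ge0// ltW.
apply: (@block_fourth_moment _ _ _ _ Lmu off_col col_idx coef CW).
- by rewrite map_inj_uniq; [exact/filter_uniq/enum_uniq|move=> i i' [->]].
- by move=> q /col_idxP[i ->] /=; rewrite negbK.
- exact: coef_meas.
- by case=> [[[j|[j c']]|j]|c'] z1 z2 //=; rewrite rt_mix /slam coord_mix.
- by move=> q /col_idxP[i ->].
- by move=> q /col_idxP[i ->].
- by move=> q /col_idxP[i ->].
- exact: CW0.
have ns : nneg_meas (fun z : S => \sum_(i | i != a) yt i z ^+ 4) by exact: nn_sum.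
apply: (@mean_le_good _ (fun z => B ^+ 4 / kap ^+ 4 * n.+1%:R * \sum_(i | i != a) yt i z ^+ 4)).
- by apply: nn_sqr; apply: measurable_sum => q; apply: measurable_funX; exact: coef_meas.
- exact: nnZ.
- move=> z gz.
  have s1 : 0 <= \sum_(q <- col_idx) coef q z ^+ 2 by apply: sumr_ge0 => q _; exact: sqr_ge0.
  have h1 := coef_sqr gz; have h2 := le_trans s1 h1.
  apply: (@le_trans _ _ ((B ^+ 2 / kap ^+ 2 * \sum_(i | i != a) yt i z ^+ 2) ^+ 2)).
    by rewrite ler_sqr.
  rewrite exprMn expr_div_n -!exprM -mulrA; apply: ler_wpM2l.
    by rewrite divr_ge0// exprn_ge0// ltW.
  apply: (le_trans (sqr_sum_le _ _)); rewrite card_ord; apply: ler_wpM2l => //.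
  by apply: ler_sum => i _; rewrite -exprM.
have mY i : mean_le L (fun z => yt i z ^+ 4) response_const.
  by rewrite /mean_le; under eq_integral do rewrite ytE; exact: mean_response_fourth.
apply: (@le_trans _ _ ((B ^+ 4 / kap ^+ 4 * n.+1%:R * \sum_(i < n.+1 | i != a) response_const)%:E)).
  by apply: mean_leZ => //; exact: mean_le_sum_cond.
have response_const0 : 0 <= response_const := mean_le_ge0 (nn_yt a) (mY a).
have nz : n%:R != 0 :> R by rewrite lt0r_neq0.
have tz : tau != 0 by rewrite lt0r_neq0.
rewrite sum_others lee_fin.
have -> : B ^+ 4 * (2 * response_const) / (n%:R ^+ 2 * tau ^+ 4) = B ^+ 4 / kap ^+ 4 * (2 * n%:R) * (n%:R * response_const).
  by field; rewrite nz tz.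
apply: ler_wpM2r; first by rewrite mulr_ge0// ltW.
apply: ler_wpM2l; first by rewrite divr_ge0// exprn_ge0// ltW.
have : (1 : R) <= n%:R by rewrite ler1n.
by rewrite -natr1; lra.
Qed.

Definition err_fourth_bound : R :=
  8 * ((3 * CW + 4) * (B ^+ 4 * (2 * response_const) / (n%:R ^+ 2 * tau ^+ 4)) + k%:R ^- 2 * CB).

(** The column sum has fourth moment of order [n ^- 2] because its weights have
    squares of total order [1 / n]. *)
Lemma mean_err_fourth : mean_le L (fun z => err a c z ^+ 4) err_fourth_bound.
Proof.
have mc : measurable_fun setT (fun z : S => \sum_(q <- col_idx) coef q z * coord q z).
  apply: measurable_sum => q; apply: measurable_funM; first exact: coef_meas.
  exact: measurable_coord.
have ms := @meas_sbst c.
apply: (@mean_le_mono _ _ _ _ _ (fun z =>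
    8 * ((\sum_(q <- col_idx) coef q z * coord q z) ^+ 4 + sbst c z ^+ 4))).
- by apply: nn_fourth; exact: meas_err.
- by apply: nnZ => //; apply: nnD; exact: nn_fourth.
- move=> z.
  have H1 : is_ridge kap (fun i => i != a) (px ^~ z) (fun i => dotp (px i z) (pbeta z) + seps i z) (bdrop a z).
    exact: ridgeP.
  have H2 : is_ridge kap (fun i => i != a) (fun i => zero_coord c (px i z))
      (fun i => dotp (zero_coord c (px i z)) (pbeta z) + seps i z) (bt z).
    exact: ridgeP.
  have := ridge_coord_error kap0 H1 H2.
  have -> : \sum_(i | i != a) px i z c 0 * (dotp (zero_coord c (px i z)) (pbeta z) + seps i z
      - dotp (zero_coord c (px i z)) (bt z)) / kap = \sum_(q <- col_idx) coef q z * coord q z.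
    rewrite sum_col; apply: eq_bigr => i _; rewrite /= -/(xt i z) -/(yt i z) -/(rt i z).
    by rewrite mxE /sW; ring.
  rewrite (_ : pbeta z c 0 = sbst c z); last by rewrite mxE.
  rewrite distrC -(_ : err a c z = sbst c z - bdrop a z c 0); last by rewrite /err mxE.
  set T := \sum_(q <- _) _ => h.
  have h4 : err a c z ^+ 4 <= (T - sbst c z) ^+ 4.
    rewrite (fourth_norm (err a c z)) (fourth_norm (T - _)).
    by rewrite lerXn2r// nnegrE.
  apply: (le_trans h4); apply: (le_trans (add_fourth _ _)).
  by rewrite [(- _) ^+ 4]fourth_norm normrN -fourth_norm.
- apply: mean_leZ => //; first by apply: nnD; exact: nn_fourth.
  apply: mean_leD; try exact: nn_fourth; first exact: mean_column.
  exact: mean_sbst_fourth.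
Qed.

End Column.

End ModelLaw.

(** * Ranks of residuals and full conformal coverage *)

Section Ranks.
Context {R : realType} {I : finType}.
Implicit Types (v : I -> R) (c : R).

Lemma le_boolR (b1 b2 : bool) : (b1 -> b2) -> b1%:R <= b2%:R :> R.
Proof. by case: b1; case: b2 => // /(_ isT). Qed.

Definition lt_count v (a : I) : R := \sum_i (v i < v a)%R%:R.
Definition le_count v (a : I) : R := \sum_i (v i <= v a)%R%:R.

(** The points of rank at least [c] all lie above the lowest of them, which
    exceeds at least [c] points. *)
Lemma lt_count_many v c : c <= #|I|%:R -> c <= \sum_j (lt_count v j < c)%R%:R.
Proof.
move=> cI; have [[j0 j0P]|H] := pselect (exists j, ~~ (lt_count v j < c)).
  case: (@arg_minP _ _ _ j0 (fun j => ~~ (lt_count v j < c)) v j0P) => j jP jmin.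
  rewrite -leNgt in jP; apply: (le_trans jP); apply: ler_sum => i _; apply: le_boolR => ij.
  by apply: contraT => /jmin; rewrite leNgt ij.
rewrite (eq_bigr (fun=> 1)); first by rewrite sumr_const.
by move=> j _; case: (boolP (lt_count v j < c)) => // jc; case: H; exists j.
Qed.

(** Symmetrically, all points counted here lie below the highest of them. *)
Lemma le_count_few v c : 0 <= c -> \sum_j (le_count v j <= c)%R%:R <= c.
Proof.
move=> c0; have [[j0 j0P]|H] := pselect (exists j, le_count v j <= c).
  case: (@arg_maxP _ _ _ j0 (fun j => le_count v j <= c) v j0P) => j jP jmax.
  by apply: (le_trans _ jP); apply: ler_sum => i _; apply: le_boolR => /jmax.
rewrite big1// => j _; case: (boolP (le_count v j <= c)) => // jc; case: H; exists j.
exact: jc.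
Qed.
End Ranks.

Lemma lt_stable {R : realDomainType} (x y x' y' d : R) : `|x - x'| < d -> `|y - y'| < d ->
  2 * d < `|x - y| -> (x < y) = (x' < y').
Proof.
rewrite !ltr_norml ltr_normr => /andP[h1 h2] /andP[h3 h4] /orP[h|h]; apply/idP/idP; lra.
Qed.

Section Bool.
Context {d : measure_display} {T : measurableType d} {R : realType}.
Variable P : probability T R.

Lemma boolR_indic (b : T -> bool) : (fun x => (b x)%:R) = \1_[set x | b x] :> (T -> R).
Proof. by apply/funext => x; rewrite indicE; congr (nat_of_bool _)%:R; apply/idP/idP => [/mem_set|/set_mem]. Qed.

Lemma indic_bool (b : T -> bool) x : \1_[set x | b x] x = (b x)%:R :> R.
Proof. by rewrite -boolR_indic. Qed.

Lemma bdd_bool (b : T -> bool) : measurable [set x | b x] -> bdd_meas (fun x => (b x)%:R : R).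
Proof. by move=> mb; rewrite boolR_indic; exact: bdd_indic. Qed.

Lemma Ex_bool (b : T -> bool) : measurable [set x | b x] ->
  Ex P (fun x => (b x)%:R) = pr P [set x | b x].
Proof. by move=> mb; rewrite boolR_indic; exact: Ex_indic. Qed.
End Bool.

(** The arithmetic of [other_coverage_variance]: the left side is the second
    moment about [p] of a conditional coverage with mean [PD] and second moment
    [PDD], and [x] is the joint coverage of two points. *)
Lemma coverage_variance_le (R : realFieldType) (p eta rho ce u x PA PD PDD : R) :
  0 <= p -> p <= 1 -> 0 <= eta -> eta <= 1 -> 0 <= rho -> 0 <= ce ->
  x <= (p + eta) * PA + rho + u -> PA <= p + eta + rho -> PDD <= x + 2 * ce -> p - ce <= PD ->
  PDD - 2 * p * PD + p ^+ 2 <= u + 3 * eta + 3 * rho + 4 * ce.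
Proof.
move=> p0 p1 e0 e1 r0 c0 hx hPA hPDD hPD.
have pe0 : 0 <= p + eta by lra.
have h1 := ler_wpM2l pe0 hPA; have h2 := ler_wpM2l p0 hPD.
have h3 : p * eta <= eta by nra.
have h4 : eta * eta <= eta by nra.
have h5 : p * rho <= rho by nra.
have h6 : eta * rho <= rho by nra.
have h7 : p * ce <= ce by nra.
by lra.
Qed.

Section FullConformal.
Context {R : realType} {n k : nat}.
Notation K := (idx n k).
Notation S := (sample K R).
Implicit Types (i j a b : 'I_n.+1) (z : S).
Variables (muL muW muE muB : probability R R) (L : probability S R).
Hypothesis Lmu : product_law (model_law muL muW muE muB) L.
Variables (tau KS KA : R).
Hypotheses (tau0 : 0 < tau) (n0 : (0 < n)%N) (KS0 : 0 <= KS) (KA0 : 0 <= KA).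
Notation rfull := (rfull tau).
Notation rdrop := (rdrop tau).
Hypothesis stability : forall i j (delta : R), j != i -> 0 < delta ->
  pr L [set z | delta <= `|rfull j z - rdrop i j z|] <= KS / (n%:R * delta ^+ 2).
Hypothesis anti : forall i (t : S -> R) (delta : R), measurable_fun setT t ->
  (forall z x, t (upd z (kE i) x) = t z) -> 0 <= delta ->
  pr L [set z | `| `|rfull i z| - t z| <= delta] <= KA * delta.

Lemma rdrop_upd i j z x : j != i -> rdrop i j (upd z (kE i) x) = rdrop i j z.
Proof.
move=> ji; rewrite /rdrop py_upd// px_upd; congr (_ - dotp _ _).
by apply: eq_ridge => l li; rewrite ?px_upd ?py_upd.
Qed.

Let mf i : measurable_fun setT (rfull i : S -> R). Proof. exact: meas_rfull. Qed.
Let md i j : measurable_fun setT (rdrop i j : S -> R). Proof. exact: meas_rdrop. Qed.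
Let mnf i : measurable_fun setT (fun z : S => `|rfull i z|). Proof. exact: measurable_normr. Qed.
Let mnd i j : measurable_fun setT (fun z : S => `|rdrop i j z|). Proof. exact: measurable_normr. Qed.
Let mgap i j : measurable_fun setT (fun z : S => `|rfull j z - rdrop i j z|).
Proof. by apply: measurable_normr; exact: measurable_funB. Qed.

Let close_meas i a (t : R) : measurable [set z : S | `| `|rfull i z| - `|rfull a z| | <= t].
Proof. by apply: measurable_ler => //; apply: measurable_normr; exact: measurable_funB. Qed.
Let gap_meas i j (t : R) : measurable [set z : S | t <= `|rfull j z - rdrop i j z|].
Proof. exact: measurable_ler. Qed.

(** Residuals of two different points are seldom close: dropping the point [i]
    makes the residual of [a] independent of the noise of [i]. *)
Lemma pr_close_residuals i a (delta : R) : a != i -> 0 < delta ->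
  pr L [set z | `| `|rfull i z| - `|rfull a z| | <= delta]
    <= 2 * KA * delta + KS / (n%:R * delta ^+ 2).
Proof.
move=> ai d0.
apply: (@le_trans _ _ (pr L [set z | `| `|rfull i z| - `|rdrop i a z| | <= 2 * delta]
   + pr L [set z | delta <= `|rfull a z - rdrop i a z|])).
  apply: pr_sub2 => //.
    by apply: measurable_ler => //; apply: measurable_normr; exact: measurable_funB.
  move=> z /= h; case: (lerP delta `|rfull a z - rdrop i a z|) => g; [by right|left].
  have := lerB_dist (rfull a z) (rdrop i a z); have := lerB_dist (rdrop i a z) (rfull a z).
  by rewrite [`|rdrop i a z - _|]distrC; move: h; rewrite !ler_norml; lra.
apply: lerD; last exact: stability.
have d2 : 0 <= 2 * delta by lra.
have tJ z x : `|rdrop i a (upd z (kE i) x)| = `|rdrop i a z| by rewrite rdrop_upd.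
by have := anti (mnd i a) tJ d2; rewrite mulrCA mulrA.
Qed.

Variables (p eta delta : R).
Hypotheses (p0 : 0 <= p) (p1 : p <= 1) (eta0 : 0 < eta) (eta1 : eta <= 1) (delta0 : 0 < delta).
Notation N := (n.+1%:R : R).

Definition rank_lt a z : R := lt_count (fun i => `|rfull i z|) a.
Definition rank_le a z : R := le_count (fun i => `|rfull i z|) a.
Definition rank_drop b a z : R := \sum_(i | i != b) (`|rdrop b i z| < `|rdrop b a z|)%R%:R.

Let lt_meas i a : measurable [set z : S | `|rfull i z| < `|rfull a z|].
Proof. exact: measurable_ltr. Qed.
Let le_meas i a : measurable [set z : S | `|rfull i z| <= `|rfull a z|].
Proof. exact: measurable_ler. Qed.
Let ltd_meas b i a : measurable [set z : S | `|rdrop b i z| < `|rdrop b a z|].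
Proof. exact: measurable_ltr. Qed.

Lemma bdd_rank_lt a : bdd_meas (rank_lt a).
Proof. by apply: bdd_sum => i; exact: bdd_bool. Qed.
Lemma bdd_rank_le a : bdd_meas (rank_le a).
Proof. by apply: bdd_sum => i; exact: bdd_bool. Qed.
Lemma bdd_rank_drop b a : bdd_meas (rank_drop b a).
Proof.
rewrite (_ : rank_drop b a = fun z => \sum_i (if i != b then (`|rdrop b i z| < `|rdrop b a z|)%R%:R else 0)).
  by apply: bdd_sum => i; case: (i != b); [exact: bdd_bool|exact: bdd_cst].
by apply/funext => z; rewrite [LHS]big_mkcond.
Qed.

Let mF a : measurable_fun setT (rank_lt a). Proof. by have [] := bdd_rank_lt a. Qed.
Let mG a : measurable_fun setT (rank_le a). Proof. by have [] := bdd_rank_le a. Qed.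
Let mD b a : measurable_fun setT (rank_drop b a). Proof. by have [] := bdd_rank_drop b a. Qed.

(** Two residuals are compared wrongly only if one of them moves by [delta] or
    if they are within [2 * delta] of each other; [flip_prob] bounds the
    probability of this. *)
Definition flip_prob : R := 4 * KA * delta + 3 * (KS / (n%:R * delta ^+ 2)).
Definition rank_error : R := (N^-1 + flip_prob) / eta.

Let KSn0 : 0 <= KS / (n%:R * delta ^+ 2).
Proof. by have h := KS0; rewrite divr_ge0// mulr_ge0// sqr_ge0. Qed.

Let flip0 : 0 <= flip_prob.
Proof.
have h1 := KA0; have h2 := ltW delta0; have h3 := KSn0.
by apply: addr_ge0; [rewrite !mulr_ge0|rewrite mulr_ge0].
Qed.

Let N0 : 0 < N. Proof. by []. Qed.

Let few_ambiguous (X : S -> R) (h : 'I_n.+1 -> S -> R) : bdd_meas X -> (forall i, bdd_meas (h i)) ->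
  (forall z, `|X z| <= 1 + \sum_i h i z) -> (forall i, Ex L (h i) <= flip_prob) ->
  pr L [set z | eta * N <= `|X z|] <= rank_error.
Proof.
move=> bX bh Xh hE; have e0 := eta0.
have bS := bdd_sum (index_enum 'I_n.+1) bh.
apply: (@le_trans _ _ (Ex L (fun z => `|X z|) / (eta * N))).
  apply: pr_markov => //; [exact: bdd_norm|by rewrite mulr_gt0|].
  by apply: measurable_ler => //; apply: measurable_normr; have [] := bX.
have -> : rank_error = (1 + N * flip_prob) / (eta * N).
  rewrite /rank_error; move: N0; set m : R := N => m0.
  by field; rewrite !lt0r_neq0.
apply: ler_wpM2r; first by rewrite invr_ge0 mulr_ge0// ltW.
apply: (@le_trans _ _ (Ex L (fun z => 1 + \sum_i h i z))).
  by apply: le_Ex => //; [exact: bdd_norm|apply: bddD => //; exact: bdd_cst].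
rewrite ExD//; last exact: bdd_cst.
rewrite Ex_cst Ex_sum// lerD2l.
apply: (@le_trans _ _ (\sum_(i < n.+1) flip_prob)); first exact: ler_sum.
by rewrite sumr_const card_ord mulr_natl.
Qed.

Lemma pr_ties a : pr L [set z | eta * N <= `|rank_le a z - rank_lt a z|] <= rank_error.
Proof.
pose h i z : R := if i == a then 0 else (`| `|rfull i z| - `|rfull a z| | <= delta)%R%:R.
apply: (few_ambiguous (h := h)).
- by apply: bddB; [exact: bdd_rank_le|exact: bdd_rank_lt].
- by move=> i; rewrite /h; case: (i == a); [exact: bdd_cst|exact: bdd_bool].
- move=> z; rewrite /rank_le /rank_lt /le_count /lt_count -sumrB.
  have T i : (`|rfull i z| <= `|rfull a z|)%R%:R - (`|rfull i z| < `|rfull a z|)%R%:R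
      = (`|rfull i z| == `|rfull a z|)%R%:R :> R.
    by case: ltgtP; rewrite ?subrr ?subr0.
  rewrite (eq_bigr (fun i => (`|rfull i z| == `|rfull a z|)%R%:R)) => [|i _]; last exact: T.
  rewrite ger0_norm; last by apply: sumr_ge0.
  rewrite (bigD1 a)//= eqxx lerD2l [leRHS](bigD1 a)//= {1}/h eqxx add0r.
  apply: ler_sum => i ia; rewrite /h (negbTE ia); apply: le_boolR => /eqP ->.
  by rewrite subrr normr0 ltW.
- move=> i; rewrite /h; case: eqP => [_|/eqP ia]; first by rewrite Ex_cst; exact: flip0.
  rewrite Ex_bool//; apply: (le_trans (pr_close_residuals _ delta0)); first by rewrite eq_sym.
  have := KSn0; have h1 := KA0; have h2 := delta0.
  have : 0 <= KA * delta by rewrite mulr_ge0// ltW.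
  by rewrite /flip_prob; lra.
Qed.

Lemma pr_rank_drop b a : a != b ->
  pr L [set z | eta * N <= `|rank_lt a z - rank_drop b a z|] <= rank_error.
Proof.
move=> ab.
pose h i z : R := if (i == a) || (i == b) then 0 else
  (delta <= `|rfull i z - rdrop b i z|)%R%:R + (delta <= `|rfull a z - rdrop b a z|)%R%:R
  + (`| `|rfull i z| - `|rfull a z| | <= 2 * delta)%R%:R.
apply: (few_ambiguous (h := h)).
- by apply: bddB; [exact: bdd_rank_lt|exact: bdd_rank_drop].
- move=> i; rewrite /h; case: (_ || _); first exact: bdd_cst.
  by apply: bddD; [apply: bddD|]; exact: bdd_bool.
- move=> z; rewrite /rank_lt /lt_count (bigD1 b)//= /rank_drop -addrA -sumrB.
  apply: (le_trans (ler_normD _ _)); apply: lerD.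
    by case: (_ < _); rewrite ?normr0 ?normr1.
  apply: (le_trans (ler_norm_sum _ _ _)).
  rewrite [leRHS](bigD1 b)//= {1}/h eqxx orbT add0r; apply: ler_sum => i ib.
  rewrite /h (negbTE ib) orbF; case: eqP => [->|/eqP ia]; first by rewrite !ltxx subrr normr0.
  have [g1|g1] := lerP delta `|rfull i z - rdrop b i z|.
    apply: (@le_trans _ _ 1); last by rewrite -addrA lerDl addr_ge0.
    by case: (_ < _); case: (_ < _); rewrite ?subrr ?subr0 ?sub0r ?normrN ?normr0 ?normr1.
  have [g2|g2] := lerP delta `|rfull a z - rdrop b a z|.
    apply: (@le_trans _ _ 1); last by rewrite add0r lerDl.
    by case: (_ < _); case: (_ < _); rewrite ?subrr ?subr0 ?sub0r ?normrN ?normr0 ?normr1.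
  rewrite !add0r; have [g3|g3] := lerP _ (2 * delta).
    by case: (_ < _); case: (_ < _); rewrite ?subrr ?subr0 ?sub0r ?normrN ?normr0 ?normr1.
  rewrite le_eqVlt (_ : (`|rfull i z| < `|rfull a z|) = (`|rdrop b i z| < `|rdrop b a z|)) ?subrr ?normr0 ?eqxx//.
  exact: (lt_stable (le_lt_trans (ler_dist_dist _ _) g1) (le_lt_trans (ler_dist_dist _ _) g2) g3).
- move=> i; rewrite /h; case E : ((i == a) || (i == b)); first by rewrite Ex_cst; exact: flip0.
  move/negbT: E; rewrite negb_or => /andP[ia ib].
  rewrite !ExD; try by [exact: bdd_bool|apply: bddD; exact: bdd_bool].
  rewrite !Ex_bool//.
  have s1 := stability ib delta0; have s2 := stability ab delta0.
  have d2 : 0 < 2 * delta by have := delta0; lra.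
  have ai : a != i by rewrite eq_sym.
  have s3 := pr_close_residuals ai d2.
  have s4 : KS / (n%:R * (2 * delta) ^+ 2) <= KS / (n%:R * delta ^+ 2).
    have nR : (0 : R) < n%:R by rewrite ltr0n.
    have dd : 0 < delta ^+ 2 by rewrite exprn_gt0.
    have ks0 := KS0; apply: ler_wpM2l => //; rewrite lef_pV2 ?posrE ?mulr_gt0 ?exprn_gt0//.
    by rewrite exprMn; apply: ler_wpM2l; [exact: ltW|]; nra.
  by rewrite /flip_prob; lra.
Qed.

Lemma rank_lt_swap s a z : involutive s -> rank_lt a (reindex (swap_idx s) z) = rank_lt (s a) z.
Proof.
move=> sK; rewrite /rank_lt /lt_count [RHS](reindex_inj (inv_inj sK)) /=.
by apply: eq_bigr => i _; rewrite !rfull_swap.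
Qed.

Lemma rank_le_swap s a z : involutive s -> rank_le a (reindex (swap_idx s) z) = rank_le (s a) z.
Proof.
move=> sK; rewrite /rank_le /le_count [RHS](reindex_inj (inv_inj sK)) /=.
by apply: eq_bigr => i _; rewrite !rfull_swap.
Qed.

Lemma rank_drop_swap s b a z : involutive s ->
  rank_drop b a (reindex (swap_idx s) z) = rank_drop (s b) (s a) z.
Proof.
move=> sK; rewrite /rank_drop [RHS](reindex_inj (inv_inj sK)) /=.
apply: eq_big => i; first by rewrite (inj_eq (inv_inj sK)).
by move=> _; rewrite !rdrop_swap.
Qed.

Lemma exchange_model s (A : set S) : involutive s -> measurable A ->
  pr L A = pr L (reindex (swap_idx s) @^-1` A).
Proof. by move=> sK; exact: (exchange_pr Lmu (swap_idxK sK) (fun q => model_law_swap _ _ _ _ s q)). Qed.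

Let transp i j : 'I_n.+1 -> 'I_n.+1 := fun x => perm.fun_of_perm (perm.tperm i j) x.
Let transpK i j : involutive (transp i j). Proof. exact: perm.tpermK. Qed.

Let lt_set_meas a (c : R) : measurable [set z | rank_lt a z < c].
Proof. exact: measurable_ltr. Qed.
Let le_set_meas a (c : R) : measurable [set z | rank_le a z <= c].
Proof. exact: measurable_ler. Qed.
Let ties_meas a : measurable [set z | eta * N <= `|rank_le a z - rank_lt a z|].
Proof. by apply: measurable_ler => //; apply: measurable_normr; exact: measurable_funB. Qed.
Let gapd_meas b a : measurable [set z | eta * N <= `|rank_lt a z - rank_drop b a z|].
Proof. by apply: measurable_ler => //; apply: measurable_normr; exact: measurable_funB. Qed.

Let share (X : 'I_n.+1 -> S -> bool) a : (forall j, measurable [set z | X j z]) ->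
  (forall s j z, involutive s -> X j (reindex (swap_idx s) z) = X (s j) z) ->
  Ex L (fun z => \sum_j (X j z)%:R) = N * pr L [set z | X a z].
Proof.
move=> mX Xs; rewrite Ex_sum => [|j]; last exact: bdd_bool.
rewrite (eq_bigr (fun=> pr L [set z | X a z])) ?sumr_const ?card_ord ?mulr_natl// => j _.
rewrite Ex_bool// (exchange_model (transpK a j) (mX a)).
by congr pr; apply/funext => z /=; rewrite Xs// /transp perm.tpermL.
Qed.

Lemma pr_rank_lt_ge a (c : R) : c <= 1 -> c <= pr L [set z | rank_lt a z < c * N].
Proof.
move=> c1; rewrite -(ler_pM2l N0) -(share _ (X := fun j z => rank_lt j z < c * N))//.
- apply: (@le_trans _ _ (Ex L (fun=> c * N))); first by rewrite Ex_cst mulrC.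
  apply: le_Ex; [exact: bdd_cst|by apply: bdd_sum => j; exact: bdd_bool|].
  by move=> z; apply: lt_count_many; rewrite card_ord -[leRHS]mul1r ler_wpM2r.
- by move=> s j z sK; rewrite rank_lt_swap.
Qed.

Lemma pr_rank_le_le a (c : R) : 0 <= c -> pr L [set z | rank_le a z <= c * N] <= c.
Proof.
move=> c0; rewrite -(ler_pM2l N0) -(share _ (X := fun j z => rank_le j z <= c * N))//.
- apply: (@le_trans _ _ (Ex L (fun=> c * N))); last by rewrite Ex_cst mulrC.
  apply: le_Ex; [by apply: bdd_sum => j; exact: bdd_bool|exact: bdd_cst|].
  by move=> z; apply: le_count_few; rewrite mulr_ge0.
- by move=> s j z sK; rewrite rank_le_swap.
Qed.

Let lt_le_ties a (c : R) z : rank_lt a z < c * N ->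
  rank_le a z <= (c + eta) * N \/ eta * N <= `|rank_le a z - rank_lt a z|.
Proof.
move=> h; case: (lerP (rank_le a z) ((c + eta) * N)) => g; [by left|right].
by apply: (le_trans _ (ler_norm _)); rewrite mulrDl in g; lra.
Qed.

Lemma pr_rank_lt_le a (c : R) : 0 <= c -> pr L [set z | rank_lt a z < c * N] <= c + eta + rank_error.
Proof.
move=> c0; apply: (le_trans (@pr_sub2 _ _ _ L _ _ _ (lt_set_meas a _) (le_set_meas a ((c + eta) * N)) (ties_meas a) _)).
  by move=> z /= h; exact: lt_le_ties.
by apply: lerD (pr_ties a); apply: pr_rank_le_le; have := eta0; lra.
Qed.

Definition covered a : set S := [set z | rank_lt a z < p * N].
Definition covered_drop b a : set S := [set z | rank_drop b a z < p * N].

Lemma meas_covered a : measurable (covered a). Proof. exact: lt_set_meas. Qed.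
Lemma meas_covered_drop b a : measurable (covered_drop b a). Proof. exact: measurable_ltr. Qed.

Let window a : set S := [set z | ((p - eta) * N <= rank_lt a z) && (rank_lt a z < (p + eta) * N)].

Let window_meas a : measurable (window a).
Proof.
rewrite (_ : window a = [set z | (p - eta) * N <= rank_lt a z] `&` [set z | rank_lt a z < (p + eta) * N]).
  by apply: measurableI; [exact: measurable_ler|exact: lt_set_meas].
by apply/funext => z; apply/propext; split => [/andP[]|[? ?]] //; apply/andP.
Qed.

Let pr_window a : pr L (window a) <= 3 * eta + rank_error.
Proof.
have hi : pr L [set z | rank_lt a z < (p + eta) * N] <= p + eta + eta + rank_error.
  by apply: pr_rank_lt_le; have h1 := p0; have := eta0; lra.
have lo : p - eta <= pr L [set z | rank_lt a z < (p - eta) * N].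
  by apply: pr_rank_lt_ge; have h1 := p1; have := eta0; lra.
suff : pr L (window a) + pr L [set z | rank_lt a z < (p - eta) * N]
    <= pr L [set z | rank_lt a z < (p + eta) * N] by lra.
rewrite -(Ex_bool L (window_meas a)) -!(Ex_bool L (lt_set_meas a _)) -ExD; last 2 first.
- exact: (bdd_bool (window_meas a)).
- exact: (bdd_bool (lt_set_meas a _)).
apply: le_Ex; [exact: bddD (bdd_bool (window_meas a)) (bdd_bool (lt_set_meas a _))|exact: (bdd_bool (lt_set_meas a _))|] => z.
have e0 : (p - eta) * N <= (p + eta) * N by apply: ler_wpM2r => //; have := eta0; lra.
case: (ltP (rank_lt a z) ((p - eta) * N)) => h /=; last by rewrite addr0.
by rewrite (lt_le_trans h e0) add0r.
Qed.

(** [3 * eta] bounds the probability of a rank within [eta] of the threshold;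
    the other terms are those of ties and of ranks changed by the deletion. *)
Definition coverage_error : R := 3 * eta + 2 * rank_error.

Let differ b a : set S := [set z | (rank_lt a z < p * N) != (rank_drop b a z < p * N)].

Let differ_sub b a : differ b a `<=` window a `|` [set z | eta * N <= `|rank_lt a z - rank_drop b a z|].
Proof.
move=> z; rewrite /differ /= => h.
case: (lerP (eta * N) `|rank_lt a z - rank_drop b a z|) => g; [by right|left].
move: g; rewrite ltr_norml => /andP[g1 g2]; apply/andP; rewrite mulrBl mulrDl.
by move: h; case: ltP => h1; case: ltP => h2 //= _; split; lra.
Qed.

Let pr_swap_drop b a (X : set S) : a != b -> measurable X ->
  `|pr L (X `&` covered a) - pr L (X `&` covered_drop b a)| <= coverage_error.
Proof.
move=> ab mX.
have mW : measurable (window a `|` [set z | eta * N <= `|rank_lt a z - rank_drop b a z|]).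
  exact: measurableU.
apply: (@le_trans _ _ (pr L (window a `|` [set z | eta * N <= `|rank_lt a z - rank_drop b a z|]))).
  apply: pr_close => //; try by [apply: measurableI => //; exact: meas_covered|apply: measurableI => //; exact: meas_covered_drop].
    move=> z [Xz Az]; case: (boolP (rank_drop b a z < p * N)) => h; [by left|right].
    by apply: (@differ_sub b a z); rewrite /differ /= (negbTE h) Az.
  move=> z [Xz Az]; case: (boolP (rank_lt a z < p * N)) => h; [by left|right].
  by apply: (@differ_sub b a z); rewrite /differ /= (negbTE h) Az.
apply: (le_trans (prU_le L (window_meas a) (gapd_meas b a))).
by have := pr_window a; have := pr_rank_drop ab; rewrite /coverage_error; lra.
Qed.

(** By exchangeability the joint coverage of two points is an average over the
    second point, which the rank of residuals determines up to [eta]. *)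
Let pr_joint b a : a != b ->
  n%:R * pr L (covered a `&` covered b) <= N * ((p + eta) * pr L (covered a) + rank_error).
Proof.
move=> ab.
have mc j : measurable (covered a `&` covered j) by apply: measurableI; exact: meas_covered.
have E j : j != a -> pr L (covered a `&` covered j) = pr L (covered a `&` covered b).
  move=> ja; rewrite [RHS](exchange_model (transpK b j) (mc b)); congr pr; apply/funext => z.
  rewrite /covered /= !rank_lt_swap// /transp perm.tpermL perm.tpermD// eq_sym//.
have -> : n%:R * pr L (covered a `&` covered b) = \sum_(j | j != a) pr L (covered a `&` covered j).
  by rewrite (eq_bigr _ E) sum_others.
apply: (@le_trans _ _ (\sum_j pr L (covered a `&` covered j))).
  by rewrite [leRHS](bigID (fun j => j != a))/= lerDl; apply: sumr_ge0 => j _; exact: pr_ge0.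
have bc j : bdd_meas (fun z : S => (rank_lt j z < p * N)%R%:R : R) by exact: bdd_bool.
have bt j : bdd_meas (fun z : S => (eta * N <= `|rank_le j z - rank_lt j z|)%R%:R : R) by exact: bdd_bool.
have -> : \sum_j pr L (covered a `&` covered j)
    = Ex L (fun z => (rank_lt a z < p * N)%R%:R * \sum_j (rank_lt j z < p * N)%R%:R).
  rewrite -[RHS](@eq_Ex _ _ _ L (fun z => \sum_j (rank_lt a z < p * N)%R%:R * (rank_lt j z < p * N)%R%:R)).
    rewrite Ex_sum => [|j]; last exact: bddM.
    apply: eq_bigr => j _; rewrite -ExM_indic; try exact: meas_covered.
    by apply: eq_Ex => z; rewrite !indic_bool.
  by move=> z; rewrite mulr_sumr.
have bs : bdd_meas (fun z => \sum_j (eta * N <= `|rank_le j z - rank_lt j z|)%R%:R : R) by exact: bdd_sum.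
apply: (@le_trans _ _ (Ex L (fun z => (p + eta) * N * (rank_lt a z < p * N)%R%:R
     + \sum_j (eta * N <= `|rank_le j z - rank_lt j z|)%R%:R))).
  apply: le_Ex.
  - by apply: bddM => //; exact: bdd_sum.
  - by apply: bddD => //; apply: bddM => //; exact: bdd_cst.
  move=> z; case: (rank_lt a z < p * N); last by rewrite mul0r mulr0 add0r sumr_ge0.
  rewrite mul1r mulr1.
  have c0 : 0 <= (p + eta) * N by rewrite mulr_ge0//; have h := p0; have := eta0; lra.
  apply: (le_trans _ (lerD (le_count_few (fun i => `|rfull i z|) c0) (lexx _))).
  rewrite -big_split/=; apply: ler_sum => j _.
  case: (boolP (rank_lt j z < p * N)) => h; last by rewrite addr_ge0.
  by case: (lt_le_ties h) => g; [rewrite [X in X%:R + _](_ : _ = true :> nat)|rewrite g]; rewrite ?lerDl ?lerDr// /rank_le in g *; rewrite g.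
rewrite ExD//; last by apply: bddM => //; exact: bdd_cst.
rewrite ExZ// Ex_bool// mulrDr mulrA [N * (p + eta)]mulrC; apply: lerD => //.
rewrite Ex_sum//; apply: (@le_trans _ _ (\sum_(j < n.+1) rank_error)).
  by apply: ler_sum => j _; rewrite Ex_bool//; exact: pr_ties.
by rewrite sumr_const card_ord mulr_natl.
Qed.


Lemma rdrop_mix b i z z' : i != b -> rdrop b i (mix (off_points (pred1 b)) z z') = rdrop b i z.
Proof.
move=> ib; rewrite /rdrop bdrop_mix; last by move=> j /eqP.
by rewrite py_mix ?px_mix ?off_points_beta ?off_points_keeps.
Qed.

Lemma covered_drop_mix b a z z' : a != b ->
  covered_drop b a (mix (off_points (pred1 b)) z z') <-> covered_drop b a z.
Proof.
move=> ab; rewrite /covered_drop /= (_ : rank_drop b a (mix _ _ _) = rank_drop b a z)//.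
by apply: eq_bigr => i ib; rewrite !rdrop_mix.
Qed.

Lemma sample_ext (x y : S) : (forall q, coord q x = coord q y) -> x = y.
Proof. by move=> xy; apply/funext => q; exact: xy. Qed.

(** The coverage of [a] in the fit without [b], and that of [b] in the fit
    without [a], are independent with the same probability given all other
    points, so the second moment of this probability is a joint coverage. *)
Section TwoPoints.
Variables a b : 'I_n.+1.
Hypothesis ab : a != b.
Let J : pred K := off_points (pred2 a b).

Definition other_coverage z : R := pr L (mix J z @^-1` covered_drop b a).

Let mcd : measurable (covered_drop b a). Proof. exact: meas_covered_drop. Qed.

Lemma bdd_other_coverage : bdd_meas other_coverage. Proof. exact: bdd_pr_mix. Qed.

Lemma other_coverage_mix z z' : other_coverage (mix J z z') = other_coverage z.
Proof.
rewrite /other_coverage; congr pr; apply/funext => w /=; congr (covered_drop b a _).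
by apply: sample_ext => q; rewrite !coord_mix; case: (J q).
Qed.

Let off_point_mix (c : 'I_n.+1) (q : K) : off_points (pred1 c) q = false ->
  (c == a) || (c == b) -> J q = false.
Proof.
by case: q => [[[i|[i e]]|i]|e] //= /negbFE/eqP -> h; rewrite h.
Qed.

Lemma pr_inter_drop (X : set S) : measurable X ->
  (forall z z', X (mix (off_points (pred1 a)) z z') <-> X z) ->
  pr L (X `&` covered_drop b a) = Ex L (fun z => \1_X z * other_coverage z).
Proof.
move=> mX XJ; rewrite (pr_resample Lmu mcd mX XJ); apply: eq_Ex => z; congr (_ * _).
congr pr; apply/funext => w /=; apply/propext.
rewrite -(covered_drop_mix (mix _ z w) w ab); set u := mix _ (mix _ _ _) _.
rewrite (_ : u = mix J z w)//; apply: sample_ext => q; rewrite !coord_mix.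
case Jb : (off_points (pred1 b) q); last by rewrite (off_point_mix Jb) ?eqxx ?orbT.
case Ja : (off_points (pred1 a) q); last by rewrite (off_point_mix Ja) ?eqxx.
suff -> : J q = true by [].
by case: q Ja Jb => [[[i|[i e]]|i]|e] //= /negbTE -> /negbTE ->.
Qed.

(** Exchanging [a] and [b] fixes the other points. *)
Lemma other_coverage_sym z : pr L (mix J z @^-1` covered_drop a b) = other_coverage z.
Proof.
rewrite /other_coverage [RHS](exchange_model (transpK a b)); last exact: measurable_preimage_mix.
congr pr; apply/funext => w /=; apply/propext.
have -> : mix J z (reindex (swap_idx (transp a b)) w) = reindex (swap_idx (transp a b)) (mix J z w).
  apply: sample_ext => q; rewrite coord_reindex !coord_mix coord_reindex.
  have T i : i != a -> i != b -> transp a b i = i.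
    by move=> ia ib; rewrite /transp perm.tpermD// eq_sym.
  have U i : (i == a) || (i == b) -> (transp a b i == a) || (transp a b i == b).
    by rewrite /transp => /orP[]/eqP ->; rewrite ?perm.tpermL ?perm.tpermR eqxx ?orbT.
  case: q => [[[i|[i e]]|i]|e] //=; case E : ((i == a) || (i == b)) => /=;
    rewrite ?(U _ E)//; move/negbT: E; rewrite negb_or => /andP[ia ib];
    by rewrite !T// (negbTE ia) (negbTE ib).
by rewrite /covered_drop /= rank_drop_swap// /transp perm.tpermL perm.tpermR.
Qed.

Lemma pr_drop_drop : pr L (covered_drop a b `&` covered_drop b a)
  = Ex L (fun z => other_coverage z * other_coverage z).
Proof.
rewrite pr_inter_drop; last 2 first.
- exact: meas_covered_drop.
- by move=> z z'; apply: covered_drop_mix; rewrite eq_sym.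
transitivity (Ex L (fun z => other_coverage z * \1_(covered_drop a b) z)).
  by apply: eq_Ex => z; rewrite mulrC.
rewrite (Ex_resample Lmu (J := J) (meas_covered_drop a b) bdd_other_coverage).
- by apply: eq_Ex => z; rewrite other_coverage_sym.
- by move=> z; exact: pr_ge0.
- exact: other_coverage_mix.
Qed.

Definition other_variance : R := n%:R^-1 + 3 * eta + 3 * rank_error + 4 * coverage_error.

Lemma other_coverage_variance :
  Ex L (fun z => (other_coverage z - p) ^+ 2) <= other_variance.
Proof.
have ba : b != a by rewrite eq_sym.
have bg := bdd_other_coverage.
have -> : Ex L (fun z => (other_coverage z - p) ^+ 2) =
    pr L (covered_drop a b `&` covered_drop b a) - 2 * p * pr L (setT `&` covered_drop b a) + p ^+ 2.
  rewrite pr_drop_drop (pr_inter_drop measurableT)//.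
  rewrite -ExZ; last by apply: bddM => //; exact: bdd_indic.
  rewrite -ExB; [|exact: bddM|by apply: bddM; [exact: bdd_cst|apply: bddM => //; exact: bdd_indic]].
  rewrite -[X in _ = _ + X](Ex_cst L) -ExD; [|by apply: bddB; [exact: bddM|apply: bddM; [exact: bdd_cst|apply: bddM => //; exact: bdd_indic]]|exact: bdd_cst].
  apply: eq_Ex => z; rewrite indicT /=; ring.
have mA j : measurable (covered j) := meas_covered j.
have mD' i j : measurable (covered_drop i j) := meas_covered_drop i j.
have h1 := pr_swap_drop ab (mD' a b); have h2 := pr_swap_drop ba (mA a).
have h3 := pr_swap_drop ab (@measurableT _ S).
rewrite [covered_drop a b `&` covered a]setIC in h1.
have h4 := pr_joint ab.
have h5 : pr L (covered a) <= p + eta + rank_error by exact: pr_rank_lt_le.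
have h6 : p <= pr L (covered a) by exact: pr_rank_lt_ge.
rewrite setTI in h3.
have nR : (0 : R) < n%:R by rewrite ltr0n.
have x1 : pr L (covered a `&` covered b) <= 1 by apply: pr_le1; exact: measurableI.
set x := pr L (covered a `&` covered b) in h2 h4 x1.
set y := (p + eta) * pr L (covered a) + rank_error in h4.
have xy : x <= y + n%:R^-1.
  have ni0 : 0 < n%:R^-1 :> R by rewrite invr_gt0.
  case: (lerP 1 y) => hy; first by apply: (le_trans x1); apply: (le_trans hy); rewrite lerDl ltW.
  rewrite -(ler_pM2l nR) mulrDr mulfV ?lt0r_neq0//; apply: (le_trans h4).
  by rewrite -natr1 mulrDl mul1r lerD2l ltW.
have r0 : 0 <= rank_error.
  by apply: divr_ge0; [apply: addr_ge0; [rewrite invr_ge0|exact: flip0]|exact: ltW].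
have ce : 0 <= coverage_error.
  by rewrite /coverage_error; apply: addr_ge0; apply: mulr_ge0 => //; exact: ltW.
move: h1 h2 h3; rewrite !ler_norml => /andP[h1 _] /andP[h2 _] /andP[_ h3].
apply: (coverage_variance_le p0 p1 (ltW eta0) eta1 r0 ce xy h5).
  move: h1 h2; rewrite -/x; set c := coverage_error.
  set X := pr L (covered a `&` covered_drop a b).
  set Y := pr L (covered_drop a b `&` covered_drop b a).
  by clearbody c X Y x; lra.
move: h3 h6; set c := coverage_error; rewrite setTI; set X := pr L (covered_drop b a); set Y := pr L (covered a).
by clearbody c X Y; lra.
Qed.

Lemma norm_le_sqr (x s : R) : 0 < s -> `|x| <= s + x ^+ 2 / s.
Proof.
move=> s0; case: (lerP `|x| s) => h; first by rewrite (le_trans h)// lerDl divr_ge0 ?sqr_ge0 ?ltW.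
apply: (@le_trans _ _ (x ^+ 2 / s)); last by rewrite lerDr ltW.
by rewrite ler_pdivlMr// -[x ^+ 2]real_normK ?num_real// expr2 ler_wpM2l// ltW.
Qed.

(** Once the coverage of [a] is computed without [b], its probability given the
    points other than [a] and [b] is [other_coverage], because the points are
    independent; this probability is within [s] of [p] up to a Chebyshev term.
    The event [X] may depend on [b], since the deletion has made the coverage
    of [a] free of it. *)
Lemma coverage_decorrelates (X : set S) (s : R) : measurable X -> 0 < s ->
  (forall z z', X (mix (off_points (pred1 a)) z z') <-> X z) ->
  `|pr L (X `&` covered a) - p * pr L X| <= coverage_error + s + other_variance / s.
Proof.
move=> mX s0 XJ; have bg := bdd_other_coverage.
have h1 := pr_swap_drop ab mX.
apply: (@le_trans _ _ (`|pr L (X `&` covered a) - pr L (X `&` covered_drop b a)|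
   + `|pr L (X `&` covered_drop b a) - p * pr L X|)).
  by rewrite -[X in `|X|](subrKA (pr L (X `&` covered_drop b a))); exact: ler_normD.
rewrite -addrA; apply: lerD => //.
have bp : bdd_meas (fun z => other_coverage z - p) by apply: bddB => //; exact: bdd_cst.
have bX : bdd_meas (fun z : S => \1_X z : R) by exact: bdd_indic.
have -> : pr L (X `&` covered_drop b a) - p * pr L X = Ex L (fun z => \1_X z * (other_coverage z - p)).
  rewrite pr_inter_drop// -(Ex_indic L mX) -ExZ// -ExB; [|exact: bddM|by apply: bddM => //; exact: bdd_cst].
  by apply: eq_Ex => z; ring.
apply: (le_trans (Ex_norm _ _)); first exact: bddM.
have b2 : bdd_meas (fun z => (other_coverage z - p) ^+ 2).
  rewrite (_ : (fun z => _) = (fun z => (other_coverage z - p) * (other_coverage z - p))); first exact: bddM.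
  by apply/funext => z; rewrite expr2.
apply: (@le_trans _ _ (Ex L (fun z => s + s^-1 * (other_coverage z - p) ^+ 2))).
  apply: le_Ex; [by apply: bdd_norm; exact: bddM|by apply: bddD; [exact: bdd_cst|apply: bddM => //; exact: bdd_cst]|] => z.
  rewrite normrM [s^-1 * _]mulrC; apply: (le_trans _ (norm_le_sqr _ s0)).
  rewrite indicE; case: (_ \in _); rewrite /= ?normr1 ?mul1r// normr0 mul0r//.
rewrite ExD; [|exact: bdd_cst|by apply: bddM => //; exact: bdd_cst].
rewrite Ex_cst ExZ// lerD2l mulrC; apply: ler_wpM2r; first by rewrite invr_ge0 ltW.
exact: other_coverage_variance.
Qed.

End TwoPoints.

End FullConformal.

(** * The limit law of the residuals *)

(** A continuous function takes the value [p] at the point where it crosses [p]. *)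
Lemma lipschitz_crossing (R : realType) (D q p : R) (f : R -> R) : 0 <= D ->
  (forall t t', `|f t - f t'| <= D * `|t - t'|) -> (forall t, t < q -> f t <= p) ->
  (forall t, q < t -> p <= f t) -> f q = p.
Proof.
move=> D0 fD fl fr.
have small (e : R) : 0 < e -> exists2 x : R, 0 < x & D * x <= e.
  move=> e0; exists (e / (D + 1)); first by apply: divr_gt0; lra.
  rewrite mulrA ler_pdivrMr; last lra.
  by rewrite mulrDr mulr1 [D * e]mulrC; lra.
apply/eqP; rewrite eq_le; apply/andP; split; apply/ler_addgt0Pr => e /small[x x0 xe].
- have := fl (q - x); have := fD q (q - x); rewrite (_ : q - (q - x) = x); last by ring.
  rewrite (gtr0_norm x0) => h1 h2; have := ler_norm (f q - f (q - x)); have := h2 ltac:(lra).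
  lra.
- have := fr (q + x); have := fD (q + x) q; rewrite (_ : q + x - q = x); last by ring.
  rewrite (gtr0_norm x0) => h1 h2; have := ler_norm (f (q + x) - f q); have := h2 ltac:(lra).
  lra.
Qed.

Section Positive.
Context {d : measure_display} {T : measurableType d} {R : realType}.
Variable P : probability T R.

(** A bounded nonnegative function with mean zero vanishes almost surely. *)
Lemma Ex_gt0 (f : T -> R) : bdd_meas f -> (forall x, 0 <= f x) ->
  {ae P, forall x, 0 < f x} -> 0 < Ex P f.
Proof.
move=> bf f0 fp; rewrite lt_neqAle Ex_ge0// andbT eq_sym; apply/eqP => E0.
have [mf _] := bf.
have I0 : (\int[P]_(x in setT) `|(EFin \o f) x| = 0)%E.
  transitivity (\int[P]_x (f x)%:E)%E; last by rewrite ExE// E0.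
  by apply: eq_integral => x _; rewrite /= ger0_norm.
have mEf : measurable_fun setT (EFin \o f) by exact/measurable_EFinP.
have /(ae_eq_integral_abs P measurableT mEf) z0 := I0.
have [N [mN N0 NP]] : {ae P, forall x : T, False}.
  by apply: filterS2 fp z0 => x fx /(_ I) [] fx0; rewrite fx0 ltxx in fx.
have : P setT = 0%E.
  by apply/eqP; rewrite eq_le measure_ge0 andbT -N0; apply: le_measure; rewrite ?inE// => x _; apply: NP => -[].
by rewrite probability_setT => -[] /eqP; rewrite oner_eq0.
Qed.

Lemma Ex_close_ae (f g : T -> R) (r : R) : bdd_meas f -> bdd_meas g ->
  {ae P, forall x, `|f x - g x| <= r} -> 0 <= r -> `|Ex P f - Ex P g| <= r.
Proof.
move=> bf bg fg r0; rewrite -ExB//; have b := bddB bf bg; have bn := bdd_norm b.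
apply: (le_trans (Ex_norm _ b)); rewrite -lee_fin -ExE//.
apply: (@mean_le_ae _ _ _ P _ (fun=> r)) => //; last exact: mean_le_cst.
by split => //; have [] := bn.
Qed.

End Positive.

Section Sections.
Context {d1 d2 : measure_display} {T1 : measurableType d1} {T2 : measurableType d2} {R : realType}.
Variables (P1 : probability T1 R) (P2 : probability T2 R).

Lemma measurable_Ex_section (f : T1 * T2 -> R) : measurable_fun setT f -> (forall u, 0 <= f u) ->
  measurable_fun setT (fun x => Ex P2 (fun y => f (x, y))).
Proof.
move=> mf f0; apply: measurableT_comp => //.
apply: (@measurable_fun_fubini_tonelli_F _ _ _ _ R P2 (EFin \o f)); first exact/measurable_EFinP.
by move=> u; rewrite lee_fin.
Qed.

Lemma bdd_Ex_section (f : T1 * T2 -> R) : measurable_fun setT f -> (forall u, 0 <= f u <= 1) ->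
  bdd_meas (fun x => Ex P2 (fun y => f (x, y))).
Proof.
move=> mf f01; have f0 u : 0 <= f u by have /andP[] := f01 u.
split; first exact: measurable_Ex_section.
exists 1 => x; have g0 : 0 <= Ex P2 (fun y => f (x, y)) by apply: Ex_ge0.
rewrite ger0_norm// -(Ex_cst P2 1); apply: le_Ex; last by move=> y; have /andP[] := f01 (x, y).
  split; first exact: (measurableT_comp mf (measurable_pair1 x)).
  by exists 1 => y; rewrite ger0_norm//; have /andP[] := f01 (x, y).
exact: bdd_cst.
Qed.

Lemma Ex_swap (f : T1 * T2 -> R) : measurable_fun setT f -> (forall u, 0 <= f u <= 1) ->
  Ex P1 (fun x => Ex P2 (fun y => f (x, y))) = Ex P2 (fun y => Ex P1 (fun x => f (x, y))).
Proof.
move=> mf f01; have f0 u : 0 <= f u by have /andP[] := f01 u.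
have b1 x : bdd_meas (fun y => f (x, y)).
  split; first exact: (measurableT_comp mf (measurable_pair1 x)).
  by exists 1 => y; rewrite ger0_norm//; have /andP[] := f01 (x, y).
have b2 y : bdd_meas (fun x => f (x, y)).
  split; first exact: (measurableT_comp mf (measurable_pair2 y)).
  by exists 1 => x; rewrite ger0_norm//; have /andP[] := f01 (x, y).
congr fine; transitivity (\int[P1]_x \int[P2]_y (f (x, y))%:E)%E.
  by apply: eq_integral => x _; rewrite ExE.
transitivity (\int[P2]_y \int[P1]_x (f (x, y))%:E)%E; last first.
  by apply: eq_integral => y _; rewrite ExE.
apply: (@fubini_tonelli _ _ _ _ _ P1 P2 (EFin \o f)); first exact/measurable_EFinP.
by move=> u; rewrite lee_fin.
Qed.

End Sections.

Section IntervalProbMeas.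
Context {d : measure_display} {X : measurableType d} {R : realType}.
Variable nu : probability R R.

Lemma measurable_interval_prob (t s : X -> R) : measurable_fun setT t -> measurable_fun setT s ->
  measurable_fun setT (fun x => interval_prob nu (t x) (s x)).
Proof.
move=> mt ms; apply: measurableT_comp => //.
pose A : set (X * R) := [set u | `|u.2 + s u.1| <= t u.1].
have mA : measurable A.
  apply: measurable_ler; last exact: measurableT_comp.
  by apply: measurable_normr; apply: measurable_funD => //; exact: measurableT_comp.
rewrite (_ : (fun x => _) = nu \o xsection A); first exact: measurable_fun_xsection.
by apply/funext => x /=; congr (nu _); apply/seteqP; split => e; rewrite /xsection/= ?inE.
Qed.

End IntervalProbMeas.

Section LimitProb.
Context {R : realType}.
Variables (muL muE : probability R R) (M B N : R).
Hypotheses (M0 : 0 <= M)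
  (window : forall c r : R, 0 <= r -> pr muE [set e : R | `|e - c| <= r] <= 2 * M * r).
Hypotheses (B0 : 0 < B) (muL_bound : muL [set x : R | 0 < x <= B] = 1%E) (N0 : 0 < N).
Implicit Type T : R -> R.

(** The probability that [|epsilon + lambda N Z| <= T lambda]. *)
Definition limit_prob T : R :=
  Ex muL (fun l : R => Ex gauss (fun z : R => interval_prob muE (T l) (l * N * z))).

Let joint_meas T : measurable_fun setT T ->
  measurable_fun setT (fun u : R * R => interval_prob muE (T u.1) (u.1 * N * u.2)).
Proof.
move=> mT; apply: measurable_interval_prob; first exact: measurableT_comp.
by apply: measurable_funM => //; apply: measurable_funM.
Qed.

Let joint01 T (u : R * R) : 0 <= interval_prob muE (T u.1) (u.1 * N * u.2) <= 1.
Proof. exact: interval_prob01. Qed.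

Let bdd_outer T : measurable_fun setT T ->
  bdd_meas (fun l : R => Ex gauss (fun z : R => interval_prob muE (T l) (l * N * z))).
Proof. by move=> mT; exact: (bdd_Ex_section gauss (joint_meas mT) (joint01 T)). Qed.

Let bdd_inner (t s : R) : bdd_meas (fun z : R => interval_prob muE t (s * z)).
Proof.
split; first by apply: measurable_interval_prob => //; exact: measurable_funM.
by exists 1 => z; have /andP[h1 h2] := interval_prob01 muE t (s * z); rewrite ger0_norm.
Qed.

Lemma limit_prob01 T : measurable_fun setT T -> 0 <= limit_prob T <= 1.
Proof.
move=> mT; apply/andP; split.
  by apply: Ex_ge0 => l; apply: Ex_ge0 => z; have /andP[] := interval_prob01 muE (T l) (l * N * z).
rewrite -(Ex_cst muL 1); apply: le_Ex => [||l]; [exact: bdd_outer|exact: bdd_cst|].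
rewrite -(Ex_cst gauss 1); apply: le_Ex => [||z]; [exact: bdd_inner|exact: bdd_cst|].
by have /andP[] := interval_prob01 muE (T l) (l * N * z).
Qed.

Lemma positive_ae : {ae muL, forall l : R, 0 < l <= B}.
Proof.
have mr : measurable [set x : R | 0 < x <= B].
  rewrite (_ : [set x : R | _] = `]0, B]%classic); first exact: measurable_itv.
  by apply/seteqP; split => x /=; rewrite in_itv.
exists (~` [set x : R | 0 < x <= B]); split; first exact: measurableC.
  by rewrite probability_setC// muL_bound subee.
by move=> x /= h; exact: h.
Qed.

Lemma interval_prob_mono (t t' s : R) : t <= t' -> interval_prob muE t s <= interval_prob muE t' s.
Proof.
move=> tt; apply: pr_le; try exact: interval_prob_meas.
by move=> e /= h; exact: le_trans h tt.
Qed.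

Lemma interval_prob_lip_bound (t t' s : R) :
  `|interval_prob muE t s - interval_prob muE t' s| <= 4 * M * `|t - t'|.
Proof.
apply: (@le_trans _ _ (pr muE [set e : R | `| `|e + s| - t| <= `|t - t'|])); last exact: window_norm.
apply: pr_close; try exact: interval_prob_meas; first exact: window_norm_meas.
- move=> e /= h; case: (lerP `|e + s| t') => g; [by left|right].
  have -> : `| `|e + s| - t| = t - `|e + s| by rewrite distrC ger0_norm// subr_ge0.
  by have := ler_norm (t - t'); lra.
- move=> e /= h; case: (lerP `|e + s| t) => g; [by left|right].
  by have := ler_norm (t' - t); rewrite distrC; lra.
Qed.

Lemma limit_prob_close T T' (r : R) : measurable_fun setT T -> measurable_fun setT T' -> 0 <= r ->
  (forall l, 0 < l <= B -> `|T l - T' l| <= r) -> `|limit_prob T - limit_prob T'| <= 4 * M * r.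
Proof.
move=> mT mT' r0 TT; have M1 := M0; have Mr : 0 <= 4 * M * r by rewrite !mulr_ge0.
apply: Ex_close_ae => //; try exact: bdd_outer.
apply: filterS positive_ae => l lB; apply: Ex_close_ae => //; try exact: bdd_inner.
apply: aeW => z; apply: (le_trans (interval_prob_lip_bound _ _ _)).
by apply: ler_wpM2l; [rewrite mulr_ge0|exact: TT].
Qed.

Lemma limit_prob_mono T T' : measurable_fun setT T -> measurable_fun setT T' ->
  (forall l, T l <= T' l) -> limit_prob T <= limit_prob T'.
Proof.
move=> mT mT' TT; apply: le_Ex => [||l]; try exact: bdd_outer.
by apply: le_Ex => [||z]; try exact: bdd_inner; exact: interval_prob_mono.
Qed.

(** Given [lambda > 0] and [epsilon], the Gaussian variable charges every
    interval. *)
Lemma limit_prob_strict T T' : measurable_fun setT T -> measurable_fun setT T' ->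
  (forall l, 0 < l -> 0 <= T l < T' l) -> (forall l, T l <= T' l) -> limit_prob T < limit_prob T'.
Proof.
move=> mT mT' TT TT'; rewrite -subr_gt0 /limit_prob -ExB; try exact: bdd_outer.
have n0 := N0.
apply: Ex_gt0.
- by apply: bddB; exact: bdd_outer.
- by move=> l; rewrite subr_ge0; apply: le_Ex => [||z]; try exact: bdd_inner; exact: interval_prob_mono.
apply: filterS positive_ae => l /andP[l0 _]; have /andP[t0 tt] := TT l l0.
have lN : 0 < l * N by rewrite mulr_gt0.
pose A : set (R * R) := [set u | `|u.2 + l * N * u.1| <= T' l] `&` ~` [set u | `|u.2 + l * N * u.1| <= T l].
have mle (t : R) : measurable [set u : R * R | `|u.2 + l * N * u.1| <= t].
  apply: measurable_ler => //; apply: measurable_normr; apply: measurable_funD => //.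
  by apply: measurable_funM.
have mA : measurable A by apply: measurableI => //; exact: measurableC.
have f01 u : 0 <= (\1_A u : R) <= 1 by rewrite indicE; case: (_ \in _); rewrite ?lexx ler01.
have mf : measurable_fun setT (\1_A : R * R -> R) by exact: measurable_indic.
have mse (e : R) : measurable [set z : R | A (z, e)].
  by have := measurable_pair2 e measurableT mA; rewrite setTI.
have msz (z : R) : measurable [set e : R | A (z, e)].
  by have := measurable_pair1 z measurableT mA; rewrite setTI.
have -> : Ex gauss (fun z : R => interval_prob muE (T' l) (l * N * z))
    - Ex gauss (fun z : R => interval_prob muE (T l) (l * N * z))
    = Ex gauss (fun z => Ex muE (fun e => \1_A (z, e))).
  rewrite -ExB; try exact: bdd_inner.
  apply: eq_Ex => z.
  have m1 := interval_prob_meas (T' l) (l * N * z); have m2 := interval_prob_meas (T l) (l * N * z).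
  rewrite /interval_prob -!Ex_indic// -ExB; try exact: bdd_indic.
  apply: eq_Ex => e; rewrite !indicE.
  case: (boolP (`|e + l * N * z| <= T l)) => h.
    rewrite (mem_set (A := [set e : R | `|e + l * N * z| <= T l]))//.
    rewrite mem_set /=; last exact: le_trans h (ltW tt).
    by rewrite memNset ?subrr// => -[_]; apply.
  rewrite (memNset (A := [set e : R | `|e + l * N * z| <= T l])) ?subr0//; last exact/negP.
  congr (nat_of_bool _)%:R; apply/idP/idP => [/set_mem h'|/set_mem[h' _]]; apply: mem_set => //.
  by split => //; exact/negP.
rewrite (Ex_swap gauss muE mf f01); apply: Ex_gt0.
- have ms : measurable_fun setT (fun u : R * R => \1_A (u.2, u.1) : R).
    by apply: (measurableT_comp mf); exact: measurable_swap.
  exact: (bdd_Ex_section gauss ms (fun u => f01 (u.2, u.1))).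
- by move=> e; apply: Ex_ge0 => z; have /andP[] := f01 (z, e).
apply: aeW => e.
have -> : Ex gauss (fun z => \1_A (z, e) : R) = pr gauss [set z : R | A (z, e)].
  by rewrite -Ex_indic//; apply: eq_Ex => z; rewrite !indicE; congr (nat_of_bool _)%:R; apply/idP/idP => /set_mem h; exact: mem_set.
have ab : (T l - e) / (l * N) < (T' l - e) / (l * N) by rewrite ltr_pM2r ?invr_gt0// ltrD2r.
apply: (lt_le_trans (gauss_itv_gt0 ab)); apply: pr_le => //.
  rewrite (_ : [set z | _] = `](T l - e) / (l * N), (T' l - e) / (l * N)[%classic); first exact: measurable_itv.
  by apply/seteqP; split => x /=; rewrite in_itv.
move=> z /= /andP[]; rewrite ltr_pdivrMr// ltr_pdivlMr// => z1 z2.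
have e1 : T l < e + l * N * z by rewrite mulrC in z1; lra.
have e2 : e + l * N * z < T' l by rewrite mulrC in z2; lra.
rewrite /A /= ger0_norm; last by rewrite (le_trans t0)// ltW.
by split; [exact: ltW|apply/negP; rewrite -ltNge].
Qed.

Lemma limit_prob0 T : (forall l, T l <= 0) -> limit_prob T = 0.
Proof.
move=> T0; rewrite /limit_prob (eq_Ex muL (g := fun=> 0)) ?Ex_cst// => l.
rewrite (eq_Ex gauss (g := fun=> 0)) ?Ex_cst// => z.
apply/eqP; rewrite eq_le; have /andP[-> _] := interval_prob01 muE (T l) (l * N * z); rewrite andbT.
have h := window (- (l * N * z)) (lexx 0); rewrite mulr0 in h; apply: le_trans h.
apply: pr_le; [exact: interval_prob_meas|exact: window_meas|].
by move=> e /= h; rewrite opprK; exact: le_trans h (T0 l).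
Qed.


(** Fubini: the limit law of the triple is integrated over the noise first. *)
Lemma limit_law_prob T : measurable_fun setT T ->
  limit_law muL muE [set u | `|limit_error N u| <= T u.1.1] = (limit_prob T)%:E.
Proof.
move=> mT; set A := [set u : R * R * R | _].
have me : measurable_fun setT (limit_error N : R * R * R -> R).
  apply: measurable_funD; first exact: (measurableT_comp measurable_snd measurable_fst).
  apply: measurable_funM => //; apply: measurable_funM => //.
  exact: (measurableT_comp measurable_fst measurable_fst).
have mA : measurable A.
  apply: measurable_ler; first exact: measurable_normr.
  exact: (measurableT_comp mT (measurableT_comp measurable_fst measurable_fst)).
have -> : limit_law muL muE A = (prod_prob muL muE \x gauss)%E A by [].
pose f (u : R * R * R) : \bar R := (\1_A u)%:E.
have mf : measurable_fun setT f by apply/measurable_EFinP; exact: measurable_indic.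
have f0 u : (0 <= f u)%E by rewrite lee_fin.
rewrite -[in LHS](setIT A) -integral_indic//.
transitivity (\int[prod_prob muL muE]_x \int[gauss]_y f (x, y))%E; first exact: fubini_tonelli1.
have mg : measurable_fun setT (fun x => \int[gauss]_y f (x, y))%E.
  exact: (@measurable_fun_fubini_tonelli_F _ _ _ _ R gauss f mf f0).
transitivity (\int[muL]_l \int[muE]_e \int[gauss]_y f ((l, e), y))%E.
  have u0 u : (0 <= \int[gauss]_y f (u, y))%E by exact: integral_ge0.
  exact: (@fubini_tonelli1 _ _ _ _ _ muL muE _ mg u0).
rewrite -ExE; last exact: bdd_outer.
apply: eq_integral => l _.
have mfl : measurable_fun setT (fun u : R * R => f ((l, u.1), u.2)).
  apply: (measurableT_comp mf); apply: measurable_fun_pair => //.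
  by apply: measurable_fun_pair => //; exact: measurable_fst.
rewrite (@fubini_tonelli _ _ _ _ _ muE gauss (fun u => f ((l, u.1), u.2)) mfl (fun u => f0 _)) /=.
rewrite -ExE; last exact: bdd_inner.
apply: eq_integral => z _; rewrite /interval_prob -prE; last exact: interval_prob_meas.
rewrite -[in RHS](setIT [set e : R | _]) -integral_indic//; last exact: interval_prob_meas.
Qed.

Section Quantile.
Variables (c p : R).
Hypotheses (c0 : 0 < c) (p0 : 0 < p) (p1 : p < 1).

Definition band (t l : R) : R := t * (1 + 2 * l ^+ 2 * c).

Lemma measurable_band t : measurable_fun setT (band t).
Proof.
apply: measurable_funM => //; apply: measurable_funD => //; apply: measurable_funM => //.
by apply: measurable_funM => //; exact: measurable_funX.
Qed.

Lemma band_factor_ge1 (l : R) : 1 <= 1 + 2 * l ^+ 2 * c.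
Proof. by rewrite lerDl; apply: mulr_ge0; [rewrite mulr_ge0// sqr_ge0|exact: ltW]. Qed.

Lemma le_band (x t l : R) : (`|x / (1 + 2 * l ^+ 2 * c)| <= t) = (`|x| <= band t l).
Proof.
have h : 0 < 1 + 2 * l ^+ 2 * c by apply: lt_le_trans (band_factor_ge1 l).
by rewrite normf_div [X in _ / X]gtr0_norm// ler_pdivrMr.
Qed.

(** The distribution function of the limit of the training residuals. *)
Definition residual_cdf t : R := limit_prob (band t).

Lemma residual_cdf_mono t t' : t <= t' -> residual_cdf t <= residual_cdf t'.
Proof.
move=> tt; apply: limit_prob_mono; try exact: measurable_band.
by move=> l; apply: ler_wpM2r => //; apply: le_trans (band_factor_ge1 l).
Qed.

Lemma residual_cdf_strict t t' : 0 <= t -> t < t' -> residual_cdf t < residual_cdf t'.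
Proof.
move=> t0 tt; apply: limit_prob_strict; try exact: measurable_band.
- move=> l _; have h : 0 < 1 + 2 * l ^+ 2 * c by apply: lt_le_trans (band_factor_ge1 l).
  by rewrite mulr_ge0 ?(ltW h)//= ltr_pM2r.
- by move=> l; apply: ler_wpM2r (ltW tt); apply: le_trans (band_factor_ge1 l).
Qed.

Lemma residual_cdf_lip t t' :
  `|residual_cdf t - residual_cdf t'| <= 4 * M * (`|t - t'| * (1 + 2 * B ^+ 2 * c)).
Proof.
apply: limit_prob_close; try exact: measurable_band.
  by rewrite mulr_ge0//; apply: le_trans (band_factor_ge1 B).
move=> l /andP[l0 lB]; rewrite /band -mulrBl normrM [X in _ * X]ger0_norm; last first.
  by apply: le_trans (band_factor_ge1 l).
apply: ler_wpM2l => //; rewrite lerD2l; apply: ler_wpM2r; first exact: ltW.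
by apply: ler_wpM2l => //; rewrite ler_sqr ?nnegrE ?(ltW l0) ?(ltW B0).
Qed.

Lemma residual_cdf_le0 t : t <= 0 -> residual_cdf t = 0.
Proof.
move=> t0; apply: limit_prob0 => l; rewrite /band.
by apply: mulr_le0_ge0 => //; apply: le_trans (band_factor_ge1 l).
Qed.

Lemma residual_cdfE t :
  pushforward (limit_law muL muE) (fun u => `|limit_residual N c u|) [set x | x <= t]
  = (residual_cdf t)%:E.
Proof.
rewrite /pushforward -limit_law_prob; last exact: measurable_band.
by congr (limit_law _ _ _); apply/funext => u; rewrite /preimage /= /limit_residual le_band.
Qed.

(** The bands increase to the whole space. *)
Lemma residual_cdf_reaches : exists t, p < residual_cdf t.
Proof.
have p1' := p1.
pose F (m : nat) : set (R * R * R) := [set u | `|limit_error N u| <= band m%:R u.1.1].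
have mF m : measurable (F m).
  apply: measurable_ler.
    apply: measurable_normr; apply: measurable_funD; first exact: (measurableT_comp measurable_snd measurable_fst).
    apply: measurable_funM => //; apply: measurable_funM => //.
    exact: (measurableT_comp measurable_fst measurable_fst).
  exact: (measurableT_comp (measurable_band _) (measurableT_comp measurable_fst measurable_fst)).
have FT : \bigcup_m F m = setT.
  apply/seteqP; split => // u _.
  have [m mP] : exists m : nat, `|limit_error N u| <= m%:R.
    by exists (Num.truncn `|limit_error N u|).+1; rewrite ltW// truncnS_gt.
  exists m => //; apply: (le_trans mP); rewrite /band ler_peMr//; exact: band_factor_ge1.
have nF : {homo F : x y / (x <= y)%N >-> (x <= y)%O}.
  move=> x y xy; apply/subsetPset => u /= h; apply: (le_trans h); apply: ler_wpM2r.
    by apply: le_trans (band_factor_ge1 _).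
  by rewrite ler_nat.
have cv : (prod_prob (prod_prob muL muE) gauss \o F) @ \oo --> (1%E : \bar R).
  rewrite -(_ : prod_prob (prod_prob muL muE) gauss (\bigcup_m F m) = 1%E).
    exact: (@nondecreasing_cvg_mu _ _ R _ F mF (bigcupT_measurable _ mF) nF).
  by rewrite FT; exact: prod_probT.
have : \forall m \near \oo, (p%:E < prod_prob (prod_prob muL muE) gauss (F m))%E.
  have O : open [set y : \bar R | (p%:E < y)%E] by exact: open_ereal_gt_ereal.
  have p1e : (p%:E < 1)%E by rewrite lte_fin.
  exact: (cv _ (open_nbhs_nbhs (conj O p1e))).
case=> m _ /(_ m (leqnn m)) h; exists m%:R.
move: h; have -> : prod_prob (prod_prob muL muE) gauss (F m) = limit_law muL muE (F m) by [].
by rewrite limit_law_prob ?lte_fin//; exact: measurable_band.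
Qed.

Definition limit_quantile : R :=
  quantile p (pushforward (limit_law muL muE) (fun u => `|limit_residual N c u|)).

Let Q : set R := [set t : R | p <= residual_cdf t].

Let limit_quantileE : limit_quantile = inf Q.
Proof.
by rewrite /limit_quantile /quantile; congr inf; apply/funext => t; rewrite /mkset residual_cdfE lee_fin.
Qed.

Let Q_pos t : Q t -> 0 < t.
Proof.
move=> Qt; rewrite ltNge; apply/negP => /residual_cdf_le0 h.
by move: Qt; rewrite /Q /= h leNgt p0.
Qed.

Let Q_inf : has_inf Q.
Proof.
split; first by have [t tP] := residual_cdf_reaches; exists t; exact: ltW.
by exists 0 => t /Q_pos /ltW.
Qed.

Lemma residual_cdf_lt t : t < limit_quantile -> residual_cdf t < p.
Proof.
move=> tq; rewrite ltNge; apply/negP => h; move: tq; rewrite limit_quantileE ltNge.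
by move/negP; apply; apply: ge_inf => //; have [] := Q_inf.
Qed.

Lemma residual_cdf_ge t : limit_quantile < t -> p <= residual_cdf t.
Proof.
rewrite limit_quantileE => qt; have [u Qu ut] := inf_lt Q_inf.1 qt.
by apply: (le_trans Qu); apply: residual_cdf_mono; exact: ltW.
Qed.

Lemma limit_quantile_ge0 : 0 <= limit_quantile.
Proof.
rewrite limit_quantileE; apply: lb_le_inf; first by have [] := Q_inf.
by move=> t /Q_pos /ltW.
Qed.

Lemma residual_cdf_gt t : limit_quantile < t -> p < residual_cdf t.
Proof.
move=> qt; have q0 := limit_quantile_ge0.
have m1 : limit_quantile < (limit_quantile + t) / 2 by lra.
have m2 : (limit_quantile + t) / 2 < t by lra.
by apply: (le_lt_trans (residual_cdf_ge m1)); apply: residual_cdf_strict => //; lra.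
Qed.

Lemma residual_cdf_quantile : residual_cdf limit_quantile = p.
Proof.
have M1 := M0; have h1 := band_factor_ge1 B.
apply: (@lipschitz_crossing _ (4 * M * (1 + 2 * B ^+ 2 * c))).
- by rewrite !mulr_ge0//; exact: le_trans h1.
- move=> t t'; apply: (le_trans (residual_cdf_lip t t')).
  by rewrite le_eqVlt; apply/orP; left; apply/eqP; ring.
- by move=> t /residual_cdf_lt /ltW.
- by move=> t /residual_cdf_ge.
Qed.

Lemma limit_quantile_gt0 : 0 < limit_quantile.
Proof.
rewrite lt_neqAle limit_quantile_ge0 andbT; apply/eqP => q0.
by have := residual_cdf_quantile; rewrite -q0 residual_cdf_le0// => pp; have := p0; rewrite -pp ltxx.
Qed.

(** Both sides compare the same error with a quantile, but the training
    residuals are shrunk, so they have probability [p] in a wider band. *)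
Lemma limit_coverage_lt : limit_prob (fun=> limit_quantile) < p.
Proof.
rewrite -[ltRHS]residual_cdf_quantile; have q0 := limit_quantile_gt0.
have lt1 (l : R) : 0 < l -> 1 < 1 + 2 * l ^+ 2 * c.
  by move=> l0; rewrite ltrDl mulr_gt0// mulr_gt0// exprn_gt0.
apply: limit_prob_strict => //; first exact: measurable_band.
- by move=> l l0; rewrite (ltW q0)/= /band ltr_pMr// lt1.
- by move=> l; rewrite /band ler_pMr//; exact: band_factor_ge1.
Qed.

Lemma limit_coverageE p' : 1 - p' = p ->
  limit_coverage_uncorr muL muE p' N c = (limit_prob (fun=> limit_quantile))%:E.
Proof.
move=> pE; rewrite /limit_coverage_uncorr pE -/limit_quantile.
exact: (limit_law_prob (T := fun=> limit_quantile) (measurable_cst _)).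
Qed.

End Quantile.

End LimitProb.

(** * Residuals at a new point *)

Section FiberInterval.
Context {K : finType} {R : realType}.
Notation S := (sample K R).
Variables (mu : K -> probability R R) (L : probability S R).
Hypothesis Lmu : product_law mu L.
Variables (qE qL : K) (l : seq K) (e : K -> R) (T : R -> R).
Hypotheses (qEl : qE \notin l) (qLl : qL \notin l) (qEL : qE != qL) (mT : measurable_fun setT T).

Let wsum (z : S) : R := \sum_(q <- l) e q * coord q z.

Let meas_wsum : measurable_fun setT wsum.
Proof. by apply: measurable_sum => q; apply: measurable_funM => //; exact: measurable_coord. Qed.

Let wsum_upd q0 z x : q0 \notin l -> wsum (upd z q0 x) = wsum z.
Proof.
move=> ql; apply: eq_big_seq => q qql; rewrite coord_upd; case: eqP => // qq.
by rewrite -qq qql in ql.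
Qed.

(** The noise is integrated out first, then the scale is frozen, which leaves a
    weighted sum with deterministic weights. *)
Lemma pr_fiber_interval :
  pr L [set z | `|coord qE z + coord qL z * wsum z| <= T (coord qL z)]
  = Ex (mu qL) (fun lam : R => Ex L (fun z => interval_prob (mu qE) (T lam) (lam * wsum z))).
Proof.
set A := [set z | _].
have mL := @measurable_coord K R qL; have mE := @measurable_coord K R qE.
have ms : measurable_fun setT (fun z : S => coord qL z * wsum z) by exact: measurable_funM.
have mA : measurable A.
  apply: measurable_ler; last exact: measurableT_comp.
  by apply: measurable_normr; exact: measurable_funD.
congr fine; rewrite -[in LHS](setIT A) -integral_indic//.
have mI : measurable_fun setT (fun z : S => (\1_A z)%:E : \bar R).
  by apply/measurable_EFinP; exact: measurable_indic.
rewrite [LHS](resample1_int Lmu qE)//.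
pose F (z : S) : \bar R := (interval_prob (mu qE) (T (coord qL z)) (coord qL z * wsum z))%:E.
have mF : measurable_fun setT F.
  by apply/measurable_EFinP; apply: measurable_interval_prob => //; exact: measurableT_comp.
transitivity (\int[L]_z F z)%E.
  apply: eq_integral => z _.
  rewrite /F /interval_prob -prE; last exact: interval_prob_meas.
  rewrite -[in RHS](setIT [set x : R | _]) -integral_indic//; last exact: interval_prob_meas.
  apply: eq_integral => x _; rewrite !indicE; congr ((nat_of_bool _)%:R%:E).
  have E : A (upd z qE x) = (`|x + coord qL z * wsum z| <= T (coord qL z)) :> Prop.
    by rewrite /A /= wsum_upd// !coord_upd eqxx eq_sym (negbTE qEL).
  by apply/idP/idP => /set_mem h; apply: mem_set; move: h => /=; rewrite E.
rewrite (resample1_int_swap Lmu qL mF); last first.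
  by move=> z; rewrite lee_fin; have /andP[] := interval_prob01 (mu qE) (T (coord qL z)) (coord qL z * wsum z).
apply: eq_integral => lam _; rewrite -ExE; last first.
  split; first by apply: measurable_interval_prob => //; exact: measurable_funM.
  exists 1 => z; have /andP[h1 h2] := interval_prob01 (mu qE) (T lam) (lam * wsum z).
  by rewrite ger0_norm.
by apply: eq_integral => z _; rewrite /F wsum_upd// !coord_upd eqxx.
Qed.

End FiberInterval.

Section NewPoint.
Context {R : realType} {n k : nat}.
Notation K := (idx n k).
Notation S := (sample K R).
Implicit Types (i j a : 'I_n.+1) (c : 'I_k) (z : S).
Variables (muL muW muE muB : probability R R) (L : probability S R).
Hypothesis Lmu : product_law (model_law muL muW muE muB) L.
Variables (tau M B N m m' eta : R).
Hypotheses (tau0 : 0 < tau) (n0 : (0 < n)%N).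
Hypotheses (M0 : 0 <= M)
  (window : forall c r : R, 0 <= r -> pr muE [set e : R | `|e - c| <= r] <= 2 * M * r).
Hypotheses (B0 : 0 < B) (muL_bound : muL [set x : R | 0 < x <= B] = 1%E).
Hypotheses (m0 : 0 <= m) (m'0 : 0 <= m') (eta0 : 0 < eta).
Hypotheses (std_W : std_law muW m) (std_gauss : std_law (@gauss R) m').
Notation rdrop := (rdrop tau).
Notation err := (err tau).

Definition err_norm a z : R := l2norm (pbeta z - bdrop tau a z).
Definition err_cube a z : R := \sum_c `|err a c z| ^+ 3.

(** The three terms come from smoothing the interval at scale [eta], from the
    replacement of the summands by normal ones, and from the distance between
    the standard deviation of the sum and its limit. *)
Definition clt_bound a z : R :=
  16 * M * eta + 8 * M / eta ^+ 2 * (m + m') * (B ^+ 3 * err_cube a z)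
  + 4 * M * (B * `|err_norm a z - N|).

Lemma err_mix a c z1 z2 : err a c (mix (off_points (pred1 a)) z1 z2) = err a c z1.
Proof.
rewrite /err pbeta_mix ?off_points_beta// bdrop_mix// => j.
by move=> /eqP.
Qed.

Lemma err_normE a z : err_norm a z = Num.sqrt (\sum_c err a c z ^+ 2).
Proof. by congr Num.sqrt; apply: eq_bigr => c _; rewrite errE. Qed.

Let weight a z (q : K) : R := if q is inl (inl (inr ic)) then err a ic.2 z else 0.

Lemma rdrop_new a z1 z2 : rdrop a a (mix (off_points (pred1 a)) z1 z2)
  = coord (kE a) z2 + coord (kL a) z2 * \sum_(q <- row_idx a predT) weight a z1 q * coord q z2.
Proof.
rewrite rdropE sum_row_idx /row_sum /seps /slam !coord_mix /= eqxx /=.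
by congr (_ + _ * _); apply: eq_bigr => c _; rewrite err_mix /sW coord_mix /= eqxx.
Qed.

(** Given the other points, the residual of a new point is a sum of its noise
    and of a scale mixture of a weighted sum with small weights. *)
Lemma new_residual_limit a z1 (T : R -> R) : measurable_fun setT T ->
  `|pr L (mix (off_points (pred1 a)) z1 @^-1` [set z | `|rdrop a a z| <= T (slam a z)])
    - limit_prob muL muE N T| <= clt_bound a z1.
Proof.
move=> mT; have M1 := M0; have b0 := B0; have e0 := eta0; have mm := m0; have mm' := m'0.
set l := row_idx a predT : seq K; pose w := weight a z1.
have cube0 : 0 <= err_cube a z1 by apply: sumr_ge0 => c _; exact: exprn_ge0.
have -> : pr L (mix (off_points (pred1 a)) z1 @^-1` [set z | `|rdrop a a z| <= T (slam a z)])
   = Ex muL (fun lam : R => Ex L (fun z => interval_prob muE (T lam) (lam * \sum_(q <- l) w q * coord q z))).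
  have := @pr_fiber_interval _ _ _ _ Lmu (kE a) (kL a) l w T _ _ _ mT => <- //.
  - congr pr; apply/funext => z; rewrite /preimage /mkset rdrop_new.
    by rewrite /slam coord_mix /= eqxx.
  - by apply/negP => /row_idxP[c].
  - by apply/negP => /row_idxP[c].
have mw : measurable_fun setT (fun z : S => \sum_(q <- l) w q * coord q z).
  by apply: measurable_sum => q; apply: measurable_funM => //; exact: measurable_coord.
have mj : measurable_fun setT (fun u : R * S =>
    interval_prob muE (T u.1) (u.1 * \sum_(q <- l) w q * coord q u.2)).
  apply: measurable_interval_prob; first exact: measurableT_comp.
  by apply: measurable_funM => //; exact: (measurableT_comp mw measurable_snd).
have mg : measurable_fun setT (fun u : R * R => interval_prob muE (T u.1) (u.1 * N * u.2)).
  apply: measurable_interval_prob; first exact: measurableT_comp.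
  by apply: measurable_funM => //; apply: measurable_funM.
have c0 : 0 <= clt_bound a z1.
  rewrite /clt_bound !addr_ge0//; first by rewrite !mulr_ge0// ltW.
    apply: mulr_ge0; last by rewrite mulr_ge0// exprn_ge0// ltW.
    by apply: mulr_ge0; [rewrite divr_ge0 ?sqr_ge0// mulr_ge0|rewrite addr_ge0].
  by rewrite !mulr_ge0// ltW.
apply: Ex_close_ae; last exact: c0.
- by apply: (bdd_Ex_section L mj) => u; exact: interval_prob01.
- by apply: (bdd_Ex_section gauss mg) => u; exact: interval_prob01.
apply: filterS (positive_ae muL_bound) => lam /andP[l0 lB].
have := @interval_clt _ _ _ _ Lmu muE M M0 window l (fun q => lam * w q) m m' eta
  (row_idx_uniq a predT) m0 m'0 eta0 _ std_gauss (T lam) (lam * N).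
have -> : (fun z : S => interval_prob muE (T lam) (\sum_(q <- l) lam * w q * coord q z))
    = (fun z : S => interval_prob muE (T lam) (lam * \sum_(q <- l) w q * coord q z)).
  by apply/funext => z; rewrite mulr_sumr; congr interval_prob; apply: eq_bigr => q _; rewrite mulrA.
move=> h; apply: (le_trans (h _)); first by move=> q /row_idxP[c ->].
rewrite /clt_bound; apply: lerD; first apply: lerD => //.
- apply: ler_wpM2l.
    by apply: mulr_ge0; [rewrite divr_ge0 ?sqr_ge0// mulr_ge0|rewrite addr_ge0].
  rewrite sum_row_idx /err_cube mulr_sumr; apply: ler_sum => c _ /=.
  rewrite normrM exprMn; apply: ler_wpM2r; first exact: exprn_ge0.
  by rewrite ger0_norm ?(ltW l0)// lerXn2r// ?nnegrE ltW.
- apply: ler_wpM2l; first by rewrite mulr_ge0.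
  have -> : l2weight (fun q => lam * w q) l = lam * err_norm a z1.
    rewrite /l2weight sum_row_idx err_normE.
    rewrite (eq_bigr (fun c => lam ^+ 2 * err a c z1 ^+ 2)); last by move=> c _ /=; rewrite exprMn.
    by rewrite -mulr_sumr sqrtrM ?sqr_ge0// sqrtr_sqr ger0_norm// ltW.
  rewrite -mulrBr normrM (ger0_norm (ltW l0)); apply: ler_wpM2r => //.
Qed.

Variables (CU C4 delta1 delta2 s rho : R).
Hypotheses (delta2_gt0 : 0 < delta2) (s0 : 0 < s) (d10 : 0 <= delta1).
Hypothesis err2 : forall a, mean_le L (fun z => \sum_c err a c z ^+ 2) CU.
Hypothesis err4 : forall a c, mean_le L (fun z => err a c z ^+ 4) C4.
Hypothesis est : forall a, pr L [set z | delta1 < `|err_norm a z - N|] <= rho.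

Let meas_cube a : measurable_fun setT (err_cube a).
Proof.
apply: measurable_sum => c; apply: measurable_funX; apply: measurable_normr.
exact: meas_err.
Qed.

Let meas_norm a : measurable_fun setT (fun z : S => `|err_norm a z - N|).
Proof.
apply: measurable_normr; apply: measurable_funB => //.
rewrite (_ : err_norm a = fun z => Num.sqrt (\sum_c err a c z ^+ 2)); last first.
  by apply/funext => z; exact: err_normE.
apply: measurableT_comp.
  by apply: continuous_measurable_fun; exact: sqrt_continuous.
by apply: measurable_sum => c; apply: measurable_funX; exact: meas_err.
Qed.

(** Interpolation: a cube is at most [s] times the square plus [s^-1] times the
    fourth power. *)
Lemma pr_cube a : pr L [set z | delta2 <= err_cube a z] <= (s * CU + s^-1 * (k%:R * C4)) / delta2.
Proof.
have n2 : nneg_meas (fun z : S => \sum_c err a c z ^+ 2).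
  by apply: nn_sum => c; apply: nn_sqr; exact: meas_err.
have n4 : nneg_meas (fun z : S => \sum_c err a c z ^+ 4).
  by apply: nn_sum => c; apply: nn_fourth; exact: meas_err.
have si : 0 <= s^-1 by rewrite invr_ge0 ltW.
have nc : nneg_meas (err_cube a).
  by split => // z; apply: sumr_ge0 => c _; exact: exprn_ge0.
apply: pr_mean_le => //.
apply: (@mean_le_mono _ _ _ _ _ (fun z => s * (\sum_c err a c z ^+ 2) + s^-1 * \sum_c err a c z ^+ 4)) => //.
- by apply: nnD; apply: nnZ => //; exact: ltW.
- move=> z; rewrite !mulr_sumr -big_split /=; apply: ler_sum => c _.
  rewrite exprS real_normK ?num_real//.
  have := ler_wpM2r (sqr_ge0 (err a c z)) (norm_le_sqr (err a c z) s0).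
  move=> h; apply: (le_trans h); rewrite le_eqVlt; apply/orP; left; apply/eqP.
  by field; rewrite lt0r_neq0.
- apply: mean_leD; [by apply: nnZ => //; exact: ltW|exact: nnZ| |].
    by apply: mean_leZ => //; exact: ltW.
  apply: mean_leZ => //.
  have := @mean_le_sum _ _ _ L _ (index_enum 'I_k) (fun c z => err a c z ^+ 4) (fun=> C4).
  by rewrite sumr_const card_ord mulr_natl; apply => // c; apply: nn_fourth; exact: meas_err.
Qed.

Definition decorrelation_error : R :=
  16 * M * eta + 8 * M / eta ^+ 2 * (m + m') * (B ^+ 3 * delta2) + 4 * M * (B * delta1)
  + (rho + (s * CU + s^-1 * (k%:R * C4)) / delta2).

Lemma new_residual_decorrelates a (T : R -> R) (X : set S) : measurable_fun setT T ->
  measurable X -> (forall z z', X (mix (off_points (pred1 a)) z z') <-> X z) ->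
  `|pr L (X `&` [set z | `|rdrop a a z| <= T (slam a z)]) - limit_prob muL muE N T * pr L X|
    <= decorrelation_error.
Proof.
move=> mT mX XJ; set A := [set z : S | _]; set g := limit_prob _ _ _ _.
have M1 := M0; have b0 := B0; have e0 := eta0; have mm := m0; have mm' := m'0.
have mA : measurable A.
  apply: measurable_ler; last by apply: measurableT_comp => //; exact: measurable_coord.
  by apply: measurable_normr; exact: meas_rdrop.
have g01 : 0 <= g <= 1 by exact: limit_prob01.
pose f z : R := pr L (mix (off_points (pred1 a)) z @^-1` A).
have bf : bdd_meas f by exact: bdd_pr_mix.
have bX : bdd_meas (\1_X : S -> R) by exact: bdd_indic.
have bfg : bdd_meas (fun z => f z - g) by apply: bddB => //; exact: bdd_cst.
have f01 z : 0 <= f z <= 1 by rewrite pr_ge0 pr_le1//; exact: measurable_preimage_mix.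
have -> : pr L (X `&` A) - g * pr L X = Ex L (fun z => \1_X z * (f z - g)).
  rewrite (pr_resample Lmu mA mX XJ) -(Ex_indic L mX) -ExZ// -ExB; [|exact: bddM|by apply: bddM => //; exact: bdd_cst].
  by apply: eq_Ex => z; rewrite /f; ring.
apply: (le_trans (Ex_norm _ _)); first exact: bddM.
have mA1 : measurable [set z : S | delta1 < `|err_norm a z - N|] by exact: measurable_ltr.
have mA2 : measurable [set z : S | delta2 <= err_cube a z] by exact: measurable_ler.
have fg1 z : `|f z - g| <= 1 by exact: dist_unit.
have Xfg z : `|\1_X z * (f z - g)| <= `|f z - g|.
  by rewrite normrM indicE; case: (_ \in _); rewrite /= ?normr1 ?mul1r// normr0 mul0r.
apply: (le_trans (@Ex_le_pr _ _ _ L _ ([set z : S | delta1 < `|err_norm a z - N|] `|` [set z : S | delta2 <= err_cube a z])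
   (16 * M * eta + 8 * M / eta ^+ 2 * (m + m') * (B ^+ 3 * delta2) + 4 * M * (B * delta1)) _ _ _ _ _)).
- by apply: bdd_norm; exact: bddM.
- exact: measurableU.
- by move=> z; apply: (le_trans (Xfg z)).
- rewrite !addr_ge0//; first by rewrite !mulr_ge0// ltW.
    apply: mulr_ge0; last by rewrite mulr_ge0 ?ltW// exprn_gt0.
    by apply: mulr_ge0; [rewrite divr_ge0 ?sqr_ge0// mulr_ge0|rewrite addr_ge0].
  by rewrite !mulr_ge0// ltW.
- move=> z /not_orP[/negP h1 /negP h2]; apply: (le_trans (Xfg z)).
  rewrite -leNgt in h1; rewrite -ltNge in h2.
  apply: (le_trans (new_residual_limit a z mT)); rewrite /clt_bound.
  apply: lerD; first apply: lerD => //.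
    apply: ler_wpM2l; first by apply: mulr_ge0; [rewrite divr_ge0 ?sqr_ge0// mulr_ge0|rewrite addr_ge0].
    by apply: ler_wpM2l; [rewrite exprn_ge0// ltW|exact: ltW].
  by apply: ler_wpM2l; [rewrite mulr_ge0|apply: ler_wpM2l => //; exact: ltW].
rewrite /decorrelation_error lerD2l; apply: (le_trans (prU_le L mA1 mA2)).
by apply: lerD; [exact: est|exact: pr_cube].
Qed.

End NewPoint.

Section RealSteps.
Context {R : realType}.

Lemma count_gap_hi (n F D p kap g : R) : D < p * n -> F <= D -> (p + kap) * n <= g * n ->
  kap * n <= `|F - n * g|.
Proof.
move=> h1 h2; rewrite mulrDl => h3; rewrite distrC [n * g]mulrC.
by apply: (le_trans _ (ler_norm _)); lra.
Qed.

Lemma count_gap_lo (n F D p kap g : R) : p * n <= D -> D <= F -> g * n <= (p - kap) * n ->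
  kap * n <= `|F - n * g|.
Proof.
move=> h1 h2; rewrite mulrBl => h3; rewrite [n * g]mulrC.
by apply: (le_trans _ (ler_norm _)); lra.
Qed.

Lemma sandwich (u hi lo x ghi glo h r rho e : R) : u <= hi + e -> lo <= u + e ->
  `|hi - ghi * x| <= rho -> `|lo - glo * x| <= rho ->
  ghi * x <= (h + r) * x -> (h - r) * x <= glo * x -> r * x <= r ->
  `|u - h * x| <= rho + r + e.
Proof.
rewrite mulrDl mulrBl !ler_norml => h1 h2 /andP[h3 h4] /andP[h5 h6] h7 h8 h9.
by apply/andP; split; lra.
Qed.
Lemma joint_step (g d e u v x y : R) : 0 <= g -> g <= 1 -> 0 <= d -> 0 <= e ->
  `|u - v| <= d -> `|v - g * x| <= e -> `|y - x| <= d -> `|y - g| <= e ->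
  u <= g ^+ 2 + (2 * d + 2 * e).
Proof.
move=> g0 g1 d0 e0; rewrite !ler_norml => /andP[h1 h2] /andP[h3 h4] /andP[h5 h6] /andP[h7 h8].
have h9 : x <= g + e + d by lra.
have h10 := ler_wpM2l g0 h9.
have h11 : g * e <= e by rewrite ler_piMl.
have h12 : g * d <= d by rewrite ler_piMl.
by rewrite expr2; lra.
Qed.
End RealSteps.

Section Uncorrected.
Context {R : realType} {n k : nat}.
Notation K := (idx n k).
Notation S := (sample K R).
Implicit Types (i j a b : 'I_n.+1) (z : S).
Variables (muL muE : probability R R) (L : probability S R).
Variables (tau KS KA N c delta rho rho' : R).
Hypotheses (tau0 : 0 < tau) (n0 : (0 < n)%N) (c0 : 0 < c) (delta0 : 0 < delta).
Hypotheses (KS0 : 0 <= KS) (KA0 : 0 <= KA) (rho0 : 0 <= rho) (rho'0 : 0 <= rho').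
Notation rfull := (rfull tau).
Notation rdrop := (rdrop tau).
Hypothesis stability : forall i j, j != i ->
  pr L [set z | delta <= `|rfull j z - rdrop i j z|] <= KS / (n%:R * delta ^+ 2).
Hypothesis anti : forall i (t : R),
  pr L [set z | `| `|rfull i z| - t| <= delta] <= KA * delta.
Hypothesis decor : forall a (T : R -> R) (X : set S), measurable_fun setT T -> measurable X ->
  (forall z z', X (mix (off_points (pred1 a)) z z') <-> X z) ->
  `|pr L (X `&` [set z | `|rdrop a a z| <= T (slam a z)]) - limit_prob muL muE N T * pr L X| <= rho.
Hypothesis gap : forall a,
  pr L [set z | delta <= `|rfull a z - rdrop a a z / (1 + 2 * slam a z ^+ 2 * c)|] <= rho'.
Hypothesis cdf01 : forall t, 0 <= residual_cdf muL muE N c t <= 1.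
Notation G := (residual_cdf muL muE N c).

Let mf i : measurable_fun setT (rfull i : S -> R). Proof. exact: meas_rfull. Qed.
Let md i j : measurable_fun setT (rdrop i j : S -> R). Proof. exact: meas_rdrop. Qed.
Let mnf i : measurable_fun setT (fun z : S => `|rfull i z|). Proof. exact: measurable_normr. Qed.
Let mnd i j : measurable_fun setT (fun z : S => `|rdrop i j z|). Proof. exact: measurable_normr. Qed.

Definition full_below i t : set S := [set z | `|rfull i z| <= t].
Definition drop_below i j t : set S := [set z | `|rdrop i j z| <= t].

Let mfb i t : measurable (full_below i t). Proof. exact: measurable_ler. Qed.
Let mdb i j t : measurable (drop_below i j t). Proof. exact: measurable_ler. Qed.
Let mclose i t : measurable [set z : S | `| `|rfull i z| - t| <= delta].
Proof. by apply: measurable_ler => //; apply: measurable_normr; exact: measurable_funB. Qed.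
Let mgap i j : measurable [set z : S | delta <= `|rfull j z - rdrop i j z|].
Proof. by apply: measurable_ler => //; apply: measurable_normr; exact: measurable_funB. Qed.

Lemma norm_switch (x y t d : R) : `|x| <= t -> ~~ (`|y| <= t) -> ~~ (d <= `|x - y|) -> `| `|x| - t| <= d.
Proof.
rewrite -!ltNge => xt ty xyd; have := lerB_dist y x; rewrite distrC => h.
by rewrite distrC ger0_norm ?subr_ge0//; lra.
Qed.

Lemma norm_switch' (x y t d : R) : `|y| <= t -> ~~ (`|x| <= t) -> ~~ (d <= `|x - y|) -> `| `|x| - t| <= d.
Proof.
rewrite -!ltNge => yt tx xyd; have := lerB_dist x y => h.
by rewrite ger0_norm ?subr_ge0 ?(ltW tx)//; lra.
Qed.

Definition drop_error : R := KA * delta + KS / (n%:R * delta ^+ 2).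
Definition cdf_error : R := rho + (KA * delta + rho').

Lemma pr_drop_below (Y : set S) i j t : j != i -> measurable Y ->
  `|pr L (Y `&` full_below j t) - pr L (Y `&` drop_below i j t)| <= drop_error.
Proof.
move=> ji mY.
apply: (@le_trans _ _ (pr L ([set z | `| `|rfull j z| - t| <= delta] `|`
    [set z | delta <= `|rfull j z - rdrop i j z|]))).
  apply: pr_close; [exact: measurableI|exact: measurableI|exact: measurableU| |].
  - move=> z [Yz h]; case: (boolP (`|rdrop i j z| <= t)) => h1; [by left|right].
    case: (boolP (delta <= `|rfull j z - rdrop i j z|)) => h2; [by right|left].
    exact: norm_switch h h1 h2.
  - move=> z [Yz h]; case: (boolP (`|rfull j z| <= t)) => h1; [by left|right].
    case: (boolP (delta <= `|rfull j z - rdrop i j z|)) => h2; [by right|left].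
    exact: norm_switch' h h1 h2.
apply: (le_trans (prU_le L (mclose j t) (mgap i j))).
by apply: lerD; [exact: anti|exact: stability].
Qed.

Let mband a t : measurable [set z : S | `|rdrop a a z| <= band c t (slam a z)].
Proof.
apply: measurable_ler => //; apply: measurableT_comp; first exact: measurable_band.
exact: measurable_coord.
Qed.

(** By the definition of [c] the residual of [b] in the full fit is close to its
    leave-one-out residual shrunk by the factor that depends on its scale. *)
Lemma full_below_decorrelates b t (X : set S) : measurable X ->
  (forall z z', X (mix (off_points (pred1 b)) z z') <-> X z) ->
  `|pr L (X `&` full_below b t) - G t * pr L X| <= cdf_error.
Proof.
move=> mX XJ; have h1 := decor (measurable_band c t) mX XJ.
have f0 (l : R) : 0 < 1 + 2 * l ^+ 2 * c by apply: lt_le_trans (band_factor_ge1 c0 l).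
have mq : measurable_fun setT (fun z : S => rdrop b b z / (1 + 2 * slam b z ^+ 2 * c)).
  apply: measurable_funM => //; apply: measurable_inv; last by move=> z; rewrite lt0r_neq0.
  apply: measurable_funD => //; apply: measurable_funM => //; apply: measurable_funM => //.
  by apply: measurable_funX; exact: measurable_coord.
have mg : measurable [set z : S | delta <= `|rfull b z - rdrop b b z / (1 + 2 * slam b z ^+ 2 * c)|].
  by apply: measurable_ler => //; apply: measurable_normr; exact: measurable_funB.
have h2 : `|pr L (X `&` full_below b t) - pr L (X `&` [set z | `|rdrop b b z| <= band c t (slam b z)])|
    <= KA * delta + rho'.
  apply: (@le_trans _ _ (pr L ([set z | `| `|rfull b z| - t| <= delta] `|`
    [set z | delta <= `|rfull b z - rdrop b b z / (1 + 2 * slam b z ^+ 2 * c)|]))).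
    apply: pr_close; [exact: measurableI|exact: measurableI|exact: measurableU| |].
    - move=> z [Xz h]; case: (boolP (`|rdrop b b z| <= band c t (slam b z))) => g1; [by left|right].
      case: (boolP (delta <= `|rfull b z - rdrop b b z / (1 + 2 * slam b z ^+ 2 * c)|)) => g2; [by right|left].
      by rewrite -le_band// in g1; exact: norm_switch h g1 g2.
    - move=> z [Xz h]; case: (boolP (`|rfull b z| <= t)) => g1; [by left|right].
      case: (boolP (delta <= `|rfull b z - rdrop b b z / (1 + 2 * slam b z ^+ 2 * c)|)) => g2; [by right|left].
      by rewrite /= -le_band// in h; exact: norm_switch' h g1 g2.
  apply: (le_trans (prU_le L (mclose b t) mg)).
  by apply: lerD; [exact: anti|exact: gap].
rewrite /cdf_error [rho + _]addrC; apply: (le_trans _ (lerD h2 h1)).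
by apply: (le_trans _ (ler_normD _ _)); rewrite addrA subrK.
Qed.

Lemma drop_below_mix i j t z z' : j != i ->
  drop_below i j t (mix (off_points (pred1 i)) z z') <-> drop_below i j t z.
Proof. by move=> ji; rewrite /drop_below /= rdrop_mix. Qed.

Let drop0 : 0 <= drop_error.
Proof.
have h1 := KA0; have h2 := KS0; have h3 := delta0.
by rewrite /drop_error addr_ge0 ?divr_ge0 ?mulr_ge0 ?sqr_ge0// ltW.
Qed.

Let cdf0 : 0 <= cdf_error.
Proof.
have h1 := KA0; have h2 := rho0; have h3 := rho'0.
by rewrite /cdf_error !addr_ge0 ?mulr_ge0// ltW.
Qed.

Let pr_full_below j t : `|pr L (full_below j t) - G t| <= cdf_error.
Proof.
have := @full_below_decorrelates j t setT measurableT (fun _ _ => iff_refl _).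
by rewrite setTI prT mulr1.
Qed.

(** Two residuals are asymptotically independent: dropping the first point
    affects the second residual little, and the event for the second residual
    then does not depend on the first point. *)
Lemma pr_joint_below i j t : i != j ->
  pr L (full_below i t `&` full_below j t) <= G t ^+ 2 + (2 * drop_error + 2 * cdf_error).
Proof.
move=> ij; have ji : j != i by rewrite eq_sym.
have h1 := pr_drop_below t ji (mfb i t).
have h2 := @full_below_decorrelates i t (drop_below i j t) (mdb i j t)
  (fun z z' => drop_below_mix t z z' ji).
have h3 := pr_drop_below t ji (@measurableT _ S); rewrite !setTI in h3.
have h4 := pr_full_below j t.
rewrite setIC in h2; have /andP[g0 g1] := cdf01 t; have d0 := drop0; have c0' := cdf0.
exact: (joint_step g0 g1 d0 c0' h1 h2 h3 h4).
Qed.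

Let pr_drop_joint a i j t : i != j -> i != a -> j != a ->
  pr L (drop_below a i t `&` drop_below a j t) <= G t ^+ 2 + (4 * drop_error + 2 * cdf_error).
Proof.
move=> ij ia ja; have h0 := pr_joint_below t ij.
have h1 := pr_drop_below t ja (mfb i t); have h2 := pr_drop_below t ia (mdb a j t).
rewrite [drop_below a i t `&` _]setIC.
rewrite [drop_below a j t `&` full_below i t]setIC in h2.
by move: h1 h2; rewrite !ler_norml => /andP[h1 h1'] /andP[h2 h2']; lra.
Qed.

Let pr_drop_ge a i t : i != a -> G t - (drop_error + cdf_error) <= pr L (drop_below a i t).
Proof.
move=> ia; have h1 := pr_full_below i t; have h2 := pr_drop_below t ia (@measurableT _ S).
rewrite !setTI in h2.
by move: h1 h2; rewrite !ler_norml => /andP[h1 h1'] /andP[h2 h2']; lra.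
Qed.

Definition training_count a t z : R := \sum_(i | i != a) (`|rdrop a i z| <= t)%R%:R.

Definition pair_error : R := 6 * drop_error + 4 * cdf_error.

Let centered a t i z : R := if i != a then (`|rdrop a i z| <= t)%R%:R - G t else 0.

Let bdd_below a t i : bdd_meas (fun z : S => (`|rdrop a i z| <= t)%R%:R : R).
Proof. by apply: bdd_bool; exact: mdb. Qed.

Let bdd_centered a t i : bdd_meas (centered a t i).
Proof.
rewrite /centered; case: (i != a); last exact: bdd_cst.
by apply: bddB; [exact: bdd_below|exact: bdd_cst].
Qed.

Let centered_pair a t i j :
  Ex L (fun z => centered a t i z * centered a t j z) <= (i == j)%R%:R + pair_error.
Proof.
have d0 := drop0; have c0' := cdf0; have /andP[g0 g1] := cdf01 t.
have p0 : 0 <= pair_error by rewrite /pair_error; lra.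
have ip0 : 0 <= (i == j)%:R + pair_error by apply: addr_ge0.
case: (boolP (i == a)) => [ia|ia].
  rewrite (eq_Ex L (g := fun=> 0)) ?Ex_cst// => z.
  by rewrite /centered ia mul0r.
case: (boolP (j == a)) => [ja|ja].
  rewrite (eq_Ex L (g := fun=> 0)) ?Ex_cst// => z.
  by rewrite /centered ja mulr0.
case: (eqVneq i j) => [<-|ij].
  apply: (@le_trans _ _ 1); last by rewrite lerDl.
  rewrite -(Ex_cst L 1); apply: le_Ex; [exact: bddM|exact: bdd_cst|] => z.
  rewrite /centered ia; case: (`|rdrop a i z| <= t) => /=; first by nra.
  by nra.
rewrite add0r.
have -> : Ex L (fun z => centered a t i z * centered a t j z)
    = pr L (drop_below a i t `&` drop_below a j t) - G t * pr L (drop_below a i t)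
      - G t * pr L (drop_below a j t) + G t ^+ 2.
  rewrite -ExM_indic// -!Ex_indic// -!ExZ; try exact: bdd_indic.
  have bi l : bdd_meas (\1_(drop_below a l t) : S -> R) by exact: bdd_indic.
  have bz l : bdd_meas (fun z => G t * \1_(drop_below a l t) z) by apply: bddM => //; exact: bdd_cst.
  rewrite -[X in _ = _ + X](Ex_cst L) -!ExB; try by [exact: bddM|apply: bddB => //; exact: bddM|].
  rewrite -ExD; [|by apply: bddB => //; apply: bddB => //; exact: bddM|exact: bdd_cst].
  by apply: eq_Ex => z; rewrite /centered ia ja /drop_below !indic_bool; ring.
have h := pr_drop_joint t ij ia ja; have h1 := pr_drop_ge t ia; have h2 := pr_drop_ge t ja.
have q1 := ler_wpM2l g0 h1; have q2 := ler_wpM2l g0 h2.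
have : G t * cdf_error <= cdf_error by rewrite ler_piMl.
have : G t * drop_error <= drop_error by rewrite ler_piMl.
by rewrite /pair_error; nra.
Qed.

Variables (p kappa : R).
Hypotheses (kappa0 : 0 < kappa).

Definition count_error : R := (2 * n%:R^-1 + 4 * pair_error) / kappa ^+ 2.

Lemma bdd_training_count a t : bdd_meas (training_count a t).
Proof.
rewrite (_ : training_count a t = fun z => \sum_i (if i != a then (`|rdrop a i z| <= t)%R%:R else 0)).
  by apply: bdd_sum => i; case: (i != a); [exact: bdd_below|exact: bdd_cst].
by apply/funext => z; rewrite [LHS]big_mkcond.
Qed.

(** Second moment method: the indicators counted here are pairwise nearly
    uncorrelated, with nearly the same mean. *)
Lemma pr_training_count a t :
  pr L [set z | kappa * n%:R <= `|training_count a t z - n%:R * G t|] <= count_error.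
Proof.
have nR : (0 : R) < n%:R by rewrite ltr0n.
have n1 : (1 : R) <= n%:R by rewrite ler1n.
have k0 := kappa0; have kn : 0 < kappa * n%:R by rewrite mulr_gt0.
have d0 := drop0; have c0' := cdf0.
have p0 : 0 <= pair_error by rewrite /pair_error; lra.
have E z : training_count a t z - n%:R * G t = \sum_i centered a t i z.
  rewrite /training_count -(sum_others a) -sumrB [LHS]big_mkcond.
  by apply: eq_bigr => i _; rewrite /centered.
have bc := bdd_centered a t.
have b2 : bdd_meas (fun z => \sum_i \sum_j centered a t i z * centered a t j z).
  by apply: bdd_sum => i; apply: bdd_sum => j; exact: bddM.
have sq z : (training_count a t z - n%:R * G t) ^+ 2 = \sum_i \sum_j centered a t i z * centered a t j z.
  by rewrite E expr2 mulr_suml; apply: eq_bigr => i _; rewrite mulr_sumr.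
rewrite (_ : [set z | _] = [set z | (kappa * n%:R) ^+ 2 <= \sum_i \sum_j centered a t i z * centered a t j z]); last first.
  apply/funext => z; rewrite /mkset -sq -[X in _ = is_true (_ <= X)]real_normK ?num_real//.
  by rewrite ler_sqr// nnegrE ltW.
apply: (@le_trans _ _ (Ex L (fun z => \sum_i \sum_j centered a t i z * centered a t j z) / (kappa * n%:R) ^+ 2)).
  apply: pr_markov => //.
  - by move=> z; rewrite -sq sqr_ge0.
  - by rewrite exprn_gt0.
  - by apply: measurable_ler => //; have [] := b2.
apply: (@le_trans _ _ ((2 * n%:R + 4 * n%:R ^+ 2 * pair_error) / (kappa * n%:R) ^+ 2)); last first.
  rewrite /count_error le_eqVlt; apply/orP; left; apply/eqP; field.
  by rewrite !lt0r_neq0.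
apply: ler_wpM2r; first by rewrite invr_ge0 sqr_ge0.
rewrite Ex_sum => [|i]; last by apply: bdd_sum => j; exact: bddM.
apply: (@le_trans _ _ (\sum_(i < n.+1) (1 + n.+1%:R * pair_error))).
  apply: ler_sum => i _; rewrite Ex_sum => [|j]; last exact: bddM.
  apply: (@le_trans _ _ (\sum_j ((i == j)%R%:R + pair_error))); first by apply: ler_sum => j _; exact: centered_pair.
  rewrite big_split/= sumr_const card_ord mulr_natl lerD2r (bigD1 i)//= eqxx big1 ?addr0// => j ji.
  by rewrite eq_sym (negbTE ji).
rewrite sumr_const card_ord -mulr_natl -natr1.
have := ler_wpM2r p0 n1; have : 0 <= n%:R * pair_error by rewrite mulr_ge0// ltW.
have : n%:R * pair_error <= n%:R ^+ 2 * pair_error.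
  by apply: ler_wpM2r => //; rewrite expr2 ler_peMl// ltW.
by rewrite expr2; nra.
Qed.

Let mcount a t : measurable [set z | kappa * n%:R <= `|training_count a t z - n%:R * G t|].
Proof.
apply: measurable_ler => //; apply: measurable_normr; apply: measurable_funB => //.
by have [] := bdd_training_count a t.
Qed.

Variables (tlo thi h0 r : R).
Hypotheses (lo : G tlo <= p - kappa) (hi : p + kappa <= G thi)
  (hlo : h0 - r <= limit_prob muL muE N (fun=> tlo))
  (hhi : limit_prob muL muE N (fun=> thi) <= h0 + r) (r0 : 0 <= r).

Definition uncorrected a : set S := [set z | rank_drop tau a a z < p * n%:R].

Lemma meas_uncorrected a : measurable (uncorrected a).
Proof.
have [m _] := @bdd_rank_drop R n k tau tau0 n0 a a.
exact: (measurable_ltr m (measurable_cst _)).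
Qed.

(** Coverage by the uncorrected set lies between two interval events with fixed
    endpoints [tlo] and [thi], up to the events where the empirical distribution
    is off by [kappa] at one of them. *)
Lemma uncorrected_coverage a (X : set S) : measurable X ->
  (forall z z', X (mix (off_points (pred1 a)) z z') <-> X z) ->
  `|pr L (X `&` uncorrected a) - h0 * pr L X| <= rho + r + count_error.
Proof.
move=> mX XJ; have mU := meas_uncorrected a.
have nR : (0 : R) < n%:R by rewrite ltr0n.
have d1 := @decor a (fun=> thi) X (measurable_cst _) mX XJ.
have d2 := @decor a (fun=> tlo) X (measurable_cst _) mX XJ.
have q1 := pr_training_count a thi; have q2 := pr_training_count a tlo.
have s1 : pr L (X `&` uncorrected a) <= pr L (X `&` drop_below a a thi) + count_error.
  apply: (le_trans _ (lerD (lexx _) q1)); apply: pr_sub2 => //; try exact: measurableI.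
  move=> z [Xz Uz]; case: (boolP (`|rdrop a a z| <= thi)) => h; [by left|right].
  rewrite -ltNge in h; apply: (count_gap_hi Uz _ (ler_wpM2r (ltW nR) hi)).
  by apply: ler_sum => i _; apply: le_boolR => g; exact: le_lt_trans g h.
have s2 : pr L (X `&` drop_below a a tlo) <= pr L (X `&` uncorrected a) + count_error.
  apply: (le_trans _ (lerD (lexx _) q2)); apply: pr_sub2 => //; try exact: measurableI.
  move=> z [Xz Uz]; case: (boolP (rank_drop tau a a z < p * n%:R)) => h; [by left|right].
  rewrite -leNgt in h; apply: (count_gap_lo h _ (ler_wpM2r (ltW nR) lo)).
  by apply: ler_sum => i _; apply: le_boolR => g; exact: ltW (lt_le_trans g Uz).
have X0 := pr_ge0 L X; have X1 := pr_le1 L mX; have r0' := r0.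
have e3 : r * pr L X <= r by rewrite ler_piMr.
exact: (sandwich s1 s2 d1 d2 (ler_wpM2r X0 hhi) (ler_wpM2r X0 hlo) e3).
Qed.

End Uncorrected.

(** * From an arbitrary probability space to the canonical one *)

Section QuantileCount.
Context {R : realType} {I : finType}.
Variables (x : I -> R) (w p : R) (mu : set R -> \bar R).
Hypotheses (w0 : 0 < w) (wI : w * #|I|%:R = 1) (p0 : 0 < p) (p1 : p <= 1).
Hypothesis muE : forall t, mu [set u | u <= t] = (w * \sum_i (x i <= t)%R%:R)%:E.

Let Q : set R := [set t : R | (p%:E <= mu [set u | (u <= t)%R])%E].

Let QE t : Q t <-> p <= w * \sum_i (x i <= t)%R%:R.
Proof. by rewrite /Q /= muE lee_fin. Qed.

(** The distribution function jumps only at the atoms, so its values below [v]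
    are all at most the fraction of atoms strictly below [v], and this fraction
    is attained. *)
Lemma le_quantile v : (v <= quantile p mu) = (w * \sum_i (x i < v)%R%:R < p).
Proof.
have Qt t : Q t -> exists i, x i <= t.
  move=> /QE h; apply/not_existsP => H; move: h; rewrite big1 ?mulr0; first by rewrite leNgt p0.
  by move=> i _; case: (boolP (x i <= t)) => // it; case: (H i).
have Q0 : Q !=set0.
  exists (\sum_i `|x i|); apply/QE; rewrite (eq_bigr (fun=> 1)) ?sumr_const ?wI// => i _.
  rewrite (_ : (x i <= _) = true)//; apply: (le_trans (ler_norm _)).
  by rewrite (bigD1 i)//= lerDl; apply: sumr_ge0.
have Qlb : has_lbound Q.
  exists (- \sum_i `|x i|) => t /Qt[i it]; apply: (le_trans _ it).
  rewrite lerNl; apply: (le_trans (ler_norm _)); rewrite normrN.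
  by rewrite (bigD1 i)//= lerDl; apply: sumr_ge0.
apply/idP/idP => [vq|h]; last first.
  apply: lb_le_inf => // t /QE tQ; rewrite leNgt; apply/negP => tv.
  move: tQ; rewrite leNgt => /negP; apply; apply: le_lt_trans h.
  by apply: ler_wpM2l; [exact: ltW|apply: ler_sum => i _; apply: le_boolR => /le_lt_trans; apply].
rewrite ltNge; apply/negP => h.
have [i0 i0v] : exists i, x i < v.
  apply/not_existsP => H; move: h; rewrite big1 ?mulr0; first by rewrite leNgt p0.
  by move=> i _; case: (boolP (x i < v)) => // it; case: (H i).
case: (@arg_maxP _ _ _ i0 (fun i => x i < v) x i0v) => i iv imax.
have : Q (x i).
  apply/QE; apply: (le_trans h); apply: ler_wpM2l; first exact: ltW.
  by apply: ler_sum => j _; apply: le_boolR => /imax.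
by move=> /(ge_inf Qlb) => iq; move: iv; rewrite ltNge (le_trans vq).
Qed.
End QuantileCount.

Section Transfer.
Context {d : measure_display} {T : measurableType d} {R : realType}.
Variables (P : probability T R) (n k : nat).
Variables (lam : 'I_n.+1 -> T -> R) (W : 'I_n.+1 -> 'I_k -> T -> R)
          (eps : 'I_n.+1 -> T -> R) (bstar : 'I_k -> T -> R).
Variables (muL muW muE muB : probability R R).
Notation K := (idx n k).
Notation S := (sample K R).
Let Wp (ij : 'I_n.+1 * 'I_k) := W ij.1 ij.2.
Hypotheses (lam_iid : iid_family P muL lam) (W_iid : iid_family P muW Wp)
  (eps_iid : iid_family P muE eps)
  (bstar_iid : iid_family P muB (fun j w => Num.sqrt k%:R * bstar j w)).
Hypotheses (lam_W : indep_families P lam Wp)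
  (eps_indep : indep_families P eps (join_families lam Wp))
  (bstar_indep : indep_families P bstar (join_families (join_families lam Wp) eps)).
Hypotheses (n0 : (0 < n)%N) (k0 : (0 < k)%N).

Definition primitives (w : T) : S := sample_of (fun q : K =>
  match q with
  | inl (inl (inl i)) => lam i w
  | inl (inl (inr ij)) => Wp ij w
  | inl (inr i) => eps i w
  | inr c => Num.sqrt k%:R * bstar c w
  end).

Let mlam i : measurable_fun setT (lam i). Proof. by have [] := lam_iid. Qed.
Let mW ij : measurable_fun setT (Wp ij). Proof. by have [] := W_iid. Qed.
Let meps i : measurable_fun setT (eps i). Proof. by have [] := eps_iid. Qed.
Let mbs c : measurable_fun setT (fun w => Num.sqrt k%:R * bstar c w). Proof. by have [] := bstar_iid. Qed.

Lemma measurable_primitives : measurable_fun setT primitives.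
Proof.
apply: measurable_to_sample => -[[[i|ij]|i]|c].
- exact: mlam.
- exact: mW.
- exact: meps.
- exact: mbs.
Qed.

HB.instance Definition _ := isMeasurableFun.Build _ _ _ _ primitives measurable_primitives.
Definition primitive_law : probability S R := distribution P primitives.

Lemma pr_primitives A : measurable A -> pr primitive_law A = pr P (primitives @^-1` A).
Proof. by []. Qed.

Let sigma_gen (I : Type) (X : I -> T -> R) i (B : set R) : measurable B -> sigma_family X (X i @^-1` B).
Proof. by move=> mB; apply: sub_sigma_algebra; exists i, B. Qed.

Let sigma_bigcap (I : Type) (X : I -> T -> R) (J : finType) (F : J -> set T) :
  (forall j, sigma_family X (F j)) -> sigma_family X (\bigcap_(j in [set: J]) F j).
Proof.
move=> HF; pose G0 := [set A | exists i (B : set R), measurable B /\ A = X i @^-1` B].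
exact: (@fin_bigcap_measurable _ (g_sigma_algebraType G0) J setT F finite_finset (fun j _ => HF j)).
Qed.

Let sigmaI (I : Type) (X : I -> T -> R) A B :
  sigma_family X A -> sigma_family X B -> sigma_family X (A `&` B).
Proof.
move=> hA hB; pose G0 := [set A | exists i (B : set R), measurable B /\ A = X i @^-1` B].
exact: (@measurableI _ (g_sigma_algebraType G0) A B hA hB).
Qed.

Let pr_cap (I : finType) (X : I -> T -> R) (mu : probability R R) (B : I -> set R) :
  iid_family P mu X -> (forall i, measurable (B i)) ->
  P (\bigcap_(i in [set: I]) X i @^-1` B i) = (\prod_i pr mu (B i))%:E.
Proof.
move=> [mX lX iX] mB; rewrite iX// -prodEFin; apply: eq_bigr => i _.
by rewrite lX// prE.
Qed.

(** The three independence hypotheses peel off the coefficients, the noises and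
    the scales in turn; within each family the coordinates are independent. *)
Lemma primitive_law_product : product_law (model_law muL muW muE muB) primitive_law.
Proof.
move=> B mB.
pose AL := \bigcap_(i in [set: 'I_n.+1]) lam i @^-1` B (kL i).
pose AW := \bigcap_(ij in [set: 'I_n.+1 * 'I_k]) Wp ij @^-1` B (inl (inl (inr ij))).
pose AE := \bigcap_(i in [set: 'I_n.+1]) eps i @^-1` B (kE i).
pose AB := \bigcap_(c in [set: 'I_k]) (fun w => Num.sqrt k%:R * bstar c w) @^-1` B (kB c).
have E : primitives @^-1` box B = AB `&` (AE `&` (AL `&` AW)).
  apply/seteqP; split => w.
    move=> h; do !split=> //.
    - by move=> c _; exact: (h (kB c)).
    - by move=> i _; exact: (h (kE i)).
    - by move=> i _; exact: (h (kL i)).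
    - by move=> ij _; exact: (h (inl (inl (inr ij)))).
  by move=> [hB [hE [hL hW]]] [[[i|ij]|i]|c]; [exact: hL|exact: hW|exact: hE|exact: hB].
change (P (primitives @^-1` box B) = (\prod_q pr (model_law muL muW muE muB q) (B q))%:E).
rewrite E.
have jL : sigma_family (join_families lam Wp) AL.
  by apply: sigma_bigcap => i; exact: (sigma_gen (X := join_families lam Wp) (inl i)).
have jW : sigma_family (join_families lam Wp) AW.
  by apply: sigma_bigcap => ij; exact: (sigma_gen (X := join_families lam Wp) (inr ij)).
have jjL : sigma_family (join_families (join_families lam Wp) eps) AL.
  by apply: sigma_bigcap => i; exact: (sigma_gen (X := join_families (join_families lam Wp) eps) (inl (inl i))).
have jjW : sigma_family (join_families (join_families lam Wp) eps) AW.
  by apply: sigma_bigcap => ij; exact: (sigma_gen (X := join_families (join_families lam Wp) eps) (inl (inr ij))).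
have jjE : sigma_family (join_families (join_families lam Wp) eps) AE.
  by apply: sigma_bigcap => i; exact: (sigma_gen (X := join_families (join_families lam Wp) eps) (inr i)).
have sB : sigma_family bstar AB.
  apply: sigma_bigcap => c.
  rewrite (_ : _ @^-1` _ = bstar c @^-1` ((fun x : R => Num.sqrt k%:R * x) @^-1` B (kB c)))//.
  apply: sigma_gen; rewrite -[X in measurable X]setTI.
  have m : measurable_fun setT (fun x : R => Num.sqrt k%:R * x) by exact: measurable_funM.
  exact: m.
have sE : sigma_family eps AE by apply: sigma_bigcap => i; exact: sigma_gen.
have sL : sigma_family lam AL by apply: sigma_bigcap => i; exact: sigma_gen.
have sW : sigma_family Wp AW by apply: sigma_bigcap => i; exact: sigma_gen.
rewrite (bstar_indep sB (sigmaI jjE (sigmaI jjL jjW))) (eps_indep sE (sigmaI jL jW)) (lam_W sL sW).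
rewrite (pr_cap lam_iid)// (pr_cap W_iid)// (pr_cap eps_iid)// (pr_cap bstar_iid)//.
rewrite -!EFinM; congr EFin; rewrite !big_sumType /=.
ring.
Qed.

Let sk0 : Num.sqrt k%:R != 0 :> R.
Proof. by rewrite sqrtr_eq0 -ltNge ltr0n. Qed.

Lemma px_primitives i w : px i (primitives w) = covariate lam W i w.
Proof. by apply/colP => c; rewrite !mxE. Qed.

Lemma pbeta_primitives w : pbeta (primitives w) = bstar_vec bstar w.
Proof. by apply/colP => c; rewrite !mxE /sbst /coord /= mulrAC mulfV// mul1r. Qed.

Lemma py_primitives i w : py i (primitives w) = response lam W eps bstar i w.
Proof.
by rewrite /py /response -/(px i _) -/(pbeta _) px_primitives pbeta_primitives.
Qed.

Variable tau : R.
Hypothesis tau0 : 0 < tau.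

Lemma sum_train (F : 'I_n.+1 -> R) : \sum_(j | j != ord_max) F j = \sum_(i < n) F (train_ord i).
Proof.
rewrite big_mkcond big_ord_recr /= eqxx addr0; apply: eq_bigr => i _.
have -> : widen_ord (leqnSn n) i != ord_max by rewrite -val_eqE /= ltn_eqF.
by congr F; apply: val_inj.
Qed.

Lemma sum_all (F : 'I_n.+1 -> R) : \sum_j F j = \sum_(i < n) F (train_ord i) + F ord_max.
Proof. by rewrite big_ord_recr. Qed.

Lemma hat_beta_loo_primitives w :
  hat_beta_loo lam W eps bstar tau w = bdrop tau ord_max (primitives w).
Proof.
have nR : (0 : R) < n%:R by rewrite ltr0n.
have kap0 : 0 < n%:R * tau by exact: kap_drop_gt0.
apply: (@argmin_ridge _ _ _ _ _ _ _ _ n%:R^-1 _ kap0 _ (ridgeP _ _ _ kap0)).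
  by rewrite invr_gt0.
move=> b; rewrite /ridge_obj sum_train mulrDr l2norm_sqr; congr (_ + _); last first.
  by field; rewrite lt0r_neq0.
congr (_ * _); apply: eq_bigr => i _.
by rewrite /loss /trainY /trainX py_primitives px_primitives.
Qed.

Lemma hat_beta_primitives w : hat_beta lam W eps bstar tau w = bfull tau (primitives w).
Proof.
have kap0 : 0 < n.+1%:R * tau by exact: kap_full_gt0.
apply: (@argmin_ridge _ _ _ _ _ _ _ _ n.+1%:R^-1 _ kap0 _ (ridgeP _ _ _ kap0)).
  by rewrite invr_gt0.
move=> b; rewrite /ridge_obj sum_all !mulrDr l2norm_sqr; congr (_ + _ + _).
- congr (_ * _); apply: eq_bigr => i _.
  by rewrite /loss /trainY /trainX py_primitives px_primitives.
- by rewrite /loss /testY /testX py_primitives px_primitives.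
- by rewrite mulrA mulrA mulVf ?mul1r// pnatr_eq0.
Qed.

Lemma rfull_primitives i w : rfull tau i (primitives w)
  = response lam W eps bstar i w - dotp (covariate lam W i w) (hat_beta lam W eps bstar tau w).
Proof. by rewrite /rfull py_primitives px_primitives hat_beta_primitives. Qed.

Lemma rdrop_primitives i w : rdrop tau ord_max i (primitives w)
  = response lam W eps bstar i w - dotp (covariate lam W i w) (hat_beta_loo lam W eps bstar tau w).
Proof. by rewrite /rdrop py_primitives px_primitives hat_beta_loo_primitives. Qed.

Lemma estimation_error_primitives w :
  estimation_error lam W eps bstar tau w = err_norm tau ord_max (primitives w).
Proof. by rewrite /estimation_error /err_norm hat_beta_loo_primitives pbeta_primitives. Qed.

Lemma loo_residual_gap_primitives c w : loo_residual_gap lam W eps bstar tau c w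
  = rfull tau ord_max (primitives w)
    - rdrop tau ord_max ord_max (primitives w) / (1 + 2 * slam ord_max (primitives w) ^+ 2 * c).
Proof. by rewrite /loo_residual_gap rfull_primitives rdrop_primitives [X in _ - X]mulrC. Qed.

Variable alpha : R.
Hypotheses (alpha0 : 0 < alpha) (alpha1 : alpha < 1).

Let dirac_le (v t : R) : \d_v [set u : R | u <= t] = ((v <= t)%R%:R)%:E :> \bar R.
Proof. by rewrite diracE; congr ((nat_of_bool _)%:R%:E); apply/idP/idP => [/set_mem|h]; [|exact: mem_set]. Qed.

Lemma covered_full_primitives :
  covered_full lam W eps bstar tau alpha = primitives @^-1` covered tau (1 - alpha) ord_max.
Proof.
have p0 : 0 < 1 - alpha by rewrite subr_gt0.
have p1 : 1 - alpha <= 1 by rewrite gerBl ltW.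
have N0 : (0 : R) < n.+1%:R by [].
apply/funext => w; rewrite /covered_full /C_full /=.
rewrite -/(hat_beta lam W eps bstar tau w).
have r i : `|response lam W eps bstar i w - dotp (covariate lam W i w) (hat_beta lam W eps bstar tau w)|
   = `|rfull tau i (primitives w)| by rewrite rfull_primitives.
rewrite /testY /testX r.
have w0 : (0 : R) < n.+1%:R^-1 by rewrite invr_gt0.
have wI : (n.+1%:R^-1 : R) * #|'I_n.+1|%:R = 1 by rewrite card_ord mulVf// pnatr_eq0.
rewrite (@le_quantile R 'I_n.+1 (fun i => `|rfull tau i (primitives w)|) _ _ _ w0 wI p0 p1).
  by rewrite /covered /rank_lt /lt_count /= ltr_pdivrMl// mulrC.
move=> t; rewrite dirac_le sum_all mulrDr EFinD EFinM; congr (_ * _ + _)%E.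
rewrite -sumEFin; apply: eq_bigr => i _.
by rewrite /trainY /trainX r dirac_le.
Qed.

Lemma covered_uncorr_primitives :
  covered_uncorr lam W eps bstar tau alpha = primitives @^-1` uncorrected tau (1 - alpha) ord_max.
Proof.
have p0 : 0 < 1 - alpha by rewrite subr_gt0.
have p1 : 1 - alpha <= 1 by rewrite gerBl ltW.
have nR : (0 : R) < n%:R by rewrite ltr0n.
apply/funext => w; rewrite /covered_uncorr /C_uncorr /=.
rewrite -/(hat_beta_loo lam W eps bstar tau w).
have r i : `|response lam W eps bstar i w - dotp (covariate lam W i w) (hat_beta_loo lam W eps bstar tau w)|
   = `|rdrop tau ord_max i (primitives w)| by rewrite rdrop_primitives.
rewrite /testY /testX r.
have w0 : (0 : R) < n%:R^-1 by rewrite invr_gt0.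
have wI : (n%:R^-1 : R) * #|'I_n|%:R = 1 by rewrite card_ord mulVf// lt0r_neq0.
rewrite (@le_quantile R 'I_n (fun i => `|rdrop tau ord_max (train_ord i) (primitives w)|) _ _ _ w0 wI p0 p1).
  by rewrite /uncorrected /rank_drop /= sum_train ltr_pdivrMl// mulrC.
move=> t; rewrite EFinM; congr (_ * _)%E.
rewrite -sumEFin; apply: eq_bigr => i _.
by rewrite /trainY /trainX r dirac_le.
Qed.

(** The events that do not involve the test point form a sigma-algebra, which
    contains the generators. *)
Lemma train_event (A : set T) : sigma_family (train_family lam W eps bstar) A ->
  exists A' : set S, [/\ measurable A', forall z z', A' (mix (off_points (pred1 ord_max)) z z') <-> A' z &
    A = primitives @^-1` A'].
Proof.
pose C := [set A : set T | exists A' : set S, [/\ measurable A',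
  forall z z', A' (mix (off_points (pred1 ord_max)) z z') <-> A' z & A = primitives @^-1` A']].
apply: (_ : _ `<=` C); apply: smallest_sub; last first.
  move=> _ [s [B [mB ->]]].
  have tr i : train_ord i != ord_max :> 'I_n.+1 by rewrite -val_eqE /= ltn_eqF.
  case: s => [[i j]|i].
    exists ((fun z => px (train_ord i) z j 0) @^-1` B); split.
    - by rewrite -[X in measurable X]setTI; apply: meas_px.
    - by move=> z z'; rewrite /preimage /= px_mix ?off_points_keeps//; exact: tr.
    - by apply/funext => w; rewrite /preimage /= px_primitives.
  exists (py (train_ord i) @^-1` B); split.
  - by rewrite -[X in measurable X]setTI; apply: meas_py.
  - by move=> z z'; rewrite /preimage /= py_mix ?off_points_beta ?off_points_keeps//=; apply: tr.
  - by apply/funext => w; rewrite /preimage /= py_primitives.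
split.
- by exists set0; split => //; rewrite preimage_set0.
- move=> B [B' [mB' B'J ->]]; exists (~` B'); split; first exact: measurableC.
    by move=> z z'; rewrite /setC /= B'J.
  by rewrite setTD preimage_setC.
- move=> F HF; have /choice[F' HF'] : forall i, exists A' : set S, [/\ measurable A',
      forall z z', A' (mix (off_points (pred1 ord_max)) z z') <-> A' z & F i = primitives @^-1` A'].
    by move=> i; exact: HF.
  exists (\bigcup_i F' i); split.
  + by apply: bigcup_measurable => i _; have [] := HF' i.
  + by move=> z z'; split => -[i _ h]; exists i => //; have [_ J _] := HF' i; apply/(J z z').
  + by rewrite preimage_bigcup; apply: eq_bigcupr => i _; have [] := HF' i.
Qed.

Lemma train_family_measurable : [set A | exists i (B : set R), measurable B /\
  A = train_family lam W eps bstar i @^-1` B] `<=` measurable.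
Proof.
move=> A [i [B [mB ->]]].
have [A' [mA' _ ->]] : exists A' : set S, [/\ measurable A', forall z z', A' (mix (off_points (pred1 ord_max)) z z') <-> A' z &
    train_family lam W eps bstar i @^-1` B = primitives @^-1` A'].
  by apply: train_event; exact: sigma_gen.
by rewrite -[X in measurable X]setTI; exact: measurable_primitives.
Qed.

Lemma meas_preimage (A : set S) : measurable A -> measurable (primitives @^-1` A).
Proof. by move=> mA; rewrite -[X in measurable X]setTI; exact: measurable_primitives. Qed.

(** Decorrelation on the canonical space bounds the fluctuations of the
    conditional coverage. *)
Lemma coverage_deviation (E : set T) (E' : set S) (c e rho : R) : 0 < e -> measurable E' ->
  E = primitives @^-1` E' ->
  (forall X, measurable X -> (forall z z', X (mix (off_points (pred1 ord_max)) z z') <-> X z) ->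
    `|pr primitive_law (X `&` E') - c * pr primitive_law X| <= rho) ->
  pr P [set w | e < `|cond_prob P (sigma_family (train_family lam W eps bstar)) E w - c|] <= 2 * rho / e.
Proof.
move=> e0 mE' -> H; apply: cond_prob_deviation => //.
- exact: train_family_measurable.
- exact: meas_preimage.
- move=> A /train_event[A' [mA' A'J ->]]; rewrite -preimage_setI -!pr_primitives//.
    exact: H.
  exact: measurableI.
Qed.

Lemma meas_deviation (E : set T) (E' : set S) (c e : R) : measurable E' -> E = primitives @^-1` E' ->
  measurable [set w | e < `|cond_prob P (sigma_family (train_family lam W eps bstar)) E w - c|].
Proof.
move=> mE' ->; have [mh _ _] := cond_probP P train_family_measurable (meas_preimage mE').
have mh' : measurable_fun setT (cond_prob P (sigma_family (train_family lam W eps bstar)) (primitives @^-1` E')).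
  move=> _ B mB; rewrite setTI; apply: (g_sigma_sub_measurable train_family_measurable).
  exact: mh.
apply: measurable_ltr => //; apply: measurable_normr; exact: measurable_funB.
Qed.

End Transfer.

(** * Consequences of the hypotheses on the four laws *)

Section Laws.
Context {R : realType}.
Variable mu : probability R R.

Lemma fourth_of_eighth : finite_abs_moment 8 mu ->
  exists C : R, 0 <= C /\ (\int[mu]_x (x ^+ 4)%:E <= C%:E)%E.
Proof.
rewrite /finite_abs_moment => h; set I := (\int[mu]_x _)%E in h.
have I0 : (0 <= I)%E by apply: integral_ge0 => x _; rewrite lee_fin exprn_ge0.
have If : I \is a fin_num by rewrite ge0_fin_numE.
have mn : measurable_fun setT (fun x : R => `|x| ^+ 8).
  by apply: measurable_funX; exact: measurable_normr.
have n8 : nneg_meas (fun x : R => `|x| ^+ 8) by split => // x; rewrite exprn_ge0.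
exists (1 + fine I); split; first by rewrite addr_ge0// fine_ge0.
apply: (@mean_le_mono _ _ _ mu _ (fun x : R => 1 + `|x| ^+ 8)).
- exact: nn_fourth.
- by apply: nnD => //; split.
- move=> x; have -> : `|x| ^+ 8 = (x ^+ 4) ^+ 2.
    transitivity ((`|x| ^+ 2) ^+ 4); first by rewrite -exprM.
    by rewrite real_normK ?num_real// -!exprM.
  by have := sqr_ge0 (x ^+ 4 - 1); nra.
- apply: mean_leD => //; first exact: mean_le_cst.
  by rewrite /mean_le fineK.
Qed.

(** A polynomial tail of order six is enough for a finite fourth moment; it
    comes from [u ^+ 3 / 6 <= expR u]. *)
Lemma sub_gaussian_tail : sub_gaussian mu -> exists D : R, 0 <= D /\
  forall t : R, 0 < t -> pr mu [set x : R | t <= `|x|] <= D / t ^+ 6.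
Proof.
move=> [K K0 H]; exists (12 * K ^+ 6); split; first by rewrite mulr_ge0// exprn_ge0// ltW.
move=> t t0; have mt : measurable [set x : R | t <= `|x|].
  by apply: measurable_ler => //; exact: measurable_normr.
rewrite -lee_fin -prE//; apply: (le_trans (H t (ltW t0))); rewrite lee_fin.
set u := t ^+ 2 / K ^+ 2; have u0 : 0 < u by rewrite divr_gt0 ?exprn_gt0.
have h : u ^+ 3 / 6 <= expR u.
  by have := expR_ge1Dxn 2 (ltW u0); rewrite (_ : 3`!%:R = 6 :> R)//; lra.
rewrite expRN (_ : 12 * K ^+ 6 / t ^+ 6 = 2 * (u ^+ 3 / 6)^-1); last first.
  by rewrite /u; field; rewrite !lt0r_neq0.
have u3 : 0 < u ^+ 3 / 6 by rewrite divr_gt0// exprn_gt0.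
by apply: ler_wpM2l => //; rewrite lef_pV2 ?posrE ?expR_gt0.
Qed.

(** Dyadic layers: on [2 ^+ N <= `|x| < 2 ^+ N.+1] the integrand is at most
    [16 ^+ N.+1], while the tail bound gives a factor [64 ^- N]. *)
Lemma fourth_of_sub_gaussian : sub_gaussian mu ->
  exists C : R, 0 <= C /\ (\int[mu]_x (x ^+ 4)%:E <= C%:E)%E.
Proof.
move=> /sub_gaussian_tail[D [D0 H]]; exists (1 + 32 * D); split; first by lra.
pose f (N : nat) (x : R) : R := Num.min (x ^+ 4) (16 ^+ N).
have p16 (N : nat) : 0 < 16 ^+ N :> R by rewrite exprn_gt0.
have f0 N x : 0 <= f N x by rewrite le_min exprn_even_ge0//= ltW.
have mf N : measurable_fun setT (f N) by apply: measurable_minr => //; exact: measurable_funX.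
have mt (t : R) : measurable [set x : R | t <= `|x|].
  by apply: measurable_ler => //; exact: measurable_normr.
have step N x : f N.+1 x <= f N x + 16 ^+ N.+1 * (2 ^+ N <= `|x|)%R%:R.
  have e : x ^+ 4 = `|x| ^+ 4 by exact: fourth_norm.
  case: (lerP (2 ^+ N) `|x|) => h.
    rewrite mulr1; apply: (@le_trans _ _ (16 ^+ N.+1)); first by rewrite ge_min lexx orbT.
    by rewrite lerDr.
  rewrite mulr0 addr0 le_min; apply/andP; split; first by rewrite ge_min lexx.
  apply: (@le_trans _ _ (x ^+ 4)); first by rewrite ge_min lexx.
  rewrite e (_ : 16 ^+ N = (2 ^+ N) ^+ 4 :> R); last by rewrite -exprM mulnC exprM; congr (_ ^+ _); ring.
  by rewrite lerXn2r ?nnegrE ?exprn_ge0// ltW.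
pose q : R := 4^-1.
have bound N : mean_le mu (f N) (1 + 16 * D * (4 / 3 * (1 - q ^+ N))).
  elim: N => [|N IH].
    rewrite expr0 subrr !mulr0 addr0; apply: (@mean_le_mono _ _ _ mu _ (fun=> 1)) => //.
    - by move=> x; rewrite /f expr0 ge_min lexx orbT.
    - exact: mean_le_cst.
  have nb : nneg_meas (fun x : R => (2 ^+ N <= `|x|)%R%:R : R).
    by split => //; have [] := @bdd_bool _ _ R (fun x : R => 2 ^+ N <= `|x|) (mt _).
  apply: (@mean_le_mono _ _ _ mu _ (fun x : R => f N x + 16 ^+ N.+1 * (2 ^+ N <= `|x|)%R%:R)) => //.
  - by apply: nnD; [split|apply: nnZ => //; exact: ltW].
  have -> : 1 + 16 * D * (4 / 3 * (1 - q ^+ N.+1))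
     = (1 + 16 * D * (4 / 3 * (1 - q ^+ N))) + 16 ^+ N.+1 * (D / (2 ^+ N) ^+ 6).
    have -> : (2 ^+ N) ^+ 6 = 16 ^+ N * 4 ^+ N :> R.
      by rewrite -exprM mulnC exprM -exprMn; congr (_ ^+ _); ring.
    by rewrite /q !exprS exprVn; field; rewrite !lt0r_neq0 ?exprn_gt0.
  apply: mean_leD => //; first by apply: nnZ => //; exact: ltW.
  apply: (mean_leZ nb (ltW (p16 _))).
  have b := @bdd_bool _ _ R (fun x : R => 2 ^+ N <= `|x|) (mt _).
  rewrite /mean_le ExE// lee_fin Ex_bool//; apply: H; exact: exprn_gt0.
have q0 (N : nat) : 0 <= q ^+ N by rewrite exprn_ge0// invr_ge0.
have bound' N : (\int[mu]_x (f N x)%:E <= (1 + 32 * D)%:E)%E.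
  apply: (le_trans (bound N)); rewrite lee_fin lerD2l.
  have := q0 N; have : 0 <= D * q ^+ N by rewrite mulr_ge0.
  by lra.
have nd x : setT x -> {homo (fun N => (f N x)%:E) : a b / (a <= b)%N >-> (a <= b)%E}.
  move=> _ a b ab; rewrite lee_fin le_min ge_min lexx /=.
  by rewrite ge_min; apply/orP; right; rewrite ler_eXn2l// ltr1n.
have mg N : measurable_fun setT (fun x : R => (f N x)%:E) by exact/measurable_EFinP.
have cv := @cvg_monotone_convergence _ _ _ mu setT measurableT (fun N x => (f N x)%:E)
  mg (fun N x _ => f0 N x) nd.
have limE (x : R) : limn (fun N => (f N x)%:E) = (x ^+ 4)%:E.
  apply: lim_near_cst => //; exists (Num.truncn (x ^+ 4)).+1 => // N /= hN.
  rewrite /f min_l//; apply: (@le_trans _ _ N%:R).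
    by apply: (le_trans (ltW (truncnS_gt _))); rewrite ler_nat.
  have : (N < 16 ^ N)%N by exact: ltn_expl.
  by rewrite -natrX ler_nat; exact: ltnW.
rewrite (_ : (\int[mu]_x (x ^+ 4)%:E)%E = (\int[mu]_x limn (fun N => (f N x)%:E))%E).
  rewrite -(cvg_lim _ cv)//; apply: lime_le; first by apply/cvg_ex; eexists; exact: cv.
  exact: nearW.
by apply: eq_integral => x _; rewrite limE.
Qed.

Lemma window_of_density : bounded_density mu -> exists M : R, 0 <= M /\
  forall c r : R, 0 <= r -> pr mu [set e : R | `|e - c| <= r] <= 2 * M * r.
Proof.
move=> [f [M [mf fM H]]]; have M0 : 0 <= M by have /andP[] := fM 0; exact: le_trans.
exists M; split => // c r r0.
have mw := window_meas c r.
set A := [set e : R | _] in mw *; rewrite -lee_fin -prE// H//.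
apply: (@le_trans _ _ (\int[lebesgue_measure]_(x in A) M%:E)%E).
  apply: ge0_le_integral => //.
  - by move=> x _; rewrite lee_fin; have /andP[] := fM x.
  - apply/measurable_EFinP; exact: measurable_funTS.
  - by move=> x _; rewrite lee_fin; have /andP[] := fM x.
rewrite integral_cst//; apply: (@le_trans _ _ (M%:E * (2 * r)%:E)%E); last first.
  by rewrite -EFinM lee_fin le_eqVlt; apply/orP; left; apply/eqP; ring.
rewrite le_eqVlt; apply/orP; left; apply/eqP; congr (_ * _)%E.
have -> : A = `[c - r, c + r]%classic.
  apply/seteqP; split => x; rewrite /A /= in_itv /= ler_norml.
    by move=> /andP[h1 h2]; apply/andP; split; lra.
  by move=> /andP[h1 h2]; apply/andP; split; lra.
transitivity (if (c - r)%:E < (c + r)%:E then (c + r)%:E - (c - r)%:E else 0)%E.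
  exact: (lebesgue_measure_itv `[c - r, c + r]).
rewrite lte_fin; case: ltP => h; first by rewrite -EFinB; congr EFin; ring.
move: h; rewrite -subr_ge0 (_ : c - r - (c + r) = - (2 * r)); last by ring.
rewrite oppr_ge0 pmulr_rle0// => r1.
have -> : r = 0 by apply/eqP; rewrite eq_le r1 r0.
by rewrite mulr0.
Qed.

Lemma std_of_moments (C : R) : mean_zero mu -> unit_second_moment mu ->
  (\int[mu]_x (x ^+ 4)%:E <= C%:E)%E -> std_law mu (1 + C).
Proof.
move=> m1 m2 m4; split.
- exact: integrable_id m4.
- exact: integrable_sqr m4.
- by rewrite /Ex m1.
- by rewrite /Ex m2.
- exact: third_moment_int m4.
Qed.

Lemma bounded_positive_gt0 : bounded_positive mu ->
  exists B : R, 0 < B /\ mu [set x : R | 0 < x <= B] = 1%E.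
Proof.
move=> [B HB]; exists B; split => //; rewrite ltNge; apply/negP => B0.
move: HB; rewrite (_ : [set x : R | 0 < x <= B] = set0) ?measure0; last first.
  by apply/seteqP; split => // x /= /andP[x0 xB]; move: (lt_le_trans x0 (le_trans xB B0)); rewrite ltxx.
by move=> /eqP; rewrite eq_sym -[1%E]/(1%:E) eqe oner_eq0.
Qed.

End Laws.

(** * Choice of the parameters *)

Section Choices.
Context {R : realType}.
Implicit Types (a b : R).

Lemma mul_frac_le a b : 0 <= a -> 0 <= b -> a * (b / (a + 1)) <= b.
Proof.
move=> a0 b0; have a1 : 0 < a + 1 by lra.
by rewrite mulrA ler_pdivrMr// [a * b]mulrC; apply: ler_wpM2l => //; lra.
Qed.

Lemma frac_gt0 a b : 0 <= a -> 0 < b -> 0 < b / (a + 1).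
Proof. by move=> a0 b0; rewrite divr_gt0//; lra. Qed.

Lemma stability_term_le (KS delta w : R) n : 0 <= KS -> 0 < delta -> 0 <= w -> (0 < n)%N ->
  n%:R^-1 <= w * delta ^+ 2 / (KS + 1) -> KS / (n%:R * delta ^+ 2) <= w.
Proof.
move=> KS0 d0 w0 n0 h; have d2 : 0 < delta ^+ 2 by rewrite exprn_gt0.
rewrite invfM mulrA ler_pdivrMr//; apply: (le_trans (ler_wpM2l KS0 h)).
by apply: mul_frac_le => //; rewrite mulr_ge0// ltW.
Qed.

(** The window [eta] is chosen first, then the displacement [delta], which has
    to be small compared with [eta], and the sample size last. *)
Lemma full_parameters (KS KA e : R) : 0 <= KS -> 0 <= KA -> 0 < e ->
  exists eta delta s y : R, [/\ 0 < eta, eta <= 1, 0 < delta, 0 < s & 0 < y /\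
    forall n, (0 < n)%N -> n%:R^-1 <= y ->
      @coverage_error R n KS KA eta delta + s + @other_variance R n KS KA eta delta / s <= e].
Proof.
move=> KS0 KA0 e0; pose s := e / 4; have s0 : 0 < s by rewrite divr_gt0.
have [th [th0 th1 th2 th3]] : exists th : R, [/\ 0 < th, th <= 1, th <= s & th <= s * s].
  exists (Num.min 1 (Num.min s (s * s))); split.
  - by rewrite !lt_min ltr01 s0 mulr_gt0.
  - by rewrite ge_min lexx.
  - by rewrite !ge_min lexx !orbT.
  - by rewrite !ge_min lexx !orbT.
pose eta := th / 60; have eta0 : 0 < eta by rewrite divr_gt0.
pose w := eta * (th / 44); have w0 : 0 < w by rewrite mulr_gt0// divr_gt0.
have w3 : 0 < w / 3 by rewrite divr_gt0.
have KA4 : 0 <= 4 * KA by rewrite mulr_ge0.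
pose delta := w / 3 / (4 * KA + 1); have d0 : 0 < delta by exact: frac_gt0.
have w9 : 0 < w / 9 by rewrite divr_gt0.
pose y0 := w / 9 * delta ^+ 2 / (KS + 1).
have y00 : 0 < y0 by apply: frac_gt0 => //; rewrite mulr_gt0// exprn_gt0.
exists eta, delta, s, (Num.min y0 (Num.min (w / 3) (th / 4))); split => //.
  by rewrite /eta; lra.
split; first by rewrite !lt_min y00 w3 divr_gt0.
move=> n n0; rewrite !le_min => /and3P[h1 h2 h3].
have f1 : KS / (n%:R * delta ^+ 2) <= w / 9 by apply: stability_term_le => //; exact: ltW.
have f2 : 4 * KA * delta <= w / 3 by apply: mul_frac_le => //; exact: ltW.
have nR : (0 : R) < n%:R by rewrite ltr0n.
have f3 : n.+1%:R^-1 <= n%:R^-1 :> R by rewrite lef_pV2 ?posrE ?ltr0n// ler_nat.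
have r : @rank_error R n KS KA eta delta <= th / 44.
  rewrite /rank_error ler_pdivrMr// [th / 44 * eta]mulrC -/w /flip_prob.
  move: f1 f2 f3 h2; set A := KS / _; set C := 4 * KA * delta; set D := n.+1%:R^-1; set F := n%:R^-1.
  by clearbody w A C D F; lra.
have e1 : eta = th / 60 by [].
have c1 : @coverage_error R n KS KA eta delta <= th.
  by rewrite /coverage_error; move: r; set r := rank_error _ _ _ _; clearbody r eta; lra.
have v1 : @other_variance R n KS KA eta delta <= th.
  rewrite /other_variance /coverage_error; move: r h3; set r := rank_error _ _ _ _; set F := n%:R^-1.
  by clearbody r F eta; lra.
have v2 : @other_variance R n KS KA eta delta / s <= s.
  by rewrite ler_pdivrMr//; exact: le_trans v1 th3.
have se : e = 4 * s by rewrite /s; field.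
move: c1 v2; set X := coverage_error _ _ _ _; set Y := other_variance _ _ _ _ / s.
by clearbody X Y s; lra.
Qed.

(** The smoothing scale [eta] is chosen first; the bound [delta2] on the cubes
    of the weights must be small compared with [eta ^+ 2]. *)
Lemma decorrelation_parameters (M B m m' CU C5 th : R) : 0 <= M -> 0 < B -> 0 <= m -> 0 <= m' ->
  0 <= CU -> 0 <= C5 -> 0 < th ->
  exists eta delta1 delta2 s y : R, [/\ 0 < eta, 0 < delta1, 0 < delta2, 0 < s & 0 < y /\
    forall n k (C4 rho : R), (0 < n)%N -> n%:R^-1 <= y -> k%:R * C4 <= C5 * n%:R^-1 -> rho <= th / 5 ->
      @decorrelation_error R k M B m m' eta CU C4 delta1 delta2 s rho <= th].
Proof.
move=> M0 B0 m0 m'0 CU0 C50 th0; have t5 : 0 < th / 5 by rewrite divr_gt0.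
have M16 : 0 <= 16 * M by rewrite mulr_ge0.
pose eta := th / 5 / (16 * M + 1); have eta0 : 0 < eta by exact: frac_gt0.
pose D := 8 * M / eta ^+ 2 * (m + m') * B ^+ 3.
have D0 : 0 <= D.
  apply: mulr_ge0; last by rewrite exprn_ge0// ltW.
  by apply: mulr_ge0; [rewrite divr_ge0 ?sqr_ge0// mulr_ge0|rewrite addr_ge0].
pose delta2 := th / 5 / (D + 1); have d20 : 0 < delta2 by exact: frac_gt0.
have MB : 0 <= 4 * M * B by rewrite !mulr_ge0// ltW.
pose delta1 := th / 5 / (4 * M * B + 1); have d10 : 0 < delta1 by exact: frac_gt0.
have td : 0 < th * delta2 / 10 by rewrite divr_gt0// mulr_gt0.
pose s := th * delta2 / 10 / (CU + 1); have s0 : 0 < s by exact: frac_gt0.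
have st : 0 < s * (th * delta2 / 10) by rewrite mulr_gt0.
pose y := s * (th * delta2 / 10) / (C5 + 1); have y0 : 0 < y by exact: frac_gt0.
exists eta, delta1, delta2, s, y; split => //; split => // n k C4 rho n0 ny kC rh.
have h1 : 16 * M * eta <= th / 5 by apply: mul_frac_le => //; exact: ltW.
have h2 : D * delta2 <= th / 5 by apply: mul_frac_le => //; exact: ltW.
have h3 : 4 * M * B * delta1 <= th / 5 by apply: mul_frac_le => //; exact: ltW.
have h4 : CU * s <= th * delta2 / 10 by apply: mul_frac_le => //; exact: ltW.
have h5 : k%:R * C4 <= s * (th * delta2 / 10).
  apply: (le_trans kC); apply: (le_trans (ler_wpM2l C50 ny)).
  by apply: mul_frac_le => //; exact: ltW.
have h6 : (s * CU + s^-1 * (k%:R * C4)) / delta2 <= th / 5.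
  rewrite ler_pdivrMr//; have : s^-1 * (k%:R * C4) <= th * delta2 / 10 by rewrite ler_pdivrMl.
  by rewrite [s * CU]mulrC; lra.
rewrite /decorrelation_error.
have -> : 8 * M / eta ^+ 2 * (m + m') * (B ^+ 3 * delta2) = D * delta2 by rewrite /D; ring.
have -> : 4 * M * (B * delta1) = 4 * M * B * delta1 by ring.
by lra.
Qed.

Lemma inv_nat_eventually (y : R) : 0 < y -> \forall n \near \oo, (n%:R^-1 : R) <= y.
Proof.
move=> y0; exists (Num.truncn (y^-1)).+1 => // n /= hn.
have h : y^-1 <= n%:R by apply: (le_trans (ltW (truncnS_gt _))); rewrite ler_nat.
have n0 : (0 : R) < n%:R by apply: lt_le_trans h; rewrite invr_gt0.
by rewrite -[y]invrK lef_pV2 ?posrE ?invr_gt0.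
Qed.

(** The constant is [98 = 2 + 4 * (6 * 2 + 4 * 3)]: [drop_error] is at most
    [2 * th] and [cdf_error] at most [3 * th]. *)
Lemma count_error_le (KS KA delta rho rho' kappa th x : R) n : 0 < kappa ->
  rho <= th -> KA * delta <= th -> KS / (n%:R * delta ^+ 2) <= th -> rho' <= th ->
  n%:R^-1 <= th -> 98 * th <= x * kappa ^+ 2 ->
  @count_error R n KS KA delta rho rho' kappa <= x.
Proof.
move=> k0 h1 h2 h3 h4 h5 h6; rewrite /count_error ler_pdivrMr ?exprn_gt0//.
by apply: le_trans h6; rewrite /pair_error /drop_error /cdf_error; lra.
Qed.

End Choices.

Section ProbabilityLimits.
Context {R : realType}.
Variables (disp : nat -> measure_display) (T : forall n, measurableType (disp n))
  (P : forall n, probability (T n) R) (A : forall n, set (T n)).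

Lemma cvg_pr0 : (forall e : R, 0 < e -> \forall n \near \oo, measurable (@A n) /\ pr (P n) (@A n) <= e) ->
  (fun n => P n (@A n)) @ \oo --> (0 : \bar R).
Proof.
move=> H; apply/fine_cvgP; split.
  by apply: filterS (H 1 ltr01) => n [mA _]; exact: fin_num_measure.
apply/cvgrPdist_le => e /H; apply: filterS => n [_ h].
by rewrite /= sub0r normrN ger0_norm ?pr_ge0.
Qed.

Lemma pr_cvg0 : (fun n => P n (@A n)) @ \oo --> (0 : \bar R) ->
  forall e : R, 0 < e -> \forall n \near \oo, pr (P n) (@A n) <= e.
Proof.
move=> /fine_cvgP[_ /cvgrPdist_le H] e /H; apply: filterS => n /=.
by rewrite sub0r normrN => h; exact: le_trans (ler_norm _) h.
Qed.

End ProbabilityLimits.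

(** * Bounds for a fixed sample size *)

Section FixedSize.
Context {d : measure_display} {T : measurableType d} {R : realType}.
Variables (P : probability T R) (n k : nat).
Variables (lam : 'I_n.+1 -> T -> R) (W : 'I_n.+1 -> 'I_k -> T -> R)
          (eps : 'I_n.+1 -> T -> R) (bstar : 'I_k -> T -> R).
Variables (muL muW muE muB : probability R R).
Let Wp (ij : 'I_n.+1 * 'I_k) := W ij.1 ij.2.
Hypotheses (lam_iid : iid_family P muL lam) (W_iid : iid_family P muW Wp)
  (eps_iid : iid_family P muE eps)
  (bstar_iid : iid_family P muB (fun j w => Num.sqrt k%:R * bstar j w)).
Hypotheses (lam_W : indep_families P lam Wp)
  (eps_indep : indep_families P eps (join_families lam Wp))
  (bstar_indep : indep_families P bstar (join_families (join_families lam Wp) eps)).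
Hypotheses (n0 : (0 < n)%N) (k0 : (0 < k)%N).
Variables (B CW CE CB tau M m' Gam alpha : R).
Hypotheses (B0 : 0 < B) (muL_bound : muL [set x : R | 0 < x <= B] = 1%E).
Hypotheses (CW0 : 0 <= CW) (W4 : (\int[muW]_x (x ^+ 4)%:E <= CW%:E)%E)
  (mean_W : mean_zero muW) (var_W : unit_second_moment muW).
Hypotheses (CE0 : 0 <= CE) (E4 : (\int[muE]_x (x ^+ 4)%:E <= CE%:E)%E)
  (CB0 : 0 <= CB) (B4 : (\int[muB]_x (x ^+ 4)%:E <= CB%:E)%E).
Hypotheses (tau0 : 0 < tau) (M0 : 0 <= M)
  (window : forall c r : R, 0 <= r -> pr muE [set e : R | `|e - c| <= r] <= 2 * M * r).
Hypotheses (m'0 : 0 <= m') (std_gauss : std_law (@gauss R) m').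
Hypotheses (Gam0 : 0 <= Gam) (kn : k%:R <= Gam * n%:R :> R) (nk : n%:R <= Gam * k%:R :> R).
Hypotheses (alpha0 : 0 < alpha) (alpha1 : alpha < 1).

Let L := primitive_law lam_iid W_iid eps_iid bstar_iid.
Let Lmu : product_law (model_law muL muW muE muB) L.
Proof. exact: primitive_law_product. Qed.

Let stdW : std_law muW (1 + CW). Proof. exact: std_of_moments. Qed.
Let W1 : Ex muW (fun x => x) = 0. Proof. by have [] := stdW. Qed.
Let W2 : Ex muW (fun x => x ^+ 2) = 1. Proof. by have [] := stdW. Qed.

Definition stability_const : R := stability_sum B CW CE CB tau.
Definition density_const : R := 8 * M * (1 + B ^+ 2 * Gam / tau).

Lemma response_const_ge0 : 0 <= response_const B CW CE CB.
Proof. by have b0 := ltW B0; rewrite /response_const !(mulr_ge0, addr_ge0). Qed.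

Lemma error_const_ge0 : 0 <= error_const B CW CE CB tau.
Proof.
have h := response_const_ge0; have t0 := ltW tau0.
by rewrite /error_const; apply: addr_ge0; apply: mulr_ge0 => //; rewrite ?divr_ge0 ?addr_ge0.
Qed.

Lemma stability_const_ge0 : 0 <= stability_const.
Proof.
have h := response_const_ge0; have h2 := error_const_ge0.
rewrite /stability_const /stability_sum /loo_residual_const; apply: addr_ge0; apply: addr_ge0 => //; first exact: addr_ge0.
by rewrite mulr_ge0// sqr_ge0.
Qed.

Lemma density_const_ge0 : 0 <= density_const.
Proof.
have t0 := ltW tau0; apply: mulr_ge0; first exact: mulr_ge0.
by apply: addr_ge0 => //; rewrite divr_ge0// mulr_ge0// sqr_ge0.
Qed.

Let stability i j (delta : R) : j != i -> 0 < delta ->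
  pr L [set z | delta <= `|rfull tau j z - rdrop tau i j z|] <= stability_const / (n%:R * delta ^+ 2).
Proof. exact: (pr_stability Lmu B0 muL_bound CW0 W4 W1 W2 E4 B4 n0 k0 tau0). Qed.

Let anti i (t : sample (idx n k) R -> R) (delta : R) : measurable_fun setT t ->
  (forall z x, t (upd z (kE i) x) = t z) -> 0 <= delta ->
  pr L [set z | `| `|rfull tau i z| - t z| <= delta] <= density_const * delta.
Proof.
move=> mt tJ d0; have nR : (0 : R) < n%:R by rewrite ltr0n.
apply: (le_trans (anti_concentration Lmu muL_bound W4 W2 tau0 M0 window mt tJ d0)).
have M1 := M0; rewrite /density_const mulrAC; apply: ler_wpM2r => //.
apply: ler_wpM2l; first exact: mulr_ge0.
rewrite lerD2l invfM mulrA; apply: ler_wpM2r; first by rewrite invr_ge0 ltW.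
rewrite -mulrA; apply: ler_wpM2l; first exact: sqr_ge0.
rewrite ler_pdivrMr ?ltr0n//; apply: (le_trans kn); apply: ler_wpM2l => //.
by rewrite ler_nat.
Qed.

Lemma full_deviation (e eta delta s : R) : 0 < e -> 0 < eta -> eta <= 1 -> 0 < delta -> 0 < s ->
  let A := [set w | e < `|cond_coverage_full P lam W eps bstar tau alpha w - (1 - alpha)|] in
  measurable A /\ pr P A <= 2 * (@coverage_error R n stability_const density_const eta delta + s
    + @other_variance R n stability_const density_const eta delta / s) / e.
Proof.
move=> e0 eta0 eta1 d0 s0 A.
have cE := covered_full_primitives lam W eps bstar k0 tau0 alpha0 alpha1.
have mE := @meas_covered R n k tau tau0 (1 - alpha) ord_max.
split; first exact: (@meas_deviation _ _ _ P n k lam W eps bstar muL muW muE muB lam_iid W_iid eps_iid bstar_iid k0 _ _ _ _ mE cE).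
apply: (@coverage_deviation _ _ _ P n k lam W eps bstar muL muW muE muB lam_iid W_iid eps_iid bstar_iid k0 _ _ _ _ _ e0 mE cE) => X mX XJ.
have ab : ord_max != ord0 :> 'I_n.+1 by rewrite -val_eqE /= -lt0n.
have p0 : 0 <= 1 - alpha by rewrite subr_ge0 ltW.
have p1 : 1 - alpha <= 1 by rewrite gerBl ltW.
exact: (coverage_decorrelates Lmu tau0 n0 stability_const_ge0 density_const_ge0 stability anti
  p0 p1 eta0 eta1 d0 ab mX s0 XJ).
Qed.

(** A common constant for the sums of the fourth moments of the estimation
    errors, which are of order [1 / n] when [k] and [n] are comparable. *)
Definition fourth_const : R :=
  Gam * (8 * ((3 * CW + 4) * (B ^+ 4 * (2 * response_const B CW CE CB))) / tau ^+ 4 + 8 * CB).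

Lemma fourth_const_ge0 : 0 <= fourth_const.
Proof.
have h := response_const_ge0; have t0 := ltW tau0; have b0 := ltW B0.
apply: mulr_ge0 => //; apply: addr_ge0; last exact: mulr_ge0.
by rewrite divr_ge0 ?exprn_ge0// !(mulr_ge0, addr_ge0)// exprn_ge0.
Qed.

Lemma fourth_const_le : k%:R * @err_fourth_bound R n k B CW CE CB tau <= fourth_const * n%:R^-1.
Proof.
have h := response_const_ge0; have b0 := ltW B0.
have nR : (0 : R) < n%:R by rewrite ltr0n.
have kR : (0 : R) < k%:R by rewrite ltr0n.
have nz : n%:R != 0 :> R by rewrite lt0r_neq0.
have kz : k%:R != 0 :> R by rewrite lt0r_neq0.
have tz : tau != 0 by rewrite lt0r_neq0.
rewrite /err_fourth_bound /fourth_const.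
set X := (3 * CW + 4) * (B ^+ 4 * (2 * response_const B CW CE CB)).
have X0 : 0 <= X by rewrite /X !(mulr_ge0, addr_ge0)// exprn_ge0.
have -> : k%:R * (8 * ((3 * CW + 4) * (B ^+ 4 * (2 * response_const B CW CE CB) / (n%:R ^+ 2 * tau ^+ 4)) + k%:R ^- 2 * CB))
    = 8 * X / tau ^+ 4 * (k%:R / n%:R ^+ 2) + 8 * CB * k%:R^-1.
  by rewrite /X; field; rewrite nz tz kz.
have -> : Gam * (8 * X / tau ^+ 4 + 8 * CB) * n%:R^-1
    = 8 * X / tau ^+ 4 * (Gam / n%:R) + 8 * CB * (Gam / n%:R) by field; rewrite nz tz.
apply: lerD.
  apply: ler_wpM2l; first by rewrite divr_ge0 ?exprn_ge0 ?(ltW tau0)// mulr_ge0.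
  by rewrite ler_pdivrMr ?exprn_gt0// expr2 mulrA divfK.
apply: ler_wpM2l; first exact: mulr_ge0.
by rewrite ler_pdivlMr// mulrC ler_pdivrMr.
Qed.

Section Uncorrected.
Variables (N c : R).
Hypotheses (N0 : 0 < N) (c0 : 0 < c).
Notation G := (residual_cdf muL muE N c).

Let swap_all (A : 'I_n.+1 -> set (sample (idx n k) R)) (r : R) :
  (forall a, measurable (A a)) ->
  (forall s a z, involutive s -> A a (reindex (swap_idx s) z) <-> A (s a) z) ->
  pr L (A ord_max) <= r -> forall a, pr L (A a) <= r.
Proof.
move=> mA As h a; pose s x := perm.fun_of_perm (perm.tperm ord_max a) x.
have sK : involutive s by exact: perm.tpermK.
apply: le_trans h; rewrite [leRHS](exchange_model Lmu sK (mA _)).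
rewrite (_ : reindex (swap_idx s) @^-1` A ord_max = A a)//.
by apply/funext => z; apply/propext; rewrite /preimage /= As// /s perm.tpermL.
Qed.

Lemma uncorrected_deviation (e eta delta1 delta2 s delta kappa r rho1 rho2 tlo thi h0 : R) :
  0 < e -> 0 < eta -> 0 < delta1 -> 0 < delta2 -> 0 < s -> 0 < delta -> 0 < kappa -> 0 <= r ->
  pr P [set w | delta1 < `|estimation_error lam W eps bstar tau w - N|] <= rho1 ->
  pr P [set w | delta / 2 < `|loo_residual_gap lam W eps bstar tau c w - 0|] <= rho2 ->
  G tlo <= 1 - alpha - kappa -> 1 - alpha + kappa <= G thi ->
  h0 - r <= limit_prob muL muE N (fun=> tlo) -> limit_prob muL muE N (fun=> thi) <= h0 + r ->
  let rho := @decorrelation_error R k M B (1 + CW) m' eta (error_const B CW CE CB tau)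
    (@err_fourth_bound R n k B CW CE CB tau) delta1 delta2 s rho1 in
  let A := [set w | e < `|cond_coverage_uncorr P lam W eps bstar tau alpha w - h0|] in
  measurable A /\ pr P A <= 2 * (rho + r
    + @count_error R n stability_const density_const delta rho rho2 kappa) / e.
Proof.
move=> e0 eta0 d10 d20 s0 d0 kap0 r0 est gap lo hi hlo hhi rho A.
have cE := covered_uncorr_primitives lam W eps bstar n0 k0 tau0 alpha0 alpha1.
have mE := @meas_uncorrected R n k tau tau0 n0 (1 - alpha) ord_max.
split; first exact: (@meas_deviation _ _ _ P n k lam W eps bstar muL muW muE muB lam_iid W_iid eps_iid bstar_iid k0 _ _ _ _ mE cE).
apply: (@coverage_deviation _ _ _ P n k lam W eps bstar muL muW muE muB lam_iid W_iid eps_iid bstar_iid k0 _ _ _ _ _ e0 mE cE) => X mX XJ.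
have CW1 : 0 <= 1 + CW by rewrite addr_ge0.
have f0 (l : R) : 0 < 1 + 2 * l ^+ 2 * c by apply: lt_le_trans (band_factor_ge1 c0 l).
have mn a : measurable_fun setT (fun z : sample (idx n k) R => `|err_norm tau a z - N|).
  apply: measurable_normr; apply: measurable_funB => //.
  rewrite (_ : err_norm tau a = fun z => Num.sqrt (\sum_c0 err tau a c0 z ^+ 2)); last first.
    by apply/funext => z; exact: err_normE.
  apply: measurableT_comp; first by apply: continuous_measurable_fun; exact: sqrt_continuous.
  by apply: measurable_sum => c'; apply: measurable_funX; exact: meas_err.
have mq a : measurable_fun setT (fun z : sample (idx n k) R =>
    `|rfull tau a z - rdrop tau a a z / (1 + 2 * slam a z ^+ 2 * c)|).
  apply: measurable_normr; apply: measurable_funB; first exact: meas_rfull.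
  apply: measurable_funM; first exact: meas_rdrop.
  apply: measurable_inv; last by move=> z; rewrite lt0r_neq0.
  apply: measurable_funD => //; apply: measurable_funM => //; apply: measurable_funM => //.
  by apply: measurable_funX; exact: measurable_coord.
have est' a : pr L [set z | delta1 < `|err_norm tau a z - N|] <= rho1.
  apply: (swap_all (A := fun a => [set z | delta1 < `|err_norm tau a z - N|])) => //.
  - by move=> b; exact: measurable_ltr.
  - by move=> s' b z sK; rewrite /err_norm /= pbeta_swap bdrop_swap.
  - rewrite pr_primitives; last exact: measurable_ltr.
    apply: le_trans est; rewrite le_eqVlt; apply/orP; left; apply/eqP; congr pr.
    by apply/funext => w; rewrite /preimage /= (estimation_error_primitives lam W eps bstar n0 k0 tau0).
have gap' a : pr L [set z | delta <= `|rfull tau a z - rdrop tau a a z / (1 + 2 * slam a z ^+ 2 * c)|] <= rho2.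
  apply: (swap_all (A := fun a => [set z | delta <= `|rfull tau a z - rdrop tau a a z / (1 + 2 * slam a z ^+ 2 * c)|])) => //.
  - by move=> b; exact: measurable_ler.
  - by move=> s' b z sK; rewrite /= rfull_swap// rdrop_swap.
  - apply: le_trans gap; rewrite (_ : [set w | _] = primitives lam W eps bstar @^-1`
      [set z | delta / 2 < `|rfull tau ord_max z - rdrop tau ord_max ord_max z / (1 + 2 * slam ord_max z ^+ 2 * c)|]); last first.
      by apply/funext => w; rewrite /preimage /= (loo_residual_gap_primitives lam W eps bstar n0 k0 tau0) subr0.
    apply: pr_le; [exact: measurable_ler|exact: measurable_ltr|].
    by move=> z /= h; apply: lt_le_trans h; rewrite gtr_pMr//; lra.
have err2 a : mean_le L (fun z => \sum_c err tau a c z ^+ 2) (error_const B CW CE CB tau).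
  have h := mean_error_sqr Lmu B0 muL_bound CW0 W4 W1 W2 E4 B4 n0 k0 tau0 a.
  rewrite (_ : (fun z => _) = (fun z => dotp (pbeta z - bdrop tau a z) (pbeta z - bdrop tau a z)))//.
  by apply/funext => z; apply: eq_bigr => c' _; rewrite errE expr2.
have err4 a c' := mean_err_fourth Lmu B0 muL_bound CW0 W4 W1 W2 E4 B4 n0 k0 tau0 a c'.
have decor a (T' : R -> R) (Y : set (sample (idx n k) R)) : measurable_fun setT T' -> measurable Y ->
    (forall z z', Y (mix (off_points (pred1 a)) z z') <-> Y z) ->
    `|pr L (Y `&` [set z | `|rdrop tau a a z| <= T' (slam a z)]) - limit_prob muL muE N T' * pr L Y| <= rho.
  move=> mT mY YJ.
  exact: (new_residual_decorrelates Lmu tau0 n0 M0 window B0 muL_bound CW1 m'0 eta0 stdW std_gauss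
    d20 s0 (ltW d10) err2 err4 est' mT mY YJ).
have rho0 : 0 <= rho.
  apply: le_trans (decor ord_max (fun=> 0) setT (measurable_cst _) measurableT (fun _ _ => iff_refl _)).
  exact: normr_ge0.
have rho20 : 0 <= rho2 by apply: le_trans gap; exact: pr_ge0.
have anti' i (t : R) : pr L [set z | `| `|rfull tau i z| - t| <= delta] <= density_const * delta.
  by apply: (anti (t := fun=> t)) => //; exact: ltW.
have cdf01 t : 0 <= G t <= 1 by apply: limit_prob01; exact: measurable_band.
exact: (uncorrected_coverage tau0 n0 c0 d0 stability_const_ge0 density_const_ge0 rho0 rho20
  (fun i j ji => stability ji d0) anti' decor gap' cdf01 kap0 lo hi hlo hhi r0 mX XJ).
Qed.

End Uncorrected.
End FixedSize.

Lemma dimensions_eventually (R : realType) (dim : nat -> nat) (gamma : R) : 0 < gamma ->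
  (fun n => (dim n)%:R / n%:R : R) @ \oo --> gamma ->
  \forall n \near \oo, [/\ (0 < n)%N, (0 < dim n)%N,
    (dim n)%:R <= (2 * gamma + 2 / gamma) * n%:R &
    n%:R <= (2 * gamma + 2 / gamma) * (dim n)%:R :> R].
Proof.
move=> g0 /cvgrPdist_lt/(_ (gamma / 2)) H; have g2 : 0 < gamma / 2 by rewrite divr_gt0.
apply: filterS (H g2) => n /=; rewrite ltr_norml => /andP[h1 h2].
have q0 : 0 < (dim n)%:R / n%:R :> R by lra.
have n0 : (0 < n)%N by rewrite lt0n; apply/eqP => n0; move: q0; rewrite n0 invr0 mulr0 ltxx.
have k0 : (0 < dim n)%N by rewrite lt0n; apply/eqP => k0; move: q0; rewrite k0 mul0r ltxx.
have nR : (0 : R) < n%:R by rewrite ltr0n.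
have kR : (0 : R) < (dim n)%:R by rewrite ltr0n.
have gi : 0 < 2 / gamma by rewrite divr_gt0.
have u1 : (dim n)%:R <= 2 * gamma * n%:R :> R.
  by rewrite -ler_pdivrMr//; lra.
have u2 : gamma / 2 * n%:R <= (dim n)%:R :> R.
  by rewrite -ler_pdivlMr//; lra.
split => //; rewrite mulrDl.
  by apply: (le_trans u1); rewrite lerDl mulr_ge0// ltW.
apply: (@le_trans _ _ (2 / gamma * (dim n)%:R)); last by rewrite lerDr !mulr_ge0// ltW.
apply: (le_trans _ (ler_wpM2l (ltW gi) u2)).
by rewrite mulrA (_ : 2 / gamma * (gamma / 2) = 1) ?mul1r//; field; rewrite lt0r_neq0.
Qed.

Theorem theorem2 (R : realType)
  (disp : nat -> measure_display) (Omega : forall n, measurableType (disp n))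
  (P : forall n, probability (Omega n) R)
  (dim : nat -> nat) (gamma alpha tau : R)
  (muL muW muE muB : probability R R)
  (lam : forall n, 'I_n.+1 -> Omega n -> R)
  (W : forall n, 'I_n.+1 -> 'I_(dim n) -> Omega n -> R)
  (eps : forall n, 'I_n.+1 -> Omega n -> R)
  (bstar : forall n, 'I_(dim n) -> Omega n -> R)
  (gamma_gt0 : 0 < gamma)
  (dim_ratio : (fun n => (dim n)%:R / n%:R : R) @ \oo --> gamma)
  (alpha_gt0 : 0 < alpha) (alpha_lt1 : alpha < 1) (tau_gt0 : 0 < tau)
  (muL_bounded_positive : bounded_positive muL)
  (muW_mean : mean_zero muW) (muW_var : unit_second_moment muW)
  (muW_sub_gaussian : sub_gaussian muW)
  (muE_density : bounded_density muE)
  (muE_quantile : has_unique_quantile (1 - alpha) muE)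
  (muE_moment : finite_abs_moment 8 muE)
  (muB_moment : finite_abs_moment 8 muB)
  (lam_iid : forall n, iid_family (P n) muL (lam n))
  (W_iid : forall n, iid_family (P n) muW
     (fun ij : 'I_n.+1 * 'I_(dim n) => W n ij.1 ij.2))
  (eps_iid : forall n, iid_family (P n) muE (eps n))
  (bstar_iid : forall n, iid_family (P n) muB
     (fun j w => Num.sqrt (dim n)%:R * bstar n j w))
  (lam_W_indep : forall n, indep_families (P n) (lam n)
     (fun ij : 'I_n.+1 * 'I_(dim n) => W n ij.1 ij.2))
  (eps_indep : forall n, indep_families (P n) (eps n)
     (join_families (lam n)
        (fun ij : 'I_n.+1 * 'I_(dim n) => W n ij.1 ij.2)))
  (bstar_indep : forall n, indep_families (P n) (bstar n)
     (join_families
        (join_families (lam n)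
           (fun ij : 'I_n.+1 * 'I_(dim n) => W n ij.1 ij.2))
        (eps n))) :
  cvg_in_probability P
    (fun n => cond_coverage_full (P n) (lam n) (W n) (eps n) (bstar n)
                tau alpha)
    (1 - alpha)
  /\
  forall N_inf c_inf : R, 0 < N_inf -> 0 < c_inf ->
    cvg_in_probability P
      (fun n => estimation_error (lam n) (W n) (eps n) (bstar n) tau) N_inf ->
    cvg_in_probability P
      (fun n => loo_residual_gap (lam n) (W n) (eps n) (bstar n) tau c_inf)
      0 ->
    cvg_in_probability P
      (fun n => cond_coverage_uncorr (P n) (lam n) (W n) (eps n) (bstar n)
                  tau alpha)
      (fine (limit_coverage_uncorr muL muE alpha N_inf c_inf))
    /\
    (limit_coverage_uncorr muL muE alpha N_inf c_inf < (1 - alpha)%:E)%E.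
Proof.
have [B [B0 muL_bound]] := bounded_positive_gt0 muL_bounded_positive.
have [CW [CW0 W4]] := fourth_of_sub_gaussian muW_sub_gaussian.
have [CE [CE0 E4]] := fourth_of_eighth muE_moment.
have [CB [CB0 B4]] := fourth_of_eighth muB_moment.
have [M [M0 window]] := window_of_density muE_density.
have [m' [m'0 std_gauss]] := @gauss_std_law R.
pose Gam := 2 * gamma + 2 / gamma.
have Gam0 : 0 <= Gam by rewrite addr_ge0 ?mulr_ge0 ?invr_ge0// ltW.
have ev := dimensions_eventually gamma_gt0 dim_ratio; rewrite -/Gam in ev.
pose KS := stability_const B CW CE CB tau; pose KA := density_const B tau M Gam.
have KS0 : 0 <= KS by exact: stability_const_ge0.
have KA0 : 0 <= KA by exact: density_const_ge0.
split.
  move=> e e0; apply: cvg_pr0 => e' e'0.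
  have t0 : 0 < e' * e / 2 by rewrite divr_gt0// mulr_gt0.
  have [eta [delta [s [y [eta0 eta1 d0 s0 [y0 H]]]]]] := full_parameters KS0 KA0 t0.
  apply: filterS2 ev (inv_nat_eventually y0) => n [n0 k0 kn nk] ny.
  have [mA h] := full_deviation (lam_iid n) (W_iid n) (eps_iid n) (bstar_iid n) (lam_W_indep n)
    (eps_indep n) (bstar_indep n) n0 k0 B0 muL_bound CW0 W4 muW_mean muW_var CE0 E4 CB0 B4 tau_gt0
    M0 window Gam0 kn alpha_gt0 alpha_lt1 e0 eta0 eta1 d0 s0.
  split => //; apply: (le_trans h); rewrite ler_pdivrMr//.
  by have := H n n0 ny; rewrite -/KS -/KA; lra.
move=> N c N0 c0 est gap.
pose p : R := 1 - alpha.
have p0 : 0 < p by rewrite subr_gt0.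
have p1 : p < 1 by rewrite gtrBl.
pose q := limit_quantile muL muE N c p.
pose G := residual_cdf muL muE N c.
have covE : limit_coverage_uncorr muL muE alpha N c = (limit_prob muL muE N (fun=> q))%:E.
  exact: limit_coverageE.
rewrite covE /=; split; last first.
  by rewrite lte_fin; exact: (limit_coverage_lt M0 window B0 muL_bound N0 c0 p0 p1).
move=> e e0; apply: cvg_pr0 => e' e'0.
pose tot := e' * e / 2; have tot0 : 0 < tot by rewrite divr_gt0// mulr_gt0.
pose r := tot / 3; have r0 : 0 < r by rewrite divr_gt0.
have M4 : 0 <= 4 * M by rewrite mulr_ge0.
pose x := r / (4 * M + 1); have x0 : 0 < x by exact: frac_gt0.
have lo : 0 < p - G (q - x).
  rewrite subr_gt0; apply: (residual_cdf_lt window c0 p0 p1).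
  by rewrite -/q gtrBl.
have hi : 0 < G (q + x) - p.
  rewrite subr_gt0; apply: (residual_cdf_gt window muL_bound N0 c0 p0 p1).
  by rewrite -/q ltrDl.
pose kappa := Num.min (p - G (q - x)) (G (q + x) - p).
have kappa0 : 0 < kappa by rewrite lt_min lo hi.
have klo : G (q - x) <= 1 - alpha - kappa.
  have : kappa <= p - G (q - x) by rewrite ge_min lexx.
  by rewrite -/p lerBrDr => h; rewrite lerBrDr [G _ + _]addrC.
have khi : 1 - alpha + kappa <= G (q + x).
  have : kappa <= G (q + x) - p by rewrite ge_min lexx orbT.
  by rewrite lerBrDr => h; rewrite -/p [p + kappa]addrC.
have Mx : 4 * M * x <= r by apply: mul_frac_le => //; exact: ltW.
have close t : `|q - t| <= x ->
    `|limit_prob muL muE N (fun=> q) - limit_prob muL muE N (fun=> t)| <= r.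
  move=> qt; apply: le_trans Mx.
  exact: (@limit_prob_close R muL muE M B N M0 window muL_bound (fun=> q) (fun=> t) x
    (measurable_cst _) (measurable_cst _) (ltW x0) (fun _ _ => qt)).
have hlo : limit_prob muL muE N (fun=> q) - r <= limit_prob muL muE N (fun=> q - x).
  have := close (q - x); rewrite (_ : q - (q - x) = x); last by ring.
  by rewrite (gtr0_norm x0) => /(_ (lexx x)); rewrite ler_norml => /andP[_]; rewrite lerBlDr lerBlDl.
have hhi : limit_prob muL muE N (fun=> q + x) <= limit_prob muL muE N (fun=> q) + r.
  have := close (q + x); rewrite (_ : q - (q + x) = - x); last by ring.
  by rewrite normrN (gtr0_norm x0) => /(_ (lexx x)); rewrite ler_norml => /andP[+ _]; rewrite lerNl opprB lerBlDl.
pose th := Num.min r (r * kappa ^+ 2 / 98).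
have th0 : 0 < th by rewrite lt_min r0 divr_gt0// mulr_gt0// exprn_gt0.
have th1 : th <= r by rewrite ge_min lexx.
have th2 : 98 * th <= r * kappa ^+ 2.
  by rewrite mulrC -ler_pdivlMr// ge_min lexx orbT.
pose delta := th / (KA + 1); have d0 : 0 < delta by exact: frac_gt0.
have KAd : KA * delta <= th by apply: mul_frac_le => //; exact: ltW.
have CW1 : 0 <= 1 + CW by rewrite addr_ge0.
have CU0 : 0 <= error_const B CW CE CB tau by exact: error_const_ge0.
have F0 : 0 <= fourth_const B CW CE CB tau Gam by exact: fourth_const_ge0.
have [eta [delta1 [delta2 [s [y [eta0 d10 d20 s0 [y0 H]]]]]]] :=
  decorrelation_parameters M0 B0 CW1 m'0 CU0 F0 th0.
have t5 : 0 < th / 5 by rewrite divr_gt0.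
have d2 : 0 < delta / 2 by rewrite divr_gt0.
have y2 : 0 < th * delta ^+ 2 / (KS + 1) by apply: frac_gt0 => //; rewrite mulr_gt0// exprn_gt0.
have E1 := pr_cvg0 (est delta1 d10) t5.
have E2 := pr_cvg0 (gap (delta / 2) d2) th0.
apply: filterS2 (filterI ev (filterI E1 E2)) (filterI (inv_nat_eventually th0) (filterI (inv_nat_eventually y0) (inv_nat_eventually y2))).
move=> n [[n0 k0 kn nk] [e1 e2]] [ny1 [ny2 ny3]].
have [mA h] := uncorrected_deviation (lam_iid n) (W_iid n) (eps_iid n) (bstar_iid n) (lam_W_indep n)
  (eps_indep n) (bstar_indep n) n0 k0 B0 muL_bound CW0 W4 muW_mean muW_var CE0 E4 CB0 B4 tau_gt0
  M0 window m'0 std_gauss Gam0 kn alpha_gt0 alpha_lt1 c0 e0 eta0 d10 d20 s0 d0 kappa0 (ltW r0)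
  e1 e2 klo khi hlo hhi.
split => //; apply: (le_trans h); rewrite ler_pdivrMr//.
have rho_le := H n (dim n) _ _ n0 ny2 (fourth_const_le n0 k0 B0 CW0 CE0 CB0 tau_gt0 kn nk) (lexx _).
have cnt := @count_error_le R KS KA delta _ _ kappa th r n kappa0 rho_le KAd
  (stability_term_le KS0 d0 (ltW th0) n0 ny3) (lexx th) ny1 th2.
have totE : e' * e = 2 * (3 * r) by rewrite /r /tot; field.
rewrite totE ler_pM2l// (_ : 3 * r = r + r + r); last by ring.
by apply: lerD cnt; apply: lerD => //; exact: le_trans rho_le th1.
Qed.
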